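(* Let $\{X_j\}$ be a fourth-order stationary sequence with $\mu=EX_j$, autocovariances $\gamma_j=\mathrm{Cov}(X_0,X_j)$ and fourth-order cumulants $\kappa(h,r,s)$, such that for some $\frac12<H<1$: (a) $n^{-H}\sum_{1\le j\le nt}(X_j-\mu)\xrightarrow{d}c_HW_H(t)$ in $D[0,1]$ for some $c_H>0$; (b) $\gamma_j\sim c_0j^{2H-2}$ as $j\to\infty$ for some $c_0>0$; (c) $\sup_h\sum_{-n\le r,s\le n}|\kappa(h,r,s)|=O(n^{2H-1})$. Suppose $q(n)$ is nondecreasing, $\sup_{k\ge0}q(2^{k+1})/q(2^k)<\infty$, $q(n)\to\infty$ and $q(n)=O(n(\log n)^{-7/(4-4H)})$. Then the random vectors $$\Big[\Big(\frac{q(\hat k)}n\Big)^{H-1/2}T_{n,1},\ \Big(\frac{q(n-\hat k)}n\Big)^{H-1/2}T_{n,2}\Big]$$ converge in distribution to $$\Big[\frac1{\sqrt\xi}\sup_{0\le t\le\xi}\Big|W_H(t)-\frac t\xi W_H(\xi)\Big|,\ \frac1{\sqrt{1-\xi}}\sup_{\xi\le t\le1}\Big|(W_H(t)-W_H(\xi))-\frac{t-\xi}{1-\xi}(W_H(1)-W_H(\xi))\Big|\Big],$$ where $\xi=\inf\{t\ge0:|B_H(t)|=\sup_{0\le s\le1}|B_H(s)|\}$ and $B_H(t)=W_H(t)-tW_H(1)$.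
   Context: $W_H$ denotes fractional Brownian motion: a mean-zero Gaussian process with $E[W_H(t)W_H(s)]=(t^{2H}+s^{2H}-|t-s|^{2H})/2$. A sequence is fourth-order stationary if it has finite fourth moments and its joint moments of order at most four are shift invariant; its fourth-order cumulant is $\kappa(h,r,s)=E[\tilde X_k\tilde X_{k+h}\tilde X_{k+r}\tilde X_{k+s}]-(\gamma_h\gamma_{r-s}+\gamma_r\gamma_{h-s}+\gamma_s\gamma_{h-r})$ with $\tilde X_k=X_k-\mu$. $a_j\sim b_j$ means $a_j/b_j\to1$. $q(n)$ is a sequence of positive integers, $\omega_j(q)=1-j/(q+1)$. $\hat k=\min\{k:\max_{1\le i\le n}|\sum_{j\le i}X_j-\frac in\sum_{j\le n}X_j|=|\sum_{j\le k}X_j-\frac kn\sum_{j\le n}X_j|\}$. With $\bar X_k=\frac1k\sum_{i\le k}X_i$, $\tilde X^{(n)}_k=\frac1{n-k}\sum_{k<i\le n}X_i$: $s_{n,1}^2=\frac1{\hat k}\sum_{1\le i\le\hat k}(X_i-\bar X_{\hat k})^2+2\sum_{1\le j\le q(\hat k)}\omega_j(q(\hat k))\frac1{\hat k}\sum_{1\le i\le\hat k-j}(X_i-\bar X_{\hat k})(X_{i+j}-\bar X_{\hat k})$, $s_{n,2}^2=\frac1{n-\hat k}\sum_{\hat k<i\le n}(X_i-\tilde X^{(n)}_{\hat k})^2+2\sum_{1\le j\le q(n-\hat k)}\omega_j(q(n-\hat k))\frac1{n-\hat k}\sum_{\hat k<i\le n-j}(X_i-\tilde X^{(n)}_{\hat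 k})(X_{i+j}-\tilde X^{(n)}_{\hat k})$, $T_{n,1}=\frac1{s_{n,1}}\hat k^{-1/2}\max_{1\le k\le\hat k}|\sum_{i\le k}X_i-\frac k{\hat k}\sum_{i\le\hat k}X_i|$, $T_{n,2}=\frac1{s_{n,2}}(n-\hat k)^{-1/2}\max_{\hat k<k\le n}|\sum_{\hat k<i\le k}X_i-\frac{k-\hat k}{n-\hat k}\sum_{\hat k<i\le n}X_i|$. *)

(* Defs.v *)
From HB Require Import structures.
From mathcomp Require Import all_boot all_order all_algebra.
From mathcomp Require Import all_classical all_reals all_analysis.

Set Implicit Arguments.
Unset Strict Implicit.
Unset Printing Implicit Defensive.

Import Order.TTheory GRing.Theory Num.Theory.
Import numFieldNormedType.Exports.

Local Open Scope classical_set_scope.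
Local Open Scope ring_scope.

Section Defs.
Context {R : realType}.

Definition Exp {d} {T : measurableType d} (P : probability T R) (f : T -> R) : R :=
  fine ('E_P[f])%E.

Definition finite_fourth_moments {d} {T : measurableType d}
    (P : probability T R) (X : nat -> T -> R) : Prop :=
  forall j, measurable_fun setT (X j) /\
            ('E_P[fun w => (X j w ^+ 4)%R] < +oo)%E.

Definition fourth_order_stationary {d} {T : measurableType d}
    (P : probability T R) (X : nat -> T -> R) : Prop :=
  finite_fourth_moments P X /\
  forall (s : seq nat) (k : nat), (size s <= 4)%N ->
    'E_P[fun w => (\prod_(i <- s) X (i + k)%N w)%R]%E
    = 'E_P[fun w => (\prod_(i <- s) X i w)%R]%E.

Definition autocov {d} {T : measurableType d}
    (P : probability T R) (X : nat -> T -> R) (j : int) : R :=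
  fine (covariance P (X 0%N) (X `|j|%N)).

(** index k0 + h as a natural number (used when k0 + h >= 0) *)
Definition shift_idx (k0 : nat) (h : int) : nat := `|(k0%:Z + h)%R|%N.

(** fourth-order cumulant kappa(h,r,s); by stationarity the base index k is
    irrelevant, we take k = |h|+|r|+|s| so that all indices are >= 0 *)
Definition cum4 {d} {T : measurableType d}
    (P : probability T R) (X : nat -> T -> R) (mu : R) (h r s : int) : R :=
  let k0 := (`|h| + `|r| + `|s|)%N in
  let Xt i w := X i w - mu in
  let g := autocov P X in
  Exp P (fun w => Xt k0 w * Xt (shift_idx k0 h) w * Xt (shift_idx k0 r) w
                  * Xt (shift_idx k0 s) w)
  - (g h * g (r - s) + g r * g (h - s) + g s * g (h - r)).

Definition centered_normal {d} {T : measurableType d}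
    (Q : probability T R) (Z : T -> R) (v : R) : Prop :=
  measurable_fun setT Z /\
  (if v == 0 then Q (Z @^-1` [set 0]) = 1%E
   else forall A : set R, measurable A ->
        Q (Z @^-1` A) = normal_prob 0 (Num.sqrt v) A).

Definition fBm_cov (H s t : R) : R :=
  (t `^ (2 * H) + s `^ (2 * H) - `|t - s| `^ (2 * H)) / 2.

(** fractional Brownian motion with Hurst index H on [0, +oo), continuous
    paths; mean-zero Gaussian process = every finite linear combination is
    centered normal with the variance dictated by the covariance *)
Definition is_fBm {d} {T : measurableType d}
    (Q : probability T R) (H : R) (W : R -> T -> R) : Prop :=
  (forall w, {within [set t : R | 0 <= t], continuous (fun t => W t w)}) /\
  forall (m : nat) (t : 'I_m -> R) (a : 'I_m -> R),
    (forall i, 0 <= t i) ->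
    centered_normal Q (fun w => \sum_(i < m) a i * W (t i) w)
      (\sum_(i < m) \sum_(j < m) a i * a j * fBm_cov H (t i) (t j)).

Definition cadlag01 (x : R -> R) : Prop :=
  (forall t, 0 <= t < 1 -> x s @[s --> t^'+] --> x t) /\
  (forall t, 0 < t <= 1 -> cvg (x s @[s --> t^'-])).

Definition time_change (l : R -> R) : Prop :=
  {within `[0, 1], continuous l} /\
  (forall s t, 0 <= s -> s < t -> t <= 1 -> l s < l t) /\
  l 0 = 0 /\ l 1 = 1.

(** d_J1(x, y) < delta, for the Skorokhod J1 distance
    d(x,y) = inf_l max(sup_t |l t - t|, sup_t |x t - y (l t)|) *)
Definition skor_lt (x y : R -> R) (delta : R) : Prop :=
  exists l, time_change l /\
  exists2 d', d' < delta &
    forall t, 0 <= t <= 1 -> `|l t - t| <= d' /\ `|x t - y (l t)| <= d'.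

Definition D_bounded_continuous (F : (R -> R) -> R) : Prop :=
  (exists M, forall x, cadlag01 x -> `|F x| <= M) /\
  forall x, cadlag01 x -> forall e, 0 < e ->
    exists2 delta, 0 < delta &
      forall y, cadlag01 y -> skor_lt x y delta -> `|F x - F y| < e.

Definition psum_process (x : nat -> R) (mu H : R) (n : nat) (t : R) : R :=
  n%:R `^ (- H) *
  \sum_(1 <= j < (Num.truncn (n%:R * t)).+1) (x j - mu).

Definition seg_sum (x : nat -> R) (a k : nat) : R :=
  \sum_(1 <= i < k.+1) x (a + i)%N.

Definition cusum_dev (x : nat -> R) (n k : nat) : R :=
  `|seg_sum x 0 k - k%:R / n%:R * seg_sum x 0 n|.

Definition khat (x : nat -> R) (n : nat) : nat :=
  let M := \big[Num.max/0]_(1 <= i < n.+1) cusum_dev x n i in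
  nth 0%N [seq k <- iota 1 n | cusum_dev x n k == M] 0.

Definition bartlett (q j : nat) : R := 1 - j%:R / (q.+1)%:R.

(** long-run variance estimator on the segment x_{a+1},...,x_{a+L}
    with bandwidth qq *)
Definition lrv (x : nat -> R) (a L qq : nat) : R :=
  let m := L%:R^-1 * seg_sum x a L in
  L%:R^-1 * \sum_(1 <= i < L.+1) (x (a + i)%N - m) ^+ 2
  + 2 * \sum_(1 <= j < qq.+1) bartlett qq j * (L%:R^-1 *
        \sum_(1 <= i < (L - j).+1) (x (a + i)%N - m) * (x (a + i + j)%N - m)).

Definition bridge_max (x : nat -> R) (a L : nat) : R :=
  (Num.sqrt L%:R)^-1 *
  \big[Num.max/0]_(1 <= k < L.+1)
     `|seg_sum x a k - k%:R / L%:R * seg_sum x a L|.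

Definition seg_stat (x : nat -> R) (a L qq : nat) : R :=
  (Num.sqrt (lrv x a L qq))^-1 * bridge_max x a L.

Definition T_n1 (x : nat -> R) (q : nat -> nat) (n : nat) : R :=
  seg_stat x 0%N (khat x n) (q (khat x n)).

Definition T_n2 (x : nat -> R) (q : nat -> nat) (n : nat) : R :=
  seg_stat x (khat x n) (n - khat x n)%N (q (n - khat x n)%N).

Definition xi_of (w : R -> R) : R :=
  let B t := w t - t * w 1 in
  inf [set t | 0 <= t /\ `|B t| = sup [set `|B s| | s in `[0, 1]]].

Definition limit1 (w : R -> R) : R :=
  let xi := xi_of w in
  (Num.sqrt xi)^-1 *
  sup [set `|w t - t / xi * w xi| | t in `[0, xi]].

Definition limit2 (w : R -> R) : R :=
  let xi := xi_of w in
  (Num.sqrt (1 - xi))^-1 *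
  sup [set `|(w t - w xi) - (t - xi) / (1 - xi) * (w 1 - w xi)|
       | t in `[xi, 1]].

End Defs.

(* Main.v *)
Require Import Defs.
From HB Require Import structures.
From mathcomp Require Import all_boot all_order all_algebra.
From mathcomp Require Import all_classical all_reals all_analysis.
From mathcomp Require Import measurable_realfun.
From mathcomp Require Import zify ring lra.

Set Implicit Arguments.
Unset Strict Implicit.
Unset Printing Implicit Defensive.

Import Order.TTheory GRing.Theory Num.Theory.
Import numFieldNormedType.Exports.

Local Open Scope classical_set_scope.
Local Open Scope ring_scope.

(** (1) Long-run variance.  With p = q + 1, the quantity p L lrv is the sum of
    the squared increments over windows of length p of the centred partial
    sums of the segment.  Conditions (b) and (c) bound the second moment of
    sum_t (V_t(p)^2 - sigma_p^2), where V_t(p) = S(t+p) - S(t) and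
    sigma_p^2 = E V_0(p)^2, and a dyadic chaining of fourth moments bounds the
    oscillations.  As q varies by a bounded factor over the segments of length
    at least delta n, finitely many window lengths suffice, so that
    q^(1-2H) lrv is uniformly close to q^(-2H) sigma_q^2 on all these segments
    at once.  The latter tends to cH^2 by (a), tested on a truncated square of
    the endpoint, and uniform integrability.

    (2) The limit.  Almost surely |B_H| has a unique maximizer.  For a fixed s,
    let Z = W(s+d) + W(s-d) - 2 W(s) and write B_H(r) = Y_r + h_r Z with
    Y independent of Z; h_r is large near s and small away from s.
    As a function of the value z of Z, sup_r |Y_r + h_r z| is convex, and two
    maximizers, one near s and one far from it, produce a jump of its slope
    at z.  A convex function has countably many such jumps, and Z has a
    density independent of Y.  Independence of a Gaussian Z from the
    sigma-algebra of Y is obtained from characteristic functions, indicators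
    being limits of trigonometric polynomials.

    (3) The mapping step avoids tightness and almost sure representations.
    For K fixed, the supremum of v - K delta over all values v taken by the
    normalized statistics at paths y at Skorokhod distance less than delta from
    x, for sample sizes n >= K, is a bounded K-Lipschitz function of x, to which
    (a) applies; it dominates the statistics and, as K grows, it converges to
    the limiting functional at every continuous x whose bridge has a unique
    maximizer.  The same applied to -g gives the lower bound. *)

(** Measurability of the statistics and of the limiting functional, built from [khat] and [xi_of],
    is never established. Their expectations still compare off null sets, as the integral of a
    nonnegative function is a supremum over simple functions below it. Hence the mapping step only
    compares them with measurable envelopes.

    As [khat] is random, the variance estimate must hold on one event for all long segments. The
    window lengths are covered by a grid of relative spacing et whose size, of order 1/et, does not
    depend on n. A grid length costs order et^2 plus a slack made as small as desired, so the union
    bound closes. Fourth moments of window sums grow like p^(4H) with 4H > 2, faster than dyadic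
    blocks multiply, so the chaining constants stay bounded.

    The second difference Z is suited to uniqueness because of the singularity of |x|^(2H) at 0: at
    step d the second difference of this function is of order d^(2H) near 0 but of order d^2 away
    from it. Covariance with Z thus singles out the times near s. Rational s and d and a rational
    gap of slopes suffice to separate two maximizers, so countably many null events cover all
    cases. *)

Section exp_kit.
Context {R : realType} {d} {T : measurableType d} (P : probability T R).
Implicit Types f g : T -> R.

Lemma measure_setT1 : (P : {measure set T -> \bar R}) setT = 1%E.
Proof. exact: probability_setT. Qed.

Definition L1 f := P.-integrable setT (EFin \o f).

Lemma Exp_Rintegral f : Exp P f = \int[P]_w f w.
Proof. by rewrite /Exp unlock. Qed.

Lemma L1_measurable f : L1 f -> measurable_fun setT f.
Proof. by case/integrableP => /measurable_EFinP. Qed.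

Lemma L1D f g : L1 f -> L1 g -> L1 (fun w => f w + g w).
Proof. by move=> lf lg; apply: (integrableD measurableT lf lg). Qed.

Lemma L1Z (k : R) f : L1 f -> L1 (fun w => k * f w).
Proof. by move=> lf; apply: (integrableZl measurableT k lf). Qed.

Lemma L1N f : L1 f -> L1 (fun w => - f w).
Proof. by move=> lf; have := L1Z (-1) lf; under eq_fun do rewrite mulN1r. Qed.

Lemma L1B f g : L1 f -> L1 g -> L1 (fun w => f w - g w).
Proof. by move=> lf lg; apply: L1D => //; exact: L1N. Qed.

Lemma L1_cst (k : R) : L1 (fun=> k).
Proof. exact: finite_measure_integrable_cst. Qed.

Lemma L1_sum (I : Type) (s : seq I) (p : pred I) (f : I -> T -> R) :
  (forall i, p i -> L1 (f i)) -> L1 (fun w => \sum_(i <- s | p i) f i w).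
Proof.
move=> lf; rewrite /L1 (_ : EFin \o _ =
  (fun w => (\sum_(i <- s | p i) (EFin \o f i) w)%E)); last first.
  by apply/funext => w /=; rewrite sumEFin.
by apply: integrable_sum.
Qed.

Lemma L1_dom f g : measurable_fun setT f -> (forall w, `|f w| <= g w) -> L1 g -> L1 f.
Proof.
move=> mf fg lg; apply: (le_integrable measurableT _ _ lg); first exact/measurable_EFinP.
by move=> w _ /=; rewrite lee_fin (le_trans (fg w))// ler_norm.
Qed.

Lemma L1_bounded f (M : R) : measurable_fun setT f -> (forall w, `|f w| <= M) -> L1 f.
Proof. by move=> mf fM; apply: (L1_dom mf fM); exact: L1_cst. Qed.

Lemma ExpD f g : L1 f -> L1 g -> Exp P (fun w => f w + g w) = Exp P f + Exp P g.
Proof. by move=> lf lg; rewrite !Exp_Rintegral RintegralD. Qed.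

Lemma ExpB f g : L1 f -> L1 g -> Exp P (fun w => f w - g w) = Exp P f - Exp P g.
Proof. by move=> lf lg; rewrite !Exp_Rintegral RintegralB. Qed.

Lemma ExpZ (k : R) f : L1 f -> Exp P (fun w => k * f w) = k * Exp P f.
Proof. by move=> lf; rewrite !Exp_Rintegral RintegralZl. Qed.

Lemma Exp_cst (k : R) : Exp P (fun=> k) = k.
Proof. by rewrite Exp_Rintegral Rintegral_cst// measure_setT1 mulr1. Qed.

Lemma Exp_sum (I : Type) (s : seq I) (p : pred I) (f : I -> T -> R) :
  (forall i, p i -> L1 (f i)) ->
  Exp P (fun w => \sum_(i <- s | p i) f i w) = \sum_(i <- s | p i) Exp P (f i).
Proof.
move=> lf; elim: s => [|i s IH].
  rewrite big_nil -[RHS](Exp_cst 0); congr Exp.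
  by apply/funext => w; rewrite big_nil.
rewrite big_cons; have [pi|npi] := ifPn; last first.
  by rewrite -IH; congr Exp; apply/funext => w; rewrite big_cons (negbTE npi).
rewrite -IH -ExpD; [|exact: lf|exact: L1_sum].
by congr Exp; apply/funext => w; rewrite big_cons pi.
Qed.

Lemma Exp_ge0 f : (forall w, 0 <= f w) -> 0 <= Exp P f.
Proof. by move=> f0; rewrite Exp_Rintegral Rintegral_ge0. Qed.

Lemma Exp_le f g : L1 f -> L1 g -> (forall w, f w <= g w) -> Exp P f <= Exp P g.
Proof. by move=> lf lg fg; rewrite !Exp_Rintegral le_Rintegral. Qed.

Lemma Exp_norm_le f : L1 f -> `|Exp P f| <= Exp P (fun w => `|f w|).
Proof. by move=> lf; rewrite !Exp_Rintegral le_normr_Rintegral. Qed.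

Lemma Exp_indic (A : set T) : measurable A -> Exp P (\1_A) = fine (P A).
Proof. by move=> mA; rewrite Exp_Rintegral /Rintegral integral_indic// setIT. Qed.

Lemma L1_indic (A : set T) : measurable A -> L1 (\1_A).
Proof.
move=> mA; apply: (@L1_bounded _ 1); first exact: measurable_indic.
by move=> w; rewrite indicE; case: (_ \in _); rewrite /= ?normr1 ?normr0.
Qed.

Lemma L1_norm f : L1 f -> L1 (fun w => `|f w|).
Proof.
move=> lf; have lf' := integrable_norm lf.
by [].
Qed.

Lemma Markov_Exp f (c : R) : (forall w, 0 <= f w) -> L1 f -> 0 < c ->
  fine (P [set w | c <= f w]) <= Exp P f / c.
Proof.
move=> f0 lf c0; have mf := L1_measurable lf.
have mA : measurable [set w | c <= f w].
  rewrite -[X in measurable X]setTI; exact: measurable_fun_le.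
rewrite -Exp_indic// ler_pdivlMr// mulrC -ExpZ; last exact: L1_indic.
apply: Exp_le => //; first by apply: L1Z; exact: L1_indic.
move=> w; rewrite indicE; case: (boolP (w \in _)) => /=; last by rewrite mulr0.
by rewrite mulr1 inE.
Qed.

Import HBNNSimple.

(** Needs no measurability of [F] and [G]: the integral is the supremum of the integrals of the
    simple functions below, and setting such a function to 0 on [N] keeps its integral and puts it
    below [G]. *)
Lemma ge0_le_integral_off (F G : T -> \bar R) (N : set T) :
  (forall x, 0 <= F x)%E -> (forall x, 0 <= G x)%E ->
  measurable N -> P N = 0%E -> (forall x, ~ N x -> F x <= G x)%E ->
  (\int[P]_x F x <= \int[P]_x G x)%E.
Proof.
move=> F0 G0 mN PN FG; rewrite ge0_integralTE//.
apply: ge_ereal_sup => _ [h /= hF <-].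
have mNC : measurable (~` N) by exact: measurableC.
pose h' := proj_nnsfun h mNC.
have -> : sintegral P h = sintegral P h'.
  rewrite -!integralT_nnsfun.
  apply: ge0_ae_eq_integral => //.
  - exact/measurable_EFinP.
  - exact/measurable_EFinP.
  - by move=> x _; rewrite lee_fin.
  - by move=> x _; rewrite lee_fin.
  exists N; split => // x /= /existsNP[_ /eqP]; rewrite /h' /=.
  rewrite /mindic indicE; case: (boolP (x \in ~` N)); rewrite ?inE ?mulr1 ?eqxx//.
  by rewrite notin_setE /= notK.
rewrite ge0_integralTE//; apply: ereal_sup_ubound; exists h' => //= x.
rewrite /mindic indicE; case: (boolP (x \in ~` N)); rewrite ?inE => Nx /=.
  by rewrite mulr1 (le_trans (hF x))// FG.
by rewrite mulr0.
Qed.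

(** Meant for functions of [khat] and [xi_of], whose measurability is not established. The common
    bound makes the integrals of the positive and negative parts finite, so that [fine] respects
    their order. *)
Lemma Exp_le_off f g (M : R) (N : set T) :
  (forall w, `|f w| <= M) -> (forall w, `|g w| <= M) ->
  measurable N -> P N = 0%E -> (forall w, ~ N w -> f w <= g w) ->
  Exp P f <= Exp P g.
Proof.
move=> fM gM mN PN fg; have M0 : 0 <= M.
  by have [w _] : [set: T] !=set0; [apply/set0P; apply/eqP => T0; have := @probability_setT _ _ _ P; rewrite T0 measure0 => /eqP; rewrite eq_sym onee_eq0|exact: le_trans (fM w)].
have fin h : (forall w, `|h w| <= M) -> (forall w, 0 <= h w) -> (\int[P]_w (h w)%:E)%E \is a fin_num.
  move=> hM h0; rewrite ge0_fin_numE; last by apply: integral_ge0 => w _; rewrite lee_fin.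
  apply: (@le_lt_trans _ _ (\int[P]_w M%:E)%E).
    apply: (@ge0_le_integral_off _ _ set0) => //.
    by move=> x _; rewrite lee_fin (le_trans _ (hM x))// ler_norm.
  by rewrite integral_cst// measure_setT1 mule1 ltry.
have E h : (\int[P]_w (h w)%:E)%E = ((\int[P]_w (Num.max (h w) 0)%:E) - (\int[P]_w (Num.max (- h w) 0)%:E))%E.
  rewrite integralE; congr (_ - _)%E; apply: eq_integral => w _.
    by rewrite funeposE -EFin_max.
  by rewrite funenegE -EFinN -EFin_max.
have mb (h : T -> R) : (forall w, `|h w| <= M) -> (forall w, `|Num.max (h w) 0| <= M).
  move=> hM w; rewrite /Num.max; case: ifP => _; [by rewrite normr0|exact: hM].
have mp (h : T -> R) : forall w, 0 <= Num.max (h w) 0 by move=> w; rewrite le_max lexx orbT.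
have Nb (h : T -> R) : (forall w, `|h w| <= M) -> (forall w, `|- h w| <= M) by move=> hM w; rewrite normrN.
have fp (h : T -> R) : (forall w, `|h w| <= M) -> (\int[P]_w (Num.max (h w) 0)%:E)%E \is a fin_num.
  by move=> hM; apply: fin; [exact: mb|exact: mp].
have fn (h : T -> R) : (forall w, `|h w| <= M) -> (\int[P]_w (Num.max (- h w) 0)%:E)%E \is a fin_num.
  by move=> hM; apply: (fp (fun w => - h w)); exact: Nb.
have EE (h : T -> R) : (forall w, `|h w| <= M) -> Exp P h =
    fine (\int[P]_w (Num.max (h w) 0)%:E)%E - fine (\int[P]_w (Num.max (- h w) 0)%:E)%E.
  by move=> hM; rewrite Exp_Rintegral /Rintegral E fineB//; [exact: fp|exact: fn].
rewrite (EE f)// (EE g)//; apply: lerB; apply: fine_le; try exact: fp; try exact: fn.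
  apply: (@ge0_le_integral_off _ _ N) => //; try by move=> w; rewrite lee_fin.
  by move=> w Nw; rewrite lee_fin ge_max !le_max fg//= lexx orbT.
apply: (@ge0_le_integral_off _ _ N) => //; try by move=> w; rewrite lee_fin le_max lexx orbT.
by move=> w Nw; rewrite lee_fin ge_max !le_max lerN2 fg//= lexx orbT.
Qed.

End exp_kit.

(** * Fourth moments and stationarity *)

Section L4.
Context {R : realType} {d} {T : measurableType d} (P : probability T R).
Implicit Types f g : T -> R.

Definition L4 f := measurable_fun setT f /\ L1 P (fun w => f w ^+ 4).

Lemma mul4_le (a b c e : R) : `|a * b * c * e| <= a ^+ 4 + b ^+ 4 + c ^+ 4 + e ^+ 4.
Proof.
have h1 := sqr_ge0 (a * b - c * e). have h2 := sqr_ge0 (a * b + c * e).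
have h3 := sqr_ge0 (a ^+ 2 - b ^+ 2). have h4 := sqr_ge0 (c ^+ 2 - e ^+ 2).
have h5 := sqr_ge0 (a ^+ 2). have h6 := sqr_ge0 (b ^+ 2).
have h7 := sqr_ge0 (c ^+ 2). have h8 := sqr_ge0 (e ^+ 2).
rewrite ler_norml; apply/andP; split; nra.
Qed.

Lemma L1_mul4 f1 f2 f3 f4 : L4 f1 -> L4 f2 -> L4 f3 -> L4 f4 ->
  L1 P (fun w => f1 w * f2 w * f3 w * f4 w).
Proof.
move=> [m1 l1] [m2 l2] [m3 l3] [m4 l4].
apply: (@L1_dom _ _ _ _ _ (fun w => f1 w ^+ 4 + f2 w ^+ 4 + f3 w ^+ 4 + f4 w ^+ 4)).
- by do 3 (apply: measurable_funM => //).
- by move=> w; exact: mul4_le.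
- by do 3 (apply: L1D => //).
Qed.

Lemma L4_cst (k : R) : L4 (fun=> k).
Proof. by split; [exact: measurable_cst|exact: L1_cst]. Qed.

Lemma L1_mul3 f1 f2 f3 : L4 f1 -> L4 f2 -> L4 f3 -> L1 P (fun w => f1 w * f2 w * f3 w).
Proof.
by move=> l1 l2 l3; have := L1_mul4 l1 l2 l3 (L4_cst 1); under eq_fun do rewrite mulr1.
Qed.

Lemma L1_mul2 f1 f2 : L4 f1 -> L4 f2 -> L1 P (fun w => f1 w * f2 w).
Proof.
by move=> l1 l2; have := L1_mul3 l1 l2 (L4_cst 1); under eq_fun do rewrite mulr1.
Qed.

Lemma L4_L1 f : L4 f -> L1 P f.
Proof. by move=> l1; have := L1_mul2 l1 (L4_cst 1); under eq_fun do rewrite mulr1. Qed.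

Lemma L1_sqr f : L4 f -> L1 P (fun w => f w ^+ 2).
Proof. by move=> l1; have := L1_mul2 l1 l1; under eq_fun do rewrite -expr2. Qed.

Lemma L4D f g : L4 f -> L4 g -> L4 (fun w => f w + g w).
Proof.
move=> [mf lf] [mg lg]; split; first exact: measurable_funD.
apply: (@L1_dom _ _ _ _ _ (fun w => 8 * f w ^+ 4 + 8 * g w ^+ 4)).
- exact/measurable_funX/measurable_funD.
- move=> w; rewrite ger0_norm; last by rewrite exprn_even_ge0.
  have h1 := sqr_ge0 (f w ^+ 2 - g w ^+ 2).
  have h2 : (f w + g w) ^+ 2 <= 2 * (f w ^+ 2 + g w ^+ 2) by have := sqr_ge0 (f w - g w); lra.
  have h3 : ((f w + g w) ^+ 2) ^+ 2 <= (2 * (f w ^+ 2 + g w ^+ 2)) ^+ 2.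
    by rewrite ler_pXn2r// nnegrE ?sqr_ge0// mulr_ge0// addr_ge0 ?sqr_ge0.
  by move: h3; rewrite -exprM; lra.
- by apply: L1D; exact: L1Z.
Qed.

Lemma L4Z (k : R) f : L4 f -> L4 (fun w => k * f w).
Proof.
move=> [mf lf]; split; first exact: measurable_funM.
by under eq_fun do rewrite exprMn; exact: L1Z.
Qed.

Lemma L4B f g : L4 f -> L4 g -> L4 (fun w => f w - g w).
Proof.
move=> lf lg; have := L4D lf (L4Z (-1) lg).
by under eq_fun do rewrite mulN1r.
Qed.

Lemma L4_sum (I : Type) (s : seq I) (p : pred I) (f : I -> T -> R) :
  (forall i, p i -> L4 (f i)) -> L4 (fun w => \sum_(i <- s | p i) f i w).
Proof.
move=> lf; elim: s => [|i s IH].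
  by under eq_fun do rewrite big_nil; exact: L4_cst.
under eq_fun do rewrite big_cons; case: (boolP (p i)) => [pi|//].
by apply: L4D => //; exact: lf.
Qed.

Lemma L1_prod4 (I : Type) (F : I -> T -> R) (s : seq I) : (forall i, L4 (F i)) ->
  (size s <= 4)%N -> L1 P (fun w => \prod_(i <- s) F i w).
Proof.
move=> lF; case: s => [|a [|b [|c [|e [|//]]]]] _.
- by under eq_fun do rewrite big_nil; exact: L1_cst.
- by under eq_fun do rewrite big_seq1; exact/L4_L1/lF.
- by under eq_fun do rewrite big_cons big_seq1; exact: L1_mul2.
- by under eq_fun do rewrite !big_cons big_nil mulr1 mulrA; exact: L1_mul3.
- by under eq_fun do rewrite !big_cons big_nil mulr1 !mulrA; exact: L1_mul4.
Qed.

End L4.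

Section centered.
Context {R : realType} {d} {T : measurableType d} (P : probability T R).
Variables (X : nat -> T -> R) (mu : R).
Hypothesis statX : fourth_order_stationary P X.
Hypothesis meanX : forall j, 'E_P[X j]%E = mu%:E.

Definition Yc (j : nat) (w : T) : R := X j w - mu.

Lemma L4_X j : L4 P (X j).
Proof.
have [mX fX] := statX.1 j; split => //; apply/integrableP; split.
  exact/measurable_EFinP/measurable_funX.
move: fX; rewrite unlock; apply: le_lt_trans.
rewrite le_eqVlt; apply/orP; left; apply/eqP; apply: eq_integral => w _ /=.
by rewrite ger0_norm// exprn_even_ge0.
Qed.

Lemma L4_Y j : L4 P (Yc j).
Proof. by apply: L4B; [exact: L4_X|exact: L4_cst]. Qed.

(** Stationarity concerns products of uncentred variables. Induction on the list [t] of centred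
    factors expands one factor [X j - mu] at a time: [j] either moves to the uncentred list or is
    dropped, and the degree never exceeds four. *)
Lemma Exp_prod_shift (t s : seq nat) (k : nat) : (size s + size t <= 4)%N ->
  Exp P (fun w => (\prod_(i <- s) X (i + k)%N w) * \prod_(j <- t) Yc (j + k)%N w) =
  Exp P (fun w => (\prod_(i <- s) X i w) * \prod_(j <- t) Yc j w).
Proof.
have L k' (t' s' : seq nat) : (size s' + size t' <= 4)%N ->
    L1 P (fun w => (\prod_(i <- s') X (i + k')%N w) * \prod_(j <- t') Yc (j + k')%N w).
  move=> st.
  pose F (i : nat + nat) := match i with inl i => X (i + k')%N | inr j => Yc (j + k')%N end.
  rewrite (_ : (fun w => _) = fun w => \prod_(i <- [seq inl i | i <- s'] ++ [seq inr i | i <- t']) F i w).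
    by apply: L1_prod4; [case=> i; [exact: L4_X|exact: L4_Y]|rewrite size_cat !size_map].
  by apply/funext => w; rewrite big_cat /= !big_map.
elim: t s => [|j t IH] s st.
  under eq_fun do rewrite big_nil mulr1; under [in RHS]eq_fun do rewrite big_nil mulr1.
  by rewrite /Exp statX.2//; move: st; rewrite addn0.
have key k' : Exp P (fun w => (\prod_(i <- s) X (i + k')%N w) * \prod_(j0 <- j :: t) Yc (j0 + k')%N w) =
   Exp P (fun w => (\prod_(i <- j :: s) X (i + k')%N w) * \prod_(j0 <- t) Yc (j0 + k')%N w)
   - mu * Exp P (fun w => (\prod_(i <- s) X (i + k')%N w) * \prod_(j0 <- t) Yc (j0 + k')%N w).
  rewrite -ExpZ; last by apply: L; move: st => /=; lia.
  rewrite -ExpB; last 2 first.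
  - by apply: L; move: st => /=; lia.
  - by apply: L1Z; apply: L; move: st => /=; lia.
  by congr Exp; apply/funext => w; rewrite !big_cons /Yc; ring.
rewrite key IH; last by move: st => /=; lia.
rewrite IH; last by move: st => /=; lia.
have e0 (a b : seq nat) : Exp P (fun w => (\prod_(i <- a) X (i + 0)%N w) * \prod_(i <- b) Yc (i + 0)%N w) =
    Exp P (fun w => (\prod_(i <- a) X i w) * \prod_(i <- b) Yc i w).
  congr Exp; apply/funext => w; congr (_ * _); by apply: eq_bigr => i _; rewrite addn0.
by rewrite -(e0 (j :: s) t) -(e0 s t) -(e0 s (j :: t)) key.
Qed.

Definition E2 i j := Exp P (fun w => Yc i w * Yc j w).
Definition E4 i j k l := Exp P (fun w => Yc i w * Yc j w * Yc k w * Yc l w).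

Lemma E2_shift i j m : E2 (i + m) (j + m) = E2 i j.
Proof.
have := @Exp_prod_shift [:: i; j] [::] m isT.
under eq_fun do rewrite !big_cons !big_nil mulr1 mul1r.
by under [in RHS]eq_fun do rewrite !big_cons !big_nil mulr1 mul1r.
Qed.

Lemma E4_shift i j k l m : E4 (i + m) (j + m) (k + m) (l + m) = E4 i j k l.
Proof.
have := @Exp_prod_shift [:: i; j; k; l] [::] m isT.
under eq_fun do rewrite !big_cons !big_nil mulr1 mul1r !mulrA.
by under [in RHS]eq_fun do rewrite !big_cons !big_nil mulr1 mul1r !mulrA.
Qed.

Lemma E2C i j : E2 i j = E2 j i.
Proof. by congr Exp; apply/funext => w; rewrite mulrC. Qed.

Lemma autocovE (z : int) : autocov P X z = E2 0 `|z|%N.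
Proof.
by rewrite /autocov unlock /E2 /Exp !meanX /=; congr fine.
Qed.

Lemma E2_autocov i j : E2 i j = autocov P X (j%:Z - i%:Z).
Proof.
rewrite autocovE; have [ij|ji] := leqP i j.
  by rewrite -(subnK ij) -{1}(add0n i) E2_shift; congr E2; lia.
by rewrite E2C -(subnK (ltnW ji)) -{1}(add0n j) E2_shift; congr E2; lia.
Qed.

(** The moment based at [i] and the one based at [k0] in [cum4] are translates of each other;
    whichever base index is smaller is shifted up to the other. *)
Lemma E4_cum4 i j k l : E4 i j k l =
  cum4 P X mu (j%:Z - i%:Z) (k%:Z - i%:Z) (l%:Z - i%:Z)
  + (E2 i j * E2 k l + E2 i k * E2 j l + E2 i l * E2 j k).
Proof.
rewrite /cum4; set k0 := (_ + _ + _)%N; rewrite -!E2_autocov.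
have e1 : k%:Z - i%:Z - (l%:Z - i%:Z) = k%:Z - l%:Z by ring.
have e2 : j%:Z - i%:Z - (l%:Z - i%:Z) = j%:Z - l%:Z by ring.
have e3 : j%:Z - i%:Z - (k%:Z - i%:Z) = j%:Z - k%:Z by ring.
rewrite e1 e2 e3 -!E2_autocov (E2C l k) (E2C l j) (E2C k j).
suff -> : E4 i j k l = E4 k0 (shift_idx k0 (j%:Z - i%:Z)) (shift_idx k0 (k%:Z - i%:Z)) (shift_idx k0 (l%:Z - i%:Z)).
  by rewrite /E4 /Yc; ring.
rewrite /shift_idx; have [ik|ki] := leqP i k0.
  rewrite -(E4_shift i j k l (k0 - i)); congr E4; rewrite /k0 in ik *; lia.
rewrite -(E4_shift k0 _ _ _ (i - k0)); congr E4; rewrite /k0 in ki *; lia.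
Qed.
End centered.

(** * Powers with real exponents and elementary sums *)

Section sums.
Context {R : realType}.

(** The tangent at 1 of a concave power. It is Young's inequality for y^th and 1 with conjugate
    exponents 1/th and 1/(1 - th). *)
Lemma powR_tangent (y th : R) : 0 <= y -> 0 < th < 1 -> y `^ th <= 1 + th * (y - 1).
Proof.
move=> y0 /andP[th0 th1].
have := @conjugate_powR R (y `^ th) 1 th^-1 (1 - th)^-1.
rewrite powR_ge0 ler01 !invrK => /(_ isT isT).
rewrite !invr_gt0 th0 subr_gt0 th1 => /(_ isT isT).
have -> : th + (1 - th) = 1 by ring.
move=> /(_ erefl); rewrite mulr1 -powRrM mulfV ?gt_eqF// powRr1// powR1.
lra.
Qed.

Lemma sumr_cst_ord (p : nat) (c : R) : \sum_(i < p) c = p%:R * c.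
Proof. by rewrite sumr_const card_ord mulr_natl. Qed.

Lemma powR_add (x a b : R) : 0 < x -> x `^ (a + b) = x `^ a * x `^ b.
Proof. by move=> x0; rewrite powRD//; apply/implyP => _; rewrite gt_eqF. Qed.

Lemma powR_div (x y a : R) : 0 <= x -> 0 <= y -> (x / y) `^ a = x `^ a / y `^ a.
Proof.
move=> x0 y0; rewrite powRM ?invr_ge0//; congr (_ * _).
by rewrite -[in LHS](powR_inv1 y0) -powRrM mulN1r powRN.
Qed.

Lemma powRm1 (x a : R) : 0 < x -> x `^ (a - 1) = x `^ a / x.
Proof. by move=> x0; rewrite powRB; [rewrite powRr1// ltW|apply/implyP => _; rewrite gt_eqF]. Qed.

Lemma powRm2 (x a : R) : 0 < x -> x `^ (a - 2) = x `^ a / (x * x).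
Proof.
by move=> x0; rewrite powRB; [rewrite powR_mulrn ?ltW|apply/implyP => _; rewrite gt_eqF].
Qed.

Lemma powR_anti (x y a : R) : 0 < x -> x <= y -> a <= 0 -> y `^ a <= x `^ a.
Proof.
move=> x0 xy a0; have y0 : 0 < y by exact: lt_le_trans xy.
rewrite -[a]opprK !(powRN _ (- a)) lef_pV2 ?posrE ?powR_gt0//.
by apply: ge0_ler_powR; rewrite ?nnegrE ?oppr_ge0// ltW.
Qed.

Lemma ler_sum_shift (m n k : nat) (F : nat -> R) : (forall i, 0 <= F i) -> (m + k <= n)%N ->
  \sum_(t < m) F (t + k)%N <= \sum_(u < n) F u.
Proof.
move=> F0 mkn; rewrite -(big_mkord predT F) (@big_cat_nat _ _ _ k)//=; last lia.
rewrite (@big_cat_nat _ _ _ (m + k) k n)//=; last lia.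
have -> : \sum_(k <= i < m + k) F i = \sum_(t < m) F (t + k)%N.
  by rewrite -{1}(add0n k) big_addn addnK big_mkord.
have h1 : 0 <= \sum_(0 <= i < k) F i by apply: sumr_ge0.
have h2 : 0 <= \sum_(m + k <= i < n) F i by apply: sumr_ge0.
lra.
Qed.

Lemma ler_sum2_shift (m n k l : nat) (F : nat -> nat -> R) : (forall i j, 0 <= F i j) ->
  (m + k <= n)%N -> (m + l <= n)%N ->
  \sum_(t < m) \sum_(s < m) F (t + k)%N (s + l)%N <= \sum_(u < n) \sum_(v < n) F u v.
Proof.
move=> F0 mk ml.
apply: (@le_trans _ _ (\sum_(t < m) \sum_(v < n) F (t + k)%N v)).
  by apply: ler_sum => t _; exact: (@ler_sum_shift _ _ _ (F (t + k)%N)).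
apply: (@ler_sum_shift _ _ _ (fun t => \sum_(v < n) F t v)) => // i.
exact: sumr_ge0.
Qed.

(** Discrete form of the integral of x^(th - 1). In the inductive step, the tangent bound at p/(p +
    1) gives p^th <= (p + 1)^th (1 - th/(p + 1)). *)
Lemma sum_powR_le (th : R) (p : nat) : 0 < th < 1 ->
  \sum_(k < p) k.+1%:R `^ (th - 1) <= p%:R `^ th / th.
Proof.
move=> /andP[th0 th1]; elim: p => [|p IH].
  by rewrite big_ord0 divr_ge0 ?powR_ge0// ltW.
rewrite big_ord_recr/=; apply: (le_trans (lerD IH (lexx _))).
have p0 : (0 : R) < p.+1%:R by rewrite ltr0n.
have E : p%:R `^ th = p.+1%:R `^ th * (p%:R / p.+1%:R) `^ th.
  by rewrite -powRM ?divr_ge0// mulrC divfK// gt_eqF.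
have E2' : p.+1%:R `^ (th - 1) = p.+1%:R `^ th / p.+1%:R :> R.
  exact: powRm1.
have := @powR_tangent (p%:R / p.+1%:R) th.
rewrite divr_ge0// th0 th1 => /(_ isT isT) ht.
rewrite ler_pdivlMr// mulrDl divfK ?gt_eqF// E E2'.
have e1 : (p%:R : R) / p.+1%:R - 1 = - (p.+1%:R)^-1.
  by rewrite -[in RHS]div1r -natr1; field; rewrite natr1 gt_eqF.
rewrite e1 in ht.
have h := powR_ge0 (p.+1%:R : R) th.
move: e1 ht E2' => _; move: (p.+1%:R^-1) => z ht _.
have := ler_wpM2l h ht; lra.
Qed.

(** Seen from [i], each distance occurs for at most two indices, one on either side. *)
Lemma sum_dist_le (g : nat -> R) (p i : nat) : (forall k, 0 <= g k) -> (i < p)%N ->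
  \sum_(j < p) g (maxn i j - minn i j)%N <= 2 * \sum_(k < p) g k.
Proof.
move=> g0 ip; rewrite -(big_mkord predT (fun j => g (maxn i j - minn i j)%N)).
rewrite (@big_cat_nat _ _ _ i)//=; last lia.
have -> : \sum_(0 <= j < i) g (maxn i j - minn i j)%N = \sum_(k < i) g (k + 1)%N.
  rewrite big_nat_rev/= big_mkord; apply: eq_bigr => -[k ki] _ /=.
  by congr g; lia.
have -> : \sum_(i <= j < p) g (maxn i j - minn i j)%N = \sum_(k < p - i) g (k + 0)%N.
  rewrite -{1}(add0n i) big_addn big_mkord; apply: eq_bigr => -[k ki] _ /=.
  by congr g; lia.
have h1 := @ler_sum_shift i p 1 g g0; have h2 := @ler_sum_shift (p - i) p 0 g g0.
rewrite mulr2n mulrDl !mul1r; apply: lerD; [apply: h1|apply: h2]; lia.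
Qed.

Lemma sum22_mul (p : nat) (A B : 'I_p -> 'I_p -> R) :
  (\sum_i \sum_j A i j) * (\sum_k \sum_l B k l) = \sum_i \sum_j \sum_k \sum_l A i j * B k l.
Proof.
rewrite mulr_suml; apply: eq_bigr => i _; rewrite mulr_suml; apply: eq_bigr => j _.
by rewrite mulr_sumr; apply: eq_bigr => k _; rewrite mulr_sumr.
Qed.

Lemma sum4_mul (p : nat) (a b c e : 'I_p -> R) :
  (\sum_i a i) * (\sum_i b i) * (\sum_i c i) * (\sum_i e i) =
  \sum_i \sum_j \sum_k \sum_l a i * b j * c k * e l.
Proof.
have D (f g : 'I_p -> R) : (\sum_i f i) * (\sum_i g i) = \sum_i \sum_j f i * g j.
  by rewrite big_distrlr.
rewrite -mulrA (D a b) (D c e) sum22_mul.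
by do 4 (apply: eq_bigr => ? _); rewrite !mulrA.
Qed.

Lemma powR_small (a th : R) : 0 < a -> 0 < th ->
  exists2 rho, 0 < rho & forall x, 0 <= x -> x <= rho -> x `^ a <= th.
Proof.
move=> a0 th0; exists (th `^ a^-1); first exact: powR_gt0.
move=> x x0 xr; have -> : th = (th `^ a^-1) `^ a.
  by rewrite -powRrM mulVf ?gt_eqF// powRr1// ltW.
by apply: ge0_ler_powR; rewrite ?nnegrE ?powR_ge0// ltW.
Qed.

Lemma nat_ge (x : R) : exists n : nat, x <= n%:R.
Proof.
have [x0|x0] := leP x 0; first by exists 0%N.
by exists (Num.truncn x).+1; exact/ltW/truncnS_gt.
Qed.

End sums.

(** * Moments of window sums under the covariance and cumulant bounds *)

Section windows.
Context {R : realType} {d} {T : measurableType d} (P : probability T R).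
Variables (Y : nat -> T -> R) (kap : int -> int -> int -> R) (H Cg Ck : R).
Hypothesis HY : forall i, L4 P (Y i).
Let e2 i j := Exp P (fun w => Y i w * Y j w).
Hypothesis e2s : forall i j m, e2 (i + m) (j + m) = e2 i j.
Hypothesis e4 : forall i j k l, Exp P (fun w => Y i w * Y j w * Y k w * Y l w) =
  kap (j%:Z - i%:Z) (k%:Z - i%:Z) (l%:Z - i%:Z)
  + (e2 i j * e2 k l + e2 i k * e2 j l + e2 i l * e2 j k).
Hypothesis Hl : 1 / 2 < H.
Hypothesis Hu : H < 1.
Hypothesis Cg0 : 0 < Cg.
Hypothesis Ck0 : 0 < Ck.
Hypothesis e2g : forall i k, `|e2 i (i + k)%N| <= Cg * k.+1%:R `^ (2 * H - 2).
Hypothesis kapb : forall n h, (0 < n)%N ->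
  \sum_(a < (2 * n).+1) \sum_(b < (2 * n).+1) `|kap h (a%:Z - n%:Z) (b%:Z - n%:Z)|
  <= Ck * n%:R `^ (2 * H - 1).

Definition V t p w := \sum_(i < p) Y (t + i)%N w.

Lemma L4_V t p : L4 P (V t p).
Proof. exact: L4_sum. Qed.

Lemma V_cat t p p' w : V t (p + p') w = V t p w + V (t + p) p' w.
Proof.
rewrite /V big_split_ord /=; congr (_ + _).
by apply: eq_bigr => i _; rewrite addnA.
Qed.

Lemma V0 t w : V t 0 w = 0. Proof. by rewrite /V big_ord0. Qed.

Let e2C i j : e2 i j = e2 j i.
Proof. by congr Exp; apply/funext => w; rewrite mulrC. Qed.

Lemma e2_dist i j : `|e2 i j| <= Cg * (maxn i j - minn i j).+1%:R `^ (2 * H - 2).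
Proof.
have [ij|ji] := leqP i j.
  by have := e2g i (j - i); rewrite subnKC.
by rewrite e2C; have := e2g j (i - j); rewrite subnKC// ltnW.
Qed.

Definition cVV s t p := Exp P (fun w => V s p w * V t p w).
Definition sig2 p := cVV 0 0 p.

Lemma cVVE s t p : cVV s t p = \sum_(i < p) \sum_(j < p) e2 (s + i) (t + j).
Proof.
rewrite /cVV /V; under eq_fun do rewrite big_distrlr /=.
rewrite Exp_sum; last by move=> i _; apply: L1_sum => j _; exact: L1_mul2.
by apply: eq_bigr => i _; rewrite Exp_sum// => j _; exact: L1_mul2.
Qed.

Lemma cVV_sig2 t p : cVV t t p = sig2 p.
Proof.
rewrite /sig2 !cVVE; apply: eq_bigr => i _; apply: eq_bigr => j _.
by rewrite !(addnC t) e2s !add0n.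
Qed.

Lemma sig2_ge0 p : 0 <= sig2 p.
Proof. by apply: Exp_ge0 => w; rewrite -expr2 sqr_ge0. Qed.

Definition Csig := 2 * Cg / (2 * H - 1).

(** Covariances decay like k^(2H - 2), which is not summable: each of the p rows of the covariance
    matrix sums to order p^(2H - 1). *)
Lemma sig2_le p : sig2 p <= Csig * p%:R `^ (2 * H).
Proof.
have hl := Hl; have hu := Hu.
rewrite /sig2 cVVE.
have [->|p0] := posnP p; first by rewrite big_ord0 powR0 ?mulr0// gt_eqF//; lra.
pose g k : R := Cg * k.+1%:R `^ (2 * H - 2).
have g0 k : 0 <= g k by rewrite mulr_ge0 ?powR_ge0// ltW.
apply: (@le_trans _ _ (\sum_(i < p) 2 * \sum_(k < p) g k)).
  apply: ler_sum => -[i ip] _ /=; apply: le_trans (sum_dist_le g0 ip).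
  by apply: ler_sum => j _; apply: le_trans (ler_norm _) (e2_dist _ _).
rewrite sumr_cst_ord -mulr_sumr.
have := @sum_powR_le R (2 * H - 1) p; rewrite (_ : 2 * H - 1 - 1 = 2 * H - 2); last by ring.
move=> /(_ ltac:(lra)) hs.
have pE : p%:R `^ (2 * H) = p%:R * p%:R `^ (2 * H - 1) :> R.
  by rewrite powRm1 ?ltr0n//; field; rewrite pnatr_eq0 -lt0n.
rewrite pE /Csig.
have : Cg * \sum_(k < p) k.+1%:R `^ (2 * H - 2) <= Cg * (p%:R `^ (2 * H - 1) / (2 * H - 1)).
  by rewrite ler_wpM2l// ltW.
move=> h; have p0' : (0 : R) <= p%:R by [].
have := ler_wpM2l p0' h; lra.
Qed.

Lemma cVV_le s t p : `|cVV s t p| <= sig2 p.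
Proof.
have l := L1_mul2 (L4_V s p) (L4_V t p).
apply: (le_trans (Exp_norm_le l)).
have Lss := L1_mul2 (L4_V s p) (L4_V s p); have Ltt := L1_mul2 (L4_V t p) (L4_V t p).
suff : Exp P (fun w => 2 * `|V s p w * V t p w|) <= sig2 p + sig2 p.
  by rewrite ExpZ; [lra|exact: L1_norm].
rewrite -{1}(cVV_sig2 s p) -(cVV_sig2 t p) /cVV -ExpD//.
apply: Exp_le; [by apply: L1Z; exact: L1_norm|exact: L1D|].
move=> w; rewrite normrM.
have := sqr_ge0 (`|V s p w| - `|V t p w|).
have := real_normK (num_real (V s p w)); have := real_normK (num_real (V t p w)).
lra.
Qed.

(** Indices of the two windows are at least (D - 1) p apart, so each of the p^2 covariances is at
    most Cg ((D - 1) p)^(2H - 2). *)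
Lemma cVV_far s t p D : (0 < p)%N -> (2 <= D)%N -> (s + D * p <= t)%N ->
  `|cVV s t p| <= Cg * D.-1%:R `^ (2 * H - 2) * p%:R `^ (2 * H).
Proof.
move=> p0 D2 st; rewrite cVVE.
have hl := Hl; have hu := Hu.
have pR : (0 : R) < p%:R by rewrite ltr0n.
have D0 : (0 : R) < D.-1%:R by rewrite ltr0n; lia.
apply: (@le_trans _ _ (\sum_(i < p) \sum_(j < p) Cg * (D.-1%:R * p%:R) `^ (2 * H - 2))).
  apply: le_trans (ler_norm_sum _ _ _) _; apply: ler_sum => -[i ip] _ /=.
  apply: le_trans (ler_norm_sum _ _ _) _; apply: ler_sum => -[j jp] _ /=.
  apply: (le_trans (e2_dist _ _)); apply: ler_wpM2l; first exact: ltW.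
  apply: powR_anti; [by rewrite mulr_gt0| |lra].
  by rewrite -natrM ler_nat; nia.
rewrite !sumr_cst_ord powRM ?(ltW pR) ?(ltW D0)//.
rewrite (powRm2 _ pR) le_eqVlt.
by apply/orP; left; apply/eqP; field; rewrite gt_eqF.
Qed.

(** A fourth moment is the cumulant plus three pairings. The pairing inside each window gives the
    square of [sig2]; the two cross pairings each give the squared covariance of the windows. *)
Lemma Exp_V22 s t p : Exp P (fun w => V s p w ^+ 2 * V t p w ^+ 2) <=
  sig2 p ^+ 2 + 2 * cVV s t p ^+ 2 +
  \sum_(i < p) \sum_(j < p) \sum_(k < p) \sum_(l < p)
    `|kap ((s + j)%:Z - (s + i)%:Z) ((t + k)%:Z - (s + i)%:Z) ((t + l)%:Z - (s + i)%:Z)|.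
Proof.
have -> : (fun w => V s p w ^+ 2 * V t p w ^+ 2) = (fun w =>
    \sum_(i < p) \sum_(j < p) \sum_(k < p) \sum_(l < p)
    Y (s + i)%N w * Y (s + j)%N w * Y (t + k)%N w * Y (t + l)%N w).
  by apply/funext => w; rewrite !expr2 mulrA /V sum4_mul.
have L i j k l : L1 P (fun w => Y (s + i)%N w * Y (s + j)%N w * Y (t + k)%N w * Y (t + l)%N w) by exact: L1_mul4.
rewrite Exp_sum; last by move=> ? _; do 3 (apply: L1_sum => ? _).
under eq_bigr => i _.
  rewrite Exp_sum; last by move=> ? _; do 2 (apply: L1_sum => ? _).
  under eq_bigr => j _.
    rewrite Exp_sum; last by move=> ? _; apply: L1_sum => ? _.
    under eq_bigr => k _.
      rewrite Exp_sum//; under eq_bigr => l _ do rewrite e4 addrC.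
      rewrite big_split/=; over.
    rewrite big_split/=; over.
  rewrite big_split/=; over.
rewrite big_split/=; apply: lerD; last first.
  by do 4 (apply: ler_sum => ? _); exact: ler_norm.
have -> : sig2 p ^+ 2 + 2 * cVV s t p ^+ 2 = cVV s s p * cVV t t p + (cVV s t p * cVV s t p + cVV s t p * cVV s t p).
  by rewrite !cVV_sig2; ring.
rewrite le_eqVlt; apply/orP; left; apply/eqP.
rewrite !cVVE !sum22_mul/=.
have H3 (A B C D : 'I_p -> 'I_p -> 'I_p -> 'I_p -> R) : (forall i j k l, A i j k l = B i j k l + (C i j k l + D i j k l)) ->
   \sum_i \sum_j \sum_k \sum_l A i j k l = \sum_i \sum_j \sum_k \sum_l B i j k l +
   (\sum_i \sum_j \sum_k \sum_l C i j k l + \sum_i \sum_j \sum_k \sum_l D i j k l).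
  move=> AB; rewrite -!big_split/=; apply: eq_bigr => i _.
  rewrite -!big_split/=; apply: eq_bigr => j _.
  rewrite -!big_split/=; apply: eq_bigr => k _.
  by rewrite -!big_split/=; apply: eq_bigr => l _.
rewrite (H3 _ (fun i j k l => e2 (s + i) (s + j) * e2 (t + k) (t + l))
  (fun i j k l => e2 (s + i) (t + k) * e2 (s + j) (t + l))
  (fun i j k l => e2 (s + i) (t + l) * e2 (s + j) (t + k))); last by move=> ? ? ? ?; rewrite addrA.
congr (_ + (_ + _)).
- by apply: eq_bigr => i _; rewrite exchange_big.
- apply: eq_bigr => i _.
  transitivity (\sum_(j < p) \sum_(l < p) \sum_(k < p) e2 (s + i) (t + l) * e2 (s + j) (t + k)).
    by apply: eq_bigr => j _; rewrite exchange_big.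
  by rewrite exchange_big.
Qed.

(** Indices below [n], recentred at [c], lie in [-n, n], the range of the cumulant condition. *)
Lemma kap_sum n c h : (0 < n)%N -> (c <= n)%N ->
  \sum_(u < n) \sum_(v < n) `|kap h (u%:Z - c%:Z) (v%:Z - c%:Z)| <= Ck * n%:R `^ (2 * H - 1).
Proof.
move=> n0 cn; apply: le_trans (kapb h n0).
have := @ler_sum2_shift R n (2 * n).+1 (n - c) (n - c) (fun a b => `|kap h (a%:Z - n%:Z) (b%:Z - n%:Z)|).
move=> /(_ (fun _ _ => normr_ge0 _)) => /(_ ltac:(lia) ltac:(lia)).
apply: le_trans; rewrite le_eqVlt; apply/orP; left; apply/eqP.
apply: eq_bigr => u _; apply: eq_bigr => v _; congr (`|kap _ _ _|); lia.
Qed.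

(** For fixed [k], the map from (t, l) to (t + k, t + l) is injective into a square of side [n].
    Hence the cumulant bound is paid once per [k], not once per [t]. *)
Lemma kap_sum_windows n m p s i h : (0 < n)%N -> (m + p <= n)%N -> (s + i <= n)%N ->
  \sum_(t < m) \sum_(k < p) \sum_(l < p)
    `|kap h ((t + k)%:Z - (s + i)%:Z) ((t + l)%:Z - (s + i)%:Z)| <= p%:R * (Ck * n%:R `^ (2 * H - 1)).
Proof.
move=> n0 mpn sn; rewrite exchange_big /= -sumr_cst_ord; apply: ler_sum => -[k kp] _ /=.
apply: le_trans (kap_sum h n0 sn).
apply: (@le_trans _ _ (\sum_(t < m) \sum_(v < n) `|kap h ((t + k)%:Z - (s + i)%:Z) (v%:Z - (s + i)%:Z)|)).
  apply: ler_sum => -[t tm] _ /=.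
  under eq_bigr => l _ do rewrite [in X in kap _ _ X](addnC t).
  by apply: (@ler_sum_shift _ _ _ _ (fun v => `|kap h ((t + k)%:Z - (s + i)%:Z) (v%:Z - (s + i)%:Z)|)) => //; lia.
apply: (@ler_sum_shift _ _ _ _ (fun u => \sum_(v < n) `|kap h (u%:Z - (s + i)%:Z) (v%:Z - (s + i)%:Z)|)); last lia.
by move=> u; exact: sumr_ge0.
Qed.

Lemma kap_sum_one p s h i : (i < p)%N -> \sum_(k < p) \sum_(l < p)
    `|kap h ((s + k)%:Z - (s + i)%:Z) ((s + l)%:Z - (s + i)%:Z)| <= Ck * p%:R `^ (2 * H - 1).
Proof.
move=> ip; apply: le_trans (@kap_sum p i h _ _); [|lia|lia].
rewrite le_eqVlt; apply/orP; left; apply/eqP.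
apply: eq_bigr => k _; apply: eq_bigr => l _; congr (`|kap _ _ _|); lia.
Qed.

Lemma near_count (m t D : nat) (A : R) : 0 <= A ->
  \sum_(s < m) (if (s + D <= t)%N || (t + D <= s)%N then 0 else A) <= (2 * D)%:R * A.
Proof.
move=> A0; rewrite -(big_mkord predT (fun s => if (s + D <= t)%N || (t + D <= s)%N then 0 else A)).
rewrite (bigID (fun s => (s + D <= t)%N || (t + D <= s)%N))/= big1 ?add0r; last by move=> i ->.
rewrite (eq_bigr (fun=> A)); last by move=> i /negbTE ->.
rewrite -big_filter big_const_seq count_predT iter_addr_0 -[A *+ _]mulr_natl ler_wpM2r// ler_nat.
have -> : (2 * D = size (iota (t - D) (2 * D)))%N by rewrite size_iota.
apply: uniq_leq_size; first by rewrite filter_uniq// iota_uniq.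
move=> s; rewrite mem_filter !mem_iota; lia.
Qed.

Definition Cv4 := 3 * Csig ^+ 2 + Ck.

Lemma Csig_gt0 : 0 < Csig.
Proof. by have hl := Hl; rewrite /Csig divr_gt0 ?mulr_gt0//; lra. Qed.

Lemma Cv4_gt0 : 0 < Cv4.
Proof. by rewrite /Cv4 ltr_wpDl// mulr_ge0// sqr_ge0. Qed.

(** The pairings contribute 3 times the square of [sig2]. The cumulants contribute p^2 choices of
    (i, j) at cost p^(2H - 1) each, and p^(2H + 1) <= p^(4H) because 2H >= 1. *)
Lemma V4_le t p : Exp P (fun w => V t p w ^+ 4) <= Cv4 * p%:R `^ (4 * H).
Proof.
have hl := Hl; have hu := Hu.
have [->|p0] := posnP p.
  under eq_fun do rewrite V0 expr0n /=.
  by rewrite Exp_cst mulr_ge0 ?powR_ge0// ltW// Cv4_gt0.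
have := Exp_V22 t t p; under eq_fun do rewrite -exprD; move=> /le_trans; apply.
rewrite cVV_sig2.
have p1 : (1 : R) <= p%:R by rewrite ler1n.
have E4H : p%:R `^ (4 * H) = p%:R `^ (2 * H) * p%:R `^ (2 * H) :> R.
  by rewrite -powR_add ?ltr0n//; congr (_ `^ _); ring.
have hs : sig2 p ^+ 2 <= Csig ^+ 2 * p%:R `^ (4 * H).
  rewrite E4H -expr2 -exprMn; apply: lerXn2r; last exact: sig2_le.
    by rewrite nnegrE sig2_ge0.
  by rewrite nnegrE mulr_ge0 ?powR_ge0// ltW// Csig_gt0.
have hk : \sum_(i < p) \sum_(j < p) \sum_(k < p) \sum_(l < p)
    `|kap ((t + j)%:Z - (t + i)%:Z) ((t + k)%:Z - (t + i)%:Z) ((t + l)%:Z - (t + i)%:Z)| <= Ck * p%:R `^ (4 * H).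
  apply: (@le_trans _ _ (p%:R * (p%:R * (Ck * p%:R `^ (2 * H - 1))))).
    rewrite -sumr_cst_ord; apply: ler_sum => -[i ip] _ /=.
    by rewrite -sumr_cst_ord; apply: ler_sum => -[j jp] _ /=; exact: kap_sum_one.
  rewrite (_ : _ * _ = Ck * (p%:R * p%:R * p%:R `^ (2 * H - 1))); last by ring.
  rewrite ler_wpM2l//; first exact: ltW.
  rewrite -expr2 -powR_mulrn// -powR_add ?ltr0n//.
  by apply: ler_powR => //; lra.
by rewrite /Cv4; lra.
Qed.

Definition Dev p m w := \sum_(t < m) (V t p w ^+ 2 - sig2 p).

Lemma L4_V2 s t p : L1 P (fun w => V s p w ^+ 2 * V t p w ^+ 2).
Proof.
have := L1_mul4 (L4_V s p) (L4_V s p) (L4_V t p) (L4_V t p).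
by under eq_fun do rewrite -mulrA -!expr2.
Qed.

Lemma L1_Dev2 p m : L1 P (fun w => Dev p m w ^+ 2).
Proof.
under eq_fun do rewrite expr2 /Dev big_distrlr /=.
apply: L1_sum => s _; apply: L1_sum => t _.
have -> : (fun w => (V s p w ^+ 2 - sig2 p) * (V t p w ^+ 2 - sig2 p)) =
  (fun w => V s p w ^+ 2 * V t p w ^+ 2 - (sig2 p * V s p w ^+ 2 + sig2 p * V t p w ^+ 2 - sig2 p ^+ 2)).
  by apply/funext => w; ring.
apply: L1B; first exact: L4_V2.
by apply: L1B; [apply: L1D; apply: L1Z; apply: L1_sqr; exact: L4_V|exact: L1_cst].
Qed.

(** [D] separates two regimes: pairs of windows closer than D p are few and bounded by the variance,
    the others have a small covariance. The last term is the cumulant part, where i, j and k cost p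
    each and the sums over t and l are absorbed by [kap_sum_windows]. *)
Lemma Dev2_le p m n D : (0 < p)%N -> (m + p <= n)%N -> (2 <= D)%N ->
  Exp P (fun w => Dev p m w ^+ 2) <=
   m%:R * (2 * ((2 * (D * p))%:R * sig2 p ^+ 2 +
      m%:R * (Cg * D.-1%:R `^ (2 * H - 2) * p%:R `^ (2 * H)) ^+ 2))
   + m%:R * (p%:R * (p%:R * (p%:R * (Ck * n%:R `^ (2 * H - 1))))).
Proof.
move=> p0 mpn D2.
have n0 : (0 < n)%N by lia.
pose B := Cg * D.-1%:R `^ (2 * H - 2) * p%:R `^ (2 * H).
have -> : (fun w => Dev p m w ^+ 2) = (fun w => \sum_(s < m) \sum_(t < m)
   (V s p w ^+ 2 * V t p w ^+ 2 - (sig2 p * V s p w ^+ 2 + sig2 p * V t p w ^+ 2 - sig2 p ^+ 2))).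
  apply/funext => w; rewrite expr2 /Dev big_distrlr /=.
  by apply: eq_bigr => s _; apply: eq_bigr => t _; ring.
have L s t : L1 P (fun w => V s p w ^+ 2 * V t p w ^+ 2 - (sig2 p * V s p w ^+ 2 + sig2 p * V t p w ^+ 2 - sig2 p ^+ 2)).
  apply: L1B; first exact: L4_V2.
  by apply: L1B; [apply: L1D; apply: L1Z; apply: L1_sqr; exact: L4_V|exact: L1_cst].
rewrite Exp_sum; last by move=> s _; exact: L1_sum.
rewrite -mulrDr -[leRHS]sumr_cst_ord; apply: ler_sum => -[s sm] _ /=.
rewrite Exp_sum//.
pose K s t := \sum_(i < p) \sum_(j < p) \sum_(k < p) \sum_(l < p)
    `|kap ((s + j)%:Z - (s + i)%:Z) ((t + k)%:Z - (s + i)%:Z) ((t + l)%:Z - (s + i)%:Z)|.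
apply: (@le_trans _ _ (\sum_(t < m) (2 * cVV s t p ^+ 2 + K s t))).
  apply: ler_sum => t _.
  rewrite ExpB; [|exact: L4_V2|]; last first.
    by apply: L1B; [apply: L1D; apply: L1Z; apply: L1_sqr; exact: L4_V|exact: L1_cst].
  rewrite ExpB; [| |exact: L1_cst]; last by apply: L1D; apply: L1Z; apply: L1_sqr; exact: L4_V.
  rewrite ExpD; [|by apply: L1Z; apply: L1_sqr; exact: L4_V..].
  rewrite (ExpZ _ (L1_sqr (L4_V s p))) (ExpZ _ (L1_sqr (L4_V t p))) Exp_cst.
  have e t' : Exp P (fun w => V t' p w ^+ 2) = sig2 p.
    by under eq_fun do rewrite expr2; exact: cVV_sig2.
  by rewrite !e; have := Exp_V22 s t p; rewrite -/(K s t); lra.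
rewrite big_split/=; apply: lerD.
  rewrite -mulr_sumr ler_wpM2l//.
  apply: (@le_trans _ _ (\sum_(t < m) ((if (t + D * p <= s)%N || (s + D * p <= t)%N then 0 else sig2 p ^+ 2) + B ^+ 2))).
    apply: ler_sum => t _; rewrite -(real_normK (num_real (cVV s t p))).
    have B0 : 0 <= B by rewrite /B !mulr_ge0 ?powR_ge0// ltW.
    case: ifPn => [/orP[far|far]|near].
    - rewrite add0r ler_pXn2r ?nnegrE//.
      have -> : cVV s t p = cVV t s p by congr Exp; apply/funext => w; rewrite mulrC.
      exact: cVV_far.
    - by rewrite add0r ler_pXn2r ?nnegrE//; exact: cVV_far.
    - apply: ler_wpDr; first exact: sqr_ge0.
      by rewrite ler_pXn2r ?nnegrE ?sig2_ge0// cVV_le.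
  rewrite big_split/= sumr_cst_ord lerD2r.
  by apply: near_count; exact: sqr_ge0.
rewrite /K exchange_big /= -sumr_cst_ord; apply: ler_sum => -[i ip] _ /=.
rewrite exchange_big /= -sumr_cst_ord; apply: ler_sum => -[j jp] _ /=.
apply: kap_sum_windows => //; lia.
Qed.

(** * Maximal inequality by dyadic chaining *)

Section maximal.
Variable C4 : R.
Hypothesis C40 : 0 <= C4.
Hypothesis V4C : forall t p, Exp P (fun w => V t p w ^+ 4) <= C4 * p%:R `^ (4 * H).

(** Young's inequality twice, unbalanced so that the factor of [y] is below 2. The recursion adds
    two halves, and 2 * 125/64 < 4 <= 2^(4H) keeps the constants bounded over all levels. *)
Lemma add4_le (x y : R) : (x + y) ^+ 4 <= 125 * x ^+ 4 + 125 / 64 * y ^+ 4.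
Proof.
have h1 : (x + y) ^+ 2 <= 5 * x ^+ 2 + 5 / 4 * y ^+ 2 by have := sqr_ge0 (2 * x - y / 2); nra.
have h0 := sqr_ge0 (x + y).
have h2 : ((x + y) ^+ 2) ^+ 2 <= (5 * x ^+ 2 + 5 / 4 * y ^+ 2) ^+ 2.
  by apply: lerXn2r; rewrite ?nnegrE//; apply: le_trans h1.
rewrite -exprM in h2; apply: (le_trans h2).
have := sqr_ge0 (x ^+ 2 * 4 - y ^+ 2 / 4); nra.
Qed.

(** An integrable majorant for the fourth powers of all sums from [a] of length at most 2^k. A sum
    reaching beyond the midpoint is the whole first half plus a sum started at the midpoint, to
    which [add4_le] applies. *)
Fixpoint Um (k : nat) (a : nat) (w : T) : R :=
  if k is k'.+1 then 125 / 64 * (Um k' a w + Um k' (a + 2 ^ k') w) + 125 * V a (2 ^ k') w ^+ 4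
  else V a 1 w ^+ 4.

Lemma Um_ge0 k a w : 0 <= Um k a w.
Proof.
elim: k a => [|k IH] a /=; first by rewrite exprn_even_ge0.
have : 0 <= V a (2 ^ k) w ^+ 4 by rewrite exprn_even_ge0.
by have := IH a; have := IH (a + 2 ^ k)%N; lra.
Qed.

Lemma Um_dom k a j w : (j <= 2 ^ k)%N -> V a j w ^+ 4 <= Um k a w.
Proof.
elim: k a j => [|k IH] a j /= jk.
  by move: jk; case: j => [|[|//]] _ //; rewrite V0 expr0n exprn_even_ge0.
have [jk'|kj] := leqP j (2 ^ k).
  have := IH a j jk'; have := Um_ge0 k a w; have := Um_ge0 k (a + 2 ^ k) w.
  have : 0 <= V a (2 ^ k) w ^+ 4 by rewrite exprn_even_ge0.
  by lra.
have -> : j = (2 ^ k + (j - 2 ^ k))%N by lia.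
rewrite V_cat; apply: (le_trans (add4_le _ _)).
have : V (a + 2 ^ k) (j - 2 ^ k) w ^+ 4 <= Um k (a + 2 ^ k) w.
  by apply: IH; move: jk; rewrite expnS; lia.
by have := Um_ge0 k a w; lra.
Qed.

Lemma L1_Um k a : L1 P (Um k a).
Proof.
elim: k a => [|k IH] a /=; first exact: (L4_V a 1).2.
by apply: L1D; [apply: L1Z; exact: L1D|apply: L1Z; exact: (L4_V a _).2].
Qed.

(** With K = 1600 one has 2 * (125/64) * K + 125 <= 4 * K, which closes the recursion of the
    constants from one level to the next. *)
Let K4 := 40 * 40 * C4.

Lemma Exp_Um k a : Exp P (Um k a) <= K4 * (2 ^ k)%:R `^ (4 * H).
Proof.
have hl := Hl; have hu := Hu; have c0 := C40.
elim: k a => [|k IH] a /=.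
  by apply: (le_trans (V4C a 1)); rewrite expn0 powR1 /K4; lra.
rewrite ExpD; [|by apply: L1Z; apply: L1D; exact: L1_Um|by apply: L1Z; exact: (L4_V a _).2].
rewrite (ExpZ _ (L1D (L1_Um k a) (L1_Um k (a + 2 ^ k)%N))).
rewrite (ExpD (L1_Um k a) (L1_Um k (a + 2 ^ k)%N)) (ExpZ _ (L4_V a _).2).
have h1 := IH a; have h2 := IH (a + 2 ^ k)%N; have h3 := V4C a (2 ^ k).
rewrite expnS natrM powRM//.
have h4 : (4 : R) <= 2 `^ (4 * H).
  rewrite [leLHS](_ : _ = 2 `^ 2%:R); last by rewrite powR_mulrn//; ring.
  by apply: ler_powR; lra.
set z := (2 ^ k)%:R `^ (4 * H) in h1 h2 h3 *; have z0 : 0 <= z by exact: powR_ge0.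
set z2 := 2 `^ (4 * H) in h4 *; clearbody z z2.
rewrite /K4 in h1 h2 *; have cz := mulr_ge0 c0 z0; have := ler_wpM2r cz h4; lra.
Qed.

(** The length [l] is rounded up to a power of two that is at most 2 l; the factor 16 pays for it,
    as 2^(4H) <= 16. *)
Lemma max_dominated l : (0 < l)%N -> exists U : nat -> T -> R,
  [/\ forall a, L1 P (U a), forall a w, 0 <= U a w,
      forall a j w, (j <= l)%N -> V a j w ^+ 4 <= U a w &
      forall a, Exp P (U a) <= 16 * K4 * l%:R `^ (4 * H)].
Proof.
have hl := Hl; have hu := Hu; have c0 := C40.
move=> l0; pose k := (trunc_log 2 l).+1.
have /andP[kl lk] := @trunc_log_bounds 2 l isT l0.
exists (Um k); split => [a|a w|a j w jl|a].
- exact: L1_Um.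
- exact: Um_ge0.
- by apply: Um_dom; apply: (leq_trans jl); exact: ltnW.
apply: (le_trans (Exp_Um _ _)).
have : (2 ^ k)%:R `^ (4 * H) <= 16 * l%:R `^ (4 * H) :> R.
  apply: (@le_trans _ _ ((2 * l%:R) `^ (4 * H))).
    apply: ge0_ler_powR; rewrite ?nnegrE ?mulr_ge0//; first lra.
    by rewrite -natrM ler_nat /k expnS leq_mul2l.
  rewrite powRM// ler_wpM2r ?powR_ge0//.
  have -> : (16 : R) = 2 `^ 4%:R by rewrite powR_mulrn//; ring.
  by apply: ler_powR; lra.
by move=> h; have := ler_wpM2l c0 h; rewrite /K4; lra.
Qed.

(** Uniform in the starting point as well: with [b] the start of the block of length [p] containing
    [k], the increment is a difference of two sums from [b] of length at most 2 p. Summing the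
    majorants of the blocks replaces a maximum, at the price of a factor n/p. *)
Lemma osc_dominated p n : (0 < p)%N -> exists U : T -> R,
  [/\ L1 P U, forall w, 0 <= U w,
      forall k j w, (k <= n)%N -> (j <= p)%N -> V k j w ^+ 4 <= U w &
      Exp P U <= (n %/ p).+1%:R * (16 * (16 * K4 * (2 * p)%:R `^ (4 * H)))].
Proof.
move=> p0; have [U [LU U0 UV EU]] := @max_dominated (2 * p) ltac:(lia).
exists (fun w => \sum_(b < (n %/ p).+1) 16 * U (b * p)%N w); split.
- by apply: L1_sum => b _; exact: L1Z.
- by move=> w; apply: sumr_ge0 => b _; rewrite mulr_ge0.
- move=> k j w kn jp.
  have kb : (k %/ p < (n %/ p).+1)%N by rewrite ltnS leq_div2r.
  rewrite (bigD1 (Ordinal kb))//=.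
  have : 0 <= \sum_(i < (n %/ p).+1 | i != Ordinal kb) 16 * U (i * p)%N w by apply: sumr_ge0 => b _; rewrite mulr_ge0.
  set b := (k %/ p * p)%N.
  have km := divn_eq k p; have lm := ltn_pmod k p0.
  have e : V b ((k %% p) + j) w = V b (k %% p) w + V k j w by rewrite V_cat; congr (_ + V _ _ w); rewrite /b; lia.
  have h1 : V b ((k %% p) + j) w ^+ 4 <= U b w by apply: UV; lia.
  have h2 : V b (k %% p) w ^+ 4 <= U b w by apply: UV; lia.
  have -> : V k j w = V b ((k %% p) + j) w + - V b (k %% p) w by rewrite e; ring.
  move: h1 h2; move: (V b (k %% p + j) w) (V b (k %% p) w) => x y h1 h2.
  have : (x + - y) ^+ 4 <= 8 * x ^+ 4 + 8 * y ^+ 4.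
    have h3 := sqr_ge0 (x ^+ 2 - y ^+ 2).
    have h4 : (x - y) ^+ 2 <= 2 * (x ^+ 2 + y ^+ 2) by have := sqr_ge0 (x + y); lra.
    have h5 : ((x - y) ^+ 2) ^+ 2 <= (2 * (x ^+ 2 + y ^+ 2)) ^+ 2.
      by rewrite ler_pXn2r// nnegrE ?sqr_ge0// mulr_ge0// addr_ge0 ?sqr_ge0.
    by move: h5; rewrite -exprM; lra.
  by lra.
- rewrite Exp_sum; last by move=> b _; exact: L1Z.
  rewrite -sumr_cst_ord; apply: ler_sum => b _; rewrite ExpZ//.
  by rewrite ler_wpM2l.
Qed.

End maximal.

(** Relative to n^2 p^(4H), near pairs are of order D p/n, far pairs of order D^(4H - 4) and
    cumulants of order (p/n)^(2 - 2H). As H < 1, [D] is fixed first by the far pairs, and then p/n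
    is made small. *)
Lemma Dev_small th : 0 < th -> exists2 rho, 0 < rho & forall n p m, (0 < p)%N ->
  p%:R <= rho * n%:R :> R -> (m <= n)%N ->
  Exp P (fun w => Dev p m w ^+ 2) <= th * (n%:R * p%:R `^ (2 * H)) ^+ 2.
Proof.
have hl := Hl; have hu := Hu; have cg := Cg0; have ck := Ck0; have cs := Csig_gt0.
move=> th0.
pose K := 8 * Csig ^+ 2 + 2 * Cg ^+ 2 + 2 * Ck.
have K0 : 0 < K by rewrite /K; have := sqr_ge0 Csig; have := sqr_ge0 Cg; lra.
have thK : 0 < th / 3 / K by rewrite !divr_gt0.
have [r1 r10 h1] := @powR_small R (4 - 4 * H) (th / 3 / K) ltac:(lra) thK.
have [D' hD'] := nat_ge (r1^-1 + 1).
have r1i : 0 < r1^-1 by rewrite invr_gt0.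
have D'0 : (0 : R) < D'%:R by lra.
have D'1 : (0 < D')%N by rewrite -(ltr_nat R).
have hD : D'%:R `^ (4 * H - 4) <= th / 3 / K.
  have -> : 4 * H - 4 = - (4 - 4 * H) by ring.
  have e := powR_inv1 (ltW D'0).
  rewrite -mulN1r powRrM e; apply: h1; first by rewrite invr_ge0 ltW.
  by rewrite -(invrK r1) lef_pV2 ?posrE//; lra.
have [r2 r20 h2] := @powR_small R (2 - 2 * H) (th / 3 / K) ltac:(lra) thK.
pose r3 := th / 3 / K / D'.+1%:R.
have D1 : (0 : R) < D'.+1%:R by rewrite ltr0n.
have r30 : 0 < r3 by rewrite divr_gt0.
exists (Num.min (Num.min r2 r3) 1); first by rewrite !lt_min r20 r30 ltr01.
move=> n p m p0 pn mn.
have pR : (0 : R) < p%:R by rewrite ltr0n.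
have nR : (0 : R) < n%:R.
  rewrite ltr0n lt0n; apply/eqP => n0; move: pn; rewrite n0 mulr0; lra.
have [pr2 [pr3 pr1]] : p%:R / n%:R <= r2 /\ p%:R / n%:R <= r3 /\ p%:R / n%:R <= (1 : R).
  have : p%:R / n%:R <= Num.min (Num.min r2 r3) 1 by rewrite ler_pdivrMr.
  by rewrite !le_min => /andP[/andP[-> ->] ->].
have pnN : (p <= n)%N by rewrite -(ler_nat R); move: pr1; rewrite ler_pdivrMr// mul1r.
have mp2 : (m + p <= 2 * n)%N by rewrite mul2n -addnn leq_add.
apply: (le_trans (Dev2_le p0 mp2 (_ : 2 <= D'.+1)%N)) => //.
set N := p%:R `^ (2 * H); rewrite /=.
have N0 : 0 < N by exact: powR_gt0.
set x := p%:R / n%:R in pr2 pr3 pr1.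
have x0 : 0 < x by rewrite divr_gt0.
have pE : p%:R = x * n%:R by rewrite /x divfK// gt_eqF.
have mR : (m%:R : R) <= n%:R by rewrite ler_nat.
have s2 : sig2 p ^+ 2 <= Csig ^+ 2 * N ^+ 2.
  have q0 : 0 <= Csig * N by exact: ltW (mulr_gt0 cs N0).
  by rewrite -exprMn; apply: lerXn2r; rewrite ?nnegrE ?sig2_ge0//; exact: sig2_le.
have e1 : D'%:R `^ (2 * H - 2) ^+ 2 = D'%:R `^ (4 * H - 4) :> R.
  by rewrite expr2 -powR_add//; congr (_ `^ _); ring.
have e2' : p%:R * p%:R * p%:R * (2 * n)%:R `^ (2 * H - 1) <= 2 * x `^ (2 - 2 * H) * n%:R * N ^+ 2.
  rewrite natrM powRM//.
  have t1 : 2 `^ (2 * H - 1) <= (2 : R).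
    rewrite -[leRHS]powRr1//; apply: ler_powR; lra.
  have t2 : p%:R * p%:R * p%:R * n%:R `^ (2 * H - 1) <= x `^ (2 - 2 * H) * n%:R * N ^+ 2.
    have -> : x `^ (2 - 2 * H) = p%:R `^ (2 - 2 * H) / n%:R `^ (2 - 2 * H).
      by rewrite /x powR_div// ltW.
    have -> : n%:R `^ (2 * H - 1) = n%:R / n%:R `^ (2 - 2 * H) :> R.
      rewrite -powRN -{2}(powRr1 (ltW nR)) -powR_add//; congr (_ `^ _); ring.
    have -> : p%:R * p%:R * p%:R = p%:R `^ (2 - 2 * H) * (p%:R `^ (1 + 2 * H)) :> R.
      by rewrite -powR_add// (_ : 2 - 2 * H + (1 + 2 * H) = 3%:R); [rewrite powR_mulrn ?(ltW pR)//; ring|ring].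
    have -> : N ^+ 2 = p%:R `^ (4 * H) by rewrite /N expr2 -powR_add//; congr (_ `^ _); ring.
    have t3 : p%:R `^ (1 + 2 * H) <= p%:R `^ (4 * H) :> R.
      by apply: ler_powR; [rewrite ler1n|lra].
    have t4 : 0 <= p%:R `^ (2 - 2 * H) / n%:R `^ (2 - 2 * H) * n%:R :> R.
      by rewrite !mulr_ge0 ?invr_ge0 ?powR_ge0// ltW.
    have := ler_wpM2l t4 t3; lra.
  have t5 : 0 <= p%:R * p%:R * p%:R * n%:R `^ (2 * H - 1) :> R by rewrite !mulr_ge0 ?powR_ge0// ltW.
  have := ler_wpM2l t5 t1; lra.
have x3 : D'.+1%:R * x <= th / 3 / K.
  by rewrite mulrC -ler_pdivlMr.
have hx := h2 x (ltW x0) pr2.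
have Q0 : 0 <= n%:R ^+ 2 * N ^+ 2 by rewrite mulr_ge0 ?sqr_ge0.
have n20 : 0 <= n%:R * N ^+ 2 by rewrite mulr_ge0 ?sqr_ge0// ltW.
apply: (@le_trans _ _ (n%:R * (2 * ((2 * (D'.+1 * p))%:R * (Csig ^+ 2 * N ^+ 2) +
    n%:R * (Cg * D'%:R `^ (2 * H - 2) * N) ^+ 2) + Ck * (2 * x `^ (2 - 2 * H) * n%:R * N ^+ 2)))).
  rewrite -mulrDr; apply: ler_pM => //.
    by do ?[exact: sqr_ge0|exact: powR_ge0|exact: (ltW ck)|exact: ler0n|apply: addr_ge0|apply: mulr_ge0].
  apply: lerD.
    rewrite ler_wpM2l//; apply: lerD; first by rewrite ler_wpM2l.
    by rewrite ler_wpM2r// sqr_ge0.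
  by have := ler_wpM2l (ltW ck) e2'; lra.
rewrite (exprMn _ (Cg * _)) (exprMn _ Cg) (exprMn _ n%:R) e1 !natrM pE.
set u := D'%:R `^ (4 * H - 4) in hD *; set v := x `^ (2 - 2 * H) in hx *.
have -> : n%:R * (2 * (2%:R * (D'.+1%:R * (x * n%:R)) * (Csig ^+ 2 * N ^+ 2) + n%:R * (Cg ^+ 2 * u * N ^+ 2)) +
   Ck * (2 * v * n%:R * N ^+ 2)) = (4 * Csig ^+ 2 * (D'.+1%:R * x) + 2 * Cg ^+ 2 * u + 2 * Ck * v) * (n%:R ^+ 2 * N ^+ 2).
  by ring.
rewrite ler_wpM2r//.
have -> : th = K * (th / 3 / K) + K * (th / 3 / K) + K * (th / 3 / K) by field; rewrite gt_eqF.
have sC := sqr_ge0 Csig; have sg := sqr_ge0 Cg.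
have a1 := ler_wpM2l sC x3; have a2 := ler_wpM2l sg hD; have a3 := ler_wpM2l (ltW ck) hx.
set q := th / 3 / K in thK a1 a2 a3 *; clearbody q u v.
have : 0 <= q * Csig ^+ 2 by rewrite mulr_ge0// ltW.
have : 0 <= q * Cg ^+ 2 by rewrite mulr_ge0// ltW.
have : 0 <= q * Ck by rewrite mulr_ge0// ltW.
rewrite /K; lra.
Qed.

End windows.

Ltac nlia := repeat match goal with
  | H : is_true (Order.le _ _) |- _ => clear H
  | H : is_true (Order.lt _ _) |- _ => clear H
  | H : is_true (andb (Order.le _ _) _) |- _ => clear H
  | H : is_true (andb (Order.lt _ _) _) |- _ => clear H
  | H : forall _, _ |- _ => clear H
  | H : @eq (Algebra.Zmodule.sort _) _ _ |- _ => clear H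
  | H : @eq (Real.sort _) _ _ |- _ => clear H
  | H := _ : _ |- _ => clear H
  end; lia.

(** * The long-run variance estimator *)

Section lag_windows.
Context {R : realType}.
Implicit Types (z y x : nat -> R).

Lemma sum_int_count (N j k : nat) : (k < N)%N ->
  \sum_(t < N) ((j < t <= k)%N)%:R = (k - j)%:R :> R.
Proof.
move=> kN; rewrite -natr_sum; congr (_%:R).
have H n : (\sum_(t < n) (j < t <= k)%N = minn k n.-1 - j)%N.
  elim: n => [|n IH]; first by rewrite big_ord0; lia.
  by rewrite big_ord_recr /= IH; case: n {IH} => [|n] /=; lia.
by rewrite H; lia.
Qed.

Definition dist (i j : nat) := (maxn i j - minn i j)%N.

Lemma lag_sum z (L p : nat) :
  \sum_(i < L) \sum_(j < L) z i * z j * (p - dist i j)%:R =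
  p%:R * (\sum_(i < L) z i ^+ 2)
  + 2 * \sum_(1 <= d < p) (p - d)%:R * \sum_(i < L - d) z i * z (i + d)%N.
Proof.
elim: L => [|L IH].
  rewrite !big_ord0 mulr0 add0r big1_seq ?mulr0// => d _.
  by rewrite sub0n big_ord0 mulr0.
have E : \sum_(i < L) z i * z L * (p - (L - i))%:R =
    \sum_(1 <= d < p) (if (d <= L)%N then (p - d)%:R * (z (L - d)%N * z L) else 0).
  transitivity (\sum_(1 <= d < (L + p).+1) (if (d <= L)%N then (p - d)%:R * (z (L - d)%N * z L) else 0)).
    rewrite (@big_cat_nat _ _ _ L.+1)//=; last by rewrite ltnS leq_addr.
    rewrite [X in _ = _ + X]big_nat_cond [X in _ = _ + X]big1 ?addr0; last first.
      by move=> d /andP[/andP[Ld _] _]; rewrite leqNgt Ld.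
    rewrite big_add1 /= big_nat_rev /= big_mkord; apply: eq_bigr => -[i iL] _ /=.
    rewrite add0n ifT; last lia.
    have -> : (L - (L - i.+1).+1)%N = i by lia.
    have -> : (L - i.+1).+1 = (L - i)%N by lia.
    by rewrite mulrC.
  have [p0|p0] := posnP p.
    rewrite p0 [RHS]big_geq//; apply: big1_seq => d _; case: ifP => // _.
    by rewrite sub0n mul0r.
  rewrite (@big_cat_nat _ _ _ p)//=; last lia.
  rewrite [X in _ + X = _]big_nat_cond [X in _ + X = _]big1 ?addr0// => d /andP[/andP[pd _] _].
  by case: ifP => // _; rewrite (_ : (p - d)%N = 0%N) ?mul0r//; lia.
have E' : \sum_(1 <= d < p) (p - d)%:R * (\sum_(i < L.+1 - d) z i * z (i + d)%N) =
   \sum_(1 <= d < p) (p - d)%:R * (\sum_(i < L - d) z i * z (i + d)%N)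
   + \sum_(1 <= d < p) (if (d <= L)%N then (p - d)%:R * (z (L - d)%N * z L) else 0).
  rewrite -big_split /=; apply: eq_bigr => d _; case: ifPn => dL.
    by rewrite subSn// big_ord_recr /= subnK// mulrDr.
  by rewrite addr0 (_ : (L.+1 - d)%N = (L - d)%N)//; lia.
rewrite [in RHS]big_ord_recr /= E' -E.
rewrite big_ord_recr /=.
under eq_bigr => i _ do rewrite big_ord_recr /=.
rewrite big_split /= IH big_ord_recr /=.
have e1 : \sum_(i < L) z i * z L * (p - dist i L)%:R = \sum_(i < L) z i * z L * (p - (L - i))%:R.
  by apply: eq_bigr => -[i iL] _ /=; rewrite (_ : dist i L = L - i)%N// /dist; lia.
have e2 : \sum_(i < L) z L * z i * (p - dist L i)%:R = \sum_(i < L) z i * z L * (p - (L - i))%:R.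
  by apply: eq_bigr => -[i iL] _ /=; rewrite (_ : dist L i = L - i)%N; [ring|rewrite /dist; lia].
rewrite e1 e2 /dist maxnn minnn subnn subn0; ring.
Qed.

Lemma sum_window z (L p t : nat) :
  \sum_(i < minn t L) z i - \sum_(i < minn (t - p) L) z i =
  \sum_(i < L) ((i < t <= i + p)%N)%:R * z i.
Proof.
have H k : \sum_(i < minn k L) z i = \sum_(i < L) ((i < k)%N)%:R * z i.
  elim: L => [|n IH]; first by rewrite minn0 !big_ord0.
  rewrite big_ord_recr /= -IH; case: ltnP => nk.
    by rewrite (minn_idPr nk) big_ord_recr /= mul1r.
  by rewrite (minn_idPl (leqW nk)) mul0r addr0.
rewrite !H -sumrB; apply: eq_bigr => -[i iL] _ /=; rewrite -mulrBl; congr (_ * _).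
have -> : (i < t <= i + p)%N = (i < t)%N && ~~ (i < t - p)%N by lia.
case: (ltnP i t) => h1; case: (ltnP i (t - p)) => h2; rewrite ?subrr ?subr0//=.
lia.
Qed.

(** Two indices share exactly p - |i - j| windows of length [p] (none if this is negative), windows
    overhanging the ends included. This is the origin of the Bartlett weights. *)
Lemma window_sum_lag z (L p : nat) :
  \sum_(t < L + p) (\sum_(i < minn t L) z i - \sum_(i < minn (t - p) L) z i) ^+ 2 =
  p%:R * (\sum_(i < L) z i ^+ 2)
  + 2 * \sum_(1 <= d < p) (p - d)%:R * \sum_(i < L - d) z i * z (i + d)%N.
Proof.
rewrite -lag_sum; under eq_bigr => t _ do rewrite sum_window expr2 big_distrlr /=.
rewrite exchange_big /=; apply: eq_bigr => -[i iL] _ /=.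
rewrite exchange_big /=; apply: eq_bigr => -[j jL] _ /=.
have <- : \sum_(t < L + p) ((maxn i j < t <= minn i j + p)%N)%:R = (p - dist i j)%:R :> R.
  by rewrite sum_int_count /dist; [congr (_%:R); lia|lia].
rewrite mulr_sumr; apply: eq_bigr => t _.
have -> : (maxn i j < t <= minn i j + p)%N = (i < t <= i + p)%N && (j < t <= j + p)%N by lia.
by case: (i < t <= i + p)%N; case: (j < t <= j + p)%N; rewrite /=; ring.
Qed.

Definition v y t p := \sum_(i < p) y (t + i)%N.

Lemma v_cat y t p p' : v y t (p + p') = v y t p + v y (t + p) p'.
Proof.
rewrite /v big_split_ord /=; congr (_ + _).
by apply: eq_bigr => i _; rewrite addnA.
Qed.

Lemma seg_sumE x mu y a k : (forall j, x j.+1 = y j + mu) ->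
  seg_sum x a k = v y a k + k%:R * mu.
Proof.
move=> xy; rewrite /seg_sum big_add1 /= big_mkord /v.
under eq_bigr do rewrite addnS xy.
by rewrite big_split /= sumr_const card_ord mulr_natl.
Qed.

Definition cs y a L k := v y a k - k%:R / L%:R * v y a L.

(** Keeping the overhanging windows, by truncating the indices with [minn], makes the identity exact
    rather than asymptotic. *)
Lemma lrv_window x mu y a L qq : (forall j, x j.+1 = y j + mu) -> (0 < L)%N ->
  L%:R * qq.+1%:R * lrv x a L qq =
  \sum_(t < L + qq.+1) (cs y a L (minn t L) - cs y a L (minn (t - qq.+1) L)) ^+ 2.
Proof.
move=> xy L0; have LR : L%:R != 0 :> R by rewrite pnatr_eq0 -lt0n.
pose z i := y (a + i)%N - v y a L / L%:R.
have cz k : cs y a L k = \sum_(i < k) z i.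
  by rewrite /z sumrB sumr_const card_ord /cs /v -mulr_natl; ring.
under eq_bigr do rewrite !cz.
rewrite window_sum_lag /lrv (seg_sumE _ _ xy).
set m := L%:R^-1 * (v y a L + _).
have mE i : x (a + i.+1)%N - m = z i.
  by rewrite addnS xy /m /z; field.
rewrite !big_add1 /= big_mkord.
have -> : \sum_(i < L) (x (a + i.+1)%N - m) ^+ 2 = \sum_(i < L) z i ^+ 2.
  by apply: eq_bigr => i _; rewrite mE.
have -> : \sum_(0 <= i < qq) bartlett qq i.+1 * (L%:R^-1 *
    (\sum_(1 <= i0 < (L - i.+1).+1) (x (a + i0)%N - m) * (x (a + i0 + i.+1)%N - m))) =
  \sum_(0 <= i < qq) L%:R^-1 / qq.+1%:R * ((qq.+1 - i.+1)%:R * \sum_(i0 < L - i.+1) z i0 * z (i0 + i.+1)%N).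
  rewrite big_nat_cond [RHS]big_nat_cond; apply: eq_bigr => d /andP[/andP[_ dq] _].
  rewrite big_add1 /= big_mkord.
  have -> : \sum_(i < L - d.+1) (x (a + i.+1)%N - m) * (x (a + i.+1 + d.+1)%N - m) = \sum_(i0 < L - d.+1) z i0 * z (i0 + d.+1)%N.
    by apply: eq_bigr => i _; rewrite mE -addnA (_ : (i.+1 + d.+1 = (i + d.+1).+1)%N)// mE.
  have -> : bartlett qq d.+1 = (qq.+1 - d.+1)%:R / qq.+1%:R :> R.
    by rewrite /bartlett natrB ?ltnS ?(ltnW dq)// mulrBl divff// pnatr_eq0.
  ring.
rewrite -mulr_sumr; field.
by rewrite LR nat1r pnatr_eq0.
Qed.

Lemma sqr_sum_perturb (I : finType) (f g : I -> R) (e : R) : 0 < e ->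
  `|\sum_i (f i + g i) ^+ 2 - \sum_i f i ^+ 2| <=
  e * (\sum_i f i ^+ 2) + (1 + e^-1) * (\sum_i g i ^+ 2).
Proof.
move=> e0; rewrite -sumrB; apply: (le_trans (ler_norm_sum _ _ _)).
rewrite !mulr_sumr -big_split /=; apply: ler_sum => i _.
have ei : 0 < e^-1 by rewrite invr_gt0.
have -> : (f i + g i) ^+ 2 - f i ^+ 2 = 2 * (f i * g i) + g i ^+ 2 by ring.
have h1 : 0 <= e^-1 * (e * f i + g i) ^+ 2 by rewrite mulr_ge0 ?sqr_ge0// ltW.
have h2 : 0 <= e^-1 * (e * f i - g i) ^+ 2 by rewrite mulr_ge0 ?sqr_ge0// ltW.
have e1 : e^-1 * (e * f i + g i) ^+ 2 = e * f i ^+ 2 + 2 * (f i * g i) + e^-1 * g i ^+ 2.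
  by field; rewrite gt_eqF.
have e2 : e^-1 * (e * f i - g i) ^+ 2 = e * f i ^+ 2 - 2 * (f i * g i) + e^-1 * g i ^+ 2.
  by field; rewrite gt_eqF.
have h3 := sqr_ge0 (g i).
rewrite e1 in h1; rewrite e2 in h2.
by rewrite ler_norml; apply/andP; split; lra.
Qed.

Lemma sqr_sub_le (a b A B : R) : `|a| <= A -> `|b| <= B -> (a - b) ^+ 2 <= 2 * A ^+ 2 + 2 * B ^+ 2.
Proof.
move=> aA bB.
have h1 : a ^+ 2 <= A ^+ 2.
  by rewrite -(real_normK (num_real a)); apply: lerXn2r; rewrite ?nnegrE// (le_trans _ aA).
have h2 : b ^+ 2 <= B ^+ 2.
  by rewrite -(real_normK (num_real b)); apply: lerXn2r; rewrite ?nnegrE// (le_trans _ bB).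
have := sqr_ge0 (a + b); lra.
Qed.

(** For windows inside the segment, the increment is a sum over the reference length [p] ([f]) plus
    a remainder [g]: the missing p' - p terms and the drift due to centring. Overhanging windows are
    bounded crudely by [O] and [M]. A sum over the segment is a difference of two prefixes, whence 2
    [Gd]. *)
Lemma window_sum_approx y (n a L p p' : nat) (s2 M O B Gd e : R) (m : nat -> R) :
  (0 < p)%N -> (p <= p')%N -> (p' <= L)%N -> (a + L <= n)%N -> 0 < e ->
  0 <= M -> 0 <= O -> 0 <= s2 -> 0 <= Gd ->
  `|v y a L| <= M ->
  (forall k j, (k <= n)%N -> (j <= p')%N -> `|v y k j| <= O) ->
  (forall t, 0 <= m t) ->
  (forall t, v y (t + p) (p' - p) ^+ 2 <= m t) -> \sum_(t < n) m t <= B ->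
  (forall k, (k <= n)%N -> `|\sum_(t < k) v y t p ^+ 2 - s2 * k%:R| <= Gd) ->
  `|\sum_(t < L + p') (cs y a L (minn t L) - cs y a L (minn (t - p') L)) ^+ 2 - s2 * L%:R| <=
  s2 * p'%:R + 2 * Gd + e * (s2 * L%:R + 2 * Gd)
  + (1 + e^-1) * (2 * B + 2 * L%:R * ((p'%:R / L%:R) * M) ^+ 2)
  + 4 * p'%:R * (O ^+ 2 + ((p'%:R / L%:R) * M) ^+ 2).
Proof.
move=> p0 pp' pL aLn e0 M0 O0 s20 Gd0 hM hO m0 hm hB hG.
have L0 : (0 < L)%N by nlia.
have LR : (0 : R) < L%:R by rewrite ltr0n.
set r := p'%:R / L%:R * M.
have r0 : 0 <= r by rewrite mulr_ge0// divr_ge0.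
pose w t := cs y a L (minn t L) - cs y a L (minn (t - p') L).
have frac k : (k <= p')%N -> `|k%:R / L%:R * v y a L| <= r.
  move=> kp; rewrite normrM ger0_norm ?divr_ge0//; apply: ler_pM => //.
  by rewrite ler_pM2r ?invr_gt0// ler_nat.
have edge1 t : (t < p')%N -> w t ^+ 2 <= 2 * O ^+ 2 + 2 * r ^+ 2.
  move=> tp; have -> : w t = v y a t - t%:R / L%:R * v y a L.
    rewrite /w (_ : (t - p' = 0)%N) ?min0n; last nlia.
    rewrite (minn_idPl _); last nlia.
    by rewrite /cs [v y a 0]/v big_ord0; ring.
  by apply: sqr_sub_le; [apply: hO; nlia|apply: frac; nlia].
have edge2 t : (L < t)%N -> (t < L + p')%N -> w t ^+ 2 <= 2 * O ^+ 2 + 2 * r ^+ 2.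
  move=> Lt tLp.
  have -> : w t = v y (a + (t - p')) (L - (t - p')) - (L - (t - p'))%:R / L%:R * v y a L.
    rewrite /w (minn_idPr (ltnW Lt)) (minn_idPl _); last nlia.
    have tL : (t - p' <= L)%N by nlia.
    have ev : v y a L = v y a (t - p') + v y (a + (t - p')) (L - (t - p')).
      by rewrite -v_cat subnKC.
    rewrite /cs (@natrB R L (t - p') tL) ev; field; exact: lt0r_neq0.
  by apply: sqr_sub_le; [apply: hO; nlia|apply: frac; nlia].
pose f (t : 'I_(L.+1 - p')) := v y (a + t) p.
pose g (t : 'I_(L.+1 - p')) := v y (a + t + p) (p' - p) - p'%:R / L%:R * v y a L.
have mid (t : 'I_(L.+1 - p')) : w (t + p')%N = f t + g t.
  case: t => t tL; rewrite /w /f /g /= addnK (minn_idPl _); last nlia.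
  rewrite (minn_idPl _); last nlia.
  have ev : v y (a + t) p' = v y (a + t) p + v y (a + t + p) (p' - p).
    by rewrite -v_cat subnKC.
  rewrite /cs natrD v_cat ev; field; exact: lt0r_neq0.
have Asplit : \sum_(t < L + p') w t ^+ 2 = \sum_(0 <= t < p') w t ^+ 2 +
    (\sum_(t < L.+1 - p') (f t + g t) ^+ 2 + \sum_(L.+1 <= t < L + p') w t ^+ 2).
  rewrite -(big_mkord predT (fun t => w t ^+ 2)) (@big_cat_nat _ _ _ p')//=; last nlia.
  congr (_ + _); rewrite (@big_cat_nat _ _ _ L.+1)//=; [|nlia|nlia].
  congr (_ + _); rewrite -{1}(add0n p') big_addn big_mkord.
  by apply: eq_bigr => t _; rewrite mid.
have h1 : 0 <= \sum_(0 <= t < p') w t ^+ 2 <= p'%:R * (2 * O ^+ 2 + 2 * r ^+ 2).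
  apply/andP; split; first by apply: sumr_ge0 => t _; exact: sqr_ge0.
  rewrite big_mkord mulr_natl -[X in _ *+ X](card_ord p') -sumr_const.
  by apply: ler_sum => -[t tp] _; exact: edge1.
have h2 : 0 <= \sum_(L.+1 <= t < L + p') w t ^+ 2 <= p'%:R * (2 * O ^+ 2 + 2 * r ^+ 2).
  have c0 : 0 <= 2 * O ^+ 2 + 2 * r ^+ 2 by rewrite addr_ge0// mulr_ge0// sqr_ge0.
  apply/andP; split; first by apply: sumr_ge0 => t _; exact: sqr_ge0.
  apply: (@le_trans _ _ (\sum_(L.+1 <= t < L + p') (2 * O ^+ 2 + 2 * r ^+ 2))).
    rewrite big_nat_cond [leRHS]big_nat_cond; apply: ler_sum => t /andP[/andP[h h'] _].
    exact: edge2.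
  have -> c : \sum_(L.+1 <= t < L + p') c = (L + p' - L.+1)%:R * c :> R.
    by rewrite big_const_nat iter_addr_0 mulr_natl.
  by rewrite ler_wpM2r// ler_nat; nlia.
have fs : \sum_(t < L.+1 - p') f t ^+ 2 =
    \sum_(t < a + (L.+1 - p')) v y t p ^+ 2 - \sum_(t < a) v y t p ^+ 2.
  by rewrite big_split_ord /= addrAC subrr add0r.
have hf : `|\sum_(t < L.+1 - p') f t ^+ 2 - s2 * (L.+1 - p')%:R| <= 2 * Gd.
  have q1 := hG (a + (L.+1 - p'))%N ltac:(nlia); have q2 := hG a ltac:(nlia).
  rewrite fs natrD in q1 *; move: q1 q2; rewrite !ler_norml => /andP[? ?] /andP[? ?].
  by apply/andP; split; lra.
have hg : \sum_(t < L.+1 - p') g t ^+ 2 <= 2 * B + 2 * L%:R * r ^+ 2.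
  apply: (@le_trans _ _ (\sum_(t < L.+1 - p') (2 * m (t + a)%N + 2 * r ^+ 2))).
    apply: ler_sum => -[t tL] _; rewrite /g /= (addnC t).
    have q1 := hm (a + t)%N.
    have q2 : (p'%:R / L%:R * v y a L) ^+ 2 <= r ^+ 2.
      rewrite -(real_normK (num_real (_ * v y a L))); apply: lerXn2r; rewrite ?nnegrE//.
      by apply: frac.
    have := sqr_ge0 (v y (a + t + p) (p' - p) + p'%:R / L%:R * v y a L).
    by lra.
  rewrite big_split /= -mulr_sumr sumr_const card_ord -[_ *+ _]mulr_natl.
  have q3 : \sum_(t < L.+1 - p') m (t + a)%N <= B.
    apply: le_trans hB; apply: ler_sum_shift => //; nlia.
  have q4 : (L.+1 - p')%:R <= L%:R :> R by rewrite ler_nat; nlia.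
  have := ler_wpM2r (sqr_ge0 r) q4; lra.
have hfg := @sqr_sum_perturb _ f g e e0.
have LL : (L.+1 - p')%:R = L%:R + 1 - p'%:R :> R by rewrite natrB ?leqW// -natr1.
have p1 : (1 : R) <= p'%:R by rewrite ler1n; nlia.
rewrite LL in hf.
have f0 : 0 <= \sum_(t < L.+1 - p') f t ^+ 2 by apply: sumr_ge0 => t _; exact: sqr_ge0.
have g0 : 0 <= \sum_(t < L.+1 - p') g t ^+ 2 by apply: sumr_ge0 => t _; exact: sqr_ge0.
rewrite -/w Asplit.
have e1i : 0 <= 1 + e^-1 by rewrite addr_ge0// invr_ge0 ltW.
have k1 := ler_wpM2l e1i hg.
have k2 : \sum_(t < L.+1 - p') f t ^+ 2 <= s2 * L%:R + 2 * Gd.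
  move: hf; rewrite ler_norml => /andP[_ k].
  have : 0 <= s2 * (p'%:R - 1) by rewrite mulr_ge0// subr_ge0.
  lra.
have k3 := ler_wpM2l (ltW e0) k2.
have k4 : 0 <= s2 * (p'%:R - 1) by rewrite mulr_ge0// subr_ge0.
move: h1 h2 hf hfg; rewrite !ler_norml => /andP[u1 u2] /andP[u3 u4] /andP[u5 u6] /andP[u7 u8].
by apply/andP; split; move: u1 u2 u3 u4 u5 u6 u7 u8 k1 k2 k3 k4 f0 g0 p1 s20 Gd0; clear; lra.
Qed.

End lag_windows.

(** * The estimator on a deterministic good event *)

Section consistency_pointwise.
Context {R : realType}.
Implicit Types (y : nat -> R).

Lemma sqr_le_of_pow4 (a b : R) : 0 <= b -> a ^+ 4 <= b ^+ 2 -> a ^+ 2 <= b.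
Proof.
move=> b0; rewrite (_ : a ^+ 4 = (a ^+ 2) ^+ 2); last by rewrite -exprM.
by rewrite ler_pXn2r// nnegrE sqr_ge0.
Qed.

Lemma norm_le_sqrt (a b : R) : 0 <= b -> a ^+ 2 <= b -> `|a| <= Num.sqrt b.
Proof. by move=> b0 ab; rewrite -sqrtr_sqr ler_sqrt. Qed.

(* The event, for window length p and grid spacing e, on which everything else
   is deterministic: y is one realization, s2 and N stand for sigma_p^2 and
   p^(2H), and e bounds the distance from p to the actual window length. *)
Record window_ok (th : R) (J n p e : nat) (s2 N : R) (y : nat -> R) := WindowOk {
  wok_dev : forall i, (i <= J)%N ->
    `|\sum_(t < (i * n) %/ J) (v y t p ^+ 2 - s2)| <= th * (n%:R * N);
  wok_U : exists2 U : nat -> R, (forall t, 0 <= U t) &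
    (forall t j, (j <= e)%N -> v y t j ^+ 4 <= U t) /\
    \sum_(t < n) U (t + p)%N <= th ^+ 2 * (n%:R * N ^+ 2);
  wok_O : forall k j, (k <= n)%N -> (j <= 2 * p)%N ->
    v y k j ^+ 4 <= (th * (n%:R * N / p%:R)) ^+ 2;
  wok_M : forall k j, (k <= n)%N -> (j <= n)%N ->
    v y k j ^+ 4 <= (th * (N * (n%:R / p%:R) ^+ 2)) ^+ 2 }.

(** The deviations are controlled on a grid of prefixes only. Between grid points sums of squares
    are monotone, so the extra error is s2 times the spacing, at most n/J + 1. *)
Lemma window_ok_dev th J n p e s2 N y (Cs : R) k : window_ok th J n p e s2 N y ->
  (0 < J)%N -> 0 <= s2 -> s2 <= Cs * N -> 0 <= N -> (k <= n)%N ->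
  `|\sum_(t < k) v y t p ^+ 2 - s2 * k%:R| <= th * (n%:R * N) + Cs * N * (n%:R / J%:R + 1).
Proof.
move=> [hdev _ _ _] J0 s20 s2C N0 kn.
have [n0|n0] := posnP n.
  have k0 : k = 0%N by lia.
  have := hdev 0%N isT; rewrite mul0n div0n big_ord0 normr0 k0 big_ord0 mulr0 subrr normr0 n0.
  have : 0 <= Cs * N by exact: le_trans s2C.
  lra.
have JR : (0 : R) < J%:R by rewrite ltr0n.
pose g i := ((i * n) %/ J)%N.
have g0 : g 0%N = 0%N by rewrite /g mul0n div0n.
have gJ : g J = n by rewrite /g mulKn.
have [i [iJ gi gi1]] : exists i, [/\ (i < J)%N, (g i <= k)%N & (k <= g i.+1)%N].
  pose Q i := (k <= g i)%N.
  have exQ : exists i, Q i by exists J; rewrite /Q gJ.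
  case: (ex_minnP exQ) => -[|i] Qi mini.
    exists 0%N; split => //; first by rewrite g0.
    by move: Qi; rewrite /Q g0 leqn0 => /eqP ->.
  exists i; split => //.
    have : (i.+1 <= J)%N by apply: mini; rewrite /Q gJ.
    by [].
  rewrite leqNgt; apply/negP => h; have := mini i (ltnW h); lia.
have dg : (g i.+1 - g i)%:R <= n%:R / J%:R + 1 :> R.
  have h : (g i.+1 - g i <= n %/ J + 1)%N.
    by rewrite /g mulSn leq_subLR (leq_trans (leq_divDl _ _ _))// addnA (addnC (i * n %/ J)%N).
  apply: (@le_trans _ _ (n %/ J + 1)%:R); first by rewrite ler_nat.
  rewrite natrD lerD2r ler_pdivlMr// -natrM ler_nat; exact: leq_divM.
pose F k := \sum_(t < k) v y t p ^+ 2.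
have Fm k1 k2 : (k1 <= k2)%N -> F k1 <= F k2.
  move=> k12; have := @ler_sum_shift R k1 k2 0 (fun t => v y t p ^+ 2).
  move=> /(_ (fun t => sqr_ge0 _)) => /(_ ltac:(lia)).
  by under eq_bigr do rewrite addn0.
have D k' : \sum_(t < k') (v y t p ^+ 2 - s2) = F k' - s2 * k'%:R.
  by rewrite sumrB sumr_const card_ord mulr_natr.
have h1 := hdev i (ltnW iJ); have h2 := hdev i.+1 iJ.
rewrite -/(g i) D in h1; rewrite -/(g i.+1) D in h2.
have f1 := Fm _ _ gi; have f2 := Fm _ _ gi1.
have r1 : (g i)%:R <= k%:R :> R by rewrite ler_nat.
have r2 : k%:R <= (g i.+1)%:R :> R by rewrite ler_nat.
rewrite natrB in dg; last lia.
have a1 := ler_wpM2l s20 r1; have a2 := ler_wpM2l s20 r2.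
have a3 := ler_wpM2l s20 dg.
have a4 : s2 * (n%:R / J%:R + 1) <= Cs * N * (n%:R / J%:R + 1).
  by rewrite ler_wpM2r// addr_ge0// divr_ge0.
rewrite -/(F k).
move: h1 h2; rewrite !ler_norml => /andP[? ?] /andP[? ?]; apply/andP; split; lra.
Qed.

Lemma approx_arith (s2 p' Gd ep L ie r2 o th g1 Cs id2 ka Z : R) :
  0 < ka * Z -> ep * Gd <= ep * (th * g1 * Z) -> ep * (s2 * L) <= ka / 4 * Z ->
  (1 + ie) * (L * r2) <= (1 + ie) * (th * id2 * Z) ->
  th * (Cs + 2 * g1 + ep * (2 * g1) + (1 + ie) * (2 + 2 * id2) + 8 * (1 + id2)) * Z <= ka / 2 * Z ->
  Gd <= th * g1 * Z -> s2 * p' <= Cs * th * Z -> p' * r2 <= 2 * th * id2 * Z ->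
  p' * o <= 2 * th * Z ->
  s2 * p' + 2 * Gd + ep * (s2 * L + 2 * Gd) + (1 + ie) * (2 * (th * Z) + 2 * L * r2)
    + 4 * p' * (o + r2) <= ka * Z.
Proof. move=> h1 h2 h3 h4 h5 h6 h7 h8 h9; lra. Qed.

(** Constants are chosen in the order [ep], [th], [J]. The term ep s2 L takes a quarter of [ka], and
    all terms carrying [th] take half of it. [id2] bounds the square of (p'/L)(n/p), since p' <= 2 p
    and n/L <= 1/de. *)
Lemma window_ok_approx (de ka Cs : R) : 0 < de -> de <= 1 -> 0 < ka -> 0 < Cs ->
  exists th : R, exists J : nat, [/\ 0 < th, th <= 1, (0 < J)%N &
  forall (n p e p' a L : nat) (s2 N : R) y, (0 < p)%N -> (p <= p')%N -> (p' <= p + e)%N ->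
    (e <= p)%N -> 2 * p%:R <= th * n%:R -> 1 <= th * n%:R -> (a + L <= n)%N ->
    de * n%:R <= L%:R -> (p' <= L)%N -> 0 < N -> 0 <= s2 -> s2 <= Cs * N ->
    window_ok th J n p e s2 N y ->
    `|\sum_(t < L + p') (cs y a L (minn t L) - cs y a L (minn (t - p') L)) ^+ 2 - s2 * L%:R|
      <= ka * (n%:R * N)].
Proof.
move=> de0 de1 ka0 Cs0.
pose ep := ka / (4 * Cs).
have ep0 : 0 < ep by rewrite divr_gt0// mulr_gt0.
have iep0 : 0 < ep^-1 by rewrite invr_gt0.
pose id2 := 4 / de ^+ 2.
have de20 : 0 < de ^+ 2 by rewrite exprn_gt0.
have id20 : 0 < id2 by rewrite divr_gt0.
pose g1 := 1 + 2 * Cs.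
pose KK := Cs + 2 * g1 + ep * (2 * g1) + (1 + ep^-1) * (2 + 2 * id2) + 8 * (1 + id2).
have g10 : 0 < g1 by rewrite /g1; lra.
have KK0 : 0 < KK.
  have : 0 < ep * (2 * g1) by rewrite mulr_gt0// mulr_gt0.
  have : 0 < (1 + ep^-1) * (2 + 2 * id2) by rewrite mulr_gt0//; lra.
  by rewrite /KK; lra.
pose th := Num.min 1 (ka / (2 * KK)).
have th0 : 0 < th by rewrite lt_min ltr01 divr_gt0// mulr_gt0.
have th1 : th <= 1 by rewrite ge_min lexx.
have thK : th * KK <= ka / 2.
  have : th <= ka / (2 * KK) by rewrite ge_min lexx orbT.
  move=> /(ler_wpM2r (ltW KK0)); rewrite (_ : ka / (2 * KK) * KK = ka / 2)//.
  by field; rewrite gt_eqF.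
have [J hJ] := nat_ge (th^-1).
have ith0 : 0 < th^-1 by rewrite invr_gt0.
have JR : (0 : R) < J%:R by exact: lt_le_trans hJ.
have J0 : (0 < J)%N by rewrite -(ltr_nat R).
have iJ : J%:R^-1 <= th by rewrite -(invrK th) lef_pV2 ?posrE.
exists th, J; split => // n p e p' a L s2 N y p0 pp' p'e ep' pn n1 aLn dL pL N0 s20 s2C ok.
have nR : (0 : R) < n%:R.
  by rewrite ltr0n lt0n; apply/eqP => n0; move: n1; rewrite n0 mulr0; lra.
have LR : (0 : R) < L%:R by apply: lt_le_trans dL; rewrite mulr_gt0.
have pR : (0 : R) < p%:R by rewrite ltr0n.
have p'2 : p'%:R <= 2 * p%:R :> R by rewrite -natrM ler_nat; nlia.
pose M := Num.sqrt (th * (N * (n%:R / p%:R) ^+ 2)).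
pose O := Num.sqrt (th * (n%:R * N / p%:R)).
have MM0 : 0 <= th * (N * (n%:R / p%:R) ^+ 2).
  by rewrite mulr_ge0 ?mulr_ge0 ?sqr_ge0// ltW.
have OO0 : 0 <= th * (n%:R * N / p%:R).
  by rewrite mulr_ge0 ?divr_ge0 ?mulr_ge0// ltW.
have [U U0 [UV US]] := wok_U ok.
(* Only fourth powers are dominated by [U]. The inequality of arithmetic and geometric means
   converts this into a bound for squares, with weights for which both halves sum to at most th n N
   / 2. *)
pose m t := (th * N + U (t + p)%N / (th * N)) / 2.
have thN : 0 < th * N by rewrite mulr_gt0.
have := @window_sum_approx R y n a L p p' s2 M O (th * (n%:R * N))
  (th * (n%:R * N) + Cs * N * (n%:R / J%:R + 1)) ep m p0 pp' pL aLn ep0.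
move=> /(_ (sqrtr_ge0 _) (sqrtr_ge0 _) s20).
have G0 : 0 <= th * (n%:R * N) + Cs * N * (n%:R / J%:R + 1).
  by rewrite addr_ge0 ?mulr_ge0 ?addr_ge0 ?divr_ge0// ltW.
move=> /(_ G0).
have hM : `|v y a L| <= M.
  apply: norm_le_sqrt => //; apply: sqr_le_of_pow4 => //.
  by apply: (wok_M ok); nlia.
move=> /(_ hM).
have hO : forall k j, (k <= n)%N -> (j <= p')%N -> `|v y k j| <= O.
  move=> k j kn jp; apply: norm_le_sqrt => //; apply: sqr_le_of_pow4 => //.
  apply: (wok_O ok) => //; nlia.
move=> /(_ hO).
have m0 t : 0 <= m t by rewrite divr_ge0// addr_ge0 ?divr_ge0// ltW.
move=> /(_ m0).
have hm t : v y (t + p) (p' - p) ^+ 2 <= m t.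
  have h4 := UV (t + p)%N (p' - p)%N ltac:(nlia).
  have h5 : 0 <= (th * N)^-1 * (v y (t + p) (p' - p) ^+ 2 - th * N) ^+ 2.
    by rewrite mulr_ge0 ?sqr_ge0 ?invr_ge0// ltW.
  have e5 : (th * N)^-1 * (v y (t + p) (p' - p) ^+ 2 - th * N) ^+ 2 =
     v y (t + p) (p' - p) ^+ 4 / (th * N) - 2 * v y (t + p) (p' - p) ^+ 2 + th * N.
    by field; rewrite !gt_eqF.
  have h6 : v y (t + p) (p' - p) ^+ 4 / (th * N) <= U (t + p)%N / (th * N).
    by rewrite ler_pM2r// invr_gt0.
  by move: h5 h6; rewrite e5 /m; clear; lra.
move=> /(_ hm).
have hB : \sum_(t < n) m t <= th * (n%:R * N).
  have -> : \sum_(t < n) m t = (n%:R * (th * N) + (\sum_(i < n) U (i + p)%N) / (th * N)) / 2.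
    by rewrite /m -mulr_suml big_split /= sumr_const card_ord -[_ *+ n]mulr_natl -mulr_suml.
  have : (\sum_(i < n) U (i + p)%N) / (th * N) <= th ^+ 2 * (n%:R * N ^+ 2) / (th * N).
    by rewrite ler_pM2r// invr_gt0.
  rewrite (_ : th ^+ 2 * (n%:R * N ^+ 2) / (th * N) = th * (n%:R * N)); first by clear; lra.
  by field; rewrite !gt_eqF.
move=> /(_ hB).
have hG k : (k <= n)%N -> `|\sum_(t < k) v y t p ^+ 2 - s2 * k%:R| <= th * (n%:R * N) + Cs * N * (n%:R / J%:R + 1).
  by move=> kn; apply: (window_ok_dev ok) => //; exact: ltW.
move=> /(_ hG) /le_trans; apply.
set Gd := th * (n%:R * N) + _.
have nN0 : 0 < n%:R * N by rewrite mulr_gt0.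
have hGd : Gd <= th * g1 * (n%:R * N).
  have t1 : Cs * N * (n%:R / J%:R + 1) <= Cs * N * (th * n%:R + th * n%:R).
    rewrite ler_wpM2l ?mulr_ge0 ?(ltW Cs0) ?(ltW N0)//; apply: lerD => //.
    by rewrite mulrC ler_wpM2r// ltW.
  by move: t1; rewrite /Gd /g1; clear; lra.
have hM2 : (p'%:R / L%:R * M) ^+ 2 <= th * (id2 * N).
  rewrite exprMn sqr_sqrtr//.
  have q1 : p'%:R / L%:R * (n%:R / p%:R) <= 2 / de.
    rewrite (_ : _ * _ = (p'%:R / p%:R) * (n%:R / L%:R)); last by ring.
    apply: ler_pM; rewrite ?divr_ge0//; first by rewrite ler_pdivrMr.
    by rewrite ler_pdivrMr// mulrC -ler_pdivrMr ?invr_gt0// invrK mulrC.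
  have q2 : (p'%:R / L%:R * (n%:R / p%:R)) ^+ 2 <= (2 / de) ^+ 2.
    have q0 : 0 <= p'%:R / L%:R * (n%:R / p%:R) :> R by apply: mulr_ge0; apply: divr_ge0.
    by apply: lerXn2r => //; rewrite nnegrE// (le_trans q0).
  rewrite (_ : (2 / de) ^+ 2 = id2) in q2; last by rewrite /id2; field; rewrite gt_eqF.
  have := ler_wpM2l (ltW thN) q2; rewrite !exprMn; clear; lra.
have hO2 : O ^+ 2 = th * (n%:R * N / p%:R) by rewrite sqr_sqrtr.
rewrite hO2; set r2 := (_ * M) ^+ 2 in hM2 *.
have hpO : p'%:R * (th * (n%:R * N / p%:R)) <= 2 * th * (n%:R * N).
  rewrite (_ : _ * _ = p'%:R / p%:R * (th * (n%:R * N))); last by ring.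
  rewrite -[leRHS]mulrA ler_wpM2r//; first by rewrite mulr_ge0// ltW.
  by rewrite ler_pdivrMr.
have p'n : p'%:R <= th * n%:R by exact: le_trans p'2 pn.
have thn : th * n%:R <= n%:R by rewrite ler_piMl.
have hpr : p'%:R * r2 <= 2 * th * id2 * (n%:R * N).
  have r20 : 0 <= r2 by exact: sqr_ge0.
  apply: (@le_trans _ _ (n%:R * (th * (id2 * N)))).
    by apply: ler_pM => //; exact: le_trans thn.
  have : 0 <= th * id2 * (n%:R * N) by exact: ltW (mulr_gt0 (mulr_gt0 th0 id20) nN0).
  by clear; lra.
have Ln : L%:R <= n%:R :> R by rewrite ler_nat; nlia.
have hLr : L%:R * r2 <= th * id2 * (n%:R * N).
  apply: (@le_trans _ _ (n%:R * (th * (id2 * N)))); last by clear; lra.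
  by apply: ler_pM => //; exact: sqr_ge0.
have hs1 : s2 * p'%:R <= Cs * th * (n%:R * N).
  apply: (@le_trans _ _ (Cs * N * (th * n%:R))); last by clear; lra.
  by apply: ler_pM.
have hs2 : s2 * L%:R <= Cs * (n%:R * N).
  by apply: (@le_trans _ _ (Cs * N * n%:R)); [apply: ler_pM|clear; lra].
have b1 := ler_wpM2l (ltW ep0) hGd; have b2 := ler_wpM2l (ltW ep0) hs2.
have e1i : 0 <= 1 + ep^-1 by rewrite addr_ge0// ltW.
have b3 := ler_wpM2l e1i hLr.
have b4 := ler_wpM2r (ltW nN0) thK.
have b5 : ep * (Cs * (n%:R * N)) = ka / 4 * (n%:R * N) by rewrite /ep; field; rewrite gt_eqF.
have knN : 0 < ka * (n%:R * N) by rewrite mulr_gt0.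
rewrite b5 in b2.
exact: (approx_arith knN b1 b2 b3 b4 hGd hs1 hpr hpO).
Qed.

End consistency_pointwise.

Section powR_one.
Context {R : realType}.
Implicit Types x a : R.

Lemma powR_le1 x a : 0 <= x -> x <= 1 -> 0 <= a -> x `^ a <= 1.
Proof.
move=> x0 x1 a0; have : x `^ a <= 1 `^ a by apply: ge0_ler_powR; rewrite ?nnegrE.
by rewrite powR1.
Qed.

Lemma powR_ge1 x a : 1 <= x -> 0 <= a -> 1 <= x `^ a.
Proof.
move=> x1 a0; have : 1 `^ a <= x `^ a by apply: ge0_ler_powR; rewrite ?nnegrE//; lra.
by rewrite powR1.
Qed.

Lemma powR_neg_ge1 x a : 0 < x -> x <= 1 -> a <= 0 -> 1 <= x `^ a.
Proof.
by move=> x0 x1 a0; have := powR_anti x0 x1 a0; rewrite powR1.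
Qed.

End powR_one.

Lemma sum4_le (R : realType) (a b c e t : R) : 0 <= a -> 0 <= b -> 0 <= c -> 0 <= e ->
  a + b + (c + e) <= t -> [/\ a <= t, b <= t, c <= t & e <= t].
Proof. by move=> *; split; lra. Qed.

(** * Probability of the good events and uniform consistency *)

Section consistency.
Context {R : realType} {d} {T : measurableType d} (P : probability T R).
Variables (Y : nat -> T -> R) (H Cs C5 : R).
Hypothesis HY : forall i, L4 P (Y i).
Hypothesis Hl : 1 / 2 < H.
Hypothesis Hu : H < 1.
Hypothesis Cs0 : 0 < Cs.
Hypothesis C50 : 0 < C5.
Let N p : R := p%:R `^ (2 * H).
Hypothesis sigC : forall p, sig2 P Y p <= Cs * N p.
Hypothesis HD : forall th, 0 < th -> exists2 rho, 0 < rho & forall n p m, (0 < p)%N ->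
  p%:R <= rho * n%:R :> R -> (m <= n)%N ->
  Exp P (fun w => Dev P Y p m w ^+ 2) <= th * (n%:R * N p) ^+ 2.
Hypothesis HM : forall l, (0 < l)%N -> exists U : nat -> T -> R,
  [/\ forall a, L1 P (U a), forall a w, 0 <= U a w,
      forall a j w, (j <= l)%N -> V Y a j w ^+ 4 <= U a w &
      forall a, Exp P (U a) <= C5 * l%:R `^ (4 * H)].
Hypothesis HO : forall p n, (0 < p)%N -> exists U : T -> R,
  [/\ L1 P U, forall w, 0 <= U w,
      forall k j w, (k <= n)%N -> (j <= p)%N -> V Y k j w ^+ 4 <= U w &
      Exp P U <= (n %/ p).+1%:R * (16 * (C5 * (2 * p)%:R `^ (4 * H)))].

Lemma N_sqr p : N p ^+ 2 = p%:R `^ (4 * H).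
Proof.
have hl := Hl.
have [->|p0] := posnP p; last by rewrite /N expr2 -powR_add ?ltr0n//; congr (_ `^ _); ring.
by rewrite /N !powR0 ?expr0n//; apply: lt0r_neq0; lra.
Qed.

Lemma osc_moment p n : (0 < p)%N -> (p <= n)%N ->
  (n %/ (2 * p)).+1%:R * (16 * (C5 * (2 * (2 * p))%:R `^ (4 * H))) <=
  2 * 16 * (4 * 4 * 4 * 4) * C5 * (n%:R / p%:R) * N p ^+ 2.
Proof.
move=> p0 pn; have hl := Hl; have hu := Hu; have c5 := C50.
have pR : (0 : R) < p%:R by rewrite ltr0n.
have h1 : (n %/ (2 * p)).+1%:R <= 2 * (n%:R / p%:R) :> R.
  have h : ((n %/ (2 * p)).+1 * p <= 2 * n)%N.
    have := leq_divM n (2 * p); move: (n %/ (2 * p))%N => z; nia.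
  by rewrite mulrA ler_pdivlMr// -!natrM ler_nat.
have h2 : (2 * (2 * p))%:R `^ (4 * H) <= (4 * 4 * 4 * 4) * N p ^+ 2.
  rewrite N_sqr mulnA natrM powRM// ler_wpM2r ?powR_ge0//.
  apply: (@le_trans _ _ (4%:R `^ 4%:R)); last by rewrite powR_mulrn// le_eqVlt; apply/orP; left; apply/eqP; ring.
  apply: ler_powR; [by rewrite ler1n|lra].
rewrite [leRHS](_ : _ = 2 * (n%:R / p%:R) * (16 * (C5 * (4 * 4 * 4 * 4 * N p ^+ 2)))); last by ring.
apply: ler_pM => //; first by rewrite !mulr_ge0 ?powR_ge0// ltW.
by rewrite ler_wpM2l// ler_wpM2l// ltW.
Qed.

(** The four requirements are normalized and added into one variable [Err], so that Markov's
    inequality is applied only once later. Three of the terms vanish with p/n; the one for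
    increments over at most [e] indices is of order (e/p)^(4H) and is small only through the grid
    spacing. *)
Lemma window_ok_prob (th : R) (J : nat) : 0 < th -> (0 < J)%N ->
  forall vt, 0 < vt -> exists2 rho, 0 < rho & forall n p e, (0 < e)%N -> (e <= p)%N ->
  p%:R <= rho * n%:R :> R -> exists Err : T -> R,
  [/\ L1 P Err, forall w, 0 <= Err w,
    Exp P Err <= C5 * (e%:R / p%:R) `^ (4 * H) + vt &
    forall w, Err w <= th ^+ 2 -> window_ok th J n p e (sig2 P Y p) (N p) (Y ^~ w)].
Proof.
move=> th0 J0 vt vt0; have hl := Hl; have hu := Hu; have c5 := C50; have h44 : 4 * H <= 4%:R by lra.
have JR : (0 : R) < J.+1%:R by rewrite ltr0n.
have vJ : 0 < vt / 3 / J.+1%:R by rewrite !divr_gt0.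
have [r1 r10 h1] := HD vJ.
pose K1 := 2 * 16 * (4 * 4 * 4 * 4) * C5.
have K10 : 0 < K1 by rewrite !mulr_gt0.
have vK : 0 < vt / 3 / K1 by rewrite !divr_gt0.
have [r2 r20 h2] := @powR_small R (4 - 4 * H) _ ltac:(lra) vK.
exists (Num.min (Num.min r1 1) (Num.min (vt / 3 / K1) r2)).
  by rewrite !lt_min r10 ltr01 vK r20.
move=> n p e e0 ep pn.
have p0 : (0 < p)%N by exact: leq_trans ep.
have pR : (0 : R) < p%:R by rewrite ltr0n.
have nR : (0 : R) < n%:R.
  by rewrite ltr0n lt0n; apply/eqP => n0; move: pn; rewrite n0 mulr0; lra.
have [pr1 [p1 [pvK pr2]]] : p%:R / n%:R <= r1 /\ p%:R / n%:R <= (1 : R) /\ p%:R / n%:R <= vt / 3 / K1 /\ p%:R / n%:R <= r2.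
  have : p%:R / n%:R <= Num.min (Num.min r1 1) (Num.min (vt / 3 / K1) r2) by rewrite ler_pdivrMr.
  by rewrite !le_min => /andP[/andP[-> ->] /andP[-> ->]].
have {}pr1 : p%:R <= r1 * n%:R by rewrite -ler_pdivrMr.
have pnN : (p <= n)%N by rewrite -(ler_nat R); move: p1; rewrite ler_pdivrMr// mul1r.
have n0 : (0 < n)%N by exact: leq_trans pnN.
have Np0 : 0 < N p by exact: powR_gt0.
have NR : N p != 0 by exact: lt0r_neq0.
have nR0 : n%:R != 0 :> R by exact: lt0r_neq0.
have pR0 : p%:R != 0 :> R by exact: lt0r_neq0.
have [U [LU U0 UV UE]] := HM e0.
have [UO [LUO UO0 UOV UOE]] := @HO (2 * p) n ltac:(by rewrite muln_gt0).
have [UM [LUM UM0 UMV UME]] := @HO n n n0.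
(* The weights are inverse to the scales in the four fields of [window_ok], so that a term of [Err]
   bounded by th^2 is exactly the corresponding field. *)
pose a1 : R := (n%:R * N p) ^- 2; pose a2 : R := (n%:R * N p ^+ 2)^-1.
pose a3 : R := p%:R ^+ 2 / (n%:R * N p) ^+ 2.
pose a4 : R := (p%:R / n%:R) ^+ 4 / N p ^+ 2.
have a10 : 0 < a1 by rewrite /a1 invr_gt0 exprn_gt0// mulr_gt0.
have a20 : 0 < a2 by rewrite /a2 invr_gt0 mulr_gt0// exprn_gt0.
have a30 : 0 < a3 by rewrite /a3 divr_gt0 ?exprn_gt0// mulr_gt0.
have a40 : 0 < a4 by rewrite /a4 divr_gt0 ?exprn_gt0// divr_gt0.
pose E1 w := \sum_(i < J.+1) a1 * Dev P Y p ((i * n) %/ J) w ^+ 2.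
pose E2 w := \sum_(t < n) a2 * U (t + p)%N w.
have LDev m : L1 P (fun w => Dev P Y p m w ^+ 2) by exact: L1_Dev2.
have LE1 : L1 P E1 by apply: L1_sum => i _; exact: L1Z.
have LE2 : L1 P E2 by apply: L1_sum => t _; exact: L1Z.
have E10 w : 0 <= E1 w by apply: sumr_ge0 => i _; rewrite mulr_ge0 ?sqr_ge0// ltW.
have E20 w : 0 <= E2 w by apply: sumr_ge0 => i _; rewrite mulr_ge0// ltW.
exists (fun w => E1 w + E2 w + (a3 * UO w + a4 * UM w)); split.
- by apply: L1D; [exact: L1D|apply: L1D; exact: L1Z].
- by move=> w; rewrite !addr_ge0// mulr_ge0// ltW.
- rewrite ExpD; [|exact: L1D|by apply: L1D; exact: L1Z].
  rewrite (ExpD LE1 LE2) (ExpD (L1Z a3 LUO) (L1Z a4 LUM)) (ExpZ _ LUO) (ExpZ _ LUM).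
  have b1 : Exp P E1 <= vt / 3.
    rewrite Exp_sum; last by move=> i _; exact: L1Z.
    apply: (@le_trans _ _ (\sum_(i < J.+1) vt / 3 / J.+1%:R)); last first.
      by rewrite sumr_cst_ord le_eqVlt; apply/orP; left; apply/eqP; field; rewrite nat1r lt0r_neq0.
    apply: ler_sum => -[i iJ] _; rewrite ExpZ//= /a1 mulrC ler_pdivrMr; last by rewrite exprn_gt0// mulr_gt0.
    apply: h1 => //; rewrite -[leqRHS](mulnK n J0) mulnC; apply: leq_div2r.
    by rewrite leq_mul2l; apply/orP; right.
  have b2 : Exp P E2 <= C5 * (e%:R / p%:R) `^ (4 * H).
    rewrite Exp_sum; last by move=> i _; exact: L1Z.
    apply: (@le_trans _ _ (\sum_(i < n) a2 * (C5 * e%:R `^ (4 * H)))).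
      by apply: ler_sum => i _; rewrite ExpZ// ler_wpM2l// ltW.
    rewrite sumr_cst_ord powR_div// -(N_sqr p) /a2 le_eqVlt; apply/orP; left; apply/eqP.
    by field; rewrite NR nR0.
  have b3 : a3 * Exp P UO <= vt / 3.
    apply: (@le_trans _ _ (a3 * (K1 * (n%:R / p%:R) * N p ^+ 2))).
      rewrite ler_wpM2l ?(ltW a30)//; apply: (le_trans UOE); exact: osc_moment.
    rewrite (_ : _ * _ = K1 * (p%:R / n%:R)); last by rewrite /a3; field; rewrite NR nR0 pR0.
    by rewrite mulrC -ler_pdivlMr.
  have b4 : a4 * Exp P UM <= vt / 3.
    have q1 : Exp P UM <= K1 * n%:R `^ (4 * H).
      apply: (le_trans UME); rewrite divnn n0.
      have q2 : (2 * n)%:R `^ (4 * H) <= (4 * 4) * n%:R `^ (4 * H) :> R.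
        rewrite natrM powRM// ler_wpM2r ?powR_ge0//.
        apply: (@le_trans _ _ (2%:R `^ 4%:R)); last by rewrite powR_mulrn// le_eqVlt; apply/orP; left; apply/eqP; ring.
        by apply: ler_powR; [rewrite ler1n|].
      have q3 := ler_wpM2l (ltW c5) q2.
      have q4 : 0 <= C5 * n%:R `^ (4 * H) by rewrite mulr_ge0 ?powR_ge0// ltW.
      by rewrite /K1; move: q3 q4; rewrite (_ : true.+1%:R = 2%:R :> R)//; lra.
    apply: (@le_trans _ _ (a4 * (K1 * n%:R `^ (4 * H)))); first by rewrite ler_wpM2l// ltW.
    have xx := h2 (p%:R / n%:R) ltac:(rewrite divr_ge0//) pr2.
    rewrite (_ : _ * _ = K1 * (p%:R / n%:R) `^ (4 - 4 * H)); first by rewrite mulrC -ler_pdivlMr.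
    rewrite /a4 N_sqr powRB; last by apply/implyP => _; rewrite mulf_neq0// invr_neq0.
    rewrite powR_mulrn ?divr_ge0// [in RHS]powR_div//; field.
    by rewrite !powR_eq0 !negb_and nR0 pR0.
  lra.
- move=> w hw.
  have [f1 f2 f3 f4] := sum4_le (E10 w) (E20 w) (mulr_ge0 (ltW a30) (UO0 w)) (mulr_ge0 (ltW a40) (UM0 w)) hw.
  split.
  + move=> i iJ.
    have iJ' : (i < J.+1)%N by [].
    have : a1 * Dev P Y p ((i * n) %/ J) w ^+ 2 <= th ^+ 2.
      apply: le_trans f1; rewrite /E1 (bigD1 (Ordinal iJ'))//= lerDl.
      by apply: sumr_ge0 => k _; rewrite mulr_ge0 ?sqr_ge0// ltW.
    rewrite /a1 mulrC ler_pdivrMr ?exprn_gt0 ?mulr_gt0// -exprMn.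
    rewrite -(real_normK (num_real (Dev _ _ _ _ _))) ler_pXn2r// nnegrE ?mulr_ge0// ltW//.
  + exists (U ^~ w) => //; split; first by move=> t j; exact: UV.
    by move: f2; rewrite /E2 -mulr_sumr /a2 mulrC ler_pdivrMr// mulr_gt0// exprn_gt0.
  + move=> k j kn jp; apply: (le_trans (UOV k j w kn jp)).
    move: f3; rewrite mulrC -ler_pdivlMr//; move/le_trans; apply.
    by rewrite /a3 le_eqVlt; apply/orP; left; apply/eqP; field; rewrite NR nR0 pR0.
  + move=> k j kn jn; apply: (le_trans (UMV k j w kn jn)).
    move: f4; rewrite mulrC -ler_pdivlMr//; move/le_trans; apply.
    by rewrite /a4 le_eqVlt; apply/orP; left; apply/eqP; field; rewrite NR nR0 pR0.
Qed.

(** Beyond the errors of the window sum and of s2, two replacements are made: the grid length p by q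
    + 1, at a relative cost 4 et because (p/(q + 1))^(2H) >= (1 - 2 et)^2, and the normalization by
    q + 1 by that by q, at a relative cost 1/q. *)
Lemma lrv_pointwise (cc de ka ep et mu : R) (x y : nat -> R) (n p e a L qq : nat) (s2 : R) :
  (forall j, x j.+1 = y j + mu) -> (0 < qq)%N -> (0 < L)%N -> 0 < cc -> 0 < de -> 0 <= ka -> 0 <= ep ->
  0 < et -> et <= 1 / 4 ->
  (0 < p)%N -> (p <= qq.+1)%N -> (qq.+1 <= p + e)%N -> e%:R <= 2 * et * p%:R ->
  de * n%:R <= L%:R -> `|s2 - cc * N p| <= ep * N p ->
  `|\sum_(t < L + qq.+1) (cs y a L (minn t L) - cs y a L (minn (t - qq.+1) L)) ^+ 2 - s2 * L%:R|
      <= ka * (n%:R * N p) ->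
  `|qq%:R `^ (1 - 2 * H) * lrv x a L qq - cc| <=
    (ka / de + ep + 4 * et * cc) + (cc + (ka / de + ep + 4 * et * cc)) / qq%:R.
Proof.
move=> xy q0 L0 cc0 de0 ka0 ep0 et0 et1 p0 pp' p'e epR nL hs hA.
have hl := Hl; have hu := Hu.
have LR : (0 : R) < L%:R by rewrite ltr0n.
have qR : (0 : R) < qq%:R by rewrite ltr0n.
have p'R : (0 : R) < qq.+1%:R by rewrite ltr0n.
have pR : (0 : R) < p%:R by rewrite ltr0n.
have hlrv := @lrv_window R x mu y a L qq xy L0.
move: hA hlrv; set A := \sum_(t < _) _; move=> hA hlrv; clearbody A.
set p' := qq.+1 in hlrv p'R pp' p'e *.
pose N' := N p'.
have N'0 : 0 < N' by exact: powR_gt0.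
have Np0 : 0 < N p by exact: powR_gt0.
have NN' : N p <= N'.
  by apply: ge0_ler_powR; rewrite ?nnegrE ?ler_nat//; lra.
pose u := N p / N'.
have u1 : u <= 1 by rewrite /u ler_pdivrMr// mul1r.
have u0 : 0 <= u by rewrite /u divr_ge0// ltW.
have u2 : 1 - 4 * et <= u.
  pose z := p%:R / p'%:R : R.
  have z0 : 0 <= z by rewrite divr_ge0.
  have z1 : z <= 1 by rewrite ler_pdivrMr// mul1r ler_nat.
  have uz : u = z `^ (2 * H) by rewrite /u /N' /N /z powR_div.
  have zh : 1 <= z * (1 + 2 * et).
    have h : (p'%:R : R) <= p%:R + e%:R by rewrite -natrD ler_nat.
    rewrite /z mulrAC ler_pdivlMr// mul1r; lra.
  have z2 : z `^ 2%:R <= z `^ (2 * H).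
    have [->|zn0] := eqVneq z 0; first by rewrite !powR0 ?lt0r_neq0//; lra.
    have zp : 0 < z by rewrite lt0r zn0.
    have -> : z `^ (2 * H) = z `^ (2 * H - 2) * z `^ 2%:R by rewrite -powR_add//; congr (_ `^ _); ring.
    have k : 1 <= z `^ (2 * H - 2).
      by apply: powR_neg_ge1 => //; lra.
    by have := ler_wpM2r (powR_ge0 z 2%:R) k; rewrite mul1r.
  rewrite uz; apply: le_trans z2; rewrite powR_mulrn//.
  have z3 : 1 - 2 * et <= z by nra.
  nra.
pose r := A / (L%:R * N').
have rlrv : lrv x a L qq = r * p'%:R `^ (2 * H - 1).
  have -> : lrv x a L qq = A / (L%:R * p'%:R).
    by rewrite -hlrv; field; rewrite !lt0r_neq0.
  rewrite /r powRm1// /N' /N; field.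
  by rewrite !lt0r_neq0//= ?powR_gt0.
have rcc : `|r - cc| <= ka / de + ep + 4 * et * cc.
  have -> : r - cc = (A - s2 * L%:R) / (L%:R * N') + ((s2 - cc * N p) / N' - cc * (1 - u)).
    by rewrite /r /u; field; rewrite !lt0r_neq0.
  apply: (le_trans (ler_normD _ _)); rewrite -[leRHS]addrA; apply: lerD.
    rewrite normrM normfV [X in _ / X]ger0_norm; last by rewrite mulr_ge0// ltW.
    rewrite ler_pdivrMr ?mulr_gt0//; apply: (le_trans hA).
    have h1 : n%:R <= L%:R / de by rewrite ler_pdivlMr// mulrC.
    rewrite (_ : ka / de * (L%:R * N') = ka * (L%:R / de * N')); last by ring.
    by rewrite ler_wpM2l//; apply: ler_pM => //; exact: ltW.
  apply: (le_trans (ler_normB _ _)); apply: lerD.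
    rewrite normrM normfV (ger0_norm (ltW N'0)) ler_pdivrMr//; apply: (le_trans hs).
    by rewrite ler_wpM2l.
  rewrite ger0_norm; last by rewrite mulr_ge0 ?subr_ge0// ltW.
  have := ler_wpM2l (ltW cc0) u2; lra.
set D := ka / de + ep + _ in rcc *.
rewrite rlrv.
pose g := (p'%:R / qq%:R) `^ (2 * H - 1) : R.
have -> : qq%:R `^ (1 - 2 * H) * (r * p'%:R `^ (2 * H - 1)) = r * g.
  rewrite /g powR_div// -(opprB _ 1) powRN; ring.
have g1 : 1 <= g.
  by apply: powR_ge1; [rewrite ler_pdivlMr// mul1r ler_nat|lra].
have g2 : g <= 1 + qq%:R^-1.
  have -> : 1 + qq%:R^-1 = p'%:R / qq%:R :> R by rewrite /p' -natr1; field; rewrite lt0r_neq0.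
  rewrite -[leRHS]powRr1 ?divr_ge0//; apply: ler_powR; last lra.
  by rewrite ler_pdivlMr// mul1r ler_nat.
have -> : r * g - cc = (r - cc) + r * (g - 1) by ring.
apply: (le_trans (ler_normD _ _)); apply: lerD => //.
rewrite normrM (ger0_norm (_ : 0 <= g - 1)) ?subr_ge0//.
apply: ler_pM => //; rewrite ?subr_ge0//; last by lra.
have -> : r = (r - cc) + cc by ring.
apply: (le_trans (ler_normD _ _)); rewrite (ger0_norm (ltW cc0)); lra.
Qed.

Variables (X : nat -> T -> R) (mu cc : R) (q : nat -> nat).
Hypothesis XY : forall j w, X j.+1 w = Y j w + mu.
Hypothesis cc0 : 0 < cc.
Hypothesis sigL : forall ep, 0 < ep -> exists p0, forall p, (p0 <= p)%N ->
  `|sig2 P Y p - cc * N p| <= ep * N p.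
Hypothesis q0 : forall n, (0 < q n)%N.
Hypothesis qm : forall m n, (m <= n)%N -> (q m <= q n)%N.
Hypothesis qd : exists C : R, forall k : nat, (q (2 ^ k.+1)%N)%:R / (q (2 ^ k)%N)%:R <= C.
Hypothesis qy : forall M : nat, exists n0 : nat, forall n, (n0 <= n)%N -> (M <= q n)%N.
Hypothesis qn : forall rho : R, 0 < rho -> exists n0 : nat, forall n, (n0 <= n)%N ->
  (q n)%:R <= rho * n%:R.

(** By monotonicity it is enough to compare values at powers of two, and at most log2 D + 2
    doublings separate [m] from D m. *)
Lemma q_ratio (D : nat) : exists2 K : R, 1 <= K & forall n m, (0 < m)%N -> (n <= D * m)%N ->
  (q n)%:R <= K * (q m)%:R.
Proof.
have [C hC] := qd.
have qR n : (0 : R) < (q n)%:R by rewrite ltr0n.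
have C1 : 1 <= C.
  apply: le_trans (hC 0%N); rewrite ler_pdivlMr// mul1r ler_nat; exact: qm.
have C0 : 0 <= C by lra.
have step k j : (q (2 ^ (k + j))%N)%:R <= C ^+ j * (q (2 ^ k)%N)%:R.
  elim: j => [|j IH]; first by rewrite addn0 expr0 mul1r.
  rewrite addnS exprS -mulrA; apply: le_trans (ler_wpM2l C0 IH).
  by rewrite -ler_pdivrMr.
pose j := (trunc_log 2 D).+1.
have Dj : (D <= 2 ^ j)%N by apply: ltnW; exact: trunc_log_ltn.
exists (C ^+ j.+1); first exact: exprn_ege1.
move=> n m m0 nD; pose k := trunc_log 2 m.
have /andP[km mk] := @trunc_log_bounds 2 m isT m0.
have nk : (n <= 2 ^ (k + j.+1))%N.
  apply: (leq_trans nD); rewrite addnC addSn -addnS expnD.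
  by apply: leq_mul => //; exact: ltnW.
apply: (@le_trans _ _ (q (2 ^ (k + j.+1))%N)%:R); first by rewrite ler_nat; exact: qm.
apply: (le_trans (step _ _)); rewrite ler_wpM2l ?exprn_ge0// ler_nat; exact: qm.
Qed.

Local Ltac sclr := clear - d T P Y H HY Hl Hu Cs0 C50 sigC HD HM HO X mu cc q XY cc0 sigL q0 qm qd qy qn.

(** All window lengths of segments longer than de n lie between [pm] and a fixed multiple of it, and
    are covered by I + 1 grid lengths with [I] depending on K/et only. In the union bound, (K +
    2)/et grid lengths cost 4 C5 et^2 each, which is small with [et]. *)
Lemma lrv_consistent (de e1 : R) : 0 < de -> de <= 1 -> 0 < e1 ->
  exists n0 : nat, forall n, (n0 <= n)%N -> exists E : set T,
  [/\ measurable E, fine (P (~` E)) <= e1 &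
   forall w, E w -> forall a L, (a + L <= n)%N -> de * n%:R <= L%:R ->
     `|(q L)%:R `^ (1 - 2 * H) * lrv (X ^~ w) a L (q L) - cc| <= e1].
Proof.
move=> de0 de1 e10; have hl := Hl; have hu := Hu; have c5 := C50; have ccp := cc0.
pose ka := de * e1 / 4.
have ka0 : 0 < ka by rewrite /ka divr_gt0// mulr_gt0.
have [th [J [th0 th1 J0 approx]]] := window_ok_approx de0 de1 ka0 Cs0.
have [D hD] := nat_ge (2 / de).
have [K K1 hK] := q_ratio D.
have K2 : 0 < K + 2 by lra.
have th20 : 0 < th ^+ 2 by rewrite exprn_gt0.
pose et := Num.min (1 / 4) (Num.min (e1 * th ^+ 2 / (8 * C5 * (K + 2))) (e1 / (32 * cc))).
have et0 : 0 < et.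
  rewrite !lt_min; apply/and3P; split; first lra.
    by rewrite divr_gt0 ?mulr_gt0.
  by rewrite divr_gt0 ?mulr_gt0.
have [et4 [et8 etc]] : et <= 1 / 4 /\ et <= e1 * th ^+ 2 / (8 * C5 * (K + 2)) /\ et <= e1 / (32 * cc).
  by have : et <= et := lexx _; rewrite {2}/et !le_min => /and3P[-> -> ->].
(* The slack is paid once for each of the at most (K + 2)/et grid lengths. *)
pose vt := e1 * th ^+ 2 * et / (2 * (K + 2)).
have vt0 : 0 < vt by rewrite /vt divr_gt0 ?mulr_gt0.
have [rho rho0 prob] := window_ok_prob th0 J0 vt0.
have [p0 hp0] := @sigL (e1 / 8) ltac:(lra).
pose I := (Num.truncn (K / et)).+1.
have KI : K / et <= I%:R by apply/ltW/truncnS_gt.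
have I1K : I.+1%:R <= (K + 2) / et.
  have h : (Num.truncn (K / et))%:R <= K / et by rewrite truncn_le// divr_ge0 ?(ltW et0)//; lra.
  rewrite /I -!natr1 mulrDl.
  have : 1 <= et^-1 by rewrite -invr1 lef_pV2 ?posrE ?ltr01//; lra.
  have : 2 / et = et^-1 + et^-1 by field; rewrite lt0r_neq0.
  lra.
pose G := (1 + I%:R * 2 * et) * 2 : R.
have G0 : 0 < G.
  have : 0 <= I%:R * 2 * et by rewrite !mulr_ge0// ltW.
  rewrite /G; lra.
(* All grid lengths are at most G r' n. The three terms make windows fit into the segments, grant
   the probability estimate, and grant 2 p <= th n for [approx]. *)
pose r' := Num.min (de / 2) (Num.min (rho / G) (th / (2 * G))).
have r'0 : 0 < r'.
  rewrite !lt_min; apply/and3P; split; rewrite divr_gt0// mulr_gt0//.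
have [n1 hn1] := qn r'0.
have [Q hQ] := nat_ge (Num.max (2 * (cc + e1) / e1) (Num.max p0%:R (et^-1))).
have [n2 hn2] := qy Q.
have [n3 hn3] := nat_ge (2 * (n2.+1)%:R / de).
have [n4 hn4] := nat_ge (th^-1).
exists (maxn n1 (maxn n3 (maxn n4 1))) => n.
rewrite !geq_max => /and4P[nn1 nn3 nn4 n0].
have nR : (0 : R) < n%:R by rewrite ltr0n.
pose m0 := Num.truncn (de * n%:R).
have m0le : m0%:R <= de * n%:R by rewrite truncn_le// mulr_ge0// ltW.
have m0gt : de * n%:R < m0%:R + 1 by rewrite natr1; exact: truncnS_gt.
have n3R : 2 * n2.+1%:R <= de * n%:R.
  have : 2 * n2.+1%:R / de <= n%:R by apply: (le_trans hn3); rewrite ler_nat.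
  by rewrite ler_pdivrMr// (mulrC n%:R).
have m0n2 : (n2 < m0)%N.
  rewrite -(ltr_nat R) ; have : (1 : R) <= n2.+1%:R by rewrite ler1n.
  rewrite -natr1; lra.
have m00 : (0 < m0)%N by exact: leq_ltn_trans m0n2.
have m0R : (1 : R) <= m0%:R by rewrite ler1n.
have nD : (n <= D * m0)%N.
  rewrite -(ler_nat R) natrM.
  apply: (@le_trans _ _ (2 / de * m0%:R)); last by rewrite ler_wpM2r.
  rewrite mulrAC ler_pdivlMr//; move: m0gt m0R nR de0 de1; sclr; lra.
have qnK := hK n m0 m00 nD.
pose pm := (q m0).+1.
have pmR : (1 : R) <= pm%:R by rewrite ler1n.
have QR : Num.max (2 * (cc + e1) / e1) (Num.max p0%:R (et^-1)) <= (q m0)%:R.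
  by apply: (le_trans hQ); rewrite ler_nat; apply: hn2; exact: ltnW.
move: QR; rewrite !ge_max => /and3P[Qe Qp Qet].
pose e := (Num.truncn (et * pm%:R)).+1.
have eR : et * pm%:R <= e%:R by apply/ltW/truncnS_gt.
have eR2 : e%:R <= 2 * et * pm%:R.
  have h : (Num.truncn (et * pm%:R))%:R <= et * pm%:R by rewrite truncn_le// mulr_ge0// ltW.
  have : 1 <= et * pm%:R.
    rewrite mulrC -ler_pdivrMr// div1r; apply: (le_trans Qet); rewrite ler_nat; exact: leqnSn.
  rewrite /e -natr1; move: h; sclr; lra.
have epm : (e <= pm)%N.
  by rewrite -(ler_nat R); have := ler_wpM2r (ltW (lt_le_trans ltr01 pmR)) et4; move: eR2 pmR; sclr; lra.
have qnr : (q n)%:R <= r' * n%:R by apply: hn1.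
have qm0n : (q m0 <= q n)%N.
  apply: qm; rewrite -(ler_nat R); apply: (le_trans m0le).
  by rewrite -[leRHS]mul1r ler_wpM2r.
have pmn : pm%:R <= 2 * r' * n%:R.
  have : (q m0)%:R <= (q n)%:R :> R by rewrite ler_nat.
  have : (1 : R) <= (q m0)%:R by rewrite ler1n.
  by rewrite /pm -natr1 => h1 h2; move: h1 h2 qnr; sclr; lra.
have [r1 [r2 r3]] : r' <= de / 2 /\ r' <= rho / G /\ r' <= th / (2 * G).
  by have : r' <= r' := lexx _; rewrite {2}/r' !le_min => /and3P[-> -> ->].
pose pt (i : nat) := (pm + i * e)%N.
have ptG i : (i <= I)%N -> (pt i)%:R <= G * r' * n%:R.
  move=> iI; rewrite /pt natrD natrM.
  have iR : (i%:R : R) <= I%:R by rewrite ler_nat.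
  have h : i%:R * e%:R <= I%:R * (2 * et * pm%:R) by apply: ler_pM.
  have g2 : 0 <= 1 + I%:R * 2 * et.
    have : 0 <= I%:R * 2 * et by rewrite !mulr_ge0// ltW.
    lra.
  have := ler_wpM2l g2 pmn => h'; move: h h'; sclr; rewrite /G; lra.
have ptrho i : (i <= I)%N -> (pt i)%:R <= rho * n%:R.
  move=> iI; apply: (le_trans (ptG i iI)); rewrite ler_wpM2r//.
  by move: r2; rewrite ler_pdivlMr// mulrC.
have ptth i : (i <= I)%N -> 2 * (pt i)%:R <= th * n%:R.
  move=> iI; have h := ptG i iI.
  have : G * r' <= th / 2.
    have h3 : r' * (2 * G) <= th by rewrite -ler_pdivlMr// pmulr_rgt0.
    have gen (x y z : R) : x * (2 * y) <= z -> y * x <= z / 2 by sclr; lra.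
    exact: gen.
  move=> /(ler_wpM2r (ltW nR)) h'; move: h h'; sclr; lra.
have ept i : (e <= pt i)%N by rewrite (leq_trans epm)// leq_addr.
have ex i : exists Err : T -> R, (i <= I)%N -> [/\ L1 P Err, forall w, 0 <= Err w,
    Exp P Err <= C5 * (e%:R / (pt i)%:R) `^ (4 * H) + vt &
    forall w, Err w <= th ^+ 2 -> window_ok th J n (pt i) e (sig2 P Y (pt i)) (N (pt i)) (Y ^~ w)].
  case: (leqP i I) => iI; last by exists (fun=> 0).
  by have [Err h] := prob n (pt i) e isT (ept i) (ptrho i iI); exists Err.
pose Err i := projT1 (cid (ex i)).
have hErr i : (i <= I)%N -> [/\ L1 P (Err i), forall w, 0 <= Err i w,
    Exp P (Err i) <= C5 * (e%:R / (pt i)%:R) `^ (4 * H) + vt &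
    forall w, Err i w <= th ^+ 2 -> window_ok th J n (pt i) e (sig2 P Y (pt i)) (N (pt i)) (Y ^~ w)].
  exact: (projT2 (cid (ex i))).
pose S w := \sum_(i < I.+1) Err i w.
have LErr (i : 'I_I.+1) : L1 P (Err i) by case: (hErr i (ltn_ord i)).
have Err0 (i : 'I_I.+1) w : 0 <= Err i w by case: (hErr i (ltn_ord i)).
have LS : L1 P S by exact: L1_sum.
have S0 w : 0 <= S w by exact: sumr_ge0.
have ES : Exp P S <= e1 * th ^+ 2.
  rewrite Exp_sum//.
  apply: (@le_trans _ _ (\sum_(i < I.+1) (4 * C5 * et ^+ 2 + vt))).
    apply: ler_sum => i _; have [_ _ h _] := hErr i (ltn_ord i); apply: (le_trans h).
    rewrite lerD2r.
    have x1 : e%:R / (pt i)%:R <= 2 * et.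
      rewrite ler_pdivrMr ?ltr0n ?addn_gt0//; apply: (le_trans eR2).
      by rewrite ler_wpM2l ?mulr_ge0 ?(ltW et0)// ler_nat leq_addr.
    have x2 : (e%:R / (pt i)%:R) `^ (4 * H) <= (2 * et) `^ (4 * H).
      by apply: ge0_ler_powR; rewrite ?nnegrE ?divr_ge0 ?mulr_ge0 ?(ltW et0)//; move: hl; sclr; lra.
    have x3 : (2 * et) `^ (4 * H) <= (2 * et) `^ 2%:R.
      have e20 : 0 < 2 * et by rewrite mulr_gt0.
      have -> : (2 * et) `^ (4 * H) = (2 * et) `^ (4 * H - 2) * (2 * et) `^ 2%:R.
        by rewrite -powR_add//; congr (_ `^ _); ring.
      have k : (2 * et) `^ (4 * H - 2) <= 1.
        by apply: powR_le1; move: et0 et4 hl; sclr; lra.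
      by have := ler_wpM2r (powR_ge0 (2 * et) 2%:R) k; rewrite mul1r.
    have := ler_wpM2l (ltW c5) (le_trans x2 x3).
    rewrite powR_mulrn ?mulr_ge0 ?(ltW et0)//; sclr; lra.
  rewrite sumr_cst_ord.
  have y0 : 0 <= 4 * C5 * et ^+ 2 + vt.
    by rewrite addr_ge0 ?(ltW vt0)// mulr_ge0 ?sqr_ge0// mulr_ge0// ltW.
  apply: (le_trans (ler_wpM2r y0 I1K)).
  rewrite mulrDr (_ : (K + 2) / et * vt = e1 * th ^+ 2 / 2); last by rewrite /vt; field; rewrite !lt0r_neq0.
  rewrite (_ : (K + 2) / et * _ = 4 * C5 * (K + 2) * et); last by field; rewrite lt0r_neq0.
  have : 4 * C5 * (K + 2) * et <= e1 * th ^+ 2 / 2.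
    move: et8; rewrite ler_pdivlMr ?mulr_gt0//; sclr; lra.
  sclr; lra.
have mB : measurable [set w | th ^+ 2 <= S w].
  have mS := L1_measurable LS.
  rewrite -[X in measurable X]setTI; exact: measurable_fun_le.
exists (~` [set w | th ^+ 2 <= S w]); split; first exact: measurableC.
  rewrite setCK; apply: (le_trans (Markov_Exp S0 LS th20)).
  by rewrite ler_pdivrMr.
move=> w /= /negP; rewrite -ltNge => Sw a L aLn dL.
have Ln : (L <= n)%N by exact: leq_trans (leq_addl _ _) aLn.
have m0L : (m0 <= L)%N by rewrite -(ler_nat R); exact: le_trans dL.
have L0 : (0 < L)%N by exact: leq_trans m0L.
have pmL : (pm <= (q L).+1)%N by rewrite ltnS; exact: qm.
(* The last grid length not exceeding q(L) + 1. *)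
pose i := (((q L).+1 - pm) %/ e)%N.
have iI : (i <= I)%N.
  rewrite /i -ltnS ltn_divLR// -(ltr_nat R) natrM.
  apply: (@le_lt_trans _ _ (q L)%:R).
    by rewrite ler_nat /pm subSS leq_subr.
  have : (q L)%:R <= (q n)%:R :> R by rewrite ler_nat; exact: qm.
  have h1 : K * pm%:R <= I%:R * e%:R.
    apply: (@le_trans _ _ (K / et * (et * pm%:R))).
      by rewrite le_eqVlt; apply/orP; left; apply/eqP; field; rewrite lt0r_neq0.
    have k0 : 0 <= K by move: K1; sclr; lra.
    by apply: ler_pM => //; [rewrite divr_ge0// ltW | rewrite mulr_ge0// ltW].
  have h2 : K * (q m0)%:R <= K * pm%:R by rewrite ler_wpM2l ?ler_nat//; move: K1; sclr; lra.
  have h3 : (0 : R) < e%:R by rewrite ltr0n.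
  by rewrite -natr1 mulrDl mul1r => h0; move: h0 h1 h2 h3 qnK; sclr; lra.
have [pi1 pi2] : (pt i <= (q L).+1)%N /\ ((q L).+1 <= pt i + e)%N.
  have h := divn_eq ((q L).+1 - pm) e; have h' := ltn_pmod ((q L).+1 - pm) (isT : (0 < e)%N).
  have h3 : ((q L).+1 = pm + ((q L).+1 - pm))%N by rewrite subnKC.
  split.
    by rewrite h3 /pt leq_add2l leq_divM.
  by rewrite h3 /pt -addnA leq_add2l {1}h leq_add2l ltnW.
have [_ _ _ ok] := hErr i iI.
have okw : window_ok th J n (pt i) e (sig2 P Y (pt i)) (N (pt i)) (Y ^~ w).
  apply: ok; apply: le_trans (ltW Sw); rewrite /S (bigD1 (Ordinal (iI : (i < I.+1)%N)))//= lerDl.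
  exact: sumr_ge0.
have pt0 : (0 < pt i)%N by rewrite addn_gt0.
have Npt : 0 < N (pt i) by rewrite powR_gt0 ?ltr0n.
have qLL : ((q L).+1 <= L)%N.
  rewrite -(ler_nat R) -natr1.
  have : (q L)%:R <= (q n)%:R :> R by rewrite ler_nat; exact: qm.
  have h1 : (1 : R) <= (q m0)%:R by rewrite ler1n.
  have h2 : (q m0)%:R <= (q n)%:R :> R by rewrite ler_nat.
  have := ler_wpM2r (ltW nR) r1 => h3 h4; move: h1 h2 h3 h4 qnr m0gt m0le m0R dL; sclr; lra.
have thn : 1 <= th * n%:R.
  by rewrite mulrC -ler_pdivrMr// div1r; apply: (le_trans hn4); rewrite ler_nat.
have hA := approx n (pt i) e (q L).+1 a L (sig2 P Y (pt i)) (N (pt i)) (Y ^~ w)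
  pt0 pi1 pi2 (ept i) (ptth i iI) thn aLn dL qLL Npt (sig2_ge0 _ _ _) (sigC _) okw.
have ep2 : e%:R <= 2 * et * (pt i)%:R.
  apply: (le_trans eR2); rewrite ler_wpM2l ?mulr_ge0 ?(ltW et0)// ler_nat leq_addr//.
have hsg : `|sig2 P Y (pt i) - cc * N (pt i)| <= e1 / 8 * N (pt i).
  apply: hp0; rewrite (leq_trans _ (leq_addr _ _))// (leq_trans _ (leqnSn _))//.
  by rewrite -(ler_nat R).
have e80 : 0 <= e1 / 8 by rewrite divr_ge0// ltW.
have := @lrv_pointwise cc de ka (e1 / 8) et mu (X ^~ w) (Y ^~ w) n (pt i) e a L (q L)
  (sig2 P Y (pt i)) (fun j => XY j w) (q0 L) L0 cc0 de0 (ltW ka0) e80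
  et0 et4 pt0 pi1 pi2 ep2 dL hsg hA.
move=> /le_trans; apply.
have kd : ka / de = e1 / 4 by rewrite /ka; field; rewrite lt0r_neq0.
have ec : 4 * et * cc <= e1 / 8.
  by move: etc; rewrite ler_pdivlMr ?mulr_gt0//; sclr; lra.
have qLR : 2 * (cc + e1) / e1 <= (q L)%:R by apply: (le_trans Qe); rewrite ler_nat; exact: qm.
have qL0 : (0 : R) < (q L)%:R by rewrite ltr0n.
have : (cc + e1) / (q L)%:R <= e1 / 2.
  rewrite ler_pdivrMr//; move: qLR; rewrite ler_pdivrMr//; sclr; lra.
rewrite kd => h.
have : (cc + (e1 / 4 + e1 / 8 + 4 * et * cc)) / (q L)%:R <= (cc + e1) / (q L)%:R.
  by rewrite ler_wpM2r ?invr_ge0 ?(ltW qL0)//; move: ec e10 ccp; sclr; lra.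
move=> h'; move: h h' ec e10 ccp; sclr; lra.
Qed.

End consistency.

(** * Dominated convergence and the standard normal law *)

Section dominated.
Context {R : realType} {d} {T : measurableType d} (P : probability T R).
Local Notation L1 := (L1 P).

Lemma Exp_cvg (f : nat -> T -> R) (g h : T -> R) :
  (forall n, measurable_fun setT (f n)) -> L1 h ->
  (forall n w, `|f n w| <= h w) -> (forall w, (fun n => f n w) @ \oo --> g w) ->
  L1 g /\ (fun n => Exp P (f n)) @ \oo --> Exp P g.
Proof.
move=> mf lh fh fg.
have mg : measurable_fun setT g by apply: measurable_fun_cvg mf _ => w _; exact: fg.
have gh w : `|g w| <= h w.
  by apply: (cvgr_to_le (cvg_norm (fg w))); apply: nearW => n; exact: fh.
have lg : L1 g by exact: L1_dom gh lh.
have lf n : L1 (f n) by exact: L1_dom (fh n) lh.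
split=> //.
have cvf w : (f n w)%:E @[n --> \oo] --> (g w)%:E.
  by apply: cvg_EFin (fg w); exact: nearW.
have [_ _] := @dominated_convergence _ _ _ P setT measurableT
  (fun n => EFin \o f n) (EFin \o g) (EFin \o h) (fun n => proj2 (measurable_EFinP _ _) (mf n))
  (proj2 (measurable_EFinP _ _) mg) (aeW _ (fun w (_ : setT w) => cvf w))
  lh (aeW _ (fun w n (_ : setT w) => fh n w : (`|(f n w)%:E| <= (h w)%:E)%E)).
move=> h1; under eq_fun do rewrite Exp_Rintegral.
rewrite Exp_Rintegral; apply: fine_cvg.
by rewrite fineK// integrable_fin_num.
Qed.

End dominated.

Section normal_kit.
Context {R : realType}.
Local Notation mu := (@lebesgue_measure R).
Local Notation pdf := (@normal_pdf R 0 1).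

(** The Radon-Nikodym derivative of [normal_prob] and the density have the same integral over every
    measurable set, hence agree almost everywhere. *)
Lemma integral_normal_ge0 (f : R -> R) : measurable_fun setT f -> (forall x, 0 <= f x) ->
  (\int[normal_prob 0 1]_x (f x)%:E = \int[mu]_x (f x * pdf x)%:E)%E.
Proof.
move=> mf f0; have nd := @normal_prob_dominates R 0 1.
rewrite -(@Radon_Nikodym_SigmaFinite.change_of_variables _ _ _ (normal_prob 0 1) mu nd)//; last first.
  exact/measurable_EFinP.
under [RHS]eq_integral do rewrite EFinM.
have mp := @measurable_normal_pdf R 0 1.
have ig := Radon_Nikodym_SigmaFinite.f_integrable nd.
have mg := measurable_int _ ig.
apply: ae_eq_integral => //.
- apply: emeasurable_funM; first exact/measurable_EFinP.
  exact: mg.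
- by apply: emeasurable_funM; exact/measurable_EFinP.
- apply: ae_eqe_mul2l; apply: integral_ae_eq => //.
  + exact/measurable_EFinP.
  + by move=> A _ mA; rewrite -Radon_Nikodym_SigmaFinite.f_integral.
Qed.

Lemma normal_pdf01E x : pdf x = normal_peak 1 * expR (- x ^+ 2 / 2).
Proof.
by rewrite normal_pdfE ?oner_neq0// /normal_fun subr0 expr1n.
Qed.

(** The exponentials differ by the factor exp(3 x^2 / 8), at least 1 + 3 x^2 / 8. Functions of
    quadratic growth thus become integrable against the density without computing a moment. *)
Lemma normal_pdf_sqr_le x : (1 + x ^+ 2) * pdf x <= 5 * (normal_peak 1 / normal_peak 2) * normal_pdf 0 2 x.
Proof.
rewrite normal_pdf01E normal_pdfE; last by rewrite pnatr_eq0.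
rewrite /normal_fun subr0.
have p2 : normal_peak 2 != 0 :> R by rewrite lt0r_neq0// normal_peak_gt0// pnatr_eq0.
rewrite [leRHS](_ : _ = normal_peak 1 * (5 * expR (- x ^+ 2 / (2 ^+ 2 *+ 2)))); last by field.
rewrite mulrCA ler_wpM2l ?normal_peak_ge0//.
set y := x ^+ 2; have y0 : 0 <= y by exact: sqr_ge0.
rewrite (_ : - y / 2 = - y / (2 ^+ 2 *+ 2) + - (3 / 8 * y)); last by field.
rewrite expRD mulrCA mulrC ler_wpM2r ?expR_ge0//.
rewrite expRN ler_pdivrMr ?expR_gt0//.
have := expR_ge1Dx (3 / 8 * y); lra.
Qed.

Lemma integrable_pdf_dom (h : R -> R) (C : R) : measurable_fun setT h ->
  (forall x, `|h x| <= C * (1 + x ^+ 2)) -> mu.-integrable setT (fun x => (h x * pdf x)%:E).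
Proof.
move=> mh hC.
have i2 := @integrable_normal_pdf R 0 2.
have C0 : 0 <= C by have := hC 0; rewrite expr0n/= addr0 mulr1; exact: le_trans.
apply: le_integrable (integrableZl measurableT (C * (5 * (normal_peak 1 / normal_peak 2))) i2) => //.
  by apply/measurable_EFinP/measurable_funM => //; exact: measurable_normal_pdf.
move=> x _ /=; rewrite lee_fin normrM (ger0_norm (normal_pdf_ge0 _ _ _)).
apply: (le_trans (ler_wpM2r (normal_pdf_ge0 _ _ _) (hC x))).
apply: le_trans (ler_norm _); rewrite -!mulrA ler_wpM2l// mulrA.
by apply: le_trans (normal_pdf_sqr_le x) _; rewrite !mulrA.
Qed.

Lemma integral_trunc_cvg (f : R -> R) : mu.-integrable setT (EFin \o f) ->
  (\int[mu]_(x in `[(- n.+1%:R)%R, n.+1%:R]) (f x)%:E)%E @[n --> \oo] --> (\int[mu]_x (f x)%:E)%E.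
Proof.
move=> fi; have mf := measurable_int _ fi.
pose A n := `[- n.+1%:R, n.+1%:R]%classic : set R.
have mA n : measurable_fun setT ((EFin \o f) \_ (A n)).
  have m1 : measurable (A n) by exact: measurable_itv.
  by apply/(measurable_restrictT _ m1); exact: measurable_funS mf.
have cA x : (((EFin \o f) \_ (A n)) x @[n --> \oo] --> (EFin \o f) x)%E.
  apply: cvg_near_cst; near=> n; rewrite patchE ifT// inE /A/= in_itv/= -ler_norml.
  apply: (@le_trans _ _ n%:R); last by rewrite ler_nat.
  by near: n; exact: nbhs_infty_ger.
have bA x n : (`|((EFin \o f) \_ (A n)) x| <= `|(f x)%:E|)%E.
  by rewrite patchE; case: ifP; rewrite //= normr0 lee_fin.
have [||_ _] := @dominated_convergence _ _ _ mu setT measurableT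
  (fun n => (EFin \o f) \_ (A n)) (EFin \o f) (fun x => `|(f x)%:E|%E) mA mf _ (integrable_abse fi).
- by apply: aeW => x _; exact: cA.
- by apply: aeW => x n _; exact: bA.
by apply: cvg_trans; apply: near_eq_cvg; apply: nearW => n; rewrite /= [RHS]integral_mkcond.
Unshelve. all: by end_near. Qed.

Lemma normal_pdf_decay : exists2 K : R, 0 < K & forall x, pdf x <= K / (1 + x ^+ 2).
Proof.
have pk s : s != 0 -> 0 < normal_peak s :> R by exact: normal_peak_gt0.
exists (5 * (normal_peak 1 / normal_peak 2) * normal_peak 2).
  by rewrite mulr_gt0 ?pk ?pnatr_eq0// mulr_gt0// divr_gt0 ?pk ?oner_neq0 ?pnatr_eq0.
move=> x; rewrite ler_pdivlMr; last by rewrite ltr_wpDr ?sqr_ge0.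
rewrite mulrC; apply: (le_trans (normal_pdf_sqr_le x)).
by rewrite ler_wpM2l ?mulr_ge0 ?invr_ge0 ?normal_peak_ge0// normal_pdf_ub// pnatr_eq0.
Qed.

Lemma is_derive_pdf (x : R) : is_derive x 1 (pdf : R -> R) (- x * pdf x).
Proof.
have -> : pdf = fun x : R => normal_peak 1 * expR (- x ^+ 2 / 2) by apply/funext => y; exact: normal_pdf01E.
have d1 : is_derive x 1 (fun x : R => - x ^+ 2 / 2) (- x).
  have -> : (fun x : R => - x ^+ 2 / 2) = (- 2^-1 *: (@GRing.exp R ^~ 2%N : R -> R)) :> (R -> R).
    by apply/funext => y; transitivity (- 2^-1 * y ^+ 2); [field|].
  by apply: is_derive_eq; rewrite /GRing.scale/= !mulr1; field.
have d2 := @is_derive1_comp R expR (fun x : R => - x ^+ 2 / 2) x _ _ (is_derive_expR _) d1.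
apply: is_derive_eq; rewrite /GRing.scale/= ; ring.
Qed.

(** The integrand is the derivative of h times the density. The fundamental theorem of calculus on
    growing symmetric intervals leaves boundary terms of order 1/n. *)
Lemma stein_integral (h h' : R -> R) (C : R) :
  (forall x : R, is_derive x 1 h (h' x)) -> continuous h' ->
  (forall x, `|h x| <= C * (1 + `|x|)) -> (forall x, `|h' x| <= C) ->
  (\int[mu]_x ((h' x - x * h x) * pdf x)%:E = 0)%E.
Proof.
move=> dh ch' hC h'C.
have C0 : 0 <= C by apply: le_trans (h'C 0).
have ch : continuous h.
  by move=> x; apply/differentiable_continuous/derivable1_diffP; case: (dh x).
have cp : continuous pdf by apply: continuous_normal_pdf; rewrite oner_neq0.
have ck : continuous (fun x : R => (h' x - x * h x) * pdf x).
  move=> x; apply: cvgM; last exact: cp.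
  by apply: cvgB; [exact: ch'|apply: cvgM; [exact: cvg_id|exact: ch]].
have fi : mu.-integrable setT (EFin \o (fun x : R => (h' x - x * h x) * pdf x)).
  apply: (@integrable_pdf_dom (fun x => h' x - x * h x) (3 * C)).
    apply: continuous_measurable_fun => x.
    by apply: cvgB; [exact: ch'|apply: cvgM; [exact: cvg_id|exact: ch]].
  move=> x; apply: (le_trans (ler_normB _ _)); rewrite normrM.
  have := ler_wpM2l (normr_ge0 x) (hC x); have := h'C x.
  have -> : x ^+ 2 = `|x| ^+ 2 by rewrite real_normK// num_real.
  set a := `|x|; have a0 : 0 <= a by exact: normr_ge0.
  have := mulr_ge0 C0 (sqr_ge0 (a - 1)); nra.
have cv := integral_trunc_cvg fi.
have ftc n : (\int[mu]_(x in `[(- n.+1%:R)%R, n.+1%:R]) ((h' x - x * h x) * pdf x)%:E =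
    (h n.+1%:R * pdf n.+1%:R)%:E - (h (- n.+1%:R) * pdf (- n.+1%:R))%:E)%E.
  have dH (x : R) : is_derive x 1 (h * pdf : R -> R) ((h' x - x * h x) * pdf x).
    have := is_derive_pdf x => ?; have := dh x => ?.
    apply: is_derive_eq; rewrite /GRing.scale/=; ring.
  apply: (@continuous_FTC2 _ _ (fun x => h x * pdf x)).
  - by rewrite gtrN.
  - exact: continuous_subspaceT.
  - split.
    + by move=> x _; case: (dH x).
    + apply: cvg_at_right_filter; apply: cvgM; [exact: ch|exact: cp].
    + apply: cvg_at_left_filter; apply: cvgM; [exact: ch|exact: cp].
  - by move=> x _; rewrite derive1E; case: (dH x).
suff c0 : (\int[mu]_(x in `[(- n.+1%:R)%R, n.+1%:R]) ((h' x - x * h x) * pdf x)%:E)%E @[n --> \oo] --> 0%E.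
  exact: (cvg_unique _ cv c0).
under eq_fun do rewrite ftc -EFinB.
apply: cvg_EFin; first exact: nearW.
have [K K0 hK] := normal_pdf_decay.
have bd (y : R) : 1 <= `|y| -> `|h y * pdf y| <= 2 * C * K / `|y|.
  move=> y1; have y0 : 0 < `|y| by exact: lt_le_trans y1.
  rewrite normrM (ger0_norm (normal_pdf_ge0 _ _ _)).
  apply: (@le_trans _ _ (C * (1 + `|y|) * (K / (1 + y ^+ 2)))).
    by apply: ler_pM => //; exact: normal_pdf_ge0.
  have -> : y ^+ 2 = `|y| ^+ 2 by rewrite real_normK// num_real.
  rewrite mulrA ler_pdivrMr; last by rewrite ltr_wpDr ?sqr_ge0.
  rewrite [leRHS]mulrAC ler_pdivlMr//.
  rewrite (_ : _ * _ * K * `|y| = C * K * (`|y| + `|y| ^+ 2)); last by ring.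
  rewrite (_ : 2 * C * K * _ = C * K * (2 + 2 * `|y| ^+ 2)); last by ring.
  apply: ler_wpM2l; first by rewrite mulr_ge0// ltW.
  by have := sqr_ge0 (`|y| - 1); nra.
apply: norm_cvg0; apply: (@squeeze_cvgr _ _ _ _ (fun=> 0) (fun n => 4 * C * K * n.+1%:R^-1)).
- apply: nearW => n; rewrite normr_ge0/=; apply: (le_trans (ler_normB _ _)).
  have n1 : 1 <= `|n.+1%:R| :> R by rewrite ger0_norm// ler1n.
  have n2 : 1 <= `|- n.+1%:R| :> R by rewrite normrN.
  have e1 : `|n.+1%:R| = n.+1%:R :> R by rewrite ger0_norm.
  have e2 : `|- n.+1%:R| = n.+1%:R :> R by rewrite normrN.
  have h1 := bd _ n1; have h2 := bd _ n2; rewrite e1 in h1; rewrite e2 in h2.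
  by apply: (le_trans (lerD h1 h2)); rewrite -mulrDl (_ : _ + _ = 4 * C * K)//; ring.
- exact: cvg_cst.
- rewrite -[X in _ --> X](mulr0 (4 * C * K)); apply: cvgMr; exact: cvg_harmonic.
Qed.

End normal_kit.

Section std_normal.
Context {R : realType} {d} {T : measurableType d} (P : probability T R) (N : T -> R).
Hypothesis hN : centered_normal P N 1.
Local Notation mu := (@lebesgue_measure R).
Local Notation pdf := (@normal_pdf R 0 1).
Local Notation L1 := (L1 P).

Lemma std_normal_measurable : measurable_fun setT N.
Proof. by case: hN. Qed.
Local Notation mN := std_normal_measurable.

Lemma std_normal_prob (A : set R) : measurable A -> P (N @^-1` A) = normal_prob 0 1 A.
Proof. by move=> mA; case: hN => _; rewrite oner_eq0 sqrtr1 => ->. Qed.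

Lemma Exp_std_ge0 (f : R -> R) (C : R) : measurable_fun setT f -> (forall x, 0 <= f x) ->
  (forall x, f x <= C * (1 + x ^+ 2)) ->
  L1 (f \o N) /\ Exp P (f \o N) = \int[mu]_x (f x * pdf x).
Proof.
move=> mf f0 fC.
have fi : mu.-integrable setT (fun x => (f x * pdf x)%:E).
  by apply: integrable_pdf_dom mf _ => x; rewrite ger0_norm//; exact: fC.
have e : (\int[P]_w ((f \o N) w)%:E = \int[mu]_x (f x * pdf x)%:E)%E.
  rewrite -integral_normal_ge0//.
  have mN' : measurable_fun setT (N : T -> measurableTypeR R) by exact: mN.
  pose NN : {mfun T >-> measurableTypeR R} := HB.pack (N : T -> measurableTypeR R)
    (isMeasurableFun.Build _ _ _ _ _ mN').
  have h := @ge0_integral_pushforward _ _ _ (measurableTypeR R) R NN mN' P setT (EFin \o f) measurableT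
    (proj2 (measurable_EFinP _ _) mf) (fun y _ => f0 y).
  transitivity (\int[P]_(x in NN @^-1` setT) (EFin \o f \o NN) x)%E => //.
  rewrite -h.
  apply: (@eq_measure_integral _ (measurableTypeR R) R setT (normal_prob 0 1) (pushforward P NN)).
  by move=> A mA _; exact: std_normal_prob.
have mfN : measurable_fun setT (f \o N) by exact: (measurableT_comp mf mN).
have lf : L1 (f \o N).
  apply/integrableP; split; first exact/measurable_EFinP.
  rewrite (eq_integral (fun w => ((f \o N) w)%:E)); last by move=> w _; rewrite /= ger0_norm.
  rewrite e; case/integrableP: fi => _; apply: le_lt_trans.
  rewrite le_eqVlt; apply/orP; left; apply/eqP/eq_integral => x _.
  by rewrite gee0_abs// lee_fin mulr_ge0// normal_pdf_ge0.
split=> //.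
by rewrite Exp_Rintegral /Rintegral e.
Qed.

(** Adding C (1 + x^2) reduces to the nonnegative case, where change of variables holds without
    integrability. *)
Lemma Exp_std (f : R -> R) (C : R) : measurable_fun setT f ->
  (forall x, `|f x| <= C * (1 + x ^+ 2)) ->
  L1 (f \o N) /\ Exp P (f \o N) = \int[mu]_x (f x * pdf x).
Proof.
move=> mf fC.
have C0 : 0 <= C by have := fC 0; rewrite expr0n/= addr0 mulr1; exact: le_trans.
pose B (x : R) := C * (1 + x ^+ 2).
have mB : measurable_fun setT B.
  apply: measurable_funM => //; apply: measurable_funD => //; exact: exprn_measurable.
have [lB eB] : L1 (B \o N) /\ Exp P (B \o N) = \int[mu]_x (B x * pdf x).
  apply: (@Exp_std_ge0 B C) => // x; by rewrite mulr_ge0// addr_ge0// sqr_ge0.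
pose g x := f x + B x.
have [lg eg] : L1 (g \o N) /\ Exp P (g \o N) = \int[mu]_x (g x * pdf x).
  apply: (@Exp_std_ge0 g (2 * C)).
  - exact: measurable_funD.
  - by move=> x; rewrite /g -lerBlDr sub0r; have := fC x; rewrite ler_norml => /andP[].
  - move=> x; rewrite /g /B; have := ler_norm (f x); have := fC x; lra.
have fE : f \o N = fun w => (g \o N) w - (B \o N) w by apply/funext => w; rewrite /= /g addrK.
split; first by rewrite fE; exact: L1B.
rewrite fE ExpB// eg eB -RintegralB//.
- by apply: eq_Rintegral => x _; rewrite -mulrBl /g addrK.
- apply: (@integrable_pdf_dom _ g (2 * C)); first exact: measurable_funD.
  move=> x; rewrite (le_trans (ler_normD _ _))// (@ger0_norm _ (B x)) ?mulr_ge0 ?addr_ge0 ?sqr_ge0//.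
  have := fC x; rewrite /B; lra.
- by apply: (@integrable_pdf_dom _ B C) => // x; rewrite ger0_norm ?mulr_ge0 ?addr_ge0 ?sqr_ge0//.
Qed.

Lemma stein (h h' : R -> R) (C : R) :
  (forall x : R, is_derive x 1 h (h' x)) -> continuous h' ->
  (forall x, `|h x| <= C * (1 + `|x|)) -> (forall x, `|h' x| <= C) ->
  [/\ L1 (h' \o N), L1 (fun w => N w * h (N w)) & Exp P (fun w => N w * h (N w)) = Exp P (h' \o N)].
Proof.
move=> dh ch' hC h'C.
have C0 : 0 <= C by apply: le_trans (h'C 0).
have ch : continuous h.
  by move=> x; apply/differentiable_continuous/derivable1_diffP; case: (dh x).
have cxh : continuous (fun x : R => x * h x) by move=> x; apply: cvgM; [exact: cvg_id|exact: ch].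
have [l1 e1] : L1 (h' \o N) /\ Exp P (h' \o N) = \int[mu]_x (h' x * pdf x).
  apply: (@Exp_std _ C); first exact: continuous_measurable_fun.
  move=> x; apply: (le_trans (h'C x)); rewrite ler_peMr// lerDl sqr_ge0//.
have bx x : `|x * h x| <= 2 * C * (1 + x ^+ 2).
  rewrite normrM; have := ler_wpM2l (normr_ge0 x) (hC x).
  have -> : x ^+ 2 = `|x| ^+ 2 by rewrite real_normK// num_real.
  set a := `|x|; have a0 : 0 <= a by exact: normr_ge0.
  have := mulr_ge0 C0 (sqr_ge0 (a - 1)); nra.
have [l2 e2] : L1 ((fun x => x * h x) \o N) /\ Exp P ((fun x => x * h x) \o N) = \int[mu]_x (x * h x * pdf x).
  by apply: (@Exp_std _ (2 * C)) => //; exact: continuous_measurable_fun.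
split=> //; apply/eqP; rewrite eq_sym -subr_eq0 e1 [Exp _ _]e2 -RintegralB//; last 2 first.
- apply: (@integrable_pdf_dom _ h' C); first exact: continuous_measurable_fun.
  by move=> x; apply: (le_trans (h'C x)); rewrite ler_peMr// lerDl sqr_ge0.
- by apply: (@integrable_pdf_dom _ (fun x => x * h x) (2 * C)) => //; exact: continuous_measurable_fun.
apply/eqP; rewrite /Rintegral.
under eq_integral do rewrite -mulrBl.
by rewrite (stein_integral dh ch' hC h'C).
Qed.

Lemma std_normal_sqr : L1 (fun w => N w ^+ 2) /\ Exp P (fun w => N w ^+ 2) = 1.
Proof.
have [] := @stein id (fun=> 1) 1.
- by move=> x; exact: cvg_cst.
- by move=> x; rewrite mul1r lerDr.
- by move=> x; rewrite normr1.
by move=> _ l; rewrite Exp_cst => e; split; [exact: l|exact: e].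
Qed.

Lemma std_normal_L1 : L1 N.
Proof.
have [||+ _] := @Exp_std id 1; [exact: measurable_id| |by apply].
move=> x /=; rewrite mul1r.
have -> : x ^+ 2 = `|x| ^+ 2 by rewrite real_normK// num_real.
by have := sqr_ge0 (`|x| - 1); have := normr_ge0 x; set a := `|x|; nra.
Qed.

Lemma Exp_std_derive (f f' : R -> R) : (forall x : R, is_derive x 1 f (f' x)) ->
  (forall x, `|f x| <= 1) -> (forall x, `|f' x| <= 1) ->
  forall s : R, is_derive s 1 (fun s => Exp P (fun w => f (s * N w))) (Exp P (fun w => N w * f' (s * N w))).
Proof.
move=> df f1 f'1 s.
have cf : continuous f.
  by move=> x; apply/differentiable_continuous/derivable1_diffP; case: (df x).
have dc (w : T) (x : R) : is_derive x 1 (fun s => f (s * N w)) (N w * f' (x * N w)).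
  have d1 : is_derive x 1 (fun s : R => s * N w) (N w).
    by apply: is_derive_eq; rewrite /GRing.scale/= mulr1 mulr0 add0r ?addr0.
  have := @is_derive1_comp R f (fun s : R => s * N w) x _ _ (df _) d1.
  by rewrite mulrC.
have lf (x : R) : L1 (fun w => f (x * N w)).
  apply: (@L1_bounded _ _ _ P _ 1) => //.
  apply: (measurableT_comp (continuous_measurable_fun cf)).
  by apply: measurable_funM => //; exact: mN.
have Is : s \in `]s - 1, s + 1[ by rewrite in_itv/= ltrBlDr ltrDl ltr01.
have H := @derivable_under_integral R _ _ P (fun s w => f (s * N w)) setT measurableT s (s - 1) (s + 1)
  Is (fun x _ => lf x) (fun x w _ _ => @ex_derive _ _ _ _ _ _ _ (dc w x)) (fun w => `|N w|)
  (fun w => normr_ge0 _) (L1_norm std_normal_L1).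
have H' := @differentiation_under_integral R _ _ P (fun s w => f (s * N w)) setT measurableT s (s - 1) (s + 1)
  Is (fun x _ => lf x) (fun x w _ _ => @ex_derive _ _ _ _ _ _ _ (dc w x)) (fun w => `|N w|)
  (fun w => normr_ge0 _) (L1_norm std_normal_L1).
have b (x : R) w : x \in `]s - 1, s + 1[ -> setT w ->
    `|partial1of2 (fun s w => f (s * N w)) x w| <= `|N w|.
  move=> _ _; rewrite partial1of2E (derive_val (is_derive := dc w x)) normrM.
  by rewrite -[leRHS]mulr1 ler_wpM2l.
have e : (fun s => Exp P (fun w => f (s * N w))) = fun s => \int[P]_w f (s * N w).
  by apply/funext => x; rewrite Exp_Rintegral.
rewrite e; apply: DeriveDef; first exact: H b.
rewrite -derive1E (H' b) Exp_Rintegral; apply: eq_Rintegral => w _.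
by rewrite partial1of2E (derive_val (is_derive := dc w s)).
Qed.

Lemma gauss_ode (y : R -> R) : (forall s : R, is_derive s 1 y (- s * y s)) ->
  forall s, y s = y 0 * expR (- s ^+ 2 / 2).
Proof.
move=> dy s.
have d1 (x : R) : is_derive x 1 (fun x : R => x ^+ 2 / 2) x.
  have -> : (fun x : R => x ^+ 2 / 2) = (2^-1 *: (@GRing.exp R ^~ 2%N : R -> R)) :> (R -> R).
    by apply/funext => z; transitivity (2^-1 * z ^+ 2); [field|].
  by apply: is_derive_eq; rewrite /GRing.scale/= !mulr1; field.
have d2 (x : R) := @is_derive1_comp R expR (fun x : R => x ^+ 2 / 2) x _ _ (is_derive_expR _) (d1 x).
have d3 (x : R) : is_derive x 1 (y * (expR \o (fun x : R => x ^+ 2 / 2))) 0.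
  have := dy x; have := d2 x => ? ?.
  by apply: is_derive_eq; rewrite /GRing.scale/=; ring.
have := is_derive_0_is_cst s 0 d3.
have -> z : (y * (expR \o (fun x : R => x ^+ 2 / 2))) z = y z * expR (z ^+ 2 / 2) by [].
have -> z : (y * (expR \o (fun x : R => x ^+ 2 / 2))) z = y z * expR (z ^+ 2 / 2) by [].
rewrite expr0n/= mul0r expR0 mulr1 => <-.
by rewrite -mulrA -expRD (_ : _ + _ = 0) ?expR0 ?mulr1//; field.
Qed.

(** The map s -> E f(sN) solves y' = - s y: differentiate under the expectation, then use Stein's
    identity and f'' = - f. Cosine and sine are treated together, which yields the characteristic
    function without complex numbers. *)
Lemma std_normal_osc (f f' : R -> R) : (forall x : R, is_derive x 1 f (f' x)) ->
  (forall x : R, is_derive x 1 f' (- f x)) ->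
  (forall x, `|f x| <= 1) -> (forall x, `|f' x| <= 1) ->
  forall s, Exp P (fun w => f (s * N w)) = f 0 * expR (- s ^+ 2 / 2).
Proof.
move=> df df' f1 f'1 s.
have cf : continuous f.
  by move=> x; apply/differentiable_continuous/derivable1_diffP; case: (df x).
have sc (a x : R) : is_derive x 1 (fun x : R => a * x) a.
  have -> : (fun x : R => a * x) = (a *: (@id R : R -> R)) by [].
  by apply: is_derive_eq; rewrite /GRing.scale/= mulr1.
have ode (x : R) : is_derive x 1 (fun s => Exp P (fun w => f (s * N w))) (- x * Exp P (fun w => f (x * N w))).
  have lf : L1 (fun w => f (x * N w)).
    apply: (@L1_bounded _ _ _ P _ 1) => //.
    apply: (measurableT_comp (continuous_measurable_fun cf)).
    by apply: measurable_funM => //; exact: mN.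
  have := Exp_std_derive df f1 f'1 x.
  have [] := @stein (fun z => f' (x * z)) (fun z => - x * f (x * z)) (1 + `|x|).
  - move=> z; have := @is_derive1_comp R f' (fun z => x * z) z _ _ (df' _) (sc x z).
    by rewrite mulrC mulrN mulNr.
  - move=> z; apply: cvgM; first exact: cvg_cst.
    apply: (@continuous_comp _ _ _ (fun z => x * z) f); last exact: cf.
    by apply: cvgM; [exact: cvg_cst|exact: cvg_id].
  - move=> z; apply: (le_trans (f'1 _)); rewrite -[leLHS]mulr1; apply: ler_pM => //; by rewrite lerDl.
  - move=> z; rewrite normrM normrN (@le_trans _ _ `|x|)// ?lerDr// ler_piMr//.
  by move=> _ _ ->; rewrite /comp ExpZ.
rewrite (gauss_ode ode).
by under [in X in Exp P X]eq_fun do rewrite mul0r; rewrite Exp_cst.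
Qed.

Lemma std_normal_cos (s : R) : Exp P (fun w => cos (s * N w)) = expR (- s ^+ 2 / 2).
Proof.
rewrite (@std_normal_osc cos (fun x => - sin x)) ?cos0 ?mul1r//.
- by move=> x; rewrite ler_norml cos_geN1 cos_le1.
- by move=> x; rewrite normrN ler_norml sin_geN1 sin_le1.
Qed.

Lemma std_normal_sin (s : R) : Exp P (fun w => sin (s * N w)) = 0.
Proof.
rewrite (@std_normal_osc sin cos) ?sin0 ?mul0r//.
- by move=> x; rewrite ler_norml sin_geN1 sin_le1.
- by move=> x; rewrite ler_norml cos_geN1 cos_le1.
Qed.

Lemma std_normal_itv_le (a b : R) : a <= b ->
  fine (P (N @^-1` `[a, b])) <= normal_peak 1 * (b - a).
Proof.
move=> ab; rewrite std_normal_prob// /normal_prob.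
have h : (\int[mu]_(x in `[a, b]) (pdf x)%:E <= (normal_peak 1 * (b - a))%:E)%E.
  apply: (@le_trans _ _ (\int[mu]_(x in `[a, b]) (normal_peak 1 : R)%:E)%E).
    apply: ge0_le_integral => //.
    - by move=> x _; rewrite lee_fin normal_pdf_ge0.
    - by apply/measurable_EFinP/measurable_funTS; exact: measurable_normal_pdf.
    - by move=> x _; rewrite lee_fin normal_pdf_ub// oner_neq0.
  rewrite integral_cst//= lebesgue_measure_itv/= lte_fin.
  have k0 : 0 <= normal_peak 1 * (b - a) by rewrite mulr_ge0 ?normal_peak_ge0 ?subr_ge0.
  by case: ifP => ab'; [rewrite -EFinB -EFinM lee_fin|rewrite mule0 lee_fin].
rewrite -lee_fin fineK//; rewrite ge0_fin_numE; first exact: le_lt_trans h (ltry _).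
by apply: integral_ge0 => x _; rewrite lee_fin normal_pdf_ge0.
Qed.

End std_normal.

(** * Trigonometric polynomials and independence of Gaussian variables *)

Section thresholds.
Context {R : realType}.

Lemma mulrn_expr_cvg0 (r : R) : 0 <= r -> r < 1 -> (fun n => n%:R * r ^+ n) @ \oo --> (0 : R).
Proof.
move=> r0 r1.
have [->|rn] := eqVneq r 0.
  apply: cvg_near_cst; near=> n; rewrite expr0n; case: eqP => [n0|_]; last by rewrite mulr0.
  by rewrite n0 mul0r.
pose s := Num.sqrt r.
have s0 : 0 < s by rewrite sqrtr_gt0 lt_def rn.
have s1 : s < 1 by rewrite -sqrtr1 ltr_sqrt.
have rs : r = s ^+ 2 by rewrite sqr_sqrtr.
pose dl := s^-1 - 1.
have dl0 : 0 < dl by rewrite subr_gt0 -invr1 ltf_pV2 ?posrE.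
have bern n : n%:R * s ^+ n <= dl^-1.
  have h : 1 + n%:R * dl <= s^-1 ^+ n.
    elim: n => [|n IH]; first by rewrite mul0r addr0 expr0.
    have e : s^-1 = 1 + dl by rewrite /dl; ring.
    rewrite exprS {1}e; apply: (@le_trans _ _ ((1 + dl) * (1 + n%:R * dl))).
      have : 0 <= n%:R * dl * dl by rewrite !mulr_ge0// ltW.
      rewrite -natr1; lra.
    by rewrite ler_wpM2l// addr_ge0// ltW.
  have sn : 0 < s ^+ n by rewrite exprn_gt0.
  rewrite -[leRHS]div1r ler_pdivlMr// mulrAC -ler_pdivlMr// div1r -exprVn.
  by apply: le_trans h; rewrite lerDr.
apply: (@squeeze_cvgr _ _ _ _ (fun=> 0) (fun n => dl^-1 * s ^+ n)).
- apply: nearW => n; rewrite mulr_ge0 ?exprn_ge0//= rs -exprM mulnC exprM expr2.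
  by rewrite mulrA ler_wpM2r// exprn_ge0// ltW.
- exact: cvg_cst.
- rewrite -[X in _ --> X](mulr0 dl^-1); apply: cvgMr; apply: cvg_expr; rewrite ger0_norm// ltW//.
Unshelve. all: by end_near. Qed.

Lemma one_sub_expn_le (u : R) m : 0 <= u -> u <= 1 -> 1 - m%:R * u <= (1 - u) ^+ m <= expR (- (m%:R * u)).
Proof.
move=> u0 u1; apply/andP; split.
  elim: m => [|m IH]; first by rewrite mul0r subr0 expr0.
  rewrite exprS; apply: (@le_trans _ _ ((1 - u) * (1 - m%:R * u))).
    have : 0 <= m%:R * u * u by rewrite !mulr_ge0.
    rewrite -natr1; lra.
  by rewrite ler_wpM2l// subr_ge0.
rewrite mulrC -mulNr expRM_natr lerXn2r ?nnegrE ?expR_ge0 ?subr_ge0//.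
by have := expR_ge1Dx (- u).
Qed.

(** The power is governed by exp(- n (2u)^n); the extra factor n decides the boundary case u = 1/2
    in favour of 1. Similar polynomials serve in the Brosowski-Deutsch proof of the
    Stone-Weierstrass theorem. *)
Lemma threshold_cvg (u : R) : 0 <= u -> u <= 1 ->
  (fun n => 1 - (1 - u ^+ n) ^+ (n * 2 ^ n)) @ \oo --> ((1 / 2 <= u)%R%:R : R).
Proof.
move=> u0 u1.
have b n := @one_sub_expn_le (u ^+ n) (n * 2 ^ n) (exprn_ge0 _ u0) (exprn_ile1 _ u0 u1).
have e n : (n * 2 ^ n)%:R * u ^+ n = n%:R * (2 * u) ^+ n by rewrite natrM natrX exprMn mulrA.
have p0 n : 0 <= (1 - u ^+ n) ^+ (n * 2 ^ n) by rewrite exprn_ge0// subr_ge0 exprn_ile1.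
case: leP => hu /=.
  rewrite -[X in _ --> X](subr0 1); apply: cvgB; first exact: cvg_cst.
  apply: (@squeeze_cvgr _ _ _ _ (fun=> 0) (fun n => n.+1%:R^-1 )); last exact: cvg_harmonic.
    apply: nearW => n; rewrite p0/=; have /andP[_ h] := b n; apply: (le_trans h).
    rewrite e expRN lef_pV2 ?posrE ?expR_gt0//.
    apply: (@le_trans _ _ (expR n%:R)); first by rewrite -natr1 addrC expR_ge1Dx.
    rewrite ler_expR ler_peMr// exprn_ege1//; lra.
  exact: cvg_cst.
apply: (@squeeze_cvgr _ _ _ _ (fun=> 0) (fun n => n%:R * (2 * u) ^+ n)).
- apply: nearW => n; rewrite subr_ge0 exprn_ile1 ?subr_ge0 ?exprn_ile1 ?gerBl ?exprn_ge0//=.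
  by have /andP[h _] := b n; rewrite -e; lra.
- exact: cvg_cst.
- by apply: mulrn_expr_cvg0; [rewrite mulr_ge0|lra].
Qed.

End thresholds.

Section trig_uniqueness.
Context {R : realType} {d} {T : measurableType d} (P : probability T R).
Variables (V : set (T -> R)) (k : T -> R) (Mk : R).
Hypothesis Vm : forall G, V G -> measurable_fun setT G.
Hypothesis VD : forall F G, V F -> V G -> V (fun w => F w + G w).
Hypothesis VZ : forall a G, V G -> V (fun w => a * G w).
Hypothesis mk : measurable_fun setT k.
Hypothesis kM : forall w, `|k w| <= Mk.

(** Orthogonality of f k to the trigonometric monomials over [V]. The weight [k] stays fixed while
    [f] is enlarged from the constant 1 to indicators of the generated sigma-algebra. *)
Definition trig_null (f : T -> R) := forall G, V G ->
  Exp P (fun w => f w * cos (G w) * k w) = 0 /\ Exp P (fun w => f w * sin (G w) * k w) = 0.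

Definition trig_class (f : T -> R) :=
  [/\ measurable_fun setT f, (exists M, forall w, `|f w| <= M) & trig_null f].

Let mcos G : V G -> measurable_fun setT (fun w => cos (G w)).
Proof. by move=> /Vm; apply: measurableT_comp; apply: continuous_measurable_fun; exact: continuous_cos. Qed.

Let msin G : V G -> measurable_fun setT (fun w => sin (G w)).
Proof. by move=> /Vm; apply: measurableT_comp; apply: continuous_measurable_fun; exact: continuous_sin. Qed.

Let cos1 (x : R) : `|cos x| <= 1. Proof. by rewrite ler_norml cos_geN1 cos_le1. Qed.
Let sin1 (x : R) : `|sin x| <= 1. Proof. by rewrite ler_norml sin_geN1 sin_le1. Qed.

Lemma L1_mul3_bounded (f g h : T -> R) (A B C : R) : measurable_fun setT f -> measurable_fun setT g ->
  measurable_fun setT h -> (forall w, `|f w| <= A) -> (forall w, `|g w| <= B) -> (forall w, `|h w| <= C) ->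
  L1 P (fun w => f w * g w * h w).
Proof.
move=> mf mg mh fA gB hC; apply: (@L1_bounded _ _ _ P _ (A * B * C)).
  by apply: measurable_funM => //; exact: measurable_funM.
by move=> w; rewrite !normrM; apply: ler_pM => //; apply: ler_pM.
Qed.

Lemma Exp_lin3 (a b A B C : R) (f g c h : T -> R) : measurable_fun setT f -> measurable_fun setT g ->
  measurable_fun setT c -> measurable_fun setT h ->
  (forall w, `|f w| <= A) -> (forall w, `|g w| <= B) -> (forall w, `|c w| <= 1) -> (forall w, `|h w| <= C) ->
  Exp P (fun w => (a * f w + b * g w) * c w * h w) =
  a * Exp P (fun w => f w * c w * h w) + b * Exp P (fun w => g w * c w * h w).
Proof.
move=> mf mg mc mh fA gB c1 hC.
have l1 := L1_mul3_bounded mf mc mh fA c1 hC; have l2 := L1_mul3_bounded mg mc mh gB c1 hC.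
rewrite -!ExpZ// -ExpD; [|exact: L1Z..].
by congr (Exp P _); apply/funext => w; ring.
Qed.

Lemma trig_class_lin (a b : R) f g : trig_class f -> trig_class g -> trig_class (fun w => a * f w + b * g w).
Proof.
move=> [mf [A fA] f0] [mg [B gB] g0]; split.
- by apply: measurable_funD; apply: measurable_funM.
- exists (`|a| * A + `|b| * B) => w; apply: (le_trans (ler_normD _ _)); rewrite !normrM.
  by apply: lerD; rewrite ler_wpM2l.
- move=> G VG; have [f1 f2] := f0 G VG; have [g1 g2] := g0 G VG.
  have lc := mcos VG; have ls := msin VG.
  rewrite (Exp_lin3 a b mf mg lc mk fA gB (fun w => cos1 _) kM).
  rewrite (Exp_lin3 a b mf mg ls mk fA gB (fun w => sin1 _) kM).
  by rewrite f1 f2 g1 g2 !mulr0 addr0.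
Qed.

Lemma trig_class_cvg (f : nat -> T -> R) g M : (forall n, trig_class (f n)) ->
  (forall n w, `|f n w| <= M) -> (forall w, (fun n => f n w) @ \oo --> g w) -> trig_class g.
Proof.
move=> tf fM fg.
have mf n : measurable_fun setT (f n) by case: (tf n).
have mg : measurable_fun setT g by apply: measurable_fun_cvg mf _ => w _; exact: fg.
have gM w : `|g w| <= M by apply: (cvgr_to_le (cvg_norm (fg w))); exact: nearW.
split=> //; first by exists M.
move=> G VG.
have gen (c : T -> R) : measurable_fun setT c -> (forall w, `|c w| <= 1) ->
    (forall n, Exp P (fun w => f n w * c w * k w) = 0) -> Exp P (fun w => g w * c w * k w) = 0.
  move=> mc c1 z.
  have [_ h] := @Exp_cvg _ _ _ P (fun n w => f n w * c w * k w) (fun w => g w * c w * k w) (fun=> M * 1 * Mk)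
    (fun n => measurable_funM (measurable_funM (mf n) mc) mk) (L1_cst _ _)
    (fun n w => ltac:(by rewrite !normrM; apply: ler_pM => //; apply: ler_pM))
    (fun w => cvgMl (cvgMl (fg w))).
  have h0 : Exp P (fun w => f n w * c w * k w) @[n --> \oo] --> (0 : R).
    by under eq_fun do rewrite z; exact: cvg_cst.
  exact: (cvg_unique _ h h0).
split; apply: gen => //; [exact: mcos| |exact: msin|] => n; by case: (tf n) => _ _ /(_ G VG) [].
Qed.

(** By the product-to-sum formulas, multiplication by cos F or sin F only replaces G by F + G and F
    - G, which remain in the linear space [V]. *)
Lemma trig_class_mul F f (c : R) : V F -> trig_class f ->
  trig_class (fun w => f w * ((1 + sin (F w - c)) / 2)).
Proof.
move=> VF tf; have [mf [A fA] f0] := tf.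
have mc := mcos VF; have ms := msin VF.
have VN G : V G -> V (fun w => F w + -1 * G w) by move=> VG; apply: VD => //; exact: VZ.
have tc : trig_class (fun w => f w * cos (F w)).
  split; first exact: measurable_funM.
    by exists A => w; rewrite normrM -[leRHS]mulr1 ler_pM.
  move=> G VG; have [a1 a2] := f0 _ (VD VF VG); have [b1 b2] := f0 _ (VN _ VG).
  have ma := VD VF VG; have mb := VN _ VG.
  split.
    rewrite (_ : (fun w => _) = fun w => 2^-1 * (f w * cos (F w + G w) * k w) + 2^-1 * (f w * cos (F w + -1 * G w) * k w)).
      rewrite ExpD ?ExpZ ?a1 ?b1 ?mulr0 ?addr0//; try apply: L1Z;
      by apply: (L1_mul3_bounded mf _ mk fA (fun w => cos1 _) kM); exact: mcos.
    by apply/funext => w; rewrite mulN1r cosD cosB; field.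
  rewrite (_ : (fun w => _) = fun w => 2^-1 * (f w * sin (F w + G w) * k w) + (- 2^-1) * (f w * sin (F w + -1 * G w) * k w)).
    rewrite ExpD ?ExpZ ?a2 ?b2 ?mulr0 ?addr0//; try apply: L1Z;
    by apply: (L1_mul3_bounded mf _ mk fA (fun w => sin1 _) kM); exact: msin.
  by apply/funext => w; rewrite mulN1r sinD sinB; field.
have ts : trig_class (fun w => f w * sin (F w)).
  split; first exact: measurable_funM.
    by exists A => w; rewrite normrM -[leRHS]mulr1 ler_pM.
  move=> G VG; have [a1 a2] := f0 _ (VD VF VG); have [b1 b2] := f0 _ (VN _ VG).
  have ma := VD VF VG; have mb := VN _ VG.
  split.
    rewrite (_ : (fun w => _) = fun w => 2^-1 * (f w * sin (F w + G w) * k w) + 2^-1 * (f w * sin (F w + -1 * G w) * k w)).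
      rewrite ExpD ?ExpZ ?a2 ?b2 ?mulr0 ?addr0//; try apply: L1Z;
      by apply: (L1_mul3_bounded mf _ mk fA (fun w => sin1 _) kM); exact: msin.
    by apply/funext => w; rewrite mulN1r sinD sinB; field.
  rewrite (_ : (fun w => _) = fun w => (- 2^-1) * (f w * cos (F w + G w) * k w) + 2^-1 * (f w * cos (F w + -1 * G w) * k w)).
    rewrite ExpD ?ExpZ ?a1 ?b1 ?mulr0 ?addr0//; try apply: L1Z;
    by apply: (L1_mul3_bounded mf _ mk fA (fun w => cos1 _) kM); exact: mcos.
  by apply/funext => w; rewrite mulN1r cosD cosB; field.
have := trig_class_lin 2^-1 1 tf (trig_class_lin (cos c / 2) (- sin c / 2) ts tc).
rewrite (_ : (fun w => _) = (fun w => f w * ((1 + sin (F w - c)) / 2)))//.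
by apply/funext => w; rewrite sinB; field.
Qed.

(** Once |F - c|/(j + 1) < pi, the value U j = (1 + sin((F - c)/(j + 1)))/2 is at least 1/2 exactly
    when c <= F. The limit in [n] supplied by [threshold_cvg] is taken first, then the limit in
    [j]. *)
Lemma trig_class_halfspace F f (c : R) : V F -> trig_class f ->
  trig_class (fun w => f w * (c <= F w)%R%:R).
Proof.
move=> VF tf; have [mf [A fA] f0] := tf.
pose U j w := (1 + sin ((j.+1%:R^-1 * F w) - c / j.+1%:R)) / 2.
have U01 j w : 0 <= U j w <= 1.
  have := sin_geN1 ((j.+1%:R^-1 * F w) - c / j.+1%:R).
  have := sin_le1 ((j.+1%:R^-1 * F w) - c / j.+1%:R).
  rewrite /U; lra.
have tU g j : trig_class g -> trig_class (fun w => g w * U j w).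
  by move=> tg; apply: trig_class_mul => //; exact: VZ.
have tUn g j n : trig_class g -> trig_class (fun w => g w * U j w ^+ n).
  move=> tg; elim: n => [|n IH]; first by under eq_fun do rewrite expr0 mulr1.
  by under eq_fun do rewrite exprSr mulrA; exact: tU.
have tUnm j n m : trig_class (fun w => f w * (1 - U j w ^+ n) ^+ m).
  elim: m => [|m IH]; first by under eq_fun do rewrite expr0 mulr1.
  rewrite (_ : (fun w => _) = fun w => 1 * (f w * (1 - U j w ^+ n) ^+ m) +
     -1 * (f w * (1 - U j w ^+ n) ^+ m * U j w ^+ n)).
    by apply: trig_class_lin => //; exact: tUn.
  by apply/funext => w; rewrite exprSr; ring.
have th j : trig_class (fun w => f w * (1 / 2 <= U j w)%R%:R).
  apply: (@trig_class_cvg (fun n w => f w * (1 - (1 - U j w ^+ n) ^+ (n * 2 ^ n))) _ A).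
  - move=> n; rewrite (_ : (fun w => _) = fun w => 1 * f w + -1 * (f w * (1 - U j w ^+ n) ^+ (n * 2 ^ n))).
      exact: trig_class_lin.
    by apply/funext => w; ring.
  - move=> n w; have /andP[u0 u1] := U01 j w; rewrite normrM -[leRHS]mulr1 ler_pM//.
    have v0 : 0 <= (1 - U j w ^+ n) ^+ (n * 2 ^ n) by rewrite exprn_ge0// subr_ge0 exprn_ile1.
    have v1 : (1 - U j w ^+ n) ^+ (n * 2 ^ n) <= 1 by rewrite exprn_ile1 ?subr_ge0 ?exprn_ile1 ?gerBl ?exprn_ge0.
    by rewrite ger0_norm ?subr_ge0// gerBl.
  - by move=> w; apply: cvgMr; have /andP[u0 u1] := U01 j w; exact: threshold_cvg.
apply: (@trig_class_cvg (fun j w => f w * (1 / 2 <= U j w)%R%:R) _ A) => //.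
  by move=> j w; rewrite normrM -[leRHS]mulr1 ler_pM//; case: (1 / 2 <= U j w); rewrite ?normr1 ?normr0.
move=> w; apply: cvg_near_cst; near=> j; congr (f w * _%:R); apply/esym; congr nat_of_bool.
set x := (F w - c) / j.+1%:R.
have Ux : U j w = (1 + sin x) / 2 by rewrite /U /x mulrBl (mulrC (F w)).
have j0 : (0 : R) < j.+1%:R by rewrite ltr0n.
have xpi : `|x| < pi.
  rewrite /x normrM (@ger0_norm _ j.+1%:R^-1) ?invr_ge0//.
  rewrite ltr_pdivrMr// mulrC -ltr_pdivrMr ?pi_gt0//.
  apply: (@lt_le_trans _ _ j%:R); last by rewrite ler_nat.
  by near: j; exact: nbhs_infty_gtr.
rewrite Ux; have [Fc|Fc] := leP c (F w).
- have : 0 <= sin x by apply: sin_ge0_pi; rewrite divr_ge0 ?subr_ge0//= ltW// (le_lt_trans (ler_norm _)).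
  by move=> h; have -> : 1 / 2 <= (1 + sin x) / 2 by lra.
- apply/esym/negbTE; rewrite -ltNge.
  have x0 : x < 0 by rewrite pmulr_llt0 ?invr_gt0// subr_lt0.
  have : 0 < sin (- x) by apply: sin_gt0_pi; rewrite oppr_gt0 x0/= -(ltr0_norm x0).
  rewrite sinN; lra.
Unshelve. all: by end_near. Qed.

(** Finite intersections are built in, so that this is a pi-system and Dynkin's lemma applies. *)
Inductive halfspaces : set (set T) :=
| halfspacesT : halfspaces setT
| halfspacesI F c A : V F -> halfspaces A -> halfspaces (A `&` [set w | c <= F w]).

Lemma halfspaces_setI : setI_closed halfspaces.
Proof.
move=> A B hA; elim=> [|F c B' VF hB IH]; first by rewrite setIT.
by rewrite setIA; exact: halfspacesI.
Qed.

Lemma halfspaces_measurable A : <<s halfspaces>> A -> measurable A.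
Proof.
apply: smallest_sub; first exact: sigma_algebra_measurable.
move=> B; elim=> [|F c B' VF hB IH]; first exact: measurableT.
apply: measurableI => //; rewrite -[X in measurable X]setTI.
by apply: measurable_fun_le => //; exact: Vm.
Qed.

Hypothesis V0 : V (fun=> 0).
Hypothesis k_null : trig_null (fun=> 1).

Lemma trig_class_sigma A : <<s halfspaces>> A -> trig_class \1_A.
Proof.
have t1 : trig_class (fun=> 1) by split=> //; exists 1 => w; rewrite normr1.
have mh (S : set T) : @measurable _ (g_sigma_algebraType halfspaces) S -> measurable S.
  exact: halfspaces_measurable.
apply: (@dynkin_induction _ (g_sigma_algebraType halfspaces) halfspaces (fun A => trig_class \1_A)) => //.
- exact: halfspaces_setI.
- by rewrite (_ : \1_setT = fun=> 1)//; apply/funext => w; rewrite indicT.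
- move=> B; elim=> [|F c B' VF hB IH].
    by rewrite (_ : \1_setT = fun=> 1)//; apply/funext => w; rewrite indicT.
  rewrite (_ : \1_(_) = fun w => \1_B' w * (c <= F w)%R%:R); first exact: trig_class_halfspace.
  apply/funext => w; rewrite !indicE in_setI -natrM mulnb; congr (_ && _)%:R.
  by apply/idP/idP; rewrite inE.
- move=> S mS tS; rewrite (_ : \1_(_) = fun w => 1 * 1 + -1 * \1_S w); first exact: trig_class_lin.
  by apply/funext => w; rewrite !indicE in_setC; case: (w \in S) => /=; ring.
- move=> F mF tF hF.
  have tU n : trig_class \1_(\bigcup_(k < n) F k).
    elim: n => [|n IH].
      rewrite bigcup_mkord big_ord0 indic0.
      rewrite (_ : cst 0 = fun w => 0 * 1 + 0 * 1); first exact: trig_class_lin.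
      by apply/funext => w; rewrite mul0r addr0.
    rewrite (_ : \1_(_) = fun w => 1 * \1_(\bigcup_(k < n) F k) w + 1 * \1_(F n) w); first exact: trig_class_lin.
    apply/funext => w; rewrite bigcup_mkord big_ord_recr/= -bigcup_mkord !mul1r.
    rewrite !indicE in_setU.
    case: (boolP (w \in \bigcup_(k < n) F k)) => [|_]; last by rewrite add0r.
    rewrite inE => -[i /= ni Fi].
    case: (boolP (w \in F n)) => [|_]; last by rewrite addr0.
    rewrite inE => Fn; have := tF i n Logic.I Logic.I.
    by move=> /(_ (ex_intro _ w (conj Fi Fn))) e; rewrite e ltnn in ni.
  apply: (@trig_class_cvg (fun n => \1_(\bigcup_(k < n) F k)) _ 1) => //.
    by move=> n w; rewrite indicE; case: (_ \in _); rewrite /= ?normr1 ?normr0.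
  move=> w; apply: cvg_near_cst.
  have [[i _ Fi]|nF] := pselect ((\bigcup_k F k) w).
    near=> n; rewrite !indicE !mem_set//; first by exists i.
    exists i => //=; near: n; exact: nbhs_infty_gt.
  apply: nearW => n; rewrite !indicE !memNset// => -[i _ Fi]; apply: nF; by exists i.
Unshelve. all: by end_near. Qed.

Lemma trig_unique A : <<s halfspaces>> A -> Exp P (fun w => \1_A w * k w) = 0.
Proof.
move=> /trig_class_sigma[_ _] /(_ _ V0)[+ _].
by under eq_fun do rewrite cos0 mulr1.
Qed.

End trig_uniqueness.

Section gaussian_family.
Context {R : realType} {d} {T : measurableType d} (Q : probability T R).
Variables (H : R) (W : R -> T -> R).
Hypothesis hW : is_fBm Q H W.
Local Notation L1 := (L1 Q).

(** Lists of pairs (coefficient, time) are used so that concatenation and scaling of lists represent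
    the vector space operations. *)
Definition gcomb (s : seq (R * R)) (w : T) : R := \sum_(p <- s) p.1 * W p.2 w.

Definition gcov (s s' : seq (R * R)) : R :=
  \sum_(p <- s) \sum_(p' <- s') p.1 * p'.1 * fBm_cov H p.2 p'.2.

Definition gpos (s : seq (R * R)) := all (fun p => 0 <= p.2) s.

Definition gscale (a : R) (s : seq (R * R)) := [seq (a * p.1, p.2) | p <- s].

Lemma gcomb_cat s s' w : gcomb (s ++ s') w = gcomb s w + gcomb s' w.
Proof. by rewrite /gcomb big_cat. Qed.

Lemma gcomb_scale a s w : gcomb (gscale a s) w = a * gcomb s w.
Proof. by rewrite /gcomb big_map mulr_sumr; apply: eq_bigr => p _; rewrite mulrA. Qed.

Lemma fBm_covC s t : fBm_cov H s t = fBm_cov H t s.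
Proof. by rewrite /fBm_cov (addrC (s `^ _)) distrC. Qed.

Lemma gcovC s s' : gcov s s' = gcov s' s.
Proof.
rewrite /gcov exchange_big; apply: eq_bigr => p _; apply: eq_bigr => q _.
by rewrite fBm_covC (mulrC q.1).
Qed.

Lemma gcov_catl s1 s2 s : gcov (s1 ++ s2) s = gcov s1 s + gcov s2 s.
Proof. by rewrite /gcov big_cat. Qed.

Lemma gcov_scalel a s s' : gcov (gscale a s) s' = a * gcov s s'.
Proof.
rewrite /gcov big_map mulr_sumr; apply: eq_bigr => p _; rewrite mulr_sumr.
by apply: eq_bigr => q _; rewrite !mulrA.
Qed.

Lemma gcov_catr s1 s2 s : gcov s (s1 ++ s2) = gcov s s1 + gcov s s2.
Proof. by rewrite gcovC gcov_catl !(gcovC s). Qed.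

Lemma gcov_scaler a s s' : gcov s' (gscale a s) = a * gcov s' s.
Proof. by rewrite gcovC gcov_scalel gcovC. Qed.

Lemma gpos_cat s s' : gpos (s ++ s') = gpos s && gpos s'.
Proof. exact: all_cat. Qed.

Lemma gpos_scale a s : gpos (gscale a s) = gpos s.
Proof. by rewrite /gpos all_map. Qed.

Lemma gcomb_normal s : gpos s -> centered_normal Q (gcomb s) (gcov s s).
Proof.
move=> /allP ps; case: hW => _ h.
have := h (size s) (fun i => (tnth (in_tuple s) i).2) (fun i => (tnth (in_tuple s) i).1)
  (fun i => ps _ (mem_tnth i (in_tuple s))).
rewrite (_ : (fun w => _) = gcomb s); last first.
  by apply/funext => w; rewrite /gcomb (big_tnth _ _ s).
rewrite (_ : \sum_(_ < _) _ = gcov s s)//.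
rewrite /gcov (big_tnth _ _ s); apply: eq_bigr => i _.
by rewrite (big_tnth _ _ s).
Qed.

Lemma gcomb_measurable s : gpos s -> measurable_fun setT (gcomb s).
Proof. by move=> /gcomb_normal[]. Qed.

(** Positivity is read off from the existence of the process. With a negative variance the square
    root would be 0, for which [normal_pdf] is by convention the indicator of [0, 1]; the
    combination and its opposite would then both be uniform on [0, 1]. *)
Lemma gcov_ge0 s : gpos s -> 0 <= gcov s s.
Proof.
move=> ps; rewrite leNgt; apply/negP => v0.
have vn : gcov s s != 0 by rewrite lt_eqF.
have n1 : Num.sqrt (gcov s s) = 0 by apply: ler0_sqrtr; exact: ltW.
have [m1 h1] := gcomb_normal ps; rewrite (negbTE vn) n1 in h1.
have pn : gpos (gscale (-1) s) by rewrite gpos_scale.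
have [m2 h2] := gcomb_normal pn.
rewrite gcov_scalel gcov_scaler mulrA mulrNN mulr1 mul1r (negbTE vn) n1 in h2.
have e : gcomb (gscale (-1) s) @^-1` `]0, +oo[ = gcomb s @^-1` `]-oo, 0[.
  by apply/seteqP; split => w /=; rewrite !in_itv/= gcomb_scale ?andbT mulN1r oppr_gt0.
have mN : measurable (`]-oo, 0[%classic : set R) by exact: measurable_itv.
have := h2 `]0, +oo[%classic (measurable_itv _); rewrite e h1//.
have pdf0 : normal_pdf 0 0 = (\1_`[0, 1] : R -> R) by rewrite /normal_pdf eqxx.
rewrite /normal_prob pdf0 => h.
have z : (\int[lebesgue_measure]_(x in `]-oo, 0%R[) (\1_`[0, 1] x : R)%:E = 0)%E.
  rewrite integral_indic//.
  rewrite (_ : _ `&` _ = set0) ?measure0//.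
  by apply/seteqP; split => // x []/=; rewrite !in_itv/= => /andP[a _] b; move: (le_lt_trans a b); rewrite ltxx.
have z1 : (\int[lebesgue_measure]_(x in `]0%R, +oo[) (\1_`[0, 1] x : R)%:E = 1)%E.
  rewrite integral_indic//.
  rewrite (_ : _ `&` _ = `]0, 1]%classic); last first.
    apply/seteqP; split => x /=; rewrite !in_itv/= ?andbT.
      by move=> [/andP[_ ->] ->].
    by move=> /andP[a b]; rewrite a b ltW.
  by rewrite [LHS](@lebesgue_measure_itv R `]0, 1])/= lte_fin ltr01 oppr0 adde0.
by move: h; rewrite z z1 => /esym/eqP; rewrite onee_eq0.
Qed.

Lemma gcomb_std s : gpos s -> 0 < gcov s s ->
  centered_normal Q (fun w => (Num.sqrt (gcov s s))^-1 * gcomb s w) 1.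
Proof.
move=> ps v0; have := @gcomb_normal (gscale (Num.sqrt (gcov s s))^-1 s).
rewrite gpos_scale gcov_scalel gcov_scaler mulrA -expr2 exprVn sqr_sqrtr ?(ltW v0)// mulVf ?gt_eqF//.
by rewrite (_ : gcomb _ = fun w => (Num.sqrt (gcov s s))^-1 * gcomb s w); [exact|apply/funext => w; exact: gcomb_scale].
Qed.

Lemma gcomb_null s : gpos s -> gcov s s = 0 -> Q (gcomb s @^-1` [set 0]) = 1%E.
Proof. by move=> ps v0; case: (gcomb_normal ps) => _; rewrite v0 eqxx. Qed.

Lemma Exp_eq_off (f g : T -> R) (M : R) (N : set T) :
  (forall w, `|f w| <= M) -> (forall w, `|g w| <= M) ->
  measurable N -> Q N = 0%E -> (forall w, ~ N w -> f w = g w) -> Exp Q f = Exp Q g.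
Proof.
move=> fM gM mN N0 fg; apply/eqP; rewrite eq_le; apply/andP; split;
by apply: (Exp_le_off _ _ mN N0) => // w nw; rewrite fg.
Qed.

Lemma gcomb_chf s : gpos s ->
  Exp Q (fun w => cos (gcomb s w)) = expR (- gcov s s / 2) /\ Exp Q (fun w => sin (gcomb s w)) = 0.
Proof.
move=> ps; have := gcov_ge0 ps; rewrite le_eqVlt => /predU1P[v0|v0].
  have z := gcomb_null ps (esym v0).
  have mz : measurable (gcomb s @^-1` [set 0]).
    by rewrite -[X in measurable X]setTI; apply: gcomb_measurable.
  have N0 : Q (~` (gcomb s @^-1` [set 0])) = 0%E by rewrite probability_setC// z subee.
  have mN := measurableC mz.
  have c1 (x : R) : `|cos x| <= 1 by rewrite ler_norml cos_geN1 cos_le1.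
  have s1 (x : R) : `|sin x| <= 1 by rewrite ler_norml sin_geN1 sin_le1.
  split.
    rewrite -v0 oppr0 mul0r expR0 -[RHS](Exp_cst Q 1).
    apply: (@Exp_eq_off _ _ 1 _ (fun w => c1 _) _ mN N0) => w; rewrite ?normr1//.
    by move=> /contrapT /= ->; rewrite cos0.
  rewrite -[RHS](Exp_cst Q 0).
  apply: (@Exp_eq_off _ _ 1 _ (fun w => s1 _) _ mN N0) => w; rewrite ?normr0//.
  by move=> /contrapT /= ->; rewrite sin0.
have hN := gcomb_std ps v0; set r := Num.sqrt _ in hN.
have r0 : r != 0 by rewrite gt_eqF// sqrtr_gt0.
have e w : gcomb s w = r * (r^-1 * gcomb s w) by rewrite mulrA mulfV// mul1r.
split.
  under eq_fun do rewrite e.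
  by rewrite (std_normal_cos hN) sqr_sqrtr// ltW.
by under eq_fun do rewrite e; rewrite (std_normal_sin hN).
Qed.

Lemma gcomb_itv_le s (a b : R) : gpos s -> 0 < gcov s s -> a <= b ->
  fine (Q (gcomb s @^-1` `[a, b])) <= normal_peak 1 / Num.sqrt (gcov s s) * (b - a).
Proof.
move=> ps v0 ab; have hN := gcomb_std ps v0.
have r0 : 0 < Num.sqrt (gcov s s) by rewrite sqrtr_gt0.
have ab' : (Num.sqrt (gcov s s))^-1 * a <= (Num.sqrt (gcov s s))^-1 * b by rewrite ler_wpM2l// invr_ge0 ltW.
have := std_normal_itv_le hN ab'.
rewrite (_ : _ @^-1` _ = gcomb s @^-1` `[a, b]).
  by rewrite -mulrBr mulrA.
by apply/seteqP; split => w /=; rewrite !in_itv/= !ler_pM2l ?invr_gt0.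
Qed.

(** [trig_unique] is used twice. First over [V], with weight cos(tau Z) or sin(tau Z) minus its
    mean: the joint characteristic function factors because the covariances vanish. Then over the
    multiples of Z, with weight the centred indicator of [A]. *)
Lemma gcomb_indep (z : seq (R * R)) (V := [set G | exists2 s, gpos s /\ gcov s z = 0 & G = gcomb s])
    (A : set T) (a b : R) : gpos z -> <<s halfspaces V >> A ->
  fine (Q (A `&` [set w | a <= gcomb z w < b])) =
  fine (Q A) * fine (Q [set w | a <= gcomb z w < b]).
Proof.
move=> pz sA.
have Vm G : V G -> measurable_fun setT G by move=> [s [ps _] ->]; exact: gcomb_measurable.
have VD F G : V F -> V G -> V (fun w => F w + G w).
  move=> [s [ps cs] ->] [s' [ps' cs'] ->]; exists (s ++ s').
    by rewrite gpos_cat ps ps' gcov_catl cs cs' addr0.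
  by apply/funext => w; rewrite gcomb_cat.
have VZ c G : V G -> V (fun w => c * G w).
  move=> [s [ps cs] ->]; exists (gscale c s).
    by rewrite gpos_scale ps gcov_scalel cs mulr0.
  by apply/funext => w; rewrite gcomb_scale.
have V0 : V (fun=> 0).
  exists [::]; first by rewrite /gpos /gcov big_nil.
  by apply/funext => w; rewrite /gcomb big_nil.
have c1 (x : R) : `|cos x| <= 1 by rewrite ler_norml cos_geN1 cos_le1.
have s1 (x : R) : `|sin x| <= 1 by rewrite ler_norml sin_geN1 sin_le1.
have mcos G : measurable_fun setT G -> measurable_fun setT (fun w : T => cos (G w) : R).
  by apply: measurableT_comp; apply: continuous_measurable_fun; exact: continuous_cos.
have msin G : measurable_fun setT G -> measurable_fun setT (fun w : T => sin (G w) : R).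
  by apply: measurableT_comp; apply: continuous_measurable_fun; exact: continuous_sin.
have mA := halfspaces_measurable Vm sA.
have E1 tau (k : T -> R) : k = (fun w => cos (tau * gcomb z w)) \/ k = (fun w => sin (tau * gcomb z w)) ->
    Exp Q (fun w => \1_A w * (k w - Exp Q k)) = 0.
  move=> hk.
  have mz : measurable_fun setT (fun w => tau * gcomb z w).
    by apply: measurable_funM => //; exact: gcomb_measurable.
  have mk : measurable_fun setT (fun w => k w - Exp Q k).
    by apply: measurable_funB => //; case: hk => ->; [exact: mcos|exact: msin].
  have k1 w : `|k w| <= 1 by case: hk => ->.
  have kM w : `|k w - Exp Q k| <= 1 + `|Exp Q k| by rewrite (le_trans (ler_normB _ _))// lerD2r.
  apply: (@trig_unique _ _ _ Q V _ _ Vm VD VZ mk kM V0 _ _ sA).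
  move=> G [s [ps cs] ->].
  have mG := gcomb_measurable ps.
  have cross (c : R) : (Exp Q (fun w => cos (gcomb s w + c * gcomb z w)) = expR (- gcov s s / 2) * expR (- (c ^+ 2 * gcov z z) / 2))
      /\ Exp Q (fun w => sin (gcomb s w + c * gcomb z w)) = 0.
    have [] := @gcomb_chf (s ++ gscale c z).
      by rewrite gpos_cat gpos_scale ps.
    rewrite gcov_catl !gcov_catr !gcov_scalel !gcov_scaler (gcovC z) cs.
    under eq_fun do rewrite gcomb_cat gcomb_scale.
    under [in X in _ -> X -> _]eq_fun do rewrite gcomb_cat gcomb_scale.
    by move=> -> ->; split=> //; rewrite -expRD; congr expR; field.
  have [cp sp] := cross tau; have [cm sm] := cross (- tau); rewrite sqrrN in cm.
  have [ez ez0] : Exp Q (fun w => cos (tau * gcomb z w)) = expR (- (tau ^+ 2 * gcov z z) / 2) /\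
      Exp Q (fun w => sin (tau * gcomb z w)) = 0.
    have [] := @gcomb_chf (gscale tau z); first by rewrite gpos_scale.
    rewrite gcov_scalel gcov_scaler mulrA -expr2.
    under eq_fun do rewrite gcomb_scale.
    by under [in X in _ -> X -> _]eq_fun do rewrite gcomb_scale.
  have [es es0] := gcomb_chf ps.
  have mp : measurable_fun setT (fun w => gcomb s w + tau * gcomb z w) by exact: measurable_funD.
  have mm : measurable_fun setT (fun w => gcomb s w + - tau * gcomb z w).
    by apply: measurable_funD => //; apply: measurable_funM => //; exact: gcomb_measurable.
  have lin (f : T -> R) (a1 a2 a3 : R) (f1 f2 f3 : T -> R) :
      (forall w, f w = a1 * f1 w + a2 * f2 w + a3 * f3 w) -> L1 f1 -> L1 f2 -> L1 f3 ->
      Exp Q f = a1 * Exp Q f1 + a2 * Exp Q f2 + a3 * Exp Q f3.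
    move=> fE l1 l2 l3; rewrite (_ : f = fun w => a1 * f1 w + a2 * f2 w + a3 * f3 w); last exact/funext.
    by rewrite !ExpD ?ExpZ//; do ?[apply: L1D]; exact: L1Z.
  have bl (f : T -> R) : measurable_fun setT f -> (forall w : T, `|f w| <= 1) -> L1 f by exact: L1_bounded.
  case: hk => kE; rewrite {}kE ?ez ?ez0; split.
  - rewrite (lin _ (1/2) (1/2) (- expR (- (tau ^+ 2 * gcov z z) / 2)) (fun w => cos (gcomb s w + tau * gcomb z w))
      (fun w => cos (gcomb s w + - tau * gcomb z w)) (fun w => cos (gcomb s w))).
    + by rewrite cp cm es; field.
    + by move=> w; rewrite (mulNr tau) cosD cosB; field.
    + by apply: bl => //; exact: mcos.
    + by apply: bl => //; exact: mcos.
    + by apply: bl => //; exact: mcos.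
  - rewrite (lin _ (1/2) (1/2) (- expR (- (tau ^+ 2 * gcov z z) / 2)) (fun w => sin (gcomb s w + tau * gcomb z w))
      (fun w => sin (gcomb s w + - tau * gcomb z w)) (fun w => sin (gcomb s w))).
    + by rewrite sp sm es0; field.
    + by move=> w; rewrite (mulNr tau) sinD sinB; field.
    + by apply: bl => //; exact: msin.
    + by apply: bl => //; exact: msin.
    + by apply: bl => //; exact: msin.
  - rewrite (lin _ (1/2) (-(1/2)) 0 (fun w => sin (gcomb s w + tau * gcomb z w))
      (fun w => sin (gcomb s w + - tau * gcomb z w)) (fun w => sin (gcomb s w))).
    + by rewrite sp sm es0; field.
    + by move=> w; rewrite (mulNr tau) sinD sinB; field.
    + by apply: bl => //; exact: msin.
    + by apply: bl => //; exact: msin.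
    + by apply: bl => //; exact: msin.
  - rewrite (lin _ (1/2) (-(1/2)) 0 (fun w => cos (gcomb s w + - tau * gcomb z w))
      (fun w => cos (gcomb s w + tau * gcomb z w)) (fun w => cos (gcomb s w))).
    + by rewrite cp cm es; field.
    + by move=> w; rewrite (mulNr tau) cosB cosD; field.
    + by apply: bl => //; exact: mcos.
    + by apply: bl => //; exact: mcos.
    + by apply: bl => //; exact: mcos.
pose V2 := [set G | exists c, G = (fun w => c * gcomb z w)].
have V2m G : V2 G -> measurable_fun setT G.
  by move=> [c ->]; apply: measurable_funM => //; exact: gcomb_measurable.
have V2D F G : V2 F -> V2 G -> V2 (fun w => F w + G w).
  by move=> [c ->] [c' ->]; exists (c + c'); apply/funext => w; rewrite mulrDl.
have V2Z c G : V2 G -> V2 (fun w => c * G w).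
  by move=> [c' ->]; exists (c * c'); apply/funext => w; rewrite mulrA.
have V20 : V2 (fun=> 0) by exists 0; apply/funext => w; rewrite mul0r.
have lA := L1_indic Q mA.
have i1 (S : set T) w : `|\1_S w| <= (1 : R) by rewrite indicE; case: (_ \in _); rewrite /= ?normr1 ?normr0.
have mk : measurable_fun setT (fun w => \1_A w - fine (Q A)).
  by apply: measurable_funB => //; exact: measurable_indic.
have kM w : `|\1_A w - fine (Q A)| <= 1 + `|fine (Q A)|.
  by rewrite (le_trans (ler_normB _ _))// lerD2r.
have kn : trig_null Q V2 (fun w => \1_A w - fine (Q A)) (fun=> 1).
  move=> G [c ->].
  have mz : measurable_fun setT (fun w => c * gcomb z w).
    by apply: measurable_funM => //; exact: gcomb_measurable.
  have gen (k : T -> R) : measurable_fun setT k -> (forall w, `|k w| <= 1) ->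
      Exp Q (fun w => \1_A w * (k w - Exp Q k)) = 0 -> Exp Q (fun w => 1 * k w * (\1_A w - fine (Q A))) = 0.
    move=> mk1 k1 h.
    have lk : L1 k by exact: L1_bounded k1.
    have lAk : L1 (fun w => \1_A w * k w).
      apply: (@L1_bounded _ _ _ Q _ 1); first by apply: measurable_funM => //; exact: measurable_indic.
      by move=> w; rewrite normrM -[leRHS]mulr1 ler_pM.
    have e1 : Exp Q (fun w => \1_A w * (k w - Exp Q k)) = Exp Q (fun w => \1_A w * k w) - Exp Q k * fine (Q A).
      rewrite -Exp_indic// -ExpZ// -ExpB//; last exact: L1Z.
      by congr (Exp Q _); apply/funext => w; ring.
    rewrite (_ : (fun w => _) = fun w => \1_A w * k w - fine (Q A) * k w); last by apply/funext => w; ring.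
    by rewrite ExpB ?ExpZ//; [rewrite mulrC -e1|exact: L1Z].
  split; apply: gen => //.
  - exact: mcos.
  - by apply: (E1 c); left.
  - exact: msin.
  - by apply: (E1 c); right.
have hu := @trig_unique _ _ _ Q V2 _ _ V2m V2D V2Z mk kM V20 kn.
have half (c : R) : <<s halfspaces V2 >> [set w | c <= gcomb z w].
  apply: sub_gen_smallest; rewrite -[X in halfspaces _ X]setTI; apply: halfspacesI; last exact: halfspacesT.
  by exists 1; apply/funext => w; rewrite mul1r.
have sab : <<s halfspaces V2 >> [set w | a <= gcomb z w < b].
  have mI := @measurableD _ (g_sigma_algebraType (halfspaces V2)) _ _ (half a) (half b).
  rewrite (_ : [set w | _] = [set w | a <= gcomb z w] `\` [set w | b <= gcomb z w])//.
  apply/seteqP; split => w /=.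
    by move=> /andP[-> h]; split=> //; apply/negP; rewrite -ltNge.
  by move=> [-> /negP]; rewrite -ltNge => ->.
have mB := halfspaces_measurable V2m sab.
have lB := L1_indic Q mB.
have := hu _ sab.
rewrite (_ : (fun w => _) = fun w => \1_(A `&` [set w | a <= gcomb z w < b]) w - fine (Q A) * \1_([set w | a <= gcomb z w < b]) w).
  rewrite ExpB ?ExpZ ?Exp_indic//; last 3 first.
  - exact: measurableI.
  - exact/L1_indic/measurableI.
  - exact: L1Z.
  by move/eqP; rewrite subr_eq0 => /eqP.
by apply/funext => w; rewrite indicI/=; ring.
Qed.

End gaussian_family.

(** * Uniqueness of the maximizer of the fractional Brownian bridge *)

Section running_sup.
Context {R : realType}.

(** Suprema of sequences are reached as limits of finite maxima, which gives their measurability. *)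
Fixpoint run_max (u : nat -> R) m : R := if m is m'.+1 then Num.max (run_max u m') `|u m'| else 0.

Definition rsup (u : nat -> R) : R := sup (range (run_max u)).

Lemma run_max_le (u : nat -> R) (M : R) m : (forall n, `|u n| <= M) -> run_max u m <= M.
Proof.
move=> uM; elim: m => [|m IH] /=; first exact: le_trans (uM 0%N).
by rewrite ge_max IH uM.
Qed.

Lemma run_max_nd (u : nat -> R) : nondecreasing_seq (run_max u).
Proof. by apply/nondecreasing_seqP => n /=; rewrite le_max lexx. Qed.

Lemma rsup_cvg (u : nat -> R) (M : R) : (forall n, `|u n| <= M) -> run_max u @ \oo --> rsup u.
Proof.
move=> uM; apply: nondecreasing_cvgn; first exact: run_max_nd.
by exists M => _ [m _ <-]; exact: run_max_le.
Qed.

Lemma rsup_ub (u : nat -> R) (M : R) n : (forall n, `|u n| <= M) -> `|u n| <= rsup u.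
Proof.
move=> uM; have c := rsup_cvg uM; rewrite -(cvg_lim (@Rhausdorff R) c).
apply: (@le_trans _ _ (run_max u n.+1)); first by rewrite /= le_max lexx orbT.
apply: nondecreasing_cvgn_le; first exact: run_max_nd.
by apply/cvg_ex; exists (rsup u).
Qed.

Lemma rsup_le (u : nat -> R) (M : R) : (forall n, `|u n| <= M) -> rsup u <= M.
Proof.
by move=> uM; apply: (cvgr_to_le (rsup_cvg uM)); apply: nearW => m; exact: run_max_le.
Qed.

Lemma measurable_rsup {d} {T : measurableType d} (f : nat -> T -> R) :
  (forall n, measurable_fun setT (f n)) -> (forall w, exists M, forall n, `|f n w| <= M) ->
  measurable_fun setT (fun w => rsup (f ^~ w)).
Proof.
move=> mf bf.
have mb m : measurable_fun setT (fun w => run_max (f ^~ w) m).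
  elim: m => [|m IH] /=; first exact: measurable_cst.
  by apply: measurable_maxr => //; exact: measurableT_comp (mf m).
apply: measurable_fun_cvg mb _ => w _.
by have [M hM] := bf w; exact: rsup_cvg hM.
Qed.

End running_sup.

(** * Slope jumps of a convex supremum *)

Section convex_jump.
Context {R : realType}.
Variables (y h : nat -> R) (My K : R).
Hypothesis yM : forall n, `|y n| <= My.
Hypothesis hK : forall n, `|h n| <= K.
Let Phi z := rsup (fun n => y n + h n * z).

Let bnd z : forall n, `|y n + h n * z| <= My + K * `|z|.
Proof.
move=> n; apply: (le_trans (ler_normD _ _)); rewrite normrM lerD//.
by rewrite ler_wpM2r.
Qed.

Lemma Phi_ge n s z : `|s| <= 1 -> s * (y n + h n * z) <= Phi z.
Proof.
move=> s1; apply: (le_trans (ler_norm _)); rewrite normrM.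
by apply: (@le_trans _ _ `|y n + h n * z|); [rewrite ler_piMl|exact: (rsup_ub n (bnd z))].
Qed.

Lemma Phi_convex (t z z' : R) : 0 <= t <= 1 -> Phi (t * z + (1 - t) * z') <= t * Phi z + (1 - t) * Phi z'.
Proof.
move=> /andP[t0 t1]; apply: rsup_le => n.
rewrite (_ : y n + _ = t * (y n + h n * z) + (1 - t) * (y n + h n * z')); last by ring.
apply: (le_trans (ler_normD _ _)); rewrite !normrM (ger0_norm t0) (@ger0_norm _ (1 - t)) ?subr_ge0//.
by apply: lerD; rewrite ler_wpM2l ?subr_ge0// (rsup_ub n (bnd _)).
Qed.

Lemma Phi_lip z z' : `|Phi z - Phi z'| <= K * `|z - z'|.
Proof.
have gen a b : Phi a <= Phi b + K * `|a - b|.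
  apply: rsup_le => n.
  rewrite (_ : y n + h n * a = (y n + h n * b) + h n * (a - b)); last by ring.
  apply: (le_trans (ler_normD _ _)); rewrite normrM lerD ?ler_wpM2r//.
  exact: (rsup_ub n (bnd _)).
have := gen z z'; have := gen z' z; rewrite (distrC z' z) ler_norml; lra.
Qed.

(** The sum of the midpoint convexity inequalities centred at x and at x + eta. *)
Lemma Phi_second_diff x eta : 0 <= Phi (x + eta + eta) - Phi (x + eta) - Phi x + Phi (x - eta).
Proof.
have mid u : 2 * Phi u <= Phi (u + eta) + Phi (u - eta).
  have := @Phi_convex (1/2) (u + eta) (u - eta) ltac:(lra).
  rewrite (_ : _ * (u + eta) + _ = u); last by field.
  lra.
have := mid (x + eta); have := mid x; rewrite addrK; lra.
Qed.

(** Index [n] bounds the slope to the right of [z] from below, and [n'] the slope to the left from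
    above. Since z lies in [x, x + eta), the intervals [x + eta, x + 2 eta] and [x - eta, x] are on
    its two sides and, by convexity, inherit these bounds up to [e]. *)
Lemma Phi_jump (M e c z x eta s s' : R) n n' : 0 < eta -> 0 < c ->
  (forall n, `|y n + h n * z| <= M) -> x <= z < x + eta -> `|s| <= 1 -> `|s'| <= 1 ->
  M - e <= s * (y n + h n * z) -> M - e <= s' * (y n' + h n' * z) -> 0 <= e ->
  c <= s * h n - s' * h n' -> e <= eta * c / 4 ->
  eta * c / 2 <= Phi (x + eta + eta) - Phi (x + eta) - Phi x + Phi (x - eta).
Proof.
move=> eta0 c0 zM /andP[xz zx] s1 s'1 he he' e0 hc ec.
have PM : Phi z <= M by exact: rsup_le.
have up : Phi (x + eta + eta) - Phi (x + eta) >= eta * (s * h n) - e.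
  set b := x + eta + eta.
  have bz : 0 < b - z by rewrite /b; lra.
  pose t := eta / (b - z).
  have t0 : 0 <= t by rewrite divr_ge0// ltW.
  have t1 : t <= 1 by rewrite ler_pdivrMr// /b; lra.
  have := @Phi_convex t z b ltac:(lra).
  rewrite (_ : t * z + (1 - t) * b = x + eta); last by rewrite /t /b; field; rewrite gt_eqF.
  have := @Phi_ge n s b s1.
  have e1 : s * (y n + h n * b) = s * (y n + h n * z) + s * h n * (b - z) by ring.
  rewrite e1 => h1 h2.
  have h3 : t * (- e + s * h n * (b - z)) <= t * (Phi b - Phi z).
    rewrite ler_wpM2l//; lra.
  have e2 : t * (- e + s * h n * (b - z)) = - (t * e) + eta * (s * h n).
    by rewrite /t; field; rewrite gt_eqF.
  have h4 : t * e <= e by rewrite ler_piMl.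
  lra.
have dn : Phi (x - eta) - Phi x >= - (eta * (s' * h n')) - e.
  set a := x - eta.
  have bz : 0 < z - a by rewrite /a; lra.
  pose t := eta / (z - a).
  have t0 : 0 <= t by rewrite divr_ge0// ltW.
  have t1 : t <= 1 by rewrite ler_pdivrMr// /a; lra.
  have := @Phi_convex t z a ltac:(lra).
  rewrite (_ : t * z + (1 - t) * a = x); last by rewrite /t /a; field; rewrite -/a gt_eqF.
  have := @Phi_ge n' s' a s'1.
  have e1 : s' * (y n' + h n' * a) = s' * (y n' + h n' * z) - s' * h n' * (z - a) by ring.
  rewrite e1 => h1 h2.
  have h3 : t * (- e - s' * h n' * (z - a)) <= t * (Phi a - Phi z).
    rewrite ler_wpM2l//; lra.
  have e2 : t * (- e - s' * h n' * (z - a)) = - (t * e) - eta * (s' * h n').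
    by rewrite /t; field; rewrite gt_eqF.
  have h4 : t * e <= e by rewrite ler_piMl.
  lra.
have := ler_wpM2l (ltW eta0) hc; rewrite mulrBr; lra.
Qed.

(** The sum telescopes to a difference of two increments of [Phi] over length 2 eta, so the bound
    does not depend on [m]. *)
Lemma Phi_second_diff_sum a eta m : 0 <= eta ->
  \sum_(k < m) (Phi (a + k%:R * eta + eta + eta) - Phi (a + k%:R * eta + eta) - Phi (a + k%:R * eta)
     + Phi (a + k%:R * eta - eta)) <= 4 * K * eta.
Proof.
move=> eta0; pose F j := Phi (a + (j%:R - 1) * eta).
have -> : \sum_(k < m) (Phi (a + k%:R * eta + eta + eta) - Phi (a + k%:R * eta + eta) - Phi (a + k%:R * eta)
     + Phi (a + k%:R * eta - eta)) = (F m.+2 - F m) - (F 2%N - F 0%N).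
  elim: m => [|m IH]; first by rewrite big_ord0 subrr.
  rewrite big_ord_recr/= IH.
  have e1 : F m.+3 = Phi (a + m%:R * eta + eta + eta) by rewrite /F -!natr1; congr Phi; ring.
  have e2 : F m.+2 = Phi (a + m%:R * eta + eta) by rewrite /F -!natr1; congr Phi; ring.
  have e3 : F m.+1 = Phi (a + m%:R * eta) by rewrite /F -!natr1; congr Phi; ring.
  have e4 : F m = Phi (a + m%:R * eta - eta) by rewrite /F; congr Phi; ring.
  rewrite -e1 -e2 -e3 -e4; ring.
have l j : `|F j.+2 - F j| <= 2 * K * eta.
  apply: (le_trans (Phi_lip _ _)).
  rewrite (_ : a + _ - _ = 2 * eta); last by rewrite -!natr1; ring.
  by rewrite ger0_norm ?mulr_ge0// mulrCA mulrA.
have := l m; have := l 0%N; rewrite !ler_norml; lra.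
Qed.

End convex_jump.

Lemma null_bigcup {R : realType} {d} {T : measurableType d} (Q : probability T R) (F : nat -> set T) :
  (forall j, measurable (F j)) -> (forall j, Q (F j) = 0%E) -> Q (\bigcup_j F j) = 0%E.
Proof.
move=> mF F0; apply/negligibleP; first exact: bigcupT_measurable.
by apply: negligible_bigcup => j; apply/negligibleP; [exact: mF|exact: F0].
Qed.

(** * Jumps along a Gaussian direction have probability zero *)

Section jump_null.
Context {R : realType} {d} {T : measurableType d} (Q : probability T R).
Variables (H : R) (W : R -> T -> R).
Hypothesis hW : is_fBm Q H W.
Variables (z : seq (R * R)) (bs : nat -> seq (R * R)) (K : R).
Hypothesis pz : gpos z.
Hypothesis vz : 0 < gcov H z z.
Hypothesis pb : forall n, gpos (bs n).
Hypothesis bb : forall w, exists M, forall n, `|gcomb W (bs n) w| <= M.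
Hypothesis hK : forall n, `|gcov H (bs n) z| <= K.

(* Z = gcomb W z plays the role of the direction in the convexity argument: two
   near-maximizers whose signed covariances with Z differ by at least c. *)
Definition sup_jump (c : R) : set T := [set w | exists M, (forall n, `|gcomb W (bs n) w| <= M) /\
  forall e, 0 < e -> exists n n' s s', [/\ `|s| <= 1, `|s'| <= 1,
    M - e <= s * gcomb W (bs n) w, M - e <= s' * gcomb W (bs n') w &
    c <= s * gcov H (bs n) z - s' * gcov H (bs n') z]].

Let v := gcov H z z.
Let Z := gcomb W z.
(** The regression coefficient on [Z]; subtracting hn Z leaves the residual [Yn], uncorrelated with
    [Z]. *)
Let hn n := gcov H (bs n) z / v.
Let Yn n := gcomb W (bs n ++ gscale (- hn n) z).
Let YE n w : Yn n w = gcomb W (bs n) w - hn n * Z w.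
Proof. by rewrite /Yn gcomb_cat gcomb_scale mulNr. Qed.
Let hnK n : `|hn n| <= K / v.
Proof. by rewrite /hn normrM (@ger0_norm _ v^-1) ?invr_ge0 ?(ltW vz)// ler_wpM2r// invr_ge0 ltW. Qed.
Let Yb w : exists M, forall n, `|Yn n w| <= M.
Proof.
have [M hM] := bb w; exists (M + K / v * `|Z w|) => n; rewrite YE.
by apply: (le_trans (ler_normB _ _)); rewrite lerD// normrM ler_wpM2r.
Qed.
Let Phi x w := rsup (fun n => Yn n w + hn n * x).
Let V := [set G | exists2 s, gpos s /\ gcov H s z = 0 & G = gcomb W s].
Let VY n : V (Yn n).
Proof.
exists (bs n ++ gscale (- hn n) z) => //; split; first by rewrite gpos_cat gpos_scale pb.
by rewrite gcov_catl gcov_scalel mulNr /hn /v divfK ?gt_eqF// subrr.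
Qed.
Let Vm G : V G -> measurable_fun setT G.
Proof. by move=> [s [ps _] ->]; exact: (gcomb_measurable hW). Qed.
Let T' := g_sigma_algebraType (halfspaces V).

(** Measurability with respect to the sigma-algebra of the combinations uncorrelated with [Z], as
    [gcomb_indep] requires for events about [Phi]. *)
Let mPhi' x : measurable_fun (setT : set T') (Phi x : T' -> R).
Proof.
apply: (@measurable_rsup _ _ T' (fun n w => Yn n w + hn n * x)).
  move=> n; apply: measurable_funD => //.
  apply: (measurability (@RGenCInfty.G R)); first exact: RGenCInfty.measurableE.
  move=> _ [_ [c ->] <-]; rewrite setTI.
  rewrite (_ : _ @^-1` _ = [set w | c <= Yn n w]).
    apply: sub_gen_smallest; rewrite -[X in halfspaces _ X]setTI.
    by apply: halfspacesI; [exact: VY|exact: halfspacesT].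
  by apply/seteqP; split => w /=; rewrite in_itv/= andbT.
move=> w; have [M hM] := Yb w; exists (M + K / v * `|x|) => n.
by apply: (le_trans (ler_normD _ _)); rewrite lerD// normrM ler_wpM2r.
Qed.

Let mPhi x : measurable_fun setT (Phi x : T -> R).
Proof. by move=> _ B mB; apply: (halfspaces_measurable Vm); exact: mPhi'. Qed.

(** The range [-A, A) of [Z] is cut into m + 1 cells of length eta. A jump with [Z] in a cell forces
    the second difference there to reach [th], itself of order eta. The Markov bounds for these
    events add up to at most 8 K/c by telescoping; independence multiplies each by the probability
    of its cell, again of order eta. *)
Lemma sup_jump_cover c A (m : nat) : 0 < c -> 0 < A -> exists N : set T, [/\ measurable N,
  fine (Q N) <= (16 * A * K * normal_peak 1 / (Num.sqrt v * c)) / m.+1%:R &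
  forall w, sup_jump c w -> - A <= Z w < A -> N w].
Proof.
move=> c0 A0; pose eta := 2 * A / m.+1%:R.
have eta0 : 0 < eta by rewrite divr_gt0// mulr_gt0.
pose x k := - A + k%:R * eta.
pose D k w := Phi (x k + eta + eta) w - Phi (x k + eta) w - Phi (x k) w + Phi (x k - eta) w.
pose th := eta * (c / v) / 2.
have cv0 : 0 < c / v by rewrite divr_gt0.
have th0 : 0 < th by rewrite divr_gt0// mulr_gt0.
pose E k := [set w | th <= D k w].
pose C k := [set w | x k <= Z w < x k + eta].
have mD' k : measurable_fun (setT : set T') (D k : T' -> R).
  apply: measurable_funD; last exact: mPhi'.
  apply: measurable_funB; last exact: mPhi'.
  by apply: measurable_funB; exact: mPhi'.
have mD k : measurable_fun setT (D k).
  apply: measurable_funD; last exact: mPhi.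
  apply: measurable_funB; last exact: mPhi.
  by apply: measurable_funB; exact: mPhi.
have sE k : <<s halfspaces V >> (E k).
  have : @measurable _ T' (setT `&` [set w | (cst th : T' -> R) w <= (D k : T' -> R) w]).
    by apply: measurable_fun_le.
  by rewrite setTI.
have mE k : measurable (E k) by exact: (halfspaces_measurable Vm).
have mZ : measurable_fun setT Z by exact: (gcomb_measurable hW).
have mC k : measurable (C k).
  rewrite (_ : C k = Z @^-1` `[x k, x k + eta[).
    by rewrite -[X in measurable X]setTI; exact: mZ.
  by apply/seteqP; split => w /=; rewrite in_itv.
have D0 k w : 0 <= D k w.
  have [M hM] := Yb w; exact: (Phi_second_diff hM hnK).
have Dsum w : \sum_(k < m.+1) D k w <= 4 * (K / v) * eta.
  have [M hM] := Yb w; apply: (Phi_second_diff_sum hM hnK); exact: ltW.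
have LD k : L1 Q (D k).
  apply: (@L1_bounded _ _ _ Q _ (4 * (K / v) * eta)) => // w.
  rewrite ger0_norm//.
  have [M hM] := Yb w; have := @Phi_second_diff_sum _ _ _ _ _ hM hnK (x k) eta 1 (ltW eta0).
  by rewrite big_ord_recl big_ord0 mul0r !addr0.
have rv0 : 0 < Num.sqrt v by rewrite sqrtr_gt0.
have QC k : fine (Q (C k)) <= normal_peak 1 / Num.sqrt v * eta.
  have h := gcomb_itv_le hW pz vz (ltW (_ : x k < x k + eta)).
  apply: le_trans (le_trans (h _) _); rewrite ?ltrDl//; last by rewrite addrAC subrr add0r.
  apply: fine_le; rewrite ?fin_num_measure//.
    by rewrite -[X in measurable X]setTI; exact: mZ.
  by apply: le_measure; rewrite ?inE//;
   [rewrite -[X in measurable X]setTI; exact: mZ|move=> w /=; rewrite in_itv/= => /andP[-> /ltW]].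
exists (\big[setU/set0]_(k < m.+1) (E k `&` C k)); split.
- by apply: bigsetU_measurable => k _; exact: measurableI.
- have QEC k : fine (Q (E k `&` C k)) <= Exp Q (D k) / th * (normal_peak 1 / Num.sqrt v * eta).
    rewrite (gcomb_indep hW _ _ pz (sE k)).
    apply: ler_pM; rewrite ?fine_ge0//.
      exact: (Markov_Exp (D0 k) (LD k) th0).
    exact: QC.
  have sub : fine (Q (\big[setU/set0]_(k < m.+1) (E k `&` C k))) <= \sum_(k < m.+1) fine (Q (E k `&` C k)).
    elim: m.+1 => [|m' IH]; first by rewrite !big_ord0 measure0.
    rewrite !big_ord_recr/=; apply: le_trans (lerD IH (lexx _)).
    have mU : measurable (\big[setU/set0]_(i < m') (E i `&` C i)).
      by apply: bigsetU_measurable => j _; exact: measurableI.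
    have mI := measurableI _ _ (mE m') (mC m').
    rewrite -fineD ?fin_num_measure//; apply: fine_le; rewrite ?fin_numD ?fin_num_measure//.
      exact: measurableU.
    exact: measureU2.
  apply: (le_trans sub); apply: (@le_trans _ _ (\sum_(k < m.+1) Exp Q (D k) / th * (normal_peak 1 / Num.sqrt v * eta))).
    by apply: ler_sum => k _; exact: QEC.
  rewrite -!mulr_suml -Exp_sum//.
  have LS : L1 Q (fun w => \sum_(k < m.+1) D k w) by exact: L1_sum.
  have := Exp_le LS (L1_cst Q _) Dsum.
  rewrite Exp_cst => h.
  apply: (@le_trans _ _ (4 * (K / v) * eta / th * (normal_peak 1 / Num.sqrt v * eta))).
    rewrite ler_wpM2r//; first by rewrite mulr_ge0 ?(ltW eta0)// divr_ge0 ?normal_peak_ge0// ltW.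
    by rewrite ler_wpM2r// invr_ge0 ltW.
  rewrite /th /eta le_eqVlt; apply/orP; left; apply/eqP.
  by field; rewrite !gt_eqF//= -natr1 ; rewrite ?pnatr_eq0 ?nat1r ?pnatr_eq0 ?A0.
- move=> w [M [bM hJ]] /andP[ZA AZ].
  pose k := Num.truncn ((Z w + A) / eta).
  have q0 : 0 <= (Z w + A) / eta by rewrite divr_ge0 ?(ltW eta0)//; lra.
  have k1 : k%:R * eta <= Z w + A by rewrite -ler_pdivlMr// truncn_le.
  have k2 : Z w + A < (k%:R + 1) * eta by rewrite -ltr_pdivrMr// natr1 truncnS_gt.
  have km : (k < m.+1)%N.
    rewrite -(ltr_nat R) -(ltr_pM2r eta0); apply: (le_lt_trans k1).
    rewrite /eta mulrCA mulfV ?gt_eqF// mulr1; lra.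
  have Cw : C k w by apply/andP; split; rewrite /x; [lra|move: k2; rewrite mulrDl mul1r; lra].
  rewrite -(bigcup_mkord m.+1 (fun k => E k `&` C k)); exists k => //=; split=> //; rewrite /E /=.
  have e0 : 0 < eta * (c / v) / 4 by rewrite divr_gt0// mulr_gt0.
  have [n [n' [s [s' [s1 s'1 a1 a2 a3]]]]] := hJ _ e0.
  have [My hMy] := Yb w.
  have bE j : Yn j w + hn j * Z w = gcomb W (bs j) w by rewrite YE subrK.
  apply: (@Phi_jump _ (Yn ^~ w) hn My (K / v) hMy hnK M (eta * (c / v) / 4) (c / v) (Z w) (x k) eta s s' n n') => //.
  + by move=> j; rewrite bE.
  + by rewrite bE.
  + by rewrite bE.
  + exact: ltW.
  + by rewrite /hn !mulrA -mulrBl ler_wpM2r// invr_ge0 ltW.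
Qed.

Lemma sup_jump_null c : 0 < c -> exists N : set T, [/\ measurable N, Q N = 0%E & sup_jump c `<=` N].
Proof.
move=> c0.
have j0 (j : nat) : 0 < (j.+1%:R : R) by rewrite ltr0n.
pose N j m := projT1 (cid (sup_jump_cover m c0 (j0 j))).
have hN j m : [/\ measurable (N j m),
    fine (Q (N j m)) <= (16 * j.+1%:R * K * normal_peak 1 / (Num.sqrt v * c)) / m.+1%:R &
    forall w, sup_jump c w -> - j.+1%:R <= Z w < j.+1%:R -> N j m w].
  exact: projT2 (cid (sup_jump_cover m c0 (j0 j))).
have mI j : measurable (\bigcap_m N j m).
  by apply: bigcapT_measurable => m; case: (hN j m).
exists (\bigcup_j \bigcap_m N j m); split.
- exact: bigcupT_measurable.
- apply: null_bigcup => // j; apply/eqP; rewrite eq_le measure_ge0 andbT -[leLHS]fineK ?fin_num_measure// lee_fin.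
  set B := 16 * j.+1%:R * K * normal_peak 1 / (Num.sqrt v * c).
  have c0' : B / m.+1%:R @[m --> \oo] --> (0 : R).
    by rewrite -[X in _ --> X](mulr0 B); apply: cvgMr; exact: cvg_harmonic.
  apply: (cvgr_to_ge c0'); apply: nearW => m; have [mN h _] := hN j m.
  apply: le_trans h; apply: fine_le; rewrite ?fin_num_measure//.
  by apply: le_measure; rewrite ?inE//; exact: bigcap_inf.
- move=> w Jw.
  pose j := Num.truncn `|Z w|.
  have hj : `|Z w| < j.+1%:R by exact: truncnS_gt.
  exists j => // m _; have [_ _ h] := hN j m; apply: h => //.
  by move: hj; rewrite ltr_norml => /andP[/ltW -> ->].
Qed.

End jump_null.

(** * Second differences of powers and the covariance of the bridge *)

Section second_difference.
Context {R : realType}.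
Variable p : R.
Hypothesis p1 : 1 < p.
Hypothesis p2 : p < 2.

(** This is [powR_tangent] for the exponent 1/p, taken at y^p. *)
Lemma powR_bernoulli (y : R) : 0 <= y -> 1 + p * (y - 1) <= y `^ p.
Proof.
have pl := p1; have pu := p2; move=> y0.
have th : 0 < p^-1 < 1 by rewrite invr_gt0 invf_lt1 ?(lt_trans ltr01)// (lt_trans ltr01).
have := @powR_tangent R (y `^ p) p^-1 (powR_ge0 _ _) th.
rewrite -powRrM mulfV ?gt_eqF ?(lt_trans ltr01)// powRr1// => h.
have : p * y <= p * (1 + p^-1 * (y `^ p - 1)) by rewrite ler_wpM2l// ltW// (lt_trans ltr01).
rewrite mulrDr mulrA mulfV ?gt_eqF ?(lt_trans ltr01)//; lra.
Qed.

Definition sdiff (x d : R) : R := `|x + d| `^ p + `|x - d| `^ p - 2 * `|x| `^ p.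

Lemma sdiffN x d : sdiff (- x) d = sdiff x d.
Proof.
rewrite /sdiff normrN -[`|- x + d|]normrN -[`|- x - d|]normrN !opprD !opprK.
by rewrite (addrC (`|x - d| `^ p)).
Qed.

Lemma sdiff_ge0 x d : 0 < x -> 0 <= d -> d <= x -> 0 <= sdiff x d.
Proof.
move=> x0 d0 dx; have a0 : 0 <= x + d by rewrite addr_ge0// ltW.
have a1 : 0 <= x - d by rewrite subr_ge0.
rewrite /sdiff (ger0_norm (ltW x0)) (ger0_norm a0) (ger0_norm a1).
have u0 : 0 <= d / x by rewrite divr_ge0// ltW.
have u1 : d / x <= 1 by rewrite ler_pdivrMr// mul1r.
have -> : x + d = x * (1 + d / x) by field; rewrite gt_eqF.
have -> : x - d = x * (1 - d / x) by field; rewrite gt_eqF.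
have v0 : 0 <= 1 + d / x by rewrite addr_ge0.
have v1 : 0 <= 1 - d / x by rewrite subr_ge0.
rewrite (powRM _ (ltW x0) v0) (powRM _ (ltW x0) v1).
have h1 := @powR_bernoulli (1 + d / x) (addr_ge0 ler01 u0).
have h2 := @powR_bernoulli (1 - d / x) ltac:(by rewrite subr_ge0).
rewrite -mulrDr (mulrC 2) -mulrBr mulr_ge0 ?powR_ge0//; lra.
Qed.

(** After writing y^p as y times y^(p - 1), the tangent bound is applied to the exponent p - 1; the
    first-order terms in d/x cancel between the two sides. *)
Lemma sdiff_le x d : 0 < x -> 0 <= d -> d <= x -> sdiff x d <= 2 * d ^+ 2 * x `^ (p - 2).
Proof.
have pl := p1; have pu := p2.
move=> x0 d0 dx; have a0 : 0 <= x + d by rewrite addr_ge0// ltW.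
have a1 : 0 <= x - d by rewrite subr_ge0.
rewrite /sdiff (ger0_norm (ltW x0)) (ger0_norm a0) (ger0_norm a1).
have u0 : 0 <= d / x by rewrite divr_ge0// ltW.
have u1 : d / x <= 1 by rewrite ler_pdivrMr// mul1r.
have -> : x + d = x * (1 + d / x) by field; rewrite gt_eqF.
have -> : x - d = x * (1 - d / x) by field; rewrite gt_eqF.
have -> : x `^ (p - 2) = x `^ p * (x ^+ 2)^-1.
  by rewrite powR_add// powRN powR_mulrn// ltW.
have v0 : 0 <= 1 + d / x by rewrite addr_ge0.
have v1 : 0 <= 1 - d / x by rewrite subr_ge0.
rewrite (powRM _ (ltW x0) v0) (powRM _ (ltW x0) v1).
set u := d / x in u0 u1 v0 v1 *.
have -> : 2 * d ^+ 2 * (x `^ p * (x ^+ 2)^-1) = x `^ p * (2 * u ^+ 2) by rewrite /u; field; rewrite gt_eqF.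
have e (y : R) : 0 <= y -> y `^ p <= y * (1 + (p - 1) * (y - 1)).
  move=> y0; rewrite -mulr_powRB1 ?(lt_trans ltr01)//.
  rewrite ler_wpM2l//; apply: powR_tangent => //; lra.
have h1 := e (1 + u) (addr_ge0 ler01 u0).
have h2 := e (1 - u) ltac:(by rewrite subr_ge0).
rewrite -mulrDr (mulrC 2 (x `^ p)) -mulrBr ler_wpM2l ?powR_ge0//.
have : (p - 1) * u ^+ 2 <= u ^+ 2 by rewrite ler_piMl ?sqr_ge0//; lra.
nra.
Qed.

(** Close to the singularity the outer terms give at least 2 d^p by Bernoulli's inequality, while
    the central one takes away at most d^p/2. *)
Lemma sdiff_near x d : 0 < d -> `|x| <= d / 4 -> d `^ p <= sdiff x d.
Proof.
have pl := p1; have pu := p2.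
move=> d0 xd; have := xd; rewrite ler_norml => /andP[xl xu].
have s1 : 0 <= x + d by lra.
have s2 : 0 <= d - x by lra.
rewrite /sdiff (ger0_norm s1) (distrC x) (ger0_norm s2).
have q : `|x| `^ p <= d `^ p / 4.
  apply: (@le_trans _ _ ((d / 4) `^ p)).
    by apply: ge0_ler_powR; rewrite ?nnegrE ?divr_ge0 ?(ltW d0)//; lra.
  rewrite powRM ?(ltW d0)// ler_wpM2l ?powR_ge0//.
  rewrite -[leRHS]powRr1//; apply: ger_powR; lra.
have h : 2 * d `^ p <= (x + d) `^ p + (d - x) `^ p.
  have -> : x + d = d * (1 + x / d) by field; rewrite gt_eqF.
  have -> : d - x = d * (1 - x / d) by field; rewrite gt_eqF.
  have u : `|x / d| <= 1 by rewrite normrM (@ger0_norm _ d^-1) ?invr_ge0 ?(ltW d0)// ler_pdivrMr// mul1r; lra.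
  move: u; rewrite ler_norml => /andP[ul uu].
  rewrite !powRM ?(ltW d0)//; [|lra|lra].
  rewrite -mulrDr mulrC ler_wpM2l ?powR_ge0//.
  have h1 := @powR_bernoulli (1 + x / d) ltac:(lra).
  have h2 := @powR_bernoulli (1 - x / d) ltac:(lra).
  lra.
have := powR_ge0 d p; lra.
Qed.

Lemma sdiff_bounded x d : `|x| <= 1 -> `|d| <= 1 -> `|sdiff x d| <= 10.
Proof.
have pl := p1; have pu := p2.
move=> x1 d1.
have b (y : R) : `|y| <= 2 -> 0 <= `|y| `^ p <= 4.
  move=> y2; rewrite powR_ge0/=; apply: (@le_trans _ _ (2 `^ p)).
    by apply: ge0_ler_powR; rewrite ?nnegrE//; lra.
  apply: (@le_trans _ _ (2 `^ 2%:R)); first by apply: ler_powR => //; lra.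
  by rewrite powR_mulrn//; lra.
have c (y : R) : `|y| <= 1 -> 0 <= `|y| `^ p <= 1.
  move=> y1; rewrite powR_ge0/= (_ : 1 = 1 `^ p); last by rewrite powR1.
  by apply: ge0_ler_powR; rewrite ?nnegrE//; lra.
have h1 := b (x + d) ltac:(have := ler_normD x d; lra).
have h2 := b (x - d) ltac:(have := ler_normB x d; lra).
have h3 := c x x1.
rewrite /sdiff ler_norml; apply/andP; lra.
Qed.

End second_difference.

Section bridge_covariance.
Context {R : realType}.
Variable H : R.
Hypothesis Hl : 1 / 2 < H.
Hypothesis Hu : H < 1.
Local Notation sd := (sdiff (2 * H)).

Definition bridge_comb (r : R) : seq (R * R) := [:: (1, r); (- r, 1)].
Definition second_comb (s d : R) : seq (R * R) := [:: (1, s + d); (1, s - d); (- 2, s)].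

(** The covariance of the bridge at [r] with the second difference of the process at [s] with step
    [d], as [gcov_bridge_second] shows. *)
Definition bridge_shift (s d r : R) : R :=
  (sd s d - sd (r - s) d) / 2 - r * ((sd s d - sd (1 - s) d) / 2).

Lemma gcov_bridge_second s d r : 0 <= d -> d <= s -> 0 <= r ->
  gcov H (bridge_comb r) (second_comb s d) = bridge_shift s d r.
Proof.
move=> d0 ds r0; have s0 : 0 <= s by exact: le_trans ds.
rewrite /gcov /bridge_comb /second_comb !big_cons !big_nil /= /fBm_cov /bridge_shift /sdiff.
rewrite (ger0_norm s0) (@ger0_norm _ (s + d)) ?addr_ge0// (@ger0_norm _ (s - d)) ?subr_ge0//.
have e1 t : `|s + d - t| = `|t - s - d| by rewrite distrC opprD addrA.
have e2 t : `|s - d - t| = `|t - s + d| by rewrite distrC opprB addrA addrAC.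
by rewrite !e1 !e2 !(distrC s); field.
Qed.

Lemma gcov_second s d : 0 < d -> d <= s -> 0 < gcov H (second_comb s d) (second_comb s d).
Proof.
have hl := Hl; have hu := Hu.
move=> d0 ds; have s0 : 0 <= s by lra.
have -> : gcov H (second_comb s d) (second_comb s d) = d `^ (2 * H) * (4 - 2 `^ (2 * H)).
  rewrite /gcov /second_comb !big_cons !big_nil /= /fBm_cov.
  have pn : 2 * H != 0 by rewrite gt_eqF//; lra.
  rewrite !subrr !normr0 powR0//.
  have -> : s + d - (s - d) = 2 * d by ring.
  have -> : s - d - (s + d) = - (2 * d) by ring.
  have -> : s + d - s = d by ring.
  have -> : s - (s + d) = - d by ring.
  have -> : s - d - s = - d by ring.
  have -> : s - (s - d) = d by ring.
  rewrite !normrN !ger0_norm ?mulr_ge0 ?(ltW d0)// powRM// ?(ltW d0)//.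
  by field.
rewrite mulr_gt0 ?powR_gt0// subr_gt0.
have -> : (4 : R) = 2 `^ 2%:R by rewrite powR_mulrn//; ring.
by rewrite /powR (gt_eqF (ltr0n _ 2)) ltr_expR ltr_pM2r ?ln_gt0 ?ltr1n//; lra.
Qed.

Lemma bridge_shift_bounded s d r : 0 <= s <= 1 -> 0 <= d <= 1 -> 0 <= r <= 1 -> `|bridge_shift s d r| <= 20.
Proof.
have hl := Hl; have hu := Hu.
move=> s01 d01 r01.
have d1 : `|d| <= 1 by rewrite ler_norml; lra.
have b x : `|x| <= 1 -> `|sd x d| <= 10 by move=> x1; apply: sdiff_bounded => //; lra.
have := b s ltac:(rewrite ler_norml; lra); rewrite ler_norml => h1.
have := b (r - s) ltac:(rewrite ler_norml; lra); rewrite ler_norml => h2.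
have := b (1 - s) ltac:(rewrite ler_norml; lra); rewrite ler_norml => h3.
have h4 : `|r * ((sd s d - sd (1 - s) d) / 2)| <= 10.
  rewrite normrM -[leRHS]mul1r ler_pM//; rewrite ler_norml; lra.
move: h4; rewrite /bridge_shift !ler_norml; lra.
Qed.

(** Near [s] the term in r - s is at least d^(2H), while at arguments of size rho or more a second
    difference lies between 0 and [B]. The smallness of [d] amounts to 8 B < d^(2H), so that the
    covariance near [s] is negative and dominates. *)
Lemma bridge_shift_separates rho s d : 0 < rho -> 0 < d -> d <= rho -> d `^ (2 - 2 * H) < rho `^ (2 - 2 * H) / 16 ->
  rho <= s -> rho <= 1 - s -> exists2 c, 0 < c & forall r r', 0 <= r <= 1 -> 0 <= r' <= 1 ->
  `|r - s| <= d / 4 -> rho <= `|r' - s| -> bridge_shift s d r <= - (`|bridge_shift s d r'| + c).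
Proof.
have hl := Hl; have hu := Hu.
move=> rho0 d0 dr dsm rs r1s.
pose B := 2 * d ^+ 2 * rho `^ (2 * H - 2).
have B0 : 0 <= B by rewrite mulr_ge0 ?powR_ge0// mulr_ge0 ?sqr_ge0.
have sB x : rho <= `|x| -> 0 <= sd x d <= B.
  move=> rx; have -> : sd x d = sd `|x| d.
    by case: (ltrP x 0) => x0; rewrite ?(ltr0_norm x0) ?sdiffN// ger0_norm.
  have x0 : 0 < `|x| by exact: lt_le_trans rx.
  have dx : d <= `|x| by exact: le_trans rx.
  have q1 : 1 < 2 * H by lra.
  have q2 : 2 * H < 2 by lra.
  rewrite (sdiff_ge0 q1 q2 x0 (ltW d0) dx) /=.
  apply: (le_trans (sdiff_le q1 q2 x0 (ltW d0) dx)).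
  have dd : 0 <= 2 * d ^+ 2 by rewrite mulr_ge0 ?sqr_ge0.
  rewrite ler_wpM2l//.
  have -> : 2 * H - 2 = - (2 - 2 * H) by ring.
  rewrite !powRN lef_pV2 ?posrE ?powR_gt0//.
  by apply: ge0_ler_powR; rewrite ?nnegrE ?(ltW rho0)//; lra.
have Bd : 8 * B < d `^ (2 * H).
  have e1 : d `^ (2 * H) = d ^+ 2 / d `^ (2 - 2 * H).
    rewrite -powRN -powR_mulrn ?(ltW d0)// -powRD ?(gt_eqF d0) ?implybT//.
    by congr (_ `^ _); ring.
  have e2 : rho `^ (2 * H - 2) = (rho `^ (2 - 2 * H))^-1.
    by rewrite -powRN; congr (_ `^ _); ring.
  have dp : 0 < d `^ (2 - 2 * H) by rewrite powR_gt0.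
  have rp : 0 < rho `^ (2 - 2 * H) by rewrite powR_gt0.
  rewrite /B e1 e2 (_ : 8 * (2 * d ^+ 2 / rho `^ (2 - 2 * H)) = d ^+ 2 * (16 / rho `^ (2 - 2 * H))); last by ring.
  rewrite ltr_pM2l ?exprn_gt0// -[ltRHS]div1r ltr_pdivlMr// mulrAC ltr_pdivrMr// mul1r.
  lra.
exists ((d `^ (2 * H) - 8 * B) / 2); first lra.
move=> r r' r01 r'01 rsd r'sd.
have h0 := @sdiff_near R (2 * H) ltac:(lra) ltac:(lra) (r - s) d d0 rsd.
have h1 := sB s ltac:(by rewrite ger0_norm ?(le_trans (ltW rho0))).
have h2 := sB (1 - s) ltac:(by rewrite ger0_norm ?(le_trans (ltW rho0))).
have h3 := sB _ r'sd.
have g (a : R) : 0 <= a <= 1 -> `|a * ((sd s d - sd (1 - s) d) / 2)| <= B / 2.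
  move=> a01; rewrite normrM -[leRHS]mul1r ler_pM//; rewrite ler_norml; lra.
have g1 := g r r01; have g2 := g r' r'01.
have h4 : `|bridge_shift s d r'| <= B.
  move: g2; rewrite /bridge_shift !ler_norml; lra.
move: g1; rewrite {1}/bridge_shift ler_norml; lra.
Qed.

(** Both s and d are taken rational, so that countably many null events account for all pairs of
    maximizers. *)
Lemma exists_separation (r r' : R) : 0 < r < 1 -> r != r' ->
  exists i n m : nat, exists2 rho, 0 < rho & let s := i%:R / n.+1%:R in let d := m.+1%:R^-1 in
  [/\ d <= rho, d `^ (2 - 2 * H) < rho `^ (2 - 2 * H) / 16, rho <= s, rho <= 1 - s & `|r - s| < d / 4 /\ rho < `|r' - s|].
Proof.
have hl := Hl; have hu := Hu.
move=> /andP[r0 r1] rr.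
have dr : 0 < `|r - r'| by rewrite normr_gt0 subr_eq0.
pose rho := Num.min (r / 2) (Num.min ((1 - r) / 2) (`|r - r'| / 2)).
have rho0 : 0 < rho by rewrite !lt_min; apply/and3P; split; [lra|lra|rewrite divr_gt0].
have [rl1 [rl2 rl3]] : rho <= r / 2 /\ rho <= (1 - r) / 2 /\ rho <= `|r - r'| / 2.
  by have : rho <= rho := lexx _; rewrite {2}/rho !le_min => /and3P[-> -> ->].
have rp : 0 < rho `^ (2 - 2 * H) by rewrite powR_gt0.
have [d0 d00 hd] := @powR_small R (2 - 2 * H) (rho `^ (2 - 2 * H) / 32) ltac:(lra) ltac:(rewrite divr_gt0//).
have [m hm] := nat_ge (Num.max d0^-1 rho^-1).
pose d : R := m.+1%:R^-1.
have mR : Num.max d0^-1 rho^-1 <= m.+1%:R by apply: (le_trans hm); rewrite ler_nat.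
move: mR; rewrite ge_max => /andP[md0 mrho].
have dd0 : d <= d0 by rewrite /d -[leRHS]invrK lef_pV2 ?posrE ?invr_gt0.
have drho : d <= rho by rewrite /d -[leRHS]invrK lef_pV2 ?posrE ?invr_gt0.
have dp : 0 < d by rewrite invr_gt0.
have [n hn] := nat_ge (8 * d^-1).
have nR : 0 < (n.+1%:R : R) by rewrite ltr0n.
pose i := Num.truncn (r * n.+1%:R).
have i1 : i%:R <= r * n.+1%:R by rewrite truncn_le// mulr_ge0// ltW.
have i2 : r * n.+1%:R < i%:R + 1 by rewrite natr1 truncnS_gt.
have s1 : i%:R / n.+1%:R <= r by rewrite ler_pdivrMr.
have nd : n.+1%:R^-1 < d / 4.
  have h : 8 * d^-1 < n.+1%:R by apply: le_lt_trans hn _; rewrite ltr_nat.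
  have h2 : 8 < n.+1%:R * d by rewrite -ltr_pdivrMr.
  rewrite -div1r ltr_pdivrMr// mulrAC ltr_pdivlMr//.
  lra.
have s2 : r - i%:R / n.+1%:R < d / 4.
  apply: le_lt_trans nd; rewrite lerBlDr -(ler_pM2r nR) mulrDl mulVf ?gt_eqF// divfK ?gt_eqF//; lra.
exists i, n, m, rho => //=; rewrite -/d; set s := i%:R / n.+1%:R in s1 s2 *.
have rs : `|r - s| < d / 4 by rewrite ger0_norm// subr_ge0.
split=> //.
- by have := hd d (ltW dp) dd0; lra.
- lra.
- lra.
- split=> //.
  have := ler_normD (r - s) (s - r'); rewrite (distrC s r') (_ : r - s + _ = r - r'); last by ring.
  lra.
Qed.

End bridge_covariance.

Section unif_cont01.
Context {R : realType}.

Lemma within01_eps (f : R -> R) : {within `[0, 1], continuous f} -> forall x e, 0 <= x <= 1 -> 0 < e ->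
  exists2 d, 0 < d & forall y, 0 <= y <= 1 -> `|x - y| < d -> `|f x - f y| < e.
Proof.
move=> /subspace_continuousP cf x e x01 e0.
have := cf x; rewrite /= in_itv/= => /(_ x01)/cvgrPdist_lt/(_ e e0).
rewrite near_withinE => /nbhs_ballP[d d0 h].
exists d => // y y01 xy; apply: (h y) => //=; rewrite in_itv//.
Qed.

(** Heine-Cantor by a supremum argument: continuity at the supremum [c] of the points up to which
    the claim holds extends it past [c], unless c = 1. *)
Lemma unif_cont01 (f : R -> R) : {within `[0, 1], continuous f} -> forall e, 0 < e ->
  exists2 d, 0 < d & forall s t, 0 <= s <= 1 -> 0 <= t <= 1 -> `|s - t| < d -> `|f s - f t| < e.
Proof.
move=> cf e e0.
pose S : set R := [set b : R | 0 <= b <= 1 /\ exists2 d : R, 0 < d &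
  forall s t, 0 <= s <= b -> 0 <= t <= b -> `|s - t| < d -> `|f s - f t| < e].
have S0 : S 0.
  split; first by rewrite lexx ler01.
  exists 1 => // s t s0 t0 _.
  by have -> : s = t; [apply/eqP; rewrite eq_le; lra|rewrite subrr normr0].
have hS : has_sup S by split; [exists 0|exists 1 => b [/andP[_ ->]]].
pose c := sup S.
have c0 : 0 <= c by apply: (sup_upper_bound hS).
have c1 : c <= 1 by apply: ge_sup; [exists 0|move=> b [/andP[_ ->]]].
have [d d0 hd] := within01_eps cf (ltac:(lra) : 0 <= c <= 1) (ltac:(lra) : 0 < e / 2).
have d20 : 0 < d / 2 by lra.
have [b Sb cb] := sup_adherent d20 hS.
have [b01 [db db0 hb]] := Sb.
pose b' := Num.min 1 (c + d / 2).
have Sb' : S b'.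
  split; first by rewrite /b' le_min ler01 ge_min lexx/=; lra.
  exists (Num.min db (d / 2)); first by rewrite lt_min db0.
  have key s t : 0 <= s <= b' -> 0 <= t <= b' -> `|s - t| < d / 2 -> b < s -> `|f s - f t| < e.
    rewrite /b' !le_min => s' t' st bs.
    have n1 : `|c - s| < d by rewrite ltr_norml; rewrite -/c in cb; lra.
    have n2 : `|c - t| < d by move: st; rewrite !ltr_norml; rewrite -/c in cb; lra.
    have h1 := hd s ltac:(lra) n1; have h2 := hd t ltac:(lra) n2.
    by move: h1 h2; rewrite !ltr_norml; lra.
  move=> s t s' t'; rewrite lt_min => /andP[st1 st2].
  have [sb|bs] := leP s b; last exact: key.
  have [tb|bt] := leP t b; last by rewrite distrC; apply: key => //; rewrite distrC.
  by apply: hb => //; lra.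
have bc : b' <= c by apply: (sup_upper_bound hS).
have b1 : b' = 1.
  have h1 : 1 <= c by move: bc; rewrite /b' ge_min => /orP[//|]; lra.
  by rewrite /b' min_l//; lra.
by have [_ [dd dd0 h]] := Sb'; rewrite b1 in h; exists dd.
Qed.

End unif_cont01.

Section fbm_argmax.
Context {R : realType} {d} {T : measurableType d} (Q : probability T R).
Variables (H : R) (W : R -> T -> R).
Hypothesis hW : is_fBm Q H W.
Hypothesis Hl : 1 / 2 < H.
Hypothesis Hu : H < 1.

Definition bridge (w : R -> R) (t : R) : R := w t - t * w 1.

Definition ratpt (n : nat) : R :=
  if unpickle n is Some (i, k) then Num.min (i%:R / k.+1%:R) 1 else 0.

Lemma ratpt01 n : 0 <= ratpt n <= 1.
Proof.
rewrite /ratpt; case: unpickle => [[i k]|]; last by rewrite lexx ler01.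
by rewrite le_min ler01 divr_ge0//= ge_min lexx orbT.
Qed.

Lemma ratpt_dense (r e : R) : 0 <= r <= 1 -> 0 < e -> exists n, `|r - ratpt n| < e.
Proof.
move=> /andP[r0 r1] e0.
have [k hk] := nat_ge (e^-1).
have kR : 0 < (k.+1%:R : R) by rewrite ltr0n.
pose i := Num.truncn (r * k.+1%:R).
have i1 : i%:R <= r * k.+1%:R by rewrite truncn_le// mulr_ge0// ltW.
have i2 : r * k.+1%:R < i%:R + 1 by rewrite natr1 truncnS_gt.
have s1 : i%:R / k.+1%:R <= r by rewrite ler_pdivrMr.
exists (pickle (i, k)); rewrite /ratpt pickleK min_l; last exact: le_trans r1.
rewrite ger0_norm ?subr_ge0//.
apply: (@lt_le_trans _ _ k.+1%:R^-1).
  by rewrite ltrBlDr -(ltr_pM2r kR) mulrDl mulVf ?gt_eqF// divfK ?gt_eqF// addrC.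
rewrite -[leRHS]invrK lef_pV2 ?posrE ?invr_gt0//; apply: (le_trans hk); rewrite ler_nat//.
Qed.

Lemma gcomb_bridge r w : gcomb W (bridge_comb r) w = bridge (fun t => W t w) r.
Proof. by rewrite /gcomb /bridge_comb !big_cons big_nil /bridge /=; ring. Qed.

Lemma fbm_cont01 w : {within `[0, 1], continuous (fun t => W t w)}.
Proof.
case: hW => h _; apply: continuous_subspaceW (h w).
by move=> t /=; rewrite in_itv/= => /andP[].
Qed.

Lemma bridge_cont w : {within `[0, 1], continuous (bridge (fun t => W t w))}.
Proof.
have c := fbm_cont01 (w := w).
move=> t; apply: cvgB; first exact: c.
apply: cvgM; last exact: cvg_cst.
have ci : {within `[0, 1], continuous (@id R)} by apply: continuous_subspaceT => ?; exact: cvg_id.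
exact: ci.
Qed.

Lemma bridge_abs_cont w : {within `[0, 1], continuous (fun t => `|bridge (fun t => W t w) t|)}.
Proof. by move=> t; apply: cvg_norm; exact: bridge_cont. Qed.

Lemma bridge_bounded w : exists M, forall r, 0 <= r <= 1 -> `|bridge (fun t => W t w) r| <= M.
Proof.
have [c _ hc] := EVT_max (ler01 : (0 : R) <= 1) (bridge_abs_cont (w := w)).
by exists `|bridge (fun t => W t w) c| => r r01; apply: hc; rewrite in_itv.
Qed.

Lemma bridge_approx w (r e e' : R) : 0 <= r <= 1 -> 0 < e -> 0 < e' ->
  exists n, `|r - ratpt n| < e' /\ `|bridge (fun t => W t w) r - bridge (fun t => W t w) (ratpt n)| < e.
Proof.
move=> r01 e0 e'0; have [dl dl0 h] := within01_eps (bridge_cont (w := w)) r01 e0.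
have [n hn] := @ratpt_dense r (Num.min dl e') r01 ltac:(by rewrite lt_min dl0).
move: hn; rewrite lt_min => /andP[h1 h2]; exists n; split=> //; exact: h (ratpt01 n) h1.
Qed.

(** The covariance at [r] is negative and exceeds the one at [r'] in absolute value by at least [c].
    The sign of the bridge at [r] therefore decides which maximizer yields the larger slope.
    Continuity and density replace both by points of the sequence. *)
Lemma argmax_sup_jump w r r' rho s dl c : 0 <= r <= 1 -> 0 <= r' <= 1 -> 0 < rho -> 0 < dl -> dl <= s -> 0 < c ->
  (forall t, 0 <= t <= 1 -> `|bridge (fun t => W t w) t| <= `|bridge (fun t => W t w) r|) ->
  (forall t, 0 <= t <= 1 -> `|bridge (fun t => W t w) t| <= `|bridge (fun t => W t w) r'|) ->
  `|r - s| < dl / 4 -> rho < `|r' - s| ->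
  (forall r r', 0 <= r <= 1 -> 0 <= r' <= 1 -> `|r - s| <= dl / 4 -> rho <= `|r' - s| ->
     bridge_shift H s dl r <= - (`|bridge_shift H s dl r'| + c)) ->
  sup_jump H W (second_comb s dl) (fun n => bridge_comb (ratpt n)) c w.
Proof.
move=> r01 r'01 rho0 dl0 dls c0 hr hr' rs r's sep.
pose B := bridge (fun t => W t w).
have M' : `|B r'| = `|B r| by apply/eqP; rewrite eq_le; apply/andP; split; [exact: hr|exact: hr'].
exists `|B r|; split; first by move=> n; rewrite gcomb_bridge; apply: hr; exact: ratpt01.
move=> e e0.
have [n [n1 n2]] := bridge_approx w r01 e0 (ltac:(lra) : 0 < dl / 4 - `|r - s|).
have [n' [n'1 n'2]] := bridge_approx w r'01 e0 (ltac:(lra) : 0 < `|r' - s| - rho).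
have rn : `|ratpt n - s| <= dl / 4.
  have := ler_normD (ratpt n - r) (r - s); rewrite (_ : ratpt n - r + _ = ratpt n - s) ?(distrC (ratpt n) r); last by ring.
  lra.
have rn' : rho <= `|ratpt n' - s|.
  have := ler_normD (r' - ratpt n') (ratpt n' - s); rewrite (_ : r' - ratpt n' + _ = r' - s); last by ring.
  lra.
have S := sep _ _ (ratpt01 n) (ratpt01 n') rn rn'.
have S' : 0 <= `|bridge_shift H s dl (ratpt n')| by exact: normr_ge0.
have near (x y : R) : `|x - y| < e -> `|x| - e <= Num.sg x * y.
  move=> xy; have : `|Num.sg x * (x - y)| <= `|x - y|.
    by rewrite normrM ler_piMl// normr_sg; case: (x != 0); rewrite ?lexx ?ler01.
  rewrite mulrBr -normrEsg; rewrite ler_norml; move: xy; clear -hW Hl Hu; lra.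
have sg1 (x : R) : `|Num.sg x| <= 1 by rewrite normr_sg; case: (x != 0); rewrite ?lexx ?ler01.
have c1 : forall n, gcov H (bridge_comb (ratpt n)) (second_comb s dl) = bridge_shift H s dl (ratpt n).
  by move=> k; apply: gcov_bridge_second => //; [exact: ltW|have /andP[] := ratpt01 k].
have h1 := near _ _ n2; have h2 := near _ _ n'2.
have bd (a x : R) : `|a| <= 1 -> `|a * x| <= `|x| by move=> a1; rewrite normrM ler_piMl.
have k2 := bd _ (bridge_shift H s dl (ratpt n')) (sg1 (B r')).
have [Bp|Bn] := ltP 0 (B r).
  exists n', n, (Num.sg (B r')), (Num.sg (B r)); split=> //.
  - by rewrite gcomb_bridge -M'.
  - by rewrite gcomb_bridge.
  - rewrite !c1 (gtr0_sg Bp) mul1r.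
    move: k2 S S'; rewrite ler_norml; clear -hW Hl Hu; lra.
(* If the bridge vanishes identically, the weight 0, a subgradient of the absolute value at 0,
   provides the second slope. *)
have [B0|Bn0] := eqVneq (B r) 0.
  exists n', n, 0, 1; rewrite normr0 normr1 ler01 lexx; split=> //.
  - by rewrite -/(B r) B0 normr0 mul0r sub0r oppr_le0 ltW.
  - rewrite gcomb_bridge mul1r -/(B r) B0 normr0.
    move: n2; rewrite -/(B r) B0 sub0r normrN ltr_norml -/(B _) => /andP[/ltW n2 _]; by rewrite sub0r.
  - by rewrite !c1 mul0r mul1r; move: S S'; clear -hW Hl Hu; lra.
have Bn' : B r < 0 by rewrite lt_neqAle Bn0.
exists n, n', (Num.sg (B r)), (Num.sg (B r')); split=> //.
- by rewrite gcomb_bridge.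
- by rewrite gcomb_bridge -M'.
- rewrite !c1 (ltr0_sg Bn') mulN1r.
  move: k2 S S'; rewrite ler_norml; clear -hW Hl Hu; lra.
Qed.

(** Makes the maximum positive, hence attained away from the endpoints, where the bridge vanishes.
    The variance at 1/2 is (1/2)^(2H) - 1/4. *)
Lemma bridge_half_neq0 : exists N : set T, [/\ measurable N, Q N = 0%E &
  forall w, ~ N w -> bridge (fun t => W t w) (1 / 2) != 0].
Proof.
have hl := Hl; have hu := Hu.
have ph : gpos (bridge_comb (1 / 2 : R)) by rewrite /gpos /= ler01 andbT; lra.
have v0 : 0 < gcov H (bridge_comb (1 / 2)) (bridge_comb (1 / 2)).
  rewrite /gcov /bridge_comb !big_cons !big_nil /= /fBm_cov !subrr !normr0 powR1.
  have pn : 2 * H != 0 by rewrite gt_eqF//; lra.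
  rewrite powR0// (distrC 1) (_ : `|1 / 2 - 1| = 1 / 2); last by rewrite ltr0_norm; lra.
  have e : (1 / 2) `^ (2 * H) > 1 / 4 :> R.
    have -> : (1 / 4 : R) = (1 / 2) `^ 2%:R by rewrite powR_mulrn; [field|lra].
    have h2 : (1 / 2 : R) != 0 by rewrite gt_eqF//; lra.
    rewrite /powR (negbTE h2) ltr_expR ltr_nM2r; first lra.
    by rewrite ln_lt0//; lra.
  lra.
exists (gcomb W (bridge_comb (1 / 2)) @^-1` `[0, 0]); split.
- by rewrite -[X in measurable X]setTI; apply: (gcomb_measurable hW ph) => //; exact: measurable_itv.
- have := gcomb_itv_le hW ph v0 (lexx 0); rewrite subrr mulr0 => h.
  have m : measurable (gcomb W (bridge_comb (1 / 2)) @^-1` `[0, 0]).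
    by rewrite -[X in measurable X]setTI; apply: (gcomb_measurable hW ph) => //; exact: measurable_itv.
  apply/eqP; rewrite eq_le measure_ge0 andbT -[leLHS]fineK ?fin_num_measure//.
- move=> w nw; apply/eqP => b0; apply: nw; rewrite /= in_itv/= gcomb_bridge b0 lexx//.
Qed.

(** [is_fBm] fixes the start only through the vanishing variance at time 0, hence almost surely. *)
Lemma fbm0 : exists N : set T, [/\ measurable N, Q N = 0%E & forall w, ~ N w -> W 0 w = 0].
Proof.
have hl := Hl; have hu := Hu.
have p0 : gpos [:: (1, 0) : R * R] by rewrite /gpos /= lexx.
have v0 : gcov H [:: (1, 0)] [:: (1, 0)] = 0.
  have pn : 2 * H != 0 by rewrite gt_eqF//; lra.
  have c00 : fBm_cov H 0 0 = 0 :> R by rewrite /fBm_cov subr0 normr0 powR0//; ring.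
  by rewrite /gcov !big_cons !big_nil /= c00 mulr0 !addr0.
have z := gcomb_null hW p0 v0.
have mz : measurable (gcomb W [:: (1, 0)] @^-1` [set 0]).
  by rewrite -[X in measurable X]setTI; apply: (gcomb_measurable hW p0).
exists (~` (gcomb W [:: (1, 0)] @^-1` [set 0])); split.
- exact: measurableC.
- by rewrite probability_setC// z subee.
- by move=> w /contrapT /=; rewrite /gcomb !big_cons big_nil /= mul1r addr0.
Qed.

Lemma fbm_unique_argmax : exists N : set T, [/\ measurable N, Q N = 0%E &
  forall w, ~ N w -> W 0 w = 0 /\ exists2 xi, 0 < xi < 1 &
    forall t, 0 <= t <= 1 -> t != xi -> `|bridge (fun t => W t w) t| < `|bridge (fun t => W t w) xi|].
Proof.
have hl := Hl; have hu := Hu; have half : 0 <= (1 / 2 : R) <= 1 by lra.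
have [N1 [mN1 QN1 hN1]] := bridge_half_neq0.
have [N2 [mN2 QN2 hN2]] := fbm0.
have ex (k : nat * nat * nat * nat) : exists N : set T, [/\ measurable N, Q N = 0%E &
    let s := k.1.1.1%:R / k.1.1.2.+1%:R in let dl := k.1.2.+1%:R^-1 in let c := k.2.+1%:R^-1 in
    dl <= s -> s <= 1 -> sup_jump H W (second_comb s dl) (fun n => bridge_comb (ratpt n)) c `<=` N].
  set s := k.1.1.1%:R / k.1.1.2.+1%:R; set dl : R := k.1.2.+1%:R^-1; set c : R := k.2.+1%:R^-1.
  have dl0 : 0 < dl by rewrite invr_gt0.
  have [ds|ds] := pselect (dl <= s /\ s <= 1); last first.
    by exists set0; split => //= a b; exfalso; apply: ds.
  have [ds1 ds2] := ds.
  have dl1 : dl <= 1 by rewrite invf_le1// ler1n.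
  have pz : gpos (second_comb s dl).
    by rewrite /gpos /= addr_ge0 ?subr_ge0 ?ds1 ?(ltW dl0) ?(le_trans (ltW dl0))//.
  have vz := gcov_second Hl Hu dl0 ds1.
  have pb n : gpos (bridge_comb (ratpt n)).
    by rewrite /gpos /= ler01 andbT; have /andP[->] := ratpt01 n.
  have bb w : exists M, forall n, `|gcomb W (bridge_comb (ratpt n)) w| <= M.
    have [M hM] := bridge_bounded w; exists M => n; rewrite gcomb_bridge; apply: hM; exact: ratpt01.
  have hK n : `|gcov H (bridge_comb (ratpt n)) (second_comb s dl)| <= 20.
    rewrite gcov_bridge_second ?(ltW dl0)//; last by have /andP[] := ratpt01 n.
    apply: bridge_shift_bounded => //; last exact: ratpt01.
      by rewrite ds2 andbT (le_trans (ltW dl0)).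
    by rewrite dl1 (ltW dl0).
  have c0 : 0 < c by rewrite invr_gt0.
  by have [N [mN QN hN]] := sup_jump_null hW pz vz pb bb hK c0; exists N.
pose F (i : nat) := if unpickle i is Some k then projT1 (cid (ex k)) else set0.
have mF i : measurable (F i).
  by rewrite /F; case: unpickle => [k|]//; case: (projT2 (cid (ex k))).
have QF i : Q (F i) = 0%E.
  by rewrite /F; case: unpickle => [k|]; [case: (projT2 (cid (ex k)))|exact: measure0].
exists (N1 `|` N2 `|` \bigcup_i F i); split.
- by apply: measurableU; [exact: measurableU|exact: bigcupT_measurable].
- have h := null_bigcup mF QF.
  by rewrite measureU0 ?measureU0//; [exact: measurableU|exact: bigcupT_measurable].
move=> w nw.
have n1 : ~ N1 w by move=> h; apply: nw; left; left.
have n2 : ~ N2 w by move=> h; apply: nw; left; right.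
have nF k : ~ projT1 (cid (ex k)) w.
  by move=> h; apply: nw; right; exists (pickle k); [|rewrite /F pickleK].
have W0 := hN2 w n2; have Bh := hN1 w n1; split=> //.
set B := bridge (fun t => W t w) in Bh *.
have [xi xi01 hxi] := EVT_max (ler01 : (0 : R) <= 1) (bridge_abs_cont (w := w)).
move: xi01; rewrite in_itv/= => xi01.
have mx t : 0 <= t <= 1 -> `|B t| <= `|B xi| by move=> t01; apply: hxi; rewrite in_itv.
have B0 : B 0 = 0 by rewrite /B /bridge W0 mul0r subr0.
have B1 : B 1 = 0 by rewrite /B /bridge mul1r subrr.
have Bpos : 0 < `|B xi|.
  by apply: lt_le_trans (mx _ half); rewrite normr_gt0.
have x01 : 0 < xi < 1.
  move: xi01 => /andP[x0 x1]; rewrite !lt_def x0 x1 !andbT; apply/andP; split; apply/eqP => xe.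
    by move: Bpos; rewrite xe B0 normr0 ltxx.
  by move: Bpos; rewrite -xe B1 normr0 ltxx.
exists xi => // t t01 txi; rewrite lt_def mx// andbT; apply/eqP => eB.
have mt u : 0 <= u <= 1 -> `|B u| <= `|B t| by rewrite -eB; exact: mx.
have xt : xi != t by rewrite eq_sym.
have [i [n [m [rho rho0 [q1 q2 q3 q4 [q5 q6]]]]]] := exists_separation Hl Hu x01 xt.
set s := i%:R / n.+1%:R in q3 q4 q5 q6; set dl := m.+1%:R^-1 in q1 q2 q5.
have dl0 : 0 < dl by rewrite invr_gt0.
have [c c0 hc] := bridge_shift_separates Hl Hu rho0 dl0 q1 q2 q3 q4.
have [l hl'] := nat_ge (c^-1).
have cl : l.+1%:R^-1 <= c.
  by rewrite -[leRHS]invrK lef_pV2 ?posrE ?invr_gt0//; apply: (le_trans hl'); rewrite ler_nat.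
have ds : dl <= s by exact: le_trans q1 q3.
have s1 : s <= 1 by rewrite -subr_ge0; apply: le_trans q4; exact: ltW.
apply: (nF (i, n, m, l)).
have [_ _ /=] := projT2 (cid (ex (i, n, m, l))); apply => //.
apply: (@argmax_sup_jump w xi t rho s dl l.+1%:R^-1) => //.
by move=> r r' r01 r'01 a b; apply: (le_trans (hc _ _ r01 r'01 a b)); rewrite lerN2 lerD2l.
Qed.

End fbm_argmax.

(** * Lipschitz envelopes for the Skorokhod distance *)

Section time_changes.
Context {R : realType}.
Implicit Types l x y z : R -> R.

Lemma eps_within01 (f : R -> R) : (forall x e : R, 0 <= x <= 1 -> 0 < e ->
  exists2 d : R, 0 < d & forall y : R, 0 <= y <= 1 -> `|x - y| < d -> `|f x - f y| < e) ->
  {within `[0, 1], continuous f}.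
Proof.
move=> h; apply/subspace_continuousP => x /=; rewrite in_itv/= => x01.
apply/cvgrPdist_lt => e e0; rewrite near_withinE; apply/nbhs_ballP.
have [d d0 hd] := h x e x01 e0; exists d => // y /= xy; rewrite in_itv/= => y01; exact: hd.
Qed.

Lemma time_change_id : time_change (@id R).
Proof. by split; [apply: continuous_subspaceT => ?; exact: cvg_id|split]. Qed.

Lemma time_change_le l s t : time_change l -> 0 <= s -> s <= t -> t <= 1 -> l s <= l t.
Proof.
move=> [_ [h _]] s0; rewrite le_eqVlt => /predU1P[->|st] t1; first by rewrite lexx.
exact/ltW/h.
Qed.

Lemma time_change01 l t : time_change l -> 0 <= t <= 1 -> 0 <= l t <= 1.
Proof.
move=> tl /andP[t0 t1]; have [_ [_ [l0 l1]]] := tl.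
have h1 := time_change_le tl (lexx 0) t0 t1; have h2 := time_change_le tl t0 t1 (lexx 1).
by rewrite l0 in h1; rewrite l1 in h2; rewrite h1 h2.
Qed.

Lemma time_change_lt_inv l s t : time_change l -> 0 <= s <= 1 -> 0 <= t <= 1 -> l s < l t -> s < t.
Proof.
move=> tl /andP[s0 s1] /andP[t0 t1]; rewrite !ltNge; apply: contra => ts.
exact: (time_change_le tl).
Qed.

(** The intermediate value theorem gives the inverse and strict monotonicity its continuity.
    Symmetry of [skor_lt] rests on it. *)
Lemma time_change_inv l : time_change l -> exists l', [/\ time_change l',
  forall t, 0 <= t <= 1 -> l (l' t) = t & forall t, 0 <= t <= 1 -> 0 <= l' t <= 1].
Proof.
move=> tl; have [cl [il [l0 l1]]] := tl.
have ex t : exists s, 0 <= t <= 1 -> 0 <= s <= 1 /\ l s = t.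
  have [t01|nt] := boolP (0 <= t <= 1); last by exists 0.
  have : Num.min (l 0) (l 1) <= t <= Num.max (l 0) (l 1) by rewrite l0 l1 min_l ?max_r.
  move=> /(IVT ler01 cl)[s]; rewrite in_itv/= => s01 ls; by exists s.
pose l' t := projT1 (cid (ex t)).
have hl' t : 0 <= t <= 1 -> 0 <= l' t <= 1 /\ l (l' t) = t by exact: (projT2 (cid (ex t))).
have inc s t : 0 <= s -> s < t -> t <= 1 -> l' s < l' t.
  move=> s0 st t1; have [s01 ls] := hl' s ltac:(lra); have [t01 lt] := hl' t ltac:(lra).
  by apply: (time_change_lt_inv tl) => //; rewrite ls lt.
exists l'; split; [|by move=> t /hl'[]|by move=> t /hl'[]].
split; last first.
  split=> //; split.
    have [s01 ls] := hl' 0 ltac:(lra); apply/eqP; rewrite eq_le; apply/andP; split; last by case/andP: s01.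
    rewrite leNgt; apply/negP => h.
    by have := il 0 (l' 0) (lexx _) h ltac:(lra); rewrite ls l0 ltxx.
  have [s01 ls] := hl' 1 ltac:(lra); apply/eqP; rewrite eq_le; apply/andP; split; first by case/andP: s01.
  rewrite leNgt; apply/negP => h.
  by have := il (l' 1) 1 ltac:(lra) h (lexx _); rewrite ls l1 ltxx.
apply: eps_within01 => x e x01 e0.
have [a01 la] := hl' x x01; set a := l' x in a01 la *.
have [d1 d10 h1] : exists2 d1 : R, 0 < d1 & forall y : R, 0 <= y <= 1 -> y < x + d1 -> l' y < a + e.
  have [ae|ae] := leP (a + e) 1; last first.
    by exists 1 => // y y01 _; have [b01 _] := hl' y y01; lra.
  exists (l (a + e) - x); first by rewrite -la subr_gt0; apply: il; lra.
  move=> y y01; rewrite addrCA subrr addr0 => h; have [b01 lb] := hl' y y01.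
  by apply: (time_change_lt_inv tl) => //; [lra|rewrite lb].
have [d2 d20 h2] : exists2 d2 : R, 0 < d2 & forall y : R, 0 <= y <= 1 -> x - d2 < y -> a - e < l' y.
  have [ae|ae] := leP 0 (a - e); last first.
    by exists 1 => // y y01 _; have [b01 _] := hl' y y01; lra.
  exists (x - l (a - e)); first by rewrite -la subr_gt0; apply: il; lra.
  move=> y y01; rewrite opprB addrCA subrr addr0 => h; have [b01 lb] := hl' y y01.
  by apply: (time_change_lt_inv tl) => //; [lra|rewrite lb].
exists (Num.min d1 d2); first by rewrite lt_min d10.
move=> y y01; rewrite lt_min !ltr_norml => /andP[k1 k2].
have := h1 y y01 ltac:(lra); have := h2 y y01 ltac:(lra); lra.
Qed.

Lemma time_change_comp l m : time_change l -> time_change m -> time_change (m \o l).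
Proof.
move=> tl tm; have [cl [il [l0 l1]]] := tl; have [cm [im [m0 m1]]] := tm.
split; last first.
  split; last by rewrite /= l0 l1 m0 m1.
  move=> s t s0 st t1 /=; have l01 := time_change01 tl.
  apply: im; [by have /andP[] := l01 s ltac:(lra)|exact: il|by have /andP[] := l01 t ltac:(lra)].
apply: eps_within01 => x e x01 e0.
have [d d0 hd] := within01_eps cm (time_change01 tl x01) e0.
have [d' d'0 hd'] := within01_eps cl x01 d0.
exists d' => // y y01 xy; apply: hd; [exact: time_change01|exact: hd'].
Qed.

Lemma skor_lt_sup x y d d' : d' < d -> 0 <= d' -> (forall t, 0 <= t <= 1 -> `|x t - y t| <= d') -> skor_lt x y d.
Proof.
move=> dd d0 h; exists id; split; first exact: time_change_id.
by exists d' => // t t01; rewrite subrr normr0; split=> //; exact: h.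
Qed.

Lemma skor_lt_refl x d : 0 < d -> skor_lt x x d.
Proof. by move=> d0; apply: (skor_lt_sup d0 (lexx _)) => t _; rewrite subrr normr0. Qed.

Lemma skor_lt_gt0 x y d : skor_lt x y d -> 0 < d.
Proof.
move=> [l [_ [d' dd h]]]; apply: le_lt_trans dd.
by have [/(le_trans (normr_ge0 _))] := h 0 ltac:(lra).
Qed.

Lemma skor_lt_sym x y d : skor_lt x y d -> skor_lt y x d.
Proof.
move=> [l [tl [d' dd h]]]; have [l' [tl' ll' l'01]] := time_change_inv tl.
exists l'; split=> //; exists d' => // t t01.
by have [] := h (l' t) (l'01 t t01); rewrite ll'// (distrC t) (distrC (x _)).
Qed.

Lemma skor_lt_trans x y z d1 d2 : skor_lt x y d1 -> skor_lt y z d2 -> skor_lt x z (d1 + d2).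
Proof.
move=> [l [tl [d1' dd1 h1]]] [m [tm [d2' dd2 h2]]].
exists (m \o l); split; first exact: time_change_comp.
exists (d1' + d2'); first exact: ltrD.
move=> t t01 /=; have [a1 a2] := h1 t t01; have [b1 b2] := h2 (l t) (time_change01 tl t01); split.
  by rewrite (addrC d1') (_ : m (l t) - t = (m (l t) - l t) + (l t - t)) ?(le_trans (ler_normD _ _)) ?lerD//; ring.
by rewrite (_ : x t - _ = (x t - y (l t)) + (y (l t) - z (m (l t)))) ?(le_trans (ler_normD _ _)) ?lerD//; ring.
Qed.

(** Uniform continuity of [x] absorbs the change of time, so that Skorokhod closeness becomes
    closeness in the sup norm. *)
Lemma skor_lt_cont x e : {within `[0, 1], continuous x} -> 0 < e ->
  exists2 d0, 0 < d0 & forall y d, d <= d0 -> skor_lt x y d -> forall t, 0 <= t <= 1 -> `|x t - y t| <= e.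
Proof.
move=> cx e0; have [dl dl0 hdl] := unif_cont01 cx (ltac:(lra) : 0 < e / 2).
exists (Num.min dl (e / 2)); first by rewrite lt_min dl0; lra.
move=> y d; rewrite le_min => /andP[ddl de] [l [tl [d' dd h]]] t t01.
have [l' [tl' ll' l'01]] := time_change_inv tl.
have [h1 h2] := h (l' t) (l'01 t t01); rewrite ll'// in h1 h2.
have h3 := hdl t (l' t) t01 (l'01 t t01) ltac:(lra).
rewrite (_ : x t - y t = (x t - x (l' t)) + (x (l' t) - y t)); last by ring.
apply: (le_trans (ler_normD _ _)); lra.
Qed.

End time_changes.

Section envelope.
Context {R : realType}.
Variables (Val : nat -> nat -> (R -> R) -> R -> Prop) (M : R).
Hypothesis VM : forall K n y v, Val K n y v -> `|v| <= M.
Hypothesis M0 : 0 <= M.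
Implicit Types x y : R -> R.

(** The value -M keeps the set nonempty when no path is admissible. *)
Let cand (K : nat) x : set R := [set r | r = - M \/ exists n y v d,
  [/\ (K <= n)%N, Val K n y v, skor_lt x y d & r = v - K%:R * d]].

Definition skor_env (K : nat) x : R := sup (cand K x).

Let cand_le K x r : cand K x r -> r <= M.
Proof.
have m0 := M0; move=> [->|[n [y [v [d [_ hv /skor_lt_gt0 d0 ->]]]]]]; first lra.
have := VM hv; rewrite ler_norml => /andP[_ vM].
have : 0 <= K%:R * d by rewrite mulr_ge0// ltW.
lra.
Qed.

Let cand_sup K x : has_sup (cand K x).
Proof. by split; [exists (- M); left|exists M => r /cand_le]. Qed.

Lemma skor_env_bound K x : `|skor_env K x| <= M.
Proof.
rewrite ler_norml; apply/andP; split; first by apply: (sup_upper_bound (cand_sup K x)); left.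
by apply: ge_sup; [exists (- M); left|move=> r /cand_le].
Qed.

Lemma skor_env_ge K n x y v d : (K <= n)%N -> Val K n y v -> skor_lt x y d -> v - K%:R * d <= skor_env K x.
Proof.
by move=> Kn hv xy; apply: (sup_upper_bound (cand_sup K x)); right; exists n, y, v, d.
Qed.

(** As [skor_lt] forces d > 0, the path itself is used at an arbitrarily small positive distance. *)
Lemma skor_env_ge_val K n x v : (K <= n)%N -> Val K n x v -> v <= skor_env K x.
Proof.
move=> Kn hv; apply/ler_addgt0Pr => e e0.
have dl : 0 < e / K.+1%:R by rewrite divr_gt0.
have := skor_env_ge Kn hv (skor_lt_refl x dl).
have : K%:R * (e / K.+1%:R) <= e by rewrite mulrCA ger_pMr// ler_pdivrMr// mul1r ler_nat.
set q := e / _; clearbody q; lra.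
Qed.

Lemma skor_env_le K x B : - M <= B ->
  (forall n y v d, (K <= n)%N -> Val K n y v -> skor_lt x y d -> v - K%:R * d <= B) -> skor_env K x <= B.
Proof.
move=> MB h; apply: ge_sup; first by exists (- M); left.
by move=> r [->//|[n [y [v [d [Kn hv xy ->]]]]]]; exact: (h _ _ _ _ Kn hv xy).
Qed.

(** By symmetry and the triangle inequality, a candidate at distance dz from one point is at
    distance d + dz from the other. *)
Lemma skor_env_lip K x y d : skor_lt x y d -> `|skor_env K x - skor_env K y| <= K%:R * d.
Proof.
have gen x' y' : skor_lt x' y' d -> skor_env K x' <= skor_env K y' + K%:R * d.
  move=> xy; have d0 := skor_lt_gt0 xy.
  apply: skor_env_le.
    have := skor_env_bound K y'; rewrite ler_norml => /andP[h _].
    have : 0 <= K%:R * d by rewrite mulr_ge0// ltW.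
    lra.
  move=> n z v dz Kn hv xz.
  have := skor_env_ge Kn hv (skor_lt_trans (skor_lt_sym xy) xz); rewrite mulrDr; lra.
move=> xy; have := gen _ _ xy; have := gen _ _ (skor_lt_sym xy); rewrite ler_norml; lra.
Qed.

Lemma skor_env_sup_lip K x y d : 0 <= d -> (forall t, 0 <= t <= 1 -> `|x t - y t| <= d) ->
  `|skor_env K x - skor_env K y| <= K%:R * d.
Proof.
move=> d0 h; apply/ler_addgt0Pr => e e0.
have dl : d < d + e / K.+1%:R by rewrite ltrDl divr_gt0.
have := skor_env_lip K (skor_lt_sup dl d0 h).
have : K%:R * (e / K.+1%:R) <= e by rewrite mulrCA ger_pMr// ler_pdivrMr// mul1r ler_nat.
rewrite mulrDr; set q := e / _; clearbody q; lra.
Qed.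

Lemma skor_env_continuous K : D_bounded_continuous (skor_env K).
Proof.
split; first by exists M => x _; exact: skor_env_bound.
move=> x _ e e0; exists (e / K.+1%:R); first by rewrite divr_gt0.
move=> y _ xy; apply: (le_lt_trans (skor_env_lip K xy)).
by rewrite mulrCA gtr_pMr// ltr_pdivrMr// mul1r ltr_nat.
Qed.

End envelope.

(** * From envelopes to convergence of expectations *)

Section lipschitz_coords.
Context {R : realType} {d} {T : measurableType d}.

(** Rounding the coordinates to multiples of 1/(k + 1) gives a function constant on countably many
    measurable cells, and the Lipschitz bound lets k grow. This suits an [F] defined as a supremum
    over paths. *)
Lemma lip_coords_measurable (m : nat) (F : (nat -> R) -> R) (C : R) (c : nat -> T -> R) :
  (forall i, measurable_fun setT (c i)) ->
  (forall a b dl, 0 <= dl -> (forall i, (i < m)%N -> `|a i - b i| <= dl) -> `|F a - F b| <= C * dl) ->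
  measurable_fun setT (fun w => F (c ^~ w)).
Proof.
move=> mc lF.
have rnd (k : nat) (x : R) : `|(Num.floor (x * k.+1%:R))%:~R / k.+1%:R - x| <= k.+1%:R^-1.
  have k0 : 0 < (k.+1%:R : R) by rewrite ltr0n.
  have f1 := floor_le_tmp (x * k.+1%:R).
  have f2 := floorD1_gt (x * k.+1%:R).
  rewrite distrC ger0_norm; last by rewrite subr_ge0 ler_pdivrMr.
  rewrite lerBlDr -(ler_pM2r k0) mulrDl mulVf ?gt_eqF// divfK ?gt_eqF//.
  by move: f2; rewrite intrD; lra.
pose G k w := F (fun i => (Num.floor (c i w * k.+1%:R))%:~R / k.+1%:R).
have cG w : G k w @[k --> \oo] --> F (c ^~ w).
  apply/cvgrPdist_le => e e0.
  have hC : (0 : R) <= `|C| by exact: normr_ge0.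
  near=> k.
  have h := lF (fun i => (Num.floor (c i w * k.+1%:R))%:~R / k.+1%:R) (c ^~ w) k.+1%:R^-1
    ltac:(by rewrite invr_ge0) (fun i _ => rnd k (c i w)).
  rewrite distrC; apply: (le_trans h).
  apply: (@le_trans _ _ (`|C| * k.+1%:R^-1)); first by rewrite ler_wpM2r ?invr_ge0// ler_norm.
  rewrite ler_pdivrMr// -ler_pdivrMl//.
  apply: (@le_trans _ _ k%:R); last by rewrite ler_nat.
  by near: k; exact: nbhs_infty_ger.
apply: (measurable_fun_cvg (h := G)); last by move=> w _; exact: cG.
move=> k _ B mB; rewrite setTI.
pose val (u : m.-tuple int) := F (fun i => (nth 0 u i)%:~R / k.+1%:R).
pose cell (u : m.-tuple int) := [set w | forall i, (i < m)%N -> Num.floor (c i w * k.+1%:R) = nth 0 u i].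
have valE u w : cell u w -> G k w = val u.
  move=> hu; apply/eqP; rewrite -subr_eq0 -normr_le0.
  have := lF (fun i => (Num.floor (c i w * k.+1%:R))%:~R / k.+1%:R) (fun i => (nth 0 u i)%:~R / k.+1%:R) 0 (lexx _).
  by rewrite mulr0; apply => i im; rewrite hu// subrr normr0.
have mcell u : measurable (cell u).
  have -> : cell u = \bigcap_(i in [set i | (i < m)%N]) [set w | Num.floor (c i w * k.+1%:R) = nth 0 u i].
    by apply/seteqP; split => w h i; exact: h.
  apply: bigcap_measurableType.
  move=> i _.
  have -> : [set w | Num.floor (c i w * k.+1%:R) = nth 0 u i] =
      (fun w => c i w * k.+1%:R) @^-1` `[(nth 0 u i)%:~R, (nth 0 u i + 1)%:~R[.
    apply/seteqP; split => w /=; rewrite in_itv/=.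
      by move=> <-; rewrite floor_le_tmp floorD1_gt.
    by move=> h; apply/floor_def.
  rewrite -[X in measurable X]setTI.
  have mi : measurable_fun setT (fun w => c i w * k.+1%:R) by apply: measurable_funM.
  by apply: mi => //; exact: measurable_itv.
have -> : G k @^-1` B = \bigcup_j (if unpickle j is Some u then [set w | B (val u) /\ cell u w] else set0).
  apply/seteqP; split => w /=.
    move=> Bw.
    have hc : cell [tuple Num.floor (c i w * k.+1%:R) | i < m] w.
      by move=> i im; rewrite -(tnth_nth 0 _ (Ordinal im)) tnth_mktuple.
    exists (pickle [tuple Num.floor (c i w * k.+1%:R) | i < m]) => //; rewrite pickleK /=.
    by split=> //; rewrite -(valE _ _ hc).
  by move=> [j _]; case: unpickle => [u|//] /= [Bu hu]; rewrite (valE _ _ hu).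
apply: bigcupT_measurable => j; case: unpickle => [u|//].
have [Bu|nB] := pselect (B (val u)).
  by rewrite (_ : [set w | _] = cell u)//; apply/seteqP; split => w //= [].
by rewrite (_ : [set w | _] = set0)//; apply/seteqP; split => w //= [].
Unshelve. all: by end_near. Qed.

End lipschitz_coords.

Section exp_negation.
Context {R : realType} {d} {T : measurableType d} (P : probability T R).

Lemma ExpN_bounded (f : T -> R) (M : R) : (forall w, `|f w| <= M) -> Exp P (fun w => - f w) = - Exp P f.
Proof.
move=> fM; have M0 (w : T) : 0 <= M by exact: le_trans (normr_ge0 _) (fM w).
have fin (g : T -> \bar R) : (forall w, 0 <= g w)%E -> (forall w, g w <= M%:E)%E -> (\int[P]_w g w)%E \is a fin_num.
  move=> g0 gM; rewrite ge0_fin_numE; last exact: integral_ge0.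
  apply: (@le_lt_trans _ _ (\int[P]_w (cst M%:E) w)%E); last first.
    by rewrite integral_cst// measure_setT1 mule1 ltry.
  apply: (@ge0_le_integral_off _ _ _ P _ _ set0).
  - exact: g0.
  - by move=> w; rewrite lee_fin (M0 w).
  - exact: measurable0.
  - exact: measure0.
  - by move=> w _; exact: gM.
rewrite !Exp_Rintegral /Rintegral -fineN; congr fine.
have := @integralN _ _ _ P setT (EFin \o f); rewrite /comp => <-.
  by apply: eq_integral => w _.
apply: fin_num_adde_defl; rewrite fin_numN; apply: fin => w //.
rewrite funenegE ge_max /= !lee_fin (M0 w) andbT.
by have := fM w; rewrite ler_norml => /andP[]; rewrite lerNl.
Qed.

End exp_negation.

Section functional_limit.
Context {R : realType} {d} {T : measurableType d} (P : probability T R)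
  {d'} {T' : measurableType d'} (Q : probability T' R).
Variables (Z : nat -> T -> R -> R) (G : T' -> R -> R) (M : R).
Hypothesis M0 : 0 <= M.
Hypothesis ZG : forall F : (R -> R) -> R, D_bounded_continuous F ->
  (fun n => Exp P (fun w => F (Z n w))) @ \oo --> Exp Q (fun w => F (G w)).
Hypothesis mZ : forall n (F : (R -> R) -> R) (C : R),
  (forall x y dl, 0 <= dl -> (forall t, 0 <= t <= 1 -> `|x t - y t| <= dl) -> `|F x - F y| <= C * dl) ->
  measurable_fun setT (fun w => F (Z n w)).
Hypothesis mG : forall (F : (R -> R) -> R) (C : R),
  (forall x y dl, 0 <= dl -> (forall t, 0 <= t <= 1 -> `|x t - y t| <= dl) -> `|F x - F y| <= C * dl) ->
  measurable_fun setT (fun w => F (G w)).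

(** Off a rare event, which costs 2 M times its probability, f is below the envelope at Z. The
    envelope is a bounded continuous test function, so for fixed K its expectation passes to the
    limit process; K is chosen beforehand so large that this expectation is close to that of h. *)
Lemma functional_limit_le (Val : nat -> nat -> (R -> R) -> R -> Prop) (f : nat -> T -> R) (h : T' -> R) (N : set T') :
  (forall K n y v, Val K n y v -> `|v| <= M) ->
  (forall n w, `|f n w| <= M) -> (forall w, `|h w| <= M) ->
  (forall K e, (0 < K)%N -> 0 < e -> exists n0, forall n, (n0 <= n)%N -> exists E : set T,
     [/\ measurable E, fine (P (~` E)) <= e & forall w, E w -> Val K n (Z n w) (f n w)]) ->
  measurable N -> Q N = 0%E ->
  (forall w, ~ N w -> (fun K => skor_env Val M K (G w)) @ \oo --> h w) ->
  forall e, 0 < e -> exists n0, forall n, (n0 <= n)%N -> Exp P (f n) <= Exp Q h + e.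
Proof.
have m0 := M0; move=> VM fM hM hE mN N0 hN e e0.
have lipE K := skor_env_sup_lip VM M0 K.
have mE K n := @mZ n _ _ (@lipE K).
have mEG K := @mG _ _ (@lipE K).
have bE K := skor_env_bound VM M0 K.
(* Multiplication by this indicator turns convergence off [N] into convergence everywhere, as
   [Exp_cvg] demands. *)
pose i := (\1_(~` N) : T' -> R).
have i1 w : `|i w| <= 1 by rewrite /i indicE; case: (_ \in _); rewrite /= ?normr1 ?normr0.
have [_ c1] := @Exp_cvg _ _ _ Q (fun K w => skor_env Val M K (G w) * i w) (fun w => h w * i w) (fun=> M)
  (fun K => measurable_funM (mEG K) (measurable_indic (measurableC mN))) (L1_cst _ _)
  (fun K w => ltac:(by rewrite normrM -[leRHS]mulr1 ler_pM))
  (fun w => ltac:(rewrite /i indicE; have [/mem_set ww|nw] := pselect (N w);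
     [rewrite in_setC ww /= mulr0; under eq_fun do rewrite mulr0; exact: cvg_cst
     |rewrite in_setC (memNset nw) /= mulr1; under eq_fun do rewrite mulr1; exact: hN])).
have e1 : Exp Q (fun w => h w * i w) = Exp Q h.
  apply: (@Exp_eq_off _ _ _ Q _ _ M N) => //.
    by move=> w; rewrite normrM -[leRHS]mulr1 ler_pM.
  by move=> w nw; rewrite /i indicE in_setC (memNset nw) mulr1.
have e2 K : Exp Q (fun w => skor_env Val M K (G w) * i w) = Exp Q (fun w => skor_env Val M K (G w)).
  apply: (@Exp_eq_off _ _ _ Q _ _ M N) => //.
    by move=> w; rewrite normrM -[leRHS]mulr1 ler_pM.
  by move=> w nw; rewrite /i indicE in_setC (memNset nw) mulr1.
rewrite e1 in c1.
have [K K0 hK] : exists2 K, (0 < K)%N & Exp Q (fun w => skor_env Val M K (G w)) <= Exp Q h + e / 4.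
  have lt4 : Exp Q h < Exp Q h + e / 4 by lra.
  by have [K _ /(_ K.+1 (leqnSn _))] := cvgr_le _ c1 _ lt4; rewrite /= e2; exists K.+1.
have lt4 : Exp Q (fun w => skor_env Val M K (G w)) < Exp Q (fun w => skor_env Val M K (G w)) + e / 4 by lra.
have cE : D_bounded_continuous (skor_env Val M K) by apply: skor_env_continuous.
have [n1 _ hn1] := cvgr_le _ (ZG cE) _ lt4.
have M1 : 0 < 8 * (M + 1) by lra.
have [n2 hn2] := hE K (e / (8 * (M + 1))) K0 (divr_gt0 e0 M1).
exists (maxn K (maxn n1 n2)) => n; rewrite !geq_max => /and3P[nK nn1 nn2].
have [E [mEE PE hEv]] := hn2 n nn2.
have mC := measurableC mEE.
have lE : L1 P (fun w => skor_env Val M K (Z n w)) by apply: (@L1_bounded _ _ _ P _ M) => //; exact: mE.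
have li : L1 P (fun w => 2 * M * \1_(~` E) w) by apply: L1Z; exact: L1_indic.
have s1 : Exp P (f n) <= Exp P (fun w => skor_env Val M K (Z n w) + 2 * M * \1_(~` E) w).
  apply: (@Exp_le_off _ _ _ P _ _ (3 * M) set0) => //.
  - by move=> w; apply: (le_trans (fM n w)); lra.
  - move=> w; apply: (le_trans (ler_normD _ _)); rewrite normrM (@ger0_norm _ (2 * M)) ?mulr_ge0//.
    have : `|\1_(~` E) w| <= (1 : R) by rewrite indicE; case: (_ \in _); rewrite /= ?normr1 ?normr0.
    move=> /(ler_wpM2l (mulr_ge0 (ler0n R 2) M0)); have := bE K (Z n w); lra.
  - move=> w _; rewrite indicE; have [Ew|nE] := pselect (E w).
      rewrite in_setC (mem_set Ew) /= mulr0 addr0.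
      exact: (skor_env_ge_val VM M0 nK (hEv w Ew)).
    rewrite in_setC (memNset nE) /= mulr1.
    have := bE K (Z n w); have := fM n w; rewrite !ler_norml; lra.
have s2 : Exp P (fun w => skor_env Val M K (Z n w) + 2 * M * \1_(~` E) w) =
    Exp P (fun w => skor_env Val M K (Z n w)) + 2 * M * fine (P (~` E)).
  by rewrite ExpD// ExpZ ?Exp_indic//; exact: L1_indic.
have s3 : 2 * M * fine (P (~` E)) <= e / 4.
  apply: (@le_trans _ _ (2 * M * (e / (8 * (M + 1))))); first by rewrite ler_wpM2l// mulr_ge0.
  rewrite mulrA ler_pdivrMr// (_ : e / 4 * _ = 2 * e * (M + 1)); last by field.
  have := mulr_ge0 M0 (ltW e0); lra.
have := hn1 n nn1 => /=; lra.
Qed.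

Lemma functional_limit_cvg (Val : nat -> nat -> (R -> R) -> R -> Prop) (f : nat -> T -> R) (h : T' -> R) (N : set T')
    (NVal := fun K n y v => Val K n y (- v)) :
  (forall K n y v, Val K n y v -> `|v| <= M) ->
  (forall n w, `|f n w| <= M) -> (forall w, `|h w| <= M) ->
  (forall K e, (0 < K)%N -> 0 < e -> exists n0, forall n, (n0 <= n)%N -> exists E : set T,
     [/\ measurable E, fine (P (~` E)) <= e & forall w, E w -> Val K n (Z n w) (f n w)]) ->
  measurable N -> Q N = 0%E ->
  (forall w, ~ N w -> (fun K => skor_env Val M K (G w)) @ \oo --> h w) ->
  (forall w, ~ N w -> (fun K => skor_env NVal M K (G w)) @ \oo --> - h w) ->
  (fun n => Exp P (f n)) @ \oo --> Exp Q h.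
Proof.
move=> VM fM hM hE mN N0 hN1 hN2.
apply/cvgrPdist_le => e e0.
have [n1 hn1] := functional_limit_le VM fM hM hE mN N0 hN1 e0.
have [||||n2 hn2] := @functional_limit_le NVal (fun n w => - f n w) (fun w => - h w) N _ _ _ _ mN N0 hN2 e e0.
- by move=> K n y v /VM; rewrite normrN.
- by move=> n w; rewrite normrN.
- by move=> w; rewrite normrN.
- move=> K e' K0 /(hE K _ K0)[n0 h0]; exists n0 => n /h0[E [mE PE hv]]; exists E; split=> // w Ew.
  by rewrite /NVal opprK; exact: hv.
exists (maxn n1 n2) => // n /=; rewrite geq_max => /andP[/hn1 h1 /hn2].
rewrite (ExpN_bounded P (fM n)) (ExpN_bounded Q hM) ler_norml; lra.
Qed.

End functional_limit.

(** * Segment statistics as functionals of the path *)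

Section segment_statistics.
Context {R : realType}.
Implicit Types (x y : R -> R) (n a L : nat).

Definition seg_dev y n a L j : R :=
  `|y ((a + j)%:R / n%:R) - y (a%:R / n%:R) - j%:R / L%:R * (y ((a + L)%:R / n%:R) - y (a%:R / n%:R))|.

Definition seg_max y n a L : R := \big[Num.max/0]_(1 <= j < L.+1) seg_dev y n a L j.

Definition seg_fun x (al be s : R) : R := `|x (al + s * (be - al)) - x al - s * (x be - x al)|.

(* The segment [al, be] is parametrized by s in [0, 1], which keeps the index
   set of the supremum fixed when al and be vary. *)
Definition seg_sup x (al be : R) : R := sup [set seg_fun x al be s | s in `[0, 1]].

Lemma seg_max_ge y n a L j : (j <= L)%N -> seg_dev y n a L j <= seg_max y n a L.
Proof.
move=> jL; have m0 : 0 <= seg_max y n a L by exact: bigmax_ge_id.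
case: j jL => [|j] jL.
  by rewrite /seg_dev addn0 subrr !mul0r subr0 normr0.
by apply: le_bigmax_seq => //; rewrite mem_index_iota.
Qed.

Lemma seg_max_le y n a L B : 0 <= B -> (forall j, (j <= L)%N -> seg_dev y n a L j <= B) -> seg_max y n a L <= B.
Proof.
by move=> B0 h; rewrite /seg_max big_nat; apply: bigmax_le => // j; rewrite ltnS => /andP[_]; exact: h.
Qed.

Variables (x : R -> R) (Mx : R).
Hypothesis xM : forall t, 0 <= t <= 1 -> `|x t| <= Mx.

Let conv01 (al be s : R) : 0 <= al <= 1 -> 0 <= be <= 1 -> 0 <= s <= 1 -> 0 <= al + s * (be - al) <= 1.
Proof.
move=> al01 be01 s01.
have -> : al + s * (be - al) = (1 - s) * al + s * be by ring.
have h1 : 0 <= (1 - s) * al by rewrite mulr_ge0; lra.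
have h2 : 0 <= s * be by rewrite mulr_ge0; lra.
have h3 : (1 - s) * al <= 1 - s by rewrite ler_piMr; lra.
have h4 : s * be <= s by rewrite ler_piMr; lra.
lra.
Qed.

Lemma seg_fun_le al be s : 0 <= al <= 1 -> 0 <= be <= 1 -> 0 <= s <= 1 -> seg_fun x al be s <= 4 * Mx.
Proof.
move=> al01 be01 s01.
have h1 := xM (conv01 al01 be01 s01); have h2 := xM al01; have h3 := xM be01.
have M0 : 0 <= Mx by exact: le_trans h2.
apply: (le_trans (ler_normB _ _)); rewrite normrM.
have h4 : `|s| * `|x be - x al| <= `|x be - x al| by rewrite ler_piMl// ger0_norm; lra.
have := ler_normB (x be) (x al); have := ler_normB (x (al + s * (be - al))) (x al).
lra.
Qed.

Lemma seg_sup_has al be : 0 <= al <= 1 -> 0 <= be <= 1 -> has_sup [set seg_fun x al be s | s in `[0, 1]].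
Proof.
move=> al01 be01; split; first by exists (seg_fun x al be 0), 0 => //=; rewrite in_itv/= lexx ler01.
by exists (4 * Mx) => r [s + <-]; rewrite /= in_itv/= => s01; exact: seg_fun_le.
Qed.

(** Four evaluations of y against x give 4 (et + om). Passing from the grid values j/L to all s
    costs [om] for the path and 2 Mx/L for the linear correction. *)
Lemma seg_close y n a L (al be et om rho th : R) : (0 < n)%N -> (0 < L)%N -> (a + L <= n)%N ->
  0 <= al <= 1 -> 0 <= be <= 1 ->
  (forall t, 0 <= t <= 1 -> `|x t - y t| <= et) ->
  (forall s t, 0 <= s <= 1 -> 0 <= t <= 1 -> `|s - t| < rho -> `|x s - x t| < om) ->
  `|a%:R / n%:R - al| <= th -> `|(a + L)%:R / n%:R - be| <= th -> th < rho -> L%:R^-1 < rho ->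
  `|seg_max y n a L - seg_sup x al be| <= 4 * (et + om) + om + 2 * Mx / L%:R.
Proof.
move=> n0 L0 aLn al01 be01 xy om_ ath bth thr Lr.
have nR : 0 < (n%:R : R) by rewrite ltr0n.
have LR : 0 < (L%:R : R) by rewrite ltr0n.
have hs := seg_sup_has al01 be01.
have p01 k : (k <= n)%N -> 0 <= (k%:R : R) / n%:R <= 1.
  by move=> kn; rewrite divr_ge0//= ler_pdivrMr// mul1r ler_nat.
have et0 : 0 <= et by exact: le_trans (normr_ge0 _) (xy 0 ltac:(lra)).
have rho0 : 0 < rho by have := normr_ge0 (a%:R / n%:R - al); lra.
have om0 : 0 < om by have := om_ 0 0 ltac:(lra) ltac:(lra); rewrite !subrr normr0; apply.
have M0 : 0 <= Mx by exact: le_trans (normr_ge0 _) (xM al01).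
have gap k ga : (k <= n)%N -> 0 <= ga <= 1 -> `|k%:R / n%:R - ga| <= th -> `|y (k%:R / n%:R) - x ga| <= et + om.
  move=> kn ga01 kga; have h1 := xy _ (p01 k kn).
  have h2 := om_ _ _ (p01 k kn) ga01 ltac:(lra).
  rewrite (_ : y _ - x ga = (x (k%:R / n%:R) - x ga) - (x (k%:R / n%:R) - y (k%:R / n%:R))); last by ring.
  apply: (le_trans (ler_normB _ _)); lra.
have ga := gap a al ltac:(by apply: leq_trans aLn; rewrite leq_addr) al01 ath.
have gb := gap (a + L)%N be aLn be01 bth.
have key j : (j <= L)%N -> `|(y ((a + j)%:R / n%:R) - y (a%:R / n%:R) - j%:R / L%:R * (y ((a + L)%:R / n%:R) - y (a%:R / n%:R)))
    - (x (al + j%:R / L%:R * (be - al)) - x al - j%:R / L%:R * (x be - x al))| <= 4 * (et + om).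
  move=> jL; set s := j%:R / L%:R.
  have s01 : 0 <= s <= 1 by rewrite divr_ge0//= ler_pdivrMr// mul1r ler_nat.
  (* Both points are the same convex combination of the ends, so the error at the ends carries
     over. *)
  have gj : `|(a + j)%:R / n%:R - (al + s * (be - al))| <= th.
    have -> : (a + j)%:R / n%:R - (al + s * (be - al)) =
        (1 - s) * (a%:R / n%:R - al) + s * ((a + L)%:R / n%:R - be).
      by rewrite /s !natrD; field; rewrite !gt_eqF.
    apply: (le_trans (ler_normD _ _)); rewrite (normrM (1 - s)) (normrM s) (@ger0_norm _ s) ?(@ger0_norm _ (1 - s)) ?subr_ge0; try by case/andP: s01.
    have h1 : (1 - s) * `|a%:R / n%:R - al| <= (1 - s) * th by rewrite ler_wpM2l// subr_ge0; case/andP: s01.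
    have h2 : s * `|(a + L)%:R / n%:R - be| <= s * th by rewrite ler_wpM2l//; case/andP: s01.
    move: h1 h2; clear -xM; lra.
  have gj' := gap (a + j)%N _ ltac:(by apply: leq_trans aLn; rewrite leq_add2l) (conv01 al01 be01 s01) gj.
  set yj := y _ in gj' *; set ya := y (a%:R / n%:R) in ga *; set yb := y ((a + L)%:R / n%:R) in gb *.
  set xj := x (al + _) in gj' *.
  have -> : yj - ya - s * (yb - ya) - (xj - x al - s * (x be - x al)) =
     (yj - xj) - (ya - x al) - (s * (yb - x be) - s * (ya - x al)) by ring.
  have h1 := ler_normB (yj - xj) (ya - x al).
  have h2 := ler_normB (s * (yb - x be)) (s * (ya - x al)).
  have h3 := ler_normB ((yj - xj) - (ya - x al)) (s * (yb - x be) - s * (ya - x al)).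
  have s1 : `|s| <= 1 by case/andP: s01 => ? ?; rewrite ger0_norm.
  have h4 : `|s * (yb - x be)| <= `|yb - x be| by rewrite normrM ler_piMl.
  have h5 : `|s * (ya - x al)| <= `|ya - x al| by rewrite normrM ler_piMl.
  move: ga gb gj' h1 h2 h3 h4 h5; clearbody s yj ya yb xj; clear -xM; lra.
have up : seg_max y n a L <= seg_sup x al be + 4 * (et + om).
  have s0 : 0 <= seg_sup x al be.
    apply: (@le_trans _ _ (seg_fun x al be 0)); first exact: normr_ge0.
    by apply: (sup_upper_bound hs); exists 0 => //=; rewrite in_itv/= lexx ler01.
  apply: seg_max_le; first by move: s0 et0 om0; clear -xM; lra.
  move=> j jL; have s01 : 0 <= (j%:R : R) / L%:R <= 1 by rewrite divr_ge0//= ler_pdivrMr// mul1r ler_nat.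
  have h1 : seg_fun x al be (j%:R / L%:R) <= seg_sup x al be.
    by apply: (sup_upper_bound hs); exists (j%:R / L%:R) => //=; rewrite in_itv.
  have := key j jL; rewrite /seg_dev; move: h1; rewrite /seg_fun.
  set A := y _ - _ - _; set B := x _ - _ - _ => h1 h2.
  have := ler_normD (A - B) B; rewrite subrK; move: h1 h2; clear -xM; lra.
have dn : seg_sup x al be <= seg_max y n a L + (4 * (et + om) + om + 2 * Mx / L%:R).
  apply: ge_sup; first exact: hs.1.
  move=> r [s + <-]; rewrite /= in_itv/= => s01.
  pose j := Num.truncn (s * L%:R).
  have j1 : j%:R <= s * L%:R by rewrite truncn_le// mulr_ge0// ?(ltW LR)//; case/andP: s01.
  have j2 : s * L%:R < j%:R + 1 by rewrite natr1 truncnS_gt.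
  have jL : (j <= L)%N by rewrite -(ler_nat R); apply: (le_trans j1); rewrite ler_piMl//; case/andP: s01.
  have sj1 : (j%:R : R) / L%:R <= s by rewrite ler_pdivrMr.
  have sj2 : s - j%:R / L%:R <= L%:R^-1.
    rewrite lerBlDr -(ler_pM2r LR) mulrDl mulVf ?gt_eqF// divfK ?gt_eqF// addrC; exact: ltW.
  have j0 : 0 <= (j%:R : R) / L%:R by rewrite divr_ge0.
  have h1 := seg_max_ge y n a jL.
  have h2 := key j jL.
  set u := j%:R / L%:R in sj1 sj2 j0 h2 *.
  have u01 : 0 <= u <= 1 by rewrite j0; case/andP: s01 => _; exact: le_trans.
  have h3 : `|x (al + s * (be - al)) - x (al + u * (be - al))| < om.
    apply: om_; [exact: conv01|exact: conv01|].
    rewrite (_ : _ - _ = (s - u) * (be - al)); last by ring.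
    rewrite normrM ger0_norm ?subr_ge0//.
    have : `|be - al| <= 1 by rewrite ler_norml; move: al01 be01; clear -xM; lra.
    by move=> hb; apply: (le_lt_trans _ Lr); apply: (le_trans _ sj2); rewrite ler_piMr// subr_ge0.
  have h4 : `|(s - u) * (x be - x al)| <= 2 * Mx / L%:R.
    rewrite normrM ger0_norm ?subr_ge0// mulrC; apply: ler_pM => //; first by rewrite subr_ge0.
    apply: (le_trans (ler_normB _ _)); have := xM al01; have := xM be01; clear -xM; lra.
  rewrite /seg_fun; move: h1 h2; rewrite /seg_dev -/u.
  set A := y _ - _ - _; set B := x (al + u * _) - _ - _ => h1 h2.
  have -> : x (al + s * (be - al)) - x al - s * (x be - x al) =
    B + (x (al + s * (be - al)) - x (al + u * (be - al))) - (s - u) * (x be - x al) by rewrite /B; ring.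
  have k1 := ler_normB (B + (x (al + s * (be - al)) - x (al + u * (be - al)))) ((s - u) * (x be - x al)).
  have k2 := ler_normD B (x (al + s * (be - al)) - x (al + u * (be - al))).
  have k3 := ler_normB A (A - B); rewrite (_ : A - (A - B) = B) in k3; last by ring.
  move: h1 h2 h3 h4 k1 k2 k3; clearbody A B u; clear -xM; lra.
have : 0 <= 2 * Mx / L%:R by rewrite divr_ge0// mulr_ge0.
rewrite ler_norml; move: up dn et0 om0; clear -xM; lra.
Qed.

End segment_statistics.

Lemma inv_cvg0 (R : realType) (K_ : nat -> nat) : (forall m, (m <= K_ m)%N) ->
  (fun m => (K_ m)%:R^-1) @ \oo --> (0 : R).
Proof.
move=> mK; apply: (@squeeze_cvgr _ _ _ _ (fun=> 0) (fun m => 2 * m.+1%:R^-1)).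
- near=> m; rewrite invr_ge0 ler0n/=.
  have m0 : (0 < m)%N by near: m; exact: nbhs_infty_gt.
  have K0 : (0 < K_ m)%N by apply: leq_trans m0 (mK m).
  rewrite ler_pdivlMr ?ltr0n// mulrC ler_pdivrMr ?ltr0n// -natrM ler_nat mul2n -addnn -addn1 leq_add//.
- exact: cvg_cst.
- by rewrite -[X in _ --> X](mulr0 2); apply: cvgM; [exact: cvg_cst|exact: cvg_harmonic].
Unshelve. all: by end_near. Qed.

Lemma cvg_pair2 (R : realType) (g : R * R -> R) (f h : nat -> R) (a b : R) : continuous g ->
  f @ \oo --> a -> h @ \oo --> b -> (fun m => g (f m, h m)) @ \oo --> g (a, b).
Proof.
move=> cg ca cb.
have cp : (fun m => (f m, h m)) @ \oo --> ((a, b) : R * R).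
  move=> A [] /= [B C] [hB hC] BC. 
  have h1 : \forall m \near \oo, B (f m) := ca _ hB.
  have h2 : \forall m \near \oo, C (h m) := cb _ hC.
  suff : \forall m \near \oo, A (f m, h m) by [].
  by near=> m; apply: (BC (f m, h m)); split=> /=; near: m.
exact: (cvg_comp _ g cp (cg _)).
Unshelve. all: by end_near. Qed.

(** Ensures that the proviso of [stat_val], a cut point at least n/K away from both ends, holds for
    large K. *)
Lemma mid_index (R : realType) (xi n K k m : R) : 0 < xi < 1 -> 0 < n -> 0 < K -> m <= K ->
  2 / xi < m -> 2 / (1 - xi) < m -> xi / 2 <= k / n -> k / n <= 1 - (1 - xi) / 2 ->
  n / K <= k /\ k <= n - n / K.
Proof.
move=> /andP[xe0 xe1] n0 K0 mK m1 m2.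
have x10 : 0 < 1 - xi by lra.
have k1 : K^-1 <= xi / 2 by rewrite -invf_div lef_pV2 ?posrE ?divr_gt0//; lra.
have k2 : K^-1 <= (1 - xi) / 2 by rewrite -invf_div lef_pV2 ?posrE ?divr_gt0//; lra.
rewrite ler_pdivlMr// ler_pdivrMr// => h1 h2.
have := ler_wpM2l (ltW n0) k1; have := ler_wpM2l (ltW n0) k2.
lra.
Qed.

(** * Envelopes at a path with a unique bridge maximizer *)

Section good_path.
Context {R : realType}.
Variables (x : R -> R) (xi : R).
Hypothesis cx : {within `[0, 1], continuous x}.
Hypothesis xi01 : 0 < xi < 1.
Hypothesis argmax : forall t, 0 <= t <= 1 -> t != xi -> `|bridge x t| < `|bridge x xi|.

Lemma path_bounded : exists2 Mx, 0 <= Mx & forall t, 0 <= t <= 1 -> `|x t| <= Mx.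
Proof.
have ca : {within `[0, 1], continuous (fun t => `|x t|)} by move=> t; apply: cvg_norm; exact: cx.
have [c _ hc] := EVT_max (ler01 : (0 : R) <= 1) ca.
by exists `|x c| => // t t01; apply: hc; rewrite in_itv.
Qed.

Let cbr : {within `[0, 1], continuous (fun t => `|bridge x t|)}.
Proof.
move=> t; apply: cvg_norm; apply: cvgB; first exact: cx.
apply: cvgM; last exact: cvg_cst.
have ci : {within `[0, 1], continuous (@id R)} by apply: continuous_subspaceT => ?; exact: cvg_id.
exact: ci.
Qed.

(** Compactness: on each of the two intervals left after removing a neighbourhood of [xi], the
    maximum is attained and is strictly smaller. *)
Lemma argmax_gap th : 0 < th -> exists2 ga, 0 < ga &
  forall t, 0 <= t <= 1 -> th <= `|t - xi| -> `|bridge x t| <= `|bridge x xi| - ga.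
Proof.
move=> th0.
have side (a b : R) : 0 <= a -> b <= 1 -> (forall t, a <= t <= b -> t != xi) -> exists2 ga, 0 < ga &
    forall t, a <= t <= b -> `|bridge x t| <= `|bridge x xi| - ga.
  move=> a0 b1 nx; have [ab|ba] := leP a b; last by exists 1 => // t; lra.
  have cs : {within `[a, b], continuous (fun t => `|bridge x t|)}.
    apply: continuous_subspaceW cbr => t /=; rewrite !in_itv/= => /andP[at_ tb].
    by rewrite (le_trans a0)//= (le_trans tb).
  have [c] := EVT_max ab cs; rewrite in_itv/= => cab hc.
  exists (`|bridge x xi| - `|bridge x c|).
    by rewrite subr_gt0; apply: argmax; [lra|exact: nx].
  by move=> t tab; rewrite opprB addrCA subrr addr0; apply: hc; rewrite in_itv.
have xe := xi01.
have [g1 g10 h1] := side 0 (xi - th) (lexx _) ltac:(lra) ltac:(move=> t tt; apply/eqP; lra).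
have [g2 g20 h2] := side (xi + th) 1 ltac:(lra) (lexx _) ltac:(move=> t tt; apply/eqP; lra).
exists (Num.min g1 g2); first by rewrite lt_min g10.
move=> t t01; have [tx|xt] := ltP t xi.
  rewrite ltr0_norm ?subr_lt0// => tth; have := h1 t ltac:(lra).
  have := ge_min g1 g1 g2; rewrite lexx /=; move: (Num.min _ _) => m mg; lra.
rewrite ger0_norm ?subr_ge0// => tth; have := h2 t ltac:(lra).
have := ge_min g2 g1 g2; rewrite lexx orbT; move: (Num.min _ _) => m mg; lra.
Qed.

(** If k/n were [th] away from [xi], the bridge there would fall short of the maximum by [ga]. The
    grid point just below [xi] falls short by less than ga/4, and exchanging x and y costs at most
    ga/8 at a point. *)
Lemma argmax_close th : 0 < th -> exists et n0, 0 < et /\ forall n y k, (n0 <= n)%N -> (1 <= k <= n)%N ->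
  (forall t, 0 <= t <= 1 -> `|x t - y t| <= et) ->
  (forall i, (1 <= i <= n)%N -> `|bridge y (i%:R / n%:R)| <= `|bridge y (k%:R / n%:R)|) ->
  `|k%:R / n%:R - xi| < th.
Proof.
move=> th0; have [ga ga0 hga] := argmax_gap th0; have /andP[xe0 xe1] := xi01.
have [dl dl0 hdl] := within01_eps cbr (ltac:(lra) : 0 <= xi <= 1) (ltac:(lra) : 0 < ga / 4).
have [n0 hn0] := nat_ge (Num.max (dl^-1) (xi^-1)).
exists (ga / 16), n0.+1; split; first lra.
move=> n y k nn kn xy hk.
have nR : 0 < (n%:R : R) by rewrite ltr0n; apply: leq_trans nn.
have : Num.max dl^-1 xi^-1 < n%:R by apply: le_lt_trans hn0 _; rewrite ltr_nat.
rewrite gt_max => /andP[nd nx].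
pose i := Num.truncn (xi * n%:R).
have i1 : i%:R <= xi * n%:R by rewrite truncn_le// mulr_ge0// ltW.
have i2 : xi * n%:R < i%:R + 1 by rewrite natr1 truncnS_gt.
have ipos : (1 <= i)%N.
  by rewrite /i truncn_gt0 ltW// mulrC -ltr_pdivrMr// div1r.
have ile : (i <= n)%N by rewrite -(ler_nat R); apply: (le_trans i1); rewrite ler_piMl// ltW.
have s1 : i%:R / n%:R <= xi by rewrite ler_pdivrMr.
have s2 : xi - i%:R / n%:R < dl.
  apply: (@le_lt_trans _ _ n%:R^-1).
    rewrite lerBlDr -(ler_pM2r nR) mulrDl mulVf ?gt_eqF// divfK ?gt_eqF//; lra.
  by rewrite -[ltRHS]invrK ltf_pV2 ?posrE ?invr_gt0.
have p01 j : (j <= n)%N -> 0 <= (j%:R : R) / n%:R <= 1.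
  by move=> jn; rewrite divr_ge0//= ler_pdivrMr// mul1r ler_nat.
have by_ t : 0 <= t <= 1 -> `|bridge x t - bridge y t| <= ga / 8.
  move=> t01; rewrite /bridge (_ : _ - _ = (x t - y t) - t * (x 1 - y 1)); last by ring.
  apply: (le_trans (ler_normB _ _)); rewrite normrM (@ger0_norm _ t); last by case/andP: t01.
  have h1 := xy t t01; have h2 := xy 1 ltac:(lra).
  have : t * `|x 1 - y 1| <= 1 * (ga / 16) by apply: ler_pM => //; lra.
  lra.
have k01 : 0 <= (k%:R : R) / n%:R <= 1 by apply: p01; case/andP: kn.
have i01 := p01 i ile.
have B1 := hdl _ i01 ltac:(by rewrite ger0_norm// subr_ge0).
have B2 := by_ _ i01; have B3 := by_ _ k01.
have B4 := hk i ltac:(by rewrite ipos ile).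
rewrite ltNge; apply/negP => thk.
have B5 := hga _ k01 thk.
have B6 := ler_normB (bridge x (i%:R / n%:R)) (bridge x (i%:R / n%:R) - bridge y (i%:R / n%:R)).
rewrite (_ : _ - (_ - _) = bridge y (i%:R / n%:R)) in B6; last by ring.
have B7 := ler_normB (bridge x (k%:R / n%:R)) (bridge x (k%:R / n%:R) - bridge y (k%:R / n%:R)).
rewrite (_ : _ - (_ - _) = bridge y (k%:R / n%:R)) in B7; last by ring.
have B8 := ler_normD (bridge y (i%:R / n%:R)) (bridge x (i%:R / n%:R) - bridge y (i%:R / n%:R)).
rewrite addrC subrK in B8.
move: B1; rewrite ltr_norml; lra.
Qed.

Variables (g : R * R -> R) (c M : R).
Hypothesis cg : continuous g.
Hypothesis c0 : 0 < c.
Hypothesis gM : forall p, `|g p| <= M.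

Definition stat1 (y : R -> R) (n k : nat) : R :=
  c^-1 * ((Num.sqrt (k%:R / n%:R))^-1 * seg_max y n 0 k).

Definition stat2 (y : R -> R) (n k : nat) : R :=
  c^-1 * ((Num.sqrt ((n - k)%N%:R / n%:R))^-1 * seg_max y n k (n - k)).

(* The value of g at the pair of statistics up to relative errors u, u' close to
   1; any value is allowed when the maximizer is too close to an endpoint. *)
Definition stat_val (K n : nat) (y : R -> R) (v : R) : Prop := `|v| <= M /\
  exists k, [/\ (1 <= k <= n)%N,
    forall i, (1 <= i <= n)%N -> `|bridge y (i%:R / n%:R)| <= `|bridge y (k%:R / n%:R)| &
    n%:R / K%:R <= k%:R :> R -> k%:R <= n%:R - n%:R / K%:R :> R ->
    exists u u', [/\ `|u - 1| <= K%:R^-1, `|u' - 1| <= K%:R^-1 & v = g (u * stat1 y n k, u' * stat2 y n k)]].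

Definition stat_lim : R := g (c^-1 * ((Num.sqrt xi)^-1 * seg_sup x 0 xi),
  c^-1 * ((Num.sqrt (1 - xi))^-1 * seg_sup x xi 1)).

Lemma stat_val_cvg (K_ n_ k_ : nat -> nat) (y_ : nat -> R -> R) (u_ u'_ : nat -> R) :
  (forall m, (m <= K_ m)%N) -> (forall m, (K_ m <= n_ m)%N) ->
  (forall et, 0 < et -> \forall m \near \oo, forall t, 0 <= t <= 1 -> `|x t - y_ m t| <= et) ->
  (forall m, (1 <= k_ m <= n_ m)%N) ->
  (fun m => (k_ m)%:R / (n_ m)%:R) @ \oo --> xi ->
  u_ @ \oo --> (1 : R) -> u'_ @ \oo --> (1 : R) ->
  (fun m => g (u_ m * stat1 (y_ m) (n_ m) (k_ m), u'_ m * stat2 (y_ m) (n_ m) (k_ m))) @ \oo --> stat_lim.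
Proof.
move=> mK Kn xy kn ckn cu cu'; have /andP[xe0 xe1] := xi01.
have n0 m : (0 < n_ m)%N by have /andP[k1 k2] := kn m; exact: leq_trans k2.
have nR m : 0 < ((n_ m)%:R : R) by rewrite ltr0n.
have rE m : ((n_ m - k_ m)%N%:R : R) / (n_ m)%:R = 1 - (k_ m)%:R / (n_ m)%:R.
  by rewrite natrB ?mulrBl ?mulfV ?gt_eqF//; case/andP: (kn m).
have ckn' : (fun m => (n_ m - k_ m)%N%:R / (n_ m)%:R) @ \oo --> 1 - xi.
  by under eq_fun do rewrite rE; apply: cvgB => //; exact: cvg_cst.
have nmR m : (m%:R : R) <= (n_ m)%:R by rewrite ler_nat (leq_trans (mK m)).
have large (l_ : nat -> nat) (a : R) : 0 < a -> (fun m => (l_ m)%:R / (n_ m)%:R) @ \oo --> a ->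
    forall B : R, \forall m \near \oo, B <= (l_ m)%:R.
  move=> a0 cl B; near=> m.
  have h1 : a / 2 <= (l_ m)%:R / (n_ m)%:R by near: m; apply: (cvgr_ge _ cl); lra.
  rewrite ler_pdivlMr// in h1.
  have h2 : B * 2 / a <= m%:R by near: m; exact: nbhs_infty_ger.
  rewrite ler_pdivrMr// in h2.
  have := ler_wpM2l (ltW a0) (nmR m); lra.
have [Mx Mx0 xM] := path_bounded.
have seg (a_ L_ : nat -> nat) (al be : R) : 0 <= al <= 1 -> 0 <= be <= 1 -> (forall m, (a_ m + L_ m <= n_ m)%N) ->
    (fun m => (a_ m)%:R / (n_ m)%:R) @ \oo --> al -> (fun m => (a_ m + L_ m)%:R / (n_ m)%:R) @ \oo --> be ->
    (forall B : R, \forall m \near \oo, B <= (L_ m)%:R) ->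
    (fun m => seg_max (y_ m) (n_ m) (a_ m) (L_ m)) @ \oo --> seg_sup x al be.
  move=> al01 be01 aL ca cb cL; apply/cvgrPdist_le => e e0.
  have [rho rho0 hrho] := unif_cont01 cx (ltac:(lra) : 0 < e / 20).
  near=> m.
  have L1 : Num.max 1 (Num.max (2 / rho) (2 * Mx * 20 / e)) <= (L_ m)%:R by near: m; exact: cL.
  move: L1; rewrite !ge_max => /and3P[L1 L2 L3].
  have LR : 0 < ((L_ m)%:R : R) by lra.
  rewrite distrC.
  have xye : forall t, 0 <= t <= 1 -> `|x t - y_ m t| <= e / 20 by near: m; apply: xy; lra.
  have h1 : `|(a_ m)%:R / (n_ m)%:R - al| <= rho / 2 by near: m; move/cvgrPdistC_le : ca; apply; lra.
  have h2 : `|(a_ m + L_ m)%:R / (n_ m)%:R - be| <= rho / 2 by near: m; move/cvgrPdistC_le : cb; apply; lra.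
  have h3 : (L_ m)%:R^-1 < rho.
    rewrite -[ltRHS]invrK ltf_pV2 ?posrE ?invr_gt0//; apply: lt_le_trans L2.
    by rewrite -[ltLHS]mul1r ltr_pM2r ?invr_gt0//; lra.
  have := seg_close xM (n0 m) (ltac:(by rewrite -(ltr_nat R)) : (0 < L_ m)%N) (aL m) al01 be01 xye hrho h1 h2 ltac:(lra) h3.
  move=> /le_trans; apply.
  have : 2 * Mx / (L_ m)%:R <= e / 20 by move: L3; rewrite ler_pdivrMr// ler_pdivrMr// => L3; lra.
  lra.
have kn1 m : (k_ m <= n_ m)%N by case/andP: (kn m).
have x01 : 0 <= xi <= 1 by lra.
have s1 : (fun m => seg_max (y_ m) (n_ m) 0 (k_ m)) @ \oo --> seg_sup x 0 xi.
  apply: (seg (fun=> 0%N)) => //; first lra.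
  - by under eq_fun do rewrite mul0r; exact: cvg_cst.
  - exact: large ckn.
have s2 : (fun m => seg_max (y_ m) (n_ m) (k_ m) (n_ m - k_ m)) @ \oo --> seg_sup x xi 1.
  apply: seg => //; first lra.
  - by move=> m; rewrite subnKC.
  - by under eq_fun do (rewrite subnKC// mulfV ?gt_eqF//); exact: cvg_cst.
  - by apply: large ckn'; lra.
have csq (r_ : nat -> R) (a : R) : 0 < a -> r_ @ \oo --> a -> (fun m => (Num.sqrt (r_ m))^-1) @ \oo --> (Num.sqrt a)^-1.
  move=> a0 cr; apply: cvgV; first by rewrite gt_eqF// sqrtr_gt0.
  exact: (continuous_cvg _ (@sqrt_continuous R a) cr).
have c1 : (fun m => u_ m * stat1 (y_ m) (n_ m) (k_ m)) @ \oo --> c^-1 * ((Num.sqrt xi)^-1 * seg_sup x 0 xi).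
  rewrite -[X in _ --> X]mul1r; apply: cvgM; first by [].
  by apply: cvgM; [exact: cvg_cst|apply: cvgM s1; exact: csq].
have c2 : (fun m => u'_ m * stat2 (y_ m) (n_ m) (k_ m)) @ \oo --> c^-1 * ((Num.sqrt (1 - xi))^-1 * seg_sup x xi 1).
  rewrite -[X in _ --> X]mul1r; apply: cvgM; first by [].
  by apply: cvgM; [exact: cvg_cst|apply: cvgM s2; apply: csq ckn'; rewrite subr_gt0].
exact: cvg_pair2.
Unshelve. all: by end_near. Qed.

(** By contradiction: a sequence of counterexamples with K and n growing and distances shrinking
    would converge by [stat_val_cvg]. This yields the uniformity in K, n and y that the envelope
    requires. *)
Lemma stat_val_close ep : 0 < ep -> exists m, forall K n y v d, (m <= K)%N -> (K <= n)%N -> stat_val K n y v ->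
  skor_lt x y d -> d <= m.+1%:R^-1 -> `|v - stat_lim| <= ep.
Proof.
move=> ep0; apply: contrapT => /forallNP H.
have ch m : exists p : nat * nat * (R -> R) * R * R, let: (K, n, y, v, d) := p in
    [/\ (m <= K)%N /\ (K <= n)%N, stat_val K n y v, skor_lt x y d, d <= m.+1%:R^-1 & ep < `|v - stat_lim|].
  apply: contrapT => /forallNP nh; apply: (H m) => K n y v d mK Kn hv xy dm.
  by rewrite leNgt; apply/negP => h; apply: (nh (K, n, y, v, d)).
pose p m := projT1 (cid (ch m)).
pose K_ m := (p m).1.1.1.1; pose n_ m := (p m).1.1.1.2; pose y_ m := (p m).1.1.2; pose v_ m := (p m).1.2; pose d_ m := (p m).2.
have hp m : [/\ (m <= K_ m)%N /\ (K_ m <= n_ m)%N, stat_val (K_ m) (n_ m) (y_ m) (v_ m), skor_lt x (y_ m) (d_ m),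
    d_ m <= m.+1%:R^-1 & ep < `|v_ m - stat_lim|].
  by rewrite /K_ /n_ /y_ /v_ /d_ /p; case: (cid (ch m)) => -[[[[K n] y] v] d].
have hk m : exists k, [/\ (1 <= k <= n_ m)%N,
    forall i, (1 <= i <= n_ m)%N -> `|bridge (y_ m) (i%:R / (n_ m)%:R)| <= `|bridge (y_ m) (k%:R / (n_ m)%:R)| &
    (n_ m)%:R / (K_ m)%:R <= k%:R :> R -> k%:R <= (n_ m)%:R - (n_ m)%:R / (K_ m)%:R :> R ->
    exists u u', [/\ `|u - 1| <= (K_ m)%:R^-1, `|u' - 1| <= (K_ m)%:R^-1 &
     v_ m = g (u * stat1 (y_ m) (n_ m) k, u' * stat2 (y_ m) (n_ m) k)]].
  by have [_ [_ h] _ _ _] := hp m.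
pose k_ m := projT1 (cid (hk m)).
have kP m := projT2 (cid (hk m)) : [/\ (1 <= k_ m <= n_ m)%N, _ & _].
have mK m : (m <= K_ m)%N by have [[]] := hp m.
have Kn m : (K_ m <= n_ m)%N by have [[]] := hp m.
have xy et : 0 < et -> \forall m \near \oo, forall t, 0 <= t <= 1 -> `|x t - y_ m t| <= et.
  move=> et0; have [d0 d00 hd] := skor_lt_cont cx et0.
  near=> m; have [_ _ sk dm _] := hp m; apply: hd sk.
  apply: (le_trans dm); rewrite -[leRHS]invrK lef_pV2 ?posrE ?invr_gt0//.
  apply: (@le_trans _ _ m%:R); last by rewrite ler_nat.
  by near: m; exact: nbhs_infty_ger.
have kn m : (1 <= k_ m <= n_ m)%N by case: (kP m).
have ckn : (fun m => (k_ m)%:R / (n_ m)%:R) @ \oo --> xi.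
  apply/cvgrPdist_lt => th th0; have [et [n0 [et0 h]]] := argmax_close th0.
  near=> m; rewrite distrC; apply: (h (n_ m) (y_ m)) => //.
  - apply: leq_trans (Kn m); apply: leq_trans (mK m); near: m; exact: nbhs_infty_ge.
  - by near: m; exact: xy.
  - by case: (kP m).
have n0 m : (0 < n_ m)%N by have /andP[k1 k2] := kn m; exact: leq_trans k2.
have nR m : 0 < ((n_ m)%:R : R) by rewrite ltr0n.
(* The default pair (0, 0) serves the cut points too close to an end; by [mid_index] they occur
   finitely often. *)
have hu m : exists uu : R * R, (n_ m)%:R / (K_ m)%:R <= (k_ m)%:R :> R -> (k_ m)%:R <= (n_ m)%:R - (n_ m)%:R / (K_ m)%:R :> R ->
    [/\ `|uu.1 - 1| <= (K_ m)%:R^-1, `|uu.2 - 1| <= (K_ m)%:R^-1 &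
     v_ m = g (uu.1 * stat1 (y_ m) (n_ m) (k_ m), uu.2 * stat2 (y_ m) (n_ m) (k_ m))].
  have [_ _ h] := kP m.
  have [a|na] := pselect ((n_ m)%:R / (K_ m)%:R <= (k_ m)%:R :> R); last by exists (0, 0) => /na.
  have [b|nb] := pselect ((k_ m)%:R <= (n_ m)%:R - (n_ m)%:R / (K_ m)%:R :> R); last by exists (0, 0) => _ /nb.
  by have [u [u' hh]] := h a b; exists (u, u').
pose uu m := projT1 (cid (hu m)).
have uP m := projT2 (cid (hu m)).
have /andP[xe0 xe1] := xi01.
have ev : \forall m \near \oo, [/\ `|(uu m).1 - 1| <= (K_ m)%:R^-1, `|(uu m).2 - 1| <= (K_ m)%:R^-1 &
     v_ m = g ((uu m).1 * stat1 (y_ m) (n_ m) (k_ m), (uu m).2 * stat2 (y_ m) (n_ m) (k_ m))].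
  near=> m.
  have h1 : xi / 2 <= (k_ m)%:R / (n_ m)%:R by near: m; apply: (cvgr_ge _ ckn); lra.
  have h2 : (k_ m)%:R / (n_ m)%:R <= 1 - (1 - xi) / 2 by near: m; apply: (cvgr_le _ ckn); lra.
  have m1 : Num.max (2 / xi) (2 / (1 - xi)) < m%:R by near: m; exact: nbhs_infty_gtr.
  move: m1; rewrite gt_max => /andP[m1 m2].
  have mR : (m%:R : R) <= (K_ m)%:R by rewrite ler_nat.
  have KR : 0 < ((K_ m)%:R : R) by apply: lt_le_trans mR; apply: le_lt_trans m1; rewrite divr_ge0// ltW.
  by have [] := mid_index xi01 (nR m) KR mR m1 m2 h1 h2; exact: (uP m).
have Kinv := @inv_cvg0 R K_ mK.
have cu (f : R * R -> R) : (\forall m \near \oo, `|f (uu m) - 1| <= (K_ m)%:R^-1) -> (fun m => f (uu m)) @ \oo --> (1 : R).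
  move=> h; apply/cvgrPdist_le => e e0; near=> m; rewrite distrC.
  have h1 : `|f (uu m) - 1| <= (K_ m)%:R^-1 by near: m.
  apply: (le_trans h1); near: m; exact: (cvgr_le _ Kinv _ e0).
have cu1 := cu fst ltac:(by apply: filterS ev => m []).
have cu2 := cu snd ltac:(by apply: filterS ev => m []).
have cv := stat_val_cvg mK Kn xy kn ckn cu1 cu2.
have /cvgrPdist_le/(_ _ ep0) h := cv.
have [m [[_ _ vE] hm]] : exists m, [/\ `|(uu m).1 - 1| <= (K_ m)%:R^-1, `|(uu m).2 - 1| <= (K_ m)%:R^-1 &
     v_ m = g ((uu m).1 * stat1 (y_ m) (n_ m) (k_ m), (uu m).2 * stat2 (y_ m) (n_ m) (k_ m))] /\
     `|stat_lim - g ((uu m).1 * stat1 (y_ m) (n_ m) (k_ m), (uu m).2 * stat2 (y_ m) (n_ m) (k_ m))| <= ep.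
  by have [m _ hm] := filterI ev h; exists m; exact: (hm m (leqnn m)).
by have [_ _ _ _] := hp m; rewrite vE distrC ltNge hm.
Unshelve. all: by end_near. Qed.

Lemma argmax_seq (f : nat -> R) n : (0 < n)%N -> exists k, (1 <= k <= n)%N /\
  forall i, (1 <= i <= n)%N -> f i <= f k.
Proof.
case: n => // n _; elim: n => [|n [k [/andP[k1 kn] hk]]].
  by exists 1%N; split=> // -[|[|i]].
have [fk|kf] := leP (f n.+2) (f k).
  exists k; split=> [|i /andP[i1 i2]]; first by rewrite k1 leqW.
  by move: i2; rewrite leq_eqVlt => /orP[/eqP->//|i2]; apply: hk; rewrite i1.
exists n.+2; split=> [|i /andP[i1 i2]]; first by rewrite leqnn.
move: i2; rewrite leq_eqVlt => /orP[/eqP->//|i2].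
by apply: le_trans (ltW kf); apply: hk; rewrite i1.
Qed.

Lemma stat_val_exists K n : (0 < n)%N -> exists k, (1 <= k <= n)%N /\
  stat_val K n x (g (stat1 x n k, stat2 x n k)).
Proof.
move=> n0; have [k [kn hk]] := argmax_seq (fun i => `|bridge x (i%:R / n%:R)|) n0.
exists k; split=> //; split; first exact: gM.
exists k; split=> // _ _; exists 1, 1; rewrite !mul1r; split=> //; by rewrite subrr normr0 invr_ge0.
Qed.

Let gM0 : 0 <= M. Proof. exact: le_trans (normr_ge0 _) (gM (0, 0)). Qed.

(** The penalty localizes the supremum: once K >= 2 M (m + 1), a path farther than 1/(m + 1)
    contributes at most -M. Closer paths give values within [ep] of the limit, and x itself gives
    one. *)
Lemma env_cvg (Val : nat -> nat -> (R -> R) -> R -> Prop) (l : R) :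
  `|l| <= M ->
  (forall K n y v, Val K n y v -> `|v| <= M) ->
  (forall ep, 0 < ep -> exists m, forall K n y v d, (m <= K)%N -> (K <= n)%N -> Val K n y v ->
    skor_lt x y d -> d <= m.+1%:R^-1 -> `|v - l| <= ep) ->
  (forall K n, (0 < n)%N -> exists v, Val K n x v) ->
  (fun K => skor_env Val M K x) @ \oo --> l.
Proof.
move=> lM VM Vl Vx; apply/cvgrPdistC_le => ep ep0; have [m hm] := Vl _ ep0.
near=> K; have mK : (m <= K)%N by near: K; exact: nbhs_infty_ge.
have K0 : (0 < K)%N by near: K; exact: nbhs_infty_gt.
rewrite ler_distl; apply/andP; split.
  have [v hv] := Vx K K K0.
  have m0 : 0 < (m.+1%:R^-1 : R) by rewrite invr_gt0.
  have h := hm K K x v _ mK (leqnn _) hv (skor_lt_refl x m0) (lexx _).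
  have := skor_env_ge_val VM gM0 (leqnn K) hv; move: h; rewrite ler_norml; lra.
apply: skor_env_le; first by move: lM; rewrite ler_norml; lra.
move=> n y v d0 Kn hv xy; have [dm|dm] := leP d0 m.+1%:R^-1.
  have := hm K n y v d0 mK Kn hv xy dm; rewrite ler_norml.
  have : 0 <= K%:R * d0 by rewrite mulr_ge0// ltW// (skor_lt_gt0 xy).
  lra.
have KM : 2 * M * m.+1%:R <= K%:R by near: K; exact: nbhs_infty_ger.
have : K%:R * m.+1%:R^-1 <= K%:R * d0 by rewrite ler_wpM2l// ltW.
rewrite -ler_pdivlMr// in KM.
have := VM _ _ _ _ hv; move: lM; rewrite !ler_norml; move: KM; set q := _ / m.+1%:R; set r := K%:R * d0; clearbody q r; lra.
Unshelve. all: by end_near. Qed.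

Lemma stat_env_cvg : (fun K => skor_env stat_val M K x) @ \oo --> stat_lim.
Proof.
apply: env_cvg; first exact: gM.
- by move=> K n y v [].
- exact: stat_val_close.
- by move=> K n n0; have [k [_ h]] := stat_val_exists K n0; eexists; exact: h.
Qed.

Lemma stat_env_cvgN :
  (fun K => skor_env (fun K n y v => stat_val K n y (- v)) M K x) @ \oo --> - stat_lim.
Proof.
apply: env_cvg; first by rewrite normrN gM.
- by move=> K n y v []; rewrite normrN.
- move=> ep ep0; have [m hm] := stat_val_close ep0; exists m => K n y v d0 mK Kn hv xy dm.
  by rewrite opprK -normrN opprD; exact: (hm K n y (- v) d0).
- move=> K n n0; have [k [_ h]] := stat_val_exists K n0; eexists (- _); rewrite opprK; exact: h.
Qed.

End good_path.

(** * Identification of the limiting functional *)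

Section limits.
Context {R : realType}.
Variables (x : R -> R) (xi : R).
Hypothesis cx : {within `[0, 1], continuous x}.
Hypothesis x0 : x 0 = 0.
Hypothesis xi01 : 0 < xi < 1.
Hypothesis argmax : forall t, 0 <= t <= 1 -> t != xi -> `|bridge x t| < `|bridge x xi|.

Lemma sup_bridge : sup [set `|bridge x s| | s in `[0, 1]] = `|bridge x xi|.
Proof.
have xe := xi01; apply/eqP; rewrite eq_le; apply/andP; split.
  apply: ge_sup; first by exists `|bridge x xi|, xi => //=; rewrite in_itv/=; lra.
  move=> r [t /=]; rewrite in_itv/= => t01 <-.
  by have [->//|tx] := eqVneq t xi; apply/ltW/argmax.
apply: ub_le_sup; last by exists xi => //=; rewrite in_itv/=; lra.
exists `|bridge x xi| => r [t /=]; rewrite in_itv/= => t01 <-.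
by have [->//|tx] := eqVneq t xi; apply/ltW/argmax.
Qed.

(** [xi_of] ranges over all t >= 0, but times beyond 1 cannot lower the infimum: any t below [xi]
    lies in [0, 1], where the maximizer is unique. *)
Lemma xi_ofE : xi_of x = xi.
Proof.
have xe := xi01; rewrite /xi_of /=.
have sb : sup [set `|x s - s * x 1| | s in `[0, 1]] = `|x xi - xi * x 1| := sup_bridge.
rewrite sb.
have lbx : lbound [set t | 0 <= t /\ `|x t - t * x 1| = `|x xi - xi * x 1|] xi.
  move=> t /= [t0 tE]; rewrite leNgt; apply/negP => tx.
  have := @argmax t ltac:(lra) ltac:(by rewrite lt_eqF).
  by rewrite /bridge tE ltxx.
apply/eqP; rewrite eq_le; apply/andP; split.
  by apply: ge_inf; [exists xi|split=> //; lra].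
by apply: lb_le_inf => //; exists xi; split=> //; lra.
Qed.

Lemma limit1E : limit1 x = (Num.sqrt xi)^-1 * seg_sup x 0 xi.
Proof.
have xe := xi01; rewrite /limit1 xi_ofE /=; congr (_ * sup _).
apply/seteqP; split=> r [t /=]; rewrite in_itv/= => /andP[t0 t1] <-.
  exists (t / xi); first by rewrite in_itv/= divr_ge0 ?ler_pdivrMr ?mul1r ?(ltW (andP xe).1)//; case/andP: xe.
  by rewrite /seg_fun !x0 !subr0 add0r divfK// gt_eqF//; case/andP: xe.
exists (t * xi); last first.
  by rewrite /seg_fun x0 !subr0 add0r mulfK// gt_eqF//; case/andP: xe.
by rewrite in_itv/= mulr_ge0 ?ler_piMl//; lra.
Qed.

Lemma limit2E : limit2 x = (Num.sqrt (1 - xi))^-1 * seg_sup x xi 1.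
Proof.
have xe := xi01; have x10 : 0 < 1 - xi by lra.
rewrite /limit2 xi_ofE /=; congr (_ * sup _).
apply/seteqP; split=> r [t /=]; rewrite in_itv/= => /andP[t0 t1] <-.
  exists ((t - xi) / (1 - xi)).
    by rewrite in_itv/= divr_ge0 ?ler_pdivrMr ?mul1r//; lra.
  by rewrite /seg_fun divfK ?gt_eqF// addrCA subrr addr0.
exists (xi + t * (1 - xi)); last first.
  by rewrite /seg_fun (addrC xi) addrK mulfK// gt_eqF.
have : 0 <= t * (1 - xi) by rewrite mulr_ge0; lra.
have : t * (1 - xi) <= 1 - xi by rewrite ler_piMl; lra.
by rewrite in_itv/=; lra.
Qed.

Variables (c : R).
Hypothesis c0 : 0 < c.

Lemma bridgeZ t : bridge (fun t => c * x t) t = c * bridge x t.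
Proof. by rewrite /bridge; ring. Qed.

Lemma argmaxZ t : 0 <= t <= 1 -> t != xi -> `|bridge (fun t => c * x t) t| < `|bridge (fun t => c * x t) xi|.
Proof. by move=> t01 tx; rewrite !bridgeZ !normrM ltr_pM2l ?normr_gt0 ?gt_eqF//; exact: argmax. Qed.

Lemma seg_supZ al be : 0 <= al <= 1 -> 0 <= be <= 1 -> c^-1 * seg_sup (fun t => c * x t) al be = seg_sup x al be.
Proof.
move=> al01 be01; have [Mx _ xM] := path_bounded cx.
have hs := seg_sup_has xM al01 be01.
have E s : seg_fun (fun t => c * x t) al be s = c * seg_fun x al be s.
  by rewrite /seg_fun -[c in RHS]ger0_norm ?(ltW c0)// -normrM; congr (`| _ |); ring.
have xM' t : 0 <= t <= 1 -> `|c * x t| <= c * Mx.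
  by move=> t01; rewrite normrM gtr0_norm// ler_pM2l//; exact: xM.
have hs' := seg_sup_has xM' al01 be01.
apply/eqP; rewrite mulrC -[_ == _]/(_ / c == _) eq_le; apply/andP; split.
  rewrite ler_pdivrMr//; apply: ge_sup; first by case: hs'.
  move=> r [s s01 <-]; rewrite E mulrC ler_pM2r//.
  by apply: (sup_upper_bound hs); exists s.
rewrite ler_pdivlMr// mulrC -ler_pdivlMl//; apply: ge_sup; first by case: hs.
move=> r [s s01 <-]; rewrite ler_pdivlMl// -E.
by apply: (sup_upper_bound hs'); exists s.
Qed.

(** The limit path in (a) is the fractional Brownian path times c; its bridge has the same
    maximizer, and c cancels in the statistics. *)
Lemma stat_limZ g : stat_lim (fun t => c * x t) xi g c = g (limit1 x, limit2 x).
Proof.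
have xe := xi01; rewrite /stat_lim limit1E limit2E; congr (g (_, _)).
  by rewrite mulrCA seg_supZ//; lra.
by rewrite mulrCA seg_supZ//; lra.
Qed.

End limits.

(** * Bounds drawn from the hypotheses and the asymptotic variance *)

Section bounds.
Context {R : realType}.

Lemma eventually_le_all (f g : nat -> R) (C : R) (n0 : nat) : (forall n, 0 < g n) ->
  (forall n, (n0 <= n)%N -> f n <= C * g n) -> exists2 C' : R, 0 < C' & forall n, f n <= C' * g n.
Proof.
move=> g0 h; pose S := \sum_(i < n0) `|f i| / g i.
have S0 : 0 <= S by apply: sumr_ge0 => i _; rewrite divr_ge0// ltW.
exists (`|C| + 1 + S) => [|n]; first by have := normr_ge0 C; lra.
have [nn|nn] := leqP n0 n.
  apply: (le_trans (h n nn)); rewrite ler_pM2r//; have := ler_norm C; lra.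
rewrite -ler_pdivrMr//.
have : f n / g n <= S.
  rewrite /S (bigD1 (Ordinal nn))//= ler_wpDr//.
    by apply: sumr_ge0 => i _; rewrite divr_ge0// ltW.
  by rewrite ler_pM2r ?invr_gt0// ler_norm.
have := normr_ge0 C; lra.
Qed.

Lemma window_sum_le (f : int -> R) (n m : nat) : (forall z, 0 <= f z) -> (n <= m)%N ->
  \sum_(a < (2 * n).+1) f (a%:Z - n%:Z) <= \sum_(a < (2 * m).+1) f (a%:Z - m%:Z).
Proof.
move=> f0 nm; rewrite -(big_mkord xpredT (fun a : nat => f (a%:Z - m%:Z))) -(big_mkord xpredT (fun a : nat => f (a%:Z - n%:Z))).
rewrite [leRHS](@big_cat_nat _ _ _ (m - n)%N)//=; last by lia.
rewrite [X in _ <= _ + X](@big_cat_nat _ _ _ (m - n + (2 * n).+1)%N)//=; [|lia|lia].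
rewrite addrCA ler_wpDr//.
  by rewrite addr_ge0//; apply: sumr_ge0.
rewrite -{1}(add0n (m - n)%N) big_addn addKn le_eqVlt; apply/orP; left; apply/eqP.
apply: eq_bigr => i _; congr f; lia.
Qed.

Lemma truncated_sqr_lip (a b B dl : R) : 0 <= B -> `|a - b| <= dl ->
  `|(Num.min `|a| B) ^+ 2 - (Num.min `|b| B) ^+ 2| <= 2 * B * dl.
Proof.
move=> B0 ab; set s := Num.min _ _; set t := Num.min _ _.
have s0 : 0 <= s <= B by rewrite /s le_min normr_ge0 B0 ge_min lexx orbT.
have t0 : 0 <= t <= B by rewrite /t le_min normr_ge0 B0 ge_min lexx orbT.
have st : `|s - t| <= dl.
  apply: le_trans ab; have h1 := ler_dist_dist a b; apply: le_trans h1.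
  rewrite /s /t !minEle; case: (leP `|a| B) => h1; case: (leP `|b| B) => h2 //; rewrite ?subrr ?normr0//.
  - by rewrite (distrC `|a| `|b|) (@ger0_norm _ (`|b| - `|a|)) ?ler_norml; lra.
  - by rewrite (@ger0_norm _ (`|a| - `|b|)) ?ler_norml; lra.
rewrite subr_sqr normrM mulrC; apply: ler_pM => //.
by rewrite ger0_norm; lra.
Qed.

(** Beyond [B] one has u^2 <= u^4 / B^2; a fourth moment bound thus gives uniform integrability of
    squares. *)
Lemma truncated_sqr_gap (u B : R) : 0 < B -> 0 <= u ^+ 2 - (Num.min `|u| B) ^+ 2 <= u ^+ 4 / B ^+ 2.
Proof.
move=> B0; rewrite -(real_normK (num_real u)) (_ : u ^+ 4 = (`|u| ^+ 2) ^+ 2); last first.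
  by rewrite real_normK ?num_real// -exprM.
have := normr_ge0 u; move: `|u| => v v0; have [vB|Bv] := leP v B.
  by rewrite subrr lexx divr_ge0 ?sqr_ge0.
rewrite subr_ge0 ler_pXn2r ?nnegrE ?(ltW B0)// (ltW Bv)/=.
rewrite ler_pdivlMr ?exprn_gt0//.
have : B ^+ 2 <= v ^+ 2 by rewrite ler_pXn2r ?nnegrE ?(ltW B0)// ltW.
have := sqr_ge0 v; have := sqr_ge0 B; move: (v ^+ 2) (B ^+ 2) => p r p0 r0 h; nra.
Qed.

Lemma bandwidth_small (q : nat -> nat) (ka C : R) (n0 : nat) : 0 < ka ->
  (forall n, (n0 <= n)%N -> (q n)%:R <= C * (n%:R * (ln n%:R) `^ (- ka))) ->
  forall rho : R, 0 < rho -> exists n1 : nat, forall n, (n1 <= n)%N -> (q n)%:R <= rho * n%:R.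
Proof.
move=> ka0 h rho rho0; pose D := `|C| + 1; have D0 : 0 < D by rewrite /D; have := normr_ge0 C; lra.
pose B := (D / rho) `^ (ka^-1); have B0 : 0 < B by rewrite powR_gt0// divr_gt0.
have [n1 hn1] := nat_ge (expR B).
exists (maxn n0 n1) => n; rewrite geq_max => /andP[/h qC nn].
apply: (le_trans qC); rewrite mulrCA mulrC ler_wpM2r//.
have lB : B <= ln n%:R.
  rewrite -[leLHS](expRK B) ler_ln ?posrE ?expR_gt0//; last by apply: lt_le_trans (expR_gt0 B) _; apply: (le_trans hn1); rewrite ler_nat.
  by apply: (le_trans hn1); rewrite ler_nat.
have pB : D / rho <= ln n%:R `^ ka.
  rewrite (_ : D / rho = B `^ ka); last by rewrite /B -powRrM mulVf ?gt_eqF// powRr1// divr_ge0 ?ltW.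
  by apply: ge0_ler_powR; rewrite ?nnegrE ?(ltW ka0) ?(ltW B0)// (le_trans (ltW B0)).
have L0 : 0 < ln n%:R `^ ka by rewrite powR_gt0// (lt_le_trans B0).
rewrite powRN; apply: (@le_trans _ _ (D / ln n%:R `^ ka)).
  by rewrite ler_pM2r ?invr_gt0// /D; have := ler_norm C; lra.
by rewrite ler_pdivrMr// mulrC -ler_pdivrMr.
Qed.

End bounds.

Section long_run_variance.
Context {R : realType} {d : measure_display} {T : measurableType d} (P : probability T R)
  {d' : measure_display} {T' : measurableType d'} (Q : probability T' R).
Variables (X : nat -> T -> R) (mu H cH c0 : R) (W : R -> T' -> R).
Hypothesis statX : fourth_order_stationary P X.
Hypothesis meanX : forall j, 'E_P[X j]%E = mu%:E.
Hypothesis Hl : 1 / 2 < H.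
Hypothesis Hu : H < 1.
Hypothesis hW : is_fBm Q H W.
Hypothesis cH0 : 0 < cH.
Hypothesis fclt : forall F : (R -> R) -> R, D_bounded_continuous F ->
  (fun n => Exp P (fun w => F (psum_process (fun j => X j w) mu H n)))
    @ \oo --> Exp Q (fun w => F (fun t => cH * W t w)).
Hypothesis c00 : 0 < c0.
Hypothesis covX : (fun j : nat => autocov P X j%:Z / (c0 * j%:R `^ (2 * H - 2))) @ \oo --> (1 : R).
Hypothesis cumX : exists C : R, exists N : nat, forall n : nat, (N <= n)%N -> forall h : int,
     \sum_(a < (2 * n).+1) \sum_(b < (2 * n).+1)
        `|cum4 P X mu h (a%:Z - n%:Z) (b%:Z - n%:Z)|
     <= C * n%:R `^ (2 * H - 1).

(** In 4 c0, one factor 2 comes from the ratio to the asymptotic form and one from replacing j by j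
    + 1; early indices are absorbed by [eventually_le_all]. *)
Lemma autocov_bound : exists2 Cg : R, 0 < Cg &
  forall j, `|autocov P X j%:Z| <= Cg * j.+1%:R `^ (2 * H - 2).
Proof.
have hl := Hl; have hu := Hu; have c0p := c00.
have [n0 _ hn0] : \forall j \near \oo, `|1 - autocov P X j%:Z / (c0 * j%:R `^ (2 * H - 2))| <= 1.
  by move/cvgrPdist_le : covX; apply.
apply: (@eventually_le_all _ _ _ (4 * c0) (maxn n0 1)) => [n|n]; first by rewrite powR_gt0.
rewrite geq_max => /andP[/hn0 /=]; set g := autocov P X n => h n1.
have nR : 0 < (n%:R : R) by rewrite ltr0n.
have p0 : 0 < (n%:R : R) `^ (2 * H - 2) by rewrite powR_gt0.
have c0n : 0 < c0 * n%:R `^ (2 * H - 2) by rewrite mulr_gt0.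
have h1 : `|g| <= 2 * (c0 * n%:R `^ (2 * H - 2)).
  rewrite -ler_pdivrMr// -{1}(gtr0_norm c0n) -normf_div.
  move: h; set r := g / _; clearbody r; rewrite !ler_norml; lra.
apply: (le_trans h1).
rewrite (_ : 4 * c0 * _ = 2 * (c0 * (2 * n.+1%:R `^ (2 * H - 2)))); last by ring.
rewrite !ler_pM2l//.
have e1 : (2 * n%:R : R) `^ (2 * H - 2) <= n.+1%:R `^ (2 * H - 2).
  rewrite (_ : 2 * H - 2 = - (2 - 2 * H)); last by ring.
  rewrite !powRN lef_pV2 ?posrE ?powR_gt0 ?mulr_gt0//.
  apply: ge0_ler_powR; rewrite ?nnegrE ?mulr_ge0//; first lra.
  by have : (1 : R) <= n%:R; [rewrite ler1n|rewrite -natr1; lra].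
apply: (@le_trans _ _ (2 * (2 * n%:R) `^ (2 * H - 2))); last by rewrite ler_pM2l.
rewrite powRM// mulrA ler_peMl ?(ltW p0)//.
have -> : (2 : R) * 2 `^ (2 * H - 2) = 2 `^ (2 * H - 1).
  by rewrite -{1}(powRr1 (ler0n R 2)) -powRD; [congr (_ `^ _); ring|apply/implyP => _; rewrite pnatr_eq0].
by rewrite -[leLHS](powRr0 2) ler_powR ?ler1n//; lra.
Qed.

(** Below the threshold the square is enlarged to the half-width max(n, N + 1), at most n (N +
    1). *)
Lemma cum4_bound : exists2 Ck : R, 0 < Ck & forall n h, (0 < n)%N ->
  \sum_(a < (2 * n).+1) \sum_(b < (2 * n).+1) `|cum4 P X mu h (a%:Z - n%:Z) (b%:Z - n%:Z)|
  <= Ck * n%:R `^ (2 * H - 1).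
Proof.
have hl := Hl; have hu := Hu.
have [C [N hN]] := cumX.
pose N1 := N.+1; exists ((`|C| + 1) * N1%:R `^ (2 * H - 1)).
  by rewrite mulr_gt0 ?powR_gt0// ltr_pwDr.
move=> n h n0; pose m := maxn n N1.
have f0 (z : int) : 0 <= \sum_(b < (2 * m).+1) `|cum4 P X mu h z (b%:Z - m%:Z)| by apply: sumr_ge0.
apply: (@le_trans _ _ (\sum_(a < (2 * m).+1) \sum_(b < (2 * m).+1) `|cum4 P X mu h (a%:Z - m%:Z) (b%:Z - m%:Z)|)).
  apply: le_trans (window_sum_le f0 (leq_maxl n N1)).
  apply: ler_sum => a _.
  exact: (@window_sum_le _ (fun z => `|cum4 P X mu h (a%:Z - n%:Z) z|)  _ _ (fun z => normr_ge0 _) (leq_maxl n N1)).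
apply: (le_trans (hN m _ h)); first exact: leq_trans (leqnSn N) (leq_maxr _ _).
rewrite -mulrA -powRM//; apply: (@le_trans _ _ ((`|C| + 1) * m%:R `^ (2 * H - 1))).
  by rewrite ler_wpM2r ?powR_ge0//; have := ler_norm C; lra.
rewrite ler_wpM2l ?addr_ge0//; apply: ge0_ler_powR; rewrite ?nnegrE ?mulr_ge0//; first lra.
rewrite -natrM ler_nat /m /N1 geq_max leq_pmull//= leq_pmulr//.
Qed.

(** The partial sums start at index 1, whence the shift. *)
Let Y j := Yc X mu j.+1.

Lemma fbm1_sqr : L1 Q (fun w => (cH * W 1 w) ^+ 2) /\ Exp Q (fun w => (cH * W 1 w) ^+ 2) = cH ^+ 2.
Proof.
have hl := Hl.
have c1 : fBm_cov H 1 1 = 1.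
  by rewrite /fBm_cov powR1 subrr normr0 powR0 ?gt_eqF//; [lra|lra].
have n1 : centered_normal Q (W 1) 1.
  have := gcomb_normal hW (s := [:: (1, 1)]) ltac:(by rewrite /gpos /= ler01).
  rewrite /gcov !big_seq1 /= !mul1r c1; congr (centered_normal _ _ _).
  by apply/funext => w; rewrite /gcomb big_seq1 mul1r.
have [l e] := std_normal_sqr n1.
have E : (fun w => (cH * W 1 w) ^+ 2) = (fun w => cH ^+ 2 * W 1 w ^+ 2) by apply/funext => w; rewrite exprMn.
by rewrite E; split; [exact: L1Z|rewrite ExpZ// e mulr1].
Qed.

Lemma psum1E p w : psum_process (fun j => X j w) mu H p 1 = p%:R `^ (- H) * V Y 0 p w.
Proof.
rewrite /psum_process mulr1 natrK /V; congr (_ * _).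
by rewrite big_add1 /= big_mkord; apply: eq_bigr => i _; rewrite /Y /Yc add0n.
Qed.

(** The error of truncation at [B] is at most C4/B^2 for the sums and is handled by dominated
    convergence for the Gaussian limit. Endpoint evaluation is Skorokhod continuous because changes
    of time fix 1. *)
Lemma sig2_cvg (C4 : R) : 0 <= C4 -> (forall p, Exp P (fun w => V Y 0 p w ^+ 4) <= C4 * p%:R `^ (4 * H)) ->
  forall ep : R, 0 < ep -> exists p0, forall p, (p0 <= p)%N ->
  `|sig2 P Y p - cH ^+ 2 * p%:R `^ (2 * H)| <= ep * p%:R `^ (2 * H).
Proof.
move=> C40 V4 ep ep0; have [lW eW] := fbm1_sqr.
pose F (B : R) (x : R -> R) := (Num.min `|x 1| B) ^+ 2.
have cF B : 0 < B -> D_bounded_continuous (F B).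
  move=> B0; split.
    exists (B ^+ 2) => x _; rewrite ger0_norm ?sqr_ge0// ler_pXn2r ?nnegrE ?(ltW B0)//.
      by rewrite ge_min lexx orbT.
    by rewrite le_min normr_ge0 ltW.
  move=> x _ e e0; exists (e / (2 * B)); first by rewrite divr_gt0// mulr_gt0.
  move=> y _ [l [[_ [_ [_ l1]]] [dl' dl h]]].
  have [_] := h 1 ltac:(lra); rewrite l1 => xy.
  apply: (le_lt_trans (truncated_sqr_lip (ltW B0) xy)).
  by rewrite mulrC -ltr_pdivlMr// mulr_gt0.
have mW : measurable_fun setT (W 1).
  have -> : W 1 = gcomb W [:: (1, 1)] by apply/funext => w; rewrite /gcomb big_seq1 mul1r.
  by apply: (gcomb_measurable hW); rewrite /gpos /= ler01.
have mF B (f : T -> R) : measurable_fun setT f -> measurable_fun setT (fun w => (Num.min `|f w| B) ^+ 2).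
  move=> mf; apply: measurable_funX; apply: measurable_minr => //.
  exact: measurableT_comp.
have mFQ B (f : T' -> R) : measurable_fun setT f -> measurable_fun setT (fun w => (Num.min `|f w| B) ^+ 2).
  move=> mf; apply: measurable_funX; apply: measurable_minr => //.
  exact: measurableT_comp.
have F0 (a B : R) : 0 <= B -> `|(Num.min `|a| B) ^+ 2| <= a ^+ 2.
  move=> B0; rewrite ger0_norm ?sqr_ge0// -(real_normK (num_real a)) ler_pXn2r ?nnegrE//.
    by rewrite ge_min lexx.
  by rewrite le_min normr_ge0.
have [B [B0 BQ BC]] : exists B : R, [/\ 0 < B, `|Exp Q (fun w => (Num.min `|cH * W 1 w| B) ^+ 2) - cH ^+ 2| <= ep / 3 & C4 / B ^+ 2 <= ep / 3].
  have cw w : (fun n : nat => (Num.min `|cH * W 1 w| n.+1%:R) ^+ 2) @ \oo --> (cH * W 1 w) ^+ 2.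
    apply: cvg_near_cst; near=> n; rewrite min_l ?real_normK ?num_real//.
    apply: (@le_trans _ _ n%:R); last by rewrite ler_nat.
    by near: n; exact: nbhs_infty_ger.
  have [_] := @Exp_cvg _ _ _ Q (fun n w => (Num.min `|cH * W 1 w| n.+1%:R) ^+ 2) (fun w => (cH * W 1 w) ^+ 2) (fun w => (cH * W 1 w) ^+ 2)
    (fun n => mFQ _ _ (measurable_funM (measurable_cst _) mW)) lW (fun n w => F0 _ _ (ler0n _ _)) cw.
  rewrite eW => /cvgrPdistC_le/(_ (ep / 3) ltac:(lra)) [n1 _ h1].
  have [n2 hn2] := nat_ge (3 * C4 / ep).
  exists (maxn n1 n2).+1%:R; split; first by rewrite ltr0n.
    by apply: h1 => /=; exact: leq_maxl.
  have hb : n2%:R <= (maxn n1 n2).+1%:R ^+ 2 :> R.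
    apply: (@le_trans _ _ (maxn n1 n2).+1%:R); first by rewrite ler_nat leqW// leq_maxr.
    by rewrite expr2 ler_peMr// ler1n.
  rewrite ler_pdivrMr ?exprn_gt0 ?ltr0n//; move: hn2; rewrite ler_pdivrMr// => hn2.
  have := ler_wpM2l (ltW ep0) hb; move: hn2; move: (_ ^+ 2) => b; lra.
have /cvgrPdistC_le/(_ (ep / 3) ltac:(lra)) [p1 _ hp1] := fclt (cF B B0).
exists p1.+1 => p pp; have p0 : (0 < p)%N by exact: leq_ltn_trans pp.
have pR : 0 < (p%:R : R) by rewrite ltr0n.
pose U w := p%:R `^ (- H) * V Y 0 p w.
have LV : L4 P (V Y 0 p) by apply: L4_V => i; exact: L4_Y.
have LU : L4 P U by exact: L4Z.
have h1 := hp1 p (ltnW pp); rewrite /= /F in h1.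
have E1 : Exp P (fun w => Num.min `|psum_process (fun j => X j w) mu H p 1| B ^+ 2) = Exp P (fun w => Num.min `|U w| B ^+ 2).
  by congr Exp; apply/funext => w; rewrite psum1E.
rewrite E1 in h1.
have E2 : Exp P (fun w => U w ^+ 2) = sig2 P Y p / p%:R `^ (2 * H).
  rewrite /U; under eq_fun do rewrite exprMn.
  rewrite ExpZ; last exact: L1_sqr.
  rewrite mulrC; congr (_ * _).
  by rewrite powRN exprVn -powR_mulrn ?powR_ge0// -powRrM (mulrC H).
have E4 : Exp P (fun w => U w ^+ 4) <= C4.
  rewrite /U; under eq_fun do rewrite exprMn.
  rewrite ExpZ; last by case: LV.
  rewrite powRN exprVn -powR_mulrn ?powR_ge0// -powRrM (mulrC H) ler_pdivrMl ?powR_gt0//.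
  by have := V4 p; rewrite (mulrC 4) (mulrC C4).
have L2 : L1 P (fun w => U w ^+ 2) by exact: L1_sqr.
have LF : L1 P (fun w => Num.min `|U w| B ^+ 2).
  by apply: L1_dom L2; [apply: mF; case: LU|move=> w; apply: F0; exact: ltW].
have gap : `|Exp P (fun w => U w ^+ 2) - Exp P (fun w => Num.min `|U w| B ^+ 2)| <= ep / 3.
  rewrite -ExpB// ger0_norm; last by apply: Exp_ge0 => w; case/andP: (truncated_sqr_gap (U w) B0).
  apply: le_trans BC; apply: (@le_trans _ _ (Exp P (fun w => (B ^+ 2)^-1 * U w ^+ 4))).
    apply: Exp_le; [exact: L1B|by apply: L1Z; case: LU|].
    by move=> w; rewrite mulrC; case/andP: (truncated_sqr_gap (U w) B0).
  by rewrite ExpZ; [rewrite mulrC ler_pM2r// invr_gt0 exprn_gt0|case: LU].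
have : `|sig2 P Y p / p%:R `^ (2 * H) - cH ^+ 2| <= ep.
  rewrite -E2; move: gap h1 BQ; rewrite !ler_norml; lra.
have N0 : 0 < (p%:R : R) `^ (2 * H) by rewrite powR_gt0.
move=> h; rewrite -{1}(divfK (lt0r_neq0 N0) (sig2 P Y p)) -mulrBl normrM (gtr0_norm N0).
by rewrite ler_pM2r.
Unshelve. all: by end_near. Qed.

Variable q : nat -> nat.
Hypothesis q0 : forall n, (0 < q n)%N.
Hypothesis qm : forall m n, (m <= n)%N -> (q m <= q n)%N.
Hypothesis qd : exists C : R, forall k : nat, (q (2 ^ k.+1)%N)%:R / (q (2 ^ k)%N)%:R <= C.
Hypothesis qy : forall M : nat, exists N : nat, forall n, (N <= n)%N -> (M <= q n)%N.
Hypothesis qn : exists C : R, exists N : nat, forall n : nat, (N <= n)%N ->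
     (q n)%:R <= C * (n%:R * (ln n%:R) `^ (- (7 / (4 - 4 * H)))).

Lemma lrv_event (de e1 : R) : 0 < de -> de <= 1 -> 0 < e1 ->
  exists n0 : nat, forall n, (n0 <= n)%N -> exists E : set T,
  [/\ measurable E, fine (P (~` E)) <= e1 &
   forall w, E w -> forall a L, (a + L <= n)%N -> de * n%:R <= L%:R ->
     `|(q L)%:R `^ (1 - 2 * H) * lrv (X ^~ w) a L (q L) - cH ^+ 2| <= e1].
Proof.
have hl := Hl; have hu := Hu.
have [Cg Cg0 hCg] := autocov_bound; have [Ck Ck0 hCk] := cum4_bound.
have sS (a b : nat) : a.+1%:Z - b.+1%:Z = a%:Z - b%:Z by clear; lia.
have HY i : L4 P (Y i) by exact: L4_Y.
have e2s i j m : Exp P (fun w => Y (i + m) w * Y (j + m) w) = Exp P (fun w => Y i w * Y j w).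
  exact: (E2_shift mu statX i.+1 j.+1 m).
have e4 i j k l : Exp P (fun w => Y i w * Y j w * Y k w * Y l w) =
    cum4 P X mu (j%:Z - i%:Z) (k%:Z - i%:Z) (l%:Z - i%:Z) +
    (Exp P (fun w => Y i w * Y j w) * Exp P (fun w => Y k w * Y l w) +
     Exp P (fun w => Y i w * Y k w) * Exp P (fun w => Y j w * Y l w) +
     Exp P (fun w => Y i w * Y l w) * Exp P (fun w => Y j w * Y k w)).
  have := E4_cum4 statX meanX i.+1 j.+1 k.+1 l.+1; rewrite /E4 /E2 => ->.
  by rewrite !sS.
have e2g i k : `|Exp P (fun w => Y i w * Y (i + k) w)| <= Cg * k.+1%:R `^ (2 * H - 2).
  have := E2_autocov statX meanX i.+1 (i + k).+1; rewrite /E2 => ->.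
  by apply: le_trans (hCg k); rewrite (_ : (i + k).+1%:Z - i.+1%:Z = k%:Z)//; lia.
have kapb n h : (0 < n)%N -> \sum_(a < (2 * n).+1) \sum_(b < (2 * n).+1) `|cum4 P X mu h (a%:Z - n%:Z) (b%:Z - n%:Z)|
    <= Ck * n%:R `^ (2 * H - 1) by exact: hCk.
have V4 := V4_le HY e2s e4 Hl Hu Cg0 Ck0 e2g kapb.
have C4 : 0 < Cv4 H Cg Ck by apply: Cv4_gt0.
have Ck5 : 0 < 16 * (40 * 40 * Cv4 H Cg Ck) by rewrite !mulr_gt0.
have [C [N0 hq]] := qn.
have ka0 : 0 < 7 / (4 - 4 * H) by rewrite divr_gt0//; lra.
have h1 p : sig2 P Y p <= Csig H Cg * p%:R `^ (2 * H) by apply: sig2_le.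
have h2 th : 0 < th -> exists2 rho, 0 < rho & forall n p m, (0 < p)%N -> p%:R <= rho * n%:R :> R -> (m <= n)%N ->
    Exp P (fun w => Dev P Y p m w ^+ 2) <= th * (n%:R * p%:R `^ (2 * H)) ^+ 2.
  exact: (Dev_small HY e2s e4 Hl Hu Cg0 Ck0 e2g kapb).
have h3 j w : X j.+1 w = Y j w + mu by rewrite /Y /Yc subrK.
have h4 : 0 < cH ^+ 2 by rewrite exprn_gt0.
have h5 := sig2_cvg (ltW C4) (V4 0%N).
exact: (lrv_consistent HY Hl Hu (Csig_gt0 Hl Cg0) Ck5 h1 h2
  (@max_dominated _ _ _ _ _ _ _ _ HY Hl Hu Cg0 Ck0 _ (ltW C4) V4)
  (fun p n p0 => osc_dominated HY Hl Hu Cg0 Ck0 (ltW C4) V4 n p0) h3 h4 h5 q0 qm qd qy (bandwidth_small ka0 hq)).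
Qed.

End long_run_variance.

(** * The statistics of the partial sum process *)

Section partial_sums.
Context {R : realType}.
Variables (x : nat -> R) (mu H : R) (n : nat).
Hypothesis n0 : (0 < n)%N.
Let y := psum_process x mu H n.
Let c : R := n%:R `^ (- H).

Let nR : 0 < (n%:R : R). Proof. by rewrite ltr0n. Qed.
Let c0 : 0 < c. Proof. by rewrite powR_gt0. Qed.

Let cM z : c * `|z| = `|c * z|. Proof. by rewrite normrM (gtr0_norm c0). Qed.

Lemma seg_sum_cat a j : seg_sum x 0 (a + j) = seg_sum x 0 a + seg_sum x a j.
Proof.
rewrite /seg_sum [LHS](@big_cat_nat _ _ _ a.+1)//= ?ltnS ?leq_addr//; congr (_ + _).
rewrite -{1}(addn1 a) addnC big_addn subSn ?leq_addr// addKn.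
by apply: eq_bigr => i _; rewrite add0n addnC.
Qed.

Lemma psum_grid i : y (i%:R / n%:R) = c * (seg_sum x 0 i - i%:R * mu).
Proof.
rewrite /y /psum_process mulrCA mulfV ?gt_eqF// mulr1 natrK; congr (_ * _).
rewrite sumrB /seg_sum; congr (_ - _).
by rewrite sumr_const_nat subSS subn0 mulr_natl.
Qed.

Lemma psum_seg_dev a L j : (0 < L)%N ->
  seg_dev y n a L j = c * `|seg_sum x a j - j%:R / L%:R * seg_sum x a L|.
Proof.
move=> L0; have LR : (L%:R : R) != 0 by rewrite pnatr_eq0 -lt0n.
rewrite /seg_dev !psum_grid !seg_sum_cat cM; congr (`| _ |).
by rewrite !natrD; field.
Qed.

Lemma psum_seg_max a L : (0 < L)%N -> seg_max y n a L = c * (Num.sqrt L%:R * bridge_max x a L).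
Proof.
move=> L0; rewrite /bridge_max mulVKf; last by rewrite gt_eqF// sqrtr_gt0 ltr0n.
rewrite /seg_max; under eq_bigr do rewrite psum_seg_dev//.
rewrite -[in LHS](mulr0 c); elim/big_ind2 : _ => // a1 b1 a2 b2 -> ->.
by rewrite maxr_pMr// ltW.
Qed.

Lemma psum_bridge i : `|bridge y (i%:R / n%:R)| = c * cusum_dev x n i.
Proof.
have n1 : y 1 = c * (seg_sum x 0 n - n%:R * mu) by rewrite -psum_grid mulfV ?gt_eqF.
rewrite /bridge psum_grid n1 /cusum_dev cM; congr (`| _ |).
by have := lt0r_neq0 nR; move=> h; field.
Qed.

(** The maximum is attained, so the filtered list is nonempty and the default 0 of [nth] never
    appears. *)
Lemma khatP : (1 <= khat x n <= n)%N /\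
  forall i, (1 <= i <= n)%N -> cusum_dev x n i <= cusum_dev x n (khat x n).
Proof.
have [k [kn hk]] := argmax_seq (cusum_dev x n) n0.
set M := \big[Num.max/0]_(1 <= i < n.+1) cusum_dev x n i.
have ge i : (1 <= i <= n)%N -> cusum_dev x n i <= M.
  by move=> hi; apply: le_bigmax_seq => //; rewrite mem_index_iota ltnS.
have Mk : cusum_dev x n k = M.
  apply/eqP; rewrite eq_le ge//= /M big_nat; apply: bigmax_le => [|i]; first exact: normr_ge0.
  by rewrite ltnS => hi; exact: hk.
have kin : k \in [seq k <- iota 1 n | cusum_dev x n k == M].
  by rewrite mem_filter Mk eqxx mem_iota add1n ltnS.
have : khat x n \in [seq k <- iota 1 n | cusum_dev x n k == M].
  by rewrite /khat -/M mem_nth//; case: [seq _ <- _ | _] kin.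
rewrite mem_filter mem_iota add1n ltnS => /andP[/eqP e h]; split=> // i hi.
by rewrite e; exact: ge.
Qed.

End partial_sums.

Section normalization.
Context {R : realType}.
Variables (H c : R).
Hypothesis c0 : 0 < c.

(** For u >= 0, |u - 1| <= |u^2 - 1|; here u^2 - 1 = (c^2 - r)/r and r >= c^2/2. *)
Lemma sqrt_ratio_close (r e1 : R) (K : nat) : (0 < K)%N -> e1 <= c ^+ 2 / (2 * K%:R) -> `|r - c ^+ 2| <= e1 ->
  0 < r /\ `|c / Num.sqrt r - 1| <= K%:R^-1.
Proof.
move=> K0 e1c rc; have KR : 0 < (K%:R : R) by rewrite ltr0n.
have c2 : 0 < c ^+ 2 by rewrite exprn_gt0.
have K1 : (1 : R) <= K%:R by rewrite ler1n.
have ec : e1 <= c ^+ 2 / 2 * K%:R^-1 by move: e1c; rewrite invfM mulrA.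
have ki : K%:R^-1 <= (1 : R) by rewrite invf_le1.
have e2 : e1 <= c ^+ 2 / 2 by apply: (le_trans ec); rewrite ler_piMr//; lra.
have r2 : c ^+ 2 / 2 <= r by move: rc; rewrite ler_norml; lra.
have r0 : 0 < r by lra.
split=> //; set u := c / _; have u0 : 0 < u by rewrite divr_gt0 ?sqrtr_gt0.
have uE : u ^+ 2 * r = c ^+ 2 by rewrite /u expr_div_n sqr_sqrtr ?(ltW r0)// divfK ?gt_eqF.
have h1 : `|u - 1| <= `|u ^+ 2 - 1|.
  rewrite (_ : u ^+ 2 - 1 = (u - 1) * (u + 1)); last by ring.
  by rewrite normrM ler_peMr// ger0_norm; lra.
apply: (le_trans h1).
have h2 : `|u ^+ 2 - 1| * r <= e1.
  rewrite -{1}(gtr0_norm r0) -normrM mulrBl uE mul1r distrC//.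
have h3 : `|u ^+ 2 - 1| * (c ^+ 2 / 2) <= c ^+ 2 / 2 * K%:R^-1.
  by apply: le_trans ec; apply: le_trans h2; rewrite ler_wpM2l.
by move: h3; rewrite mulrC ler_pM2l//; lra.
Qed.

(** An exact identity: all powers of n and q cancel, and the estimation error is confined to the
    factor c / sqrt r, the relative error of [stat_val]. *)
Lemma seg_stat_scaled (x : nat -> R) (mu : R) (n a L qq : nat) (r := qq%:R `^ (1 - 2 * H) * lrv x a L qq) :
  (0 < n)%N -> (0 < L)%N -> (0 < qq)%N -> 0 < r ->
  (qq%:R / n%:R) `^ (H - 1 / 2) * seg_stat x a L qq =
  c / Num.sqrt r * (c^-1 * ((Num.sqrt (L%:R / n%:R))^-1 * seg_max (psum_process x mu H n) n a L)).
Proof.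
move=> n0 L0 q0 r0.
have nR : 0 < (n%:R : R) by rewrite ltr0n.
have LR : 0 < (L%:R : R) by rewrite ltr0n.
have qR : 0 < (qq%:R : R) by rewrite ltr0n.
have qp : 0 < (qq%:R : R) `^ (1 - 2 * H) by rewrite powR_gt0.
have l0 : 0 < lrv x a L qq by move: r0; rewrite /r pmulr_rgt0.
have sq (z : R) : 0 < z -> Num.sqrt z = z `^ (1 / 2).
  by move=> z0; rewrite div1r powR12_sqrt// ltW.
rewrite psum_seg_max// /seg_stat.
have -> : Num.sqrt r = qq%:R `^ (1 / 2 - H) * Num.sqrt (lrv x a L qq).
  rewrite /r sqrtrM ?(ltW qp)// (sq (_ `^ _))// -powRrM; congr (_ `^ _ * _); by field.
have -> : Num.sqrt (L%:R / n%:R) = Num.sqrt L%:R / n%:R `^ (1 / 2) :> R.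
  by rewrite sqrtrM ?(ltW LR)// sqrtrV ?(ltW nR)// (sq n%:R).
have -> : (qq%:R / n%:R) `^ (H - 1 / 2) = (qq%:R `^ (1 / 2 - H))^-1 * (n%:R `^ (1 / 2) * n%:R `^ (- H)) :> R.
  rewrite powRM ?invr_ge0 ?ler0n//; congr (_ * _).
    by rewrite -powRN; congr (_ `^ _); ring.
  rewrite -powR_inv1 ?ler0n// -powRrM -powRD; last by apply/implyP => _; rewrite gt_eqF.
  by congr (_ `^ _); ring.
have s1 : Num.sqrt (lrv x a L qq) != 0 by rewrite gt_eqF// sqrtr_gt0.
have s2 : Num.sqrt (L%:R : R) != 0 by rewrite gt_eqF// sqrtr_gt0.
have s3 : (n%:R : R) `^ (1 / 2) != 0 by rewrite gt_eqF// powR_gt0.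
have s4 : (qq%:R : R) `^ (1 / 2 - H) != 0 by rewrite gt_eqF// powR_gt0.
have s5 := lt0r_neq0 c0.
set z1 := Num.sqrt (lrv x a L qq) in s1 *; set z2 := Num.sqrt L%:R in s2 *; set z3 := _ `^ (1 / 2) in s3 *.
set z4 := _ `^ (1 / 2 - H) in s4 *; set z5 := _ `^ (- H); set z6 := bridge_max x a L.
clearbody z1 z2 z3 z4 z5 z6.
by field; rewrite s1 s2 s3 s4 s5.
Qed.

End normalization.

Section measurability.
Context {R : realType}.

Definition sup_lipschitz (F : (R -> R) -> R) (C : R) : Prop := forall x y dl, 0 <= dl ->
  (forall t, 0 <= t <= 1 -> `|x t - y t| <= dl) -> `|F x - F y| <= C * dl.

Lemma psum_lip_measurable {d} {T : measurableType d} (X : nat -> T -> R) (mu H : R) (n : nat) (F : (R -> R) -> R) (C : R) :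
  (forall j, measurable_fun setT (X j)) -> sup_lipschitz F C ->
  measurable_fun setT (fun w => F (psum_process (X ^~ w) mu H n)).
Proof.
move=> mX FC.
apply: (@lip_coords_measurable _ _ _ n.+1 (fun a => F (psum_process a mu H n)) (C * (n%:R `^ (- H) * n%:R)) X) => // a b dl dl0 ab.
rewrite -mulrA; apply: FC; first by rewrite !mulr_ge0 ?powR_ge0.
move=> t /andP[t0 t1]; rewrite /psum_process -mulrBr normrM ger0_norm ?powR_ge0// -mulrA ler_wpM2l ?powR_ge0//.
have kn : (Num.truncn (n%:R * t) <= n)%N.
  rewrite -(ler_nat R); apply: (@le_trans _ _ (n%:R * t)); first by rewrite truncn_le// mulr_ge0.
  by rewrite ler_piMr.
rewrite -sumrB; apply: (le_trans (ler_norm_sum _ _ _)).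
apply: (@le_trans _ _ (\sum_(1 <= i < (Num.truncn (n%:R * t)).+1) dl)).
  rewrite [leLHS]big_nat [leRHS]big_nat; apply: ler_sum => i /andP[i1 i2].
  rewrite (_ : _ - _ = a i - b i); last by ring.
  by apply: ab; apply: leq_trans i2 _.
by rewrite sumr_const_nat subSS subn0 -[leLHS]mulr_natl ler_wpM2r// ler_nat.
Qed.

(** Replacing the path by a step function on a grid leaves finitely many coordinates; uniform
    continuity of the paths gives the limit. *)
Lemma path_lip_measurable {d} {T : measurableType d} (G : R -> T -> R) (F : (R -> R) -> R) (C : R) :
  (forall t, 0 <= t -> measurable_fun setT (G t)) ->
  (forall w, {within `[0, 1], continuous (fun t => G t w)}) -> sup_lipschitz F C ->
  measurable_fun setT (fun w => F (fun t => G t w)).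
Proof.
move=> mG cG FC; pose step (n : nat) (t : R) : R := (Num.truncn (n.+1%:R * t))%:R / n.+1%:R.
have C1 : 0 < `|C| + 1 by rewrite ltr_wpDl.
have cv w : (fun n => F (fun t => G (step n t) w)) @ \oo --> F (fun t => G t w).
  apply/cvgrPdist_le => e e0.
  have [rho rho0 hrho] := unif_cont01 (cG w) (divr_gt0 e0 C1).
  have [n0 hn0] := nat_ge rho^-1.
  exists n0 => // n /= nn.
  apply: (@le_trans _ _ (C * (e / (`|C| + 1)))); last first.
    rewrite mulrCA ger_pMr// ler_pdivrMr// mul1r.
    by apply: (le_trans (ler_norm C)); rewrite lerDl.
  apply: FC => [|t /andP[t0 t1]]; first by rewrite divr_ge0 ?ltW.
  have nR : 0 < (n.+1%:R : R) by rewrite ltr0n.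
  have nt0 : 0 <= n.+1%:R * t by rewrite mulr_ge0.
  have s0 : 0 <= step n t by rewrite divr_ge0.
  have s1 : step n t <= t by rewrite ler_pdivrMr// (mulrC t) truncn_le.
  have s2 : t - step n t < n.+1%:R^-1.
    rewrite ltrBlDr -(ltr_pM2r nR) mulrDl mulVf ?gt_eqF// divfK ?gt_eqF// mulrC addrC.
    by rewrite natr1 truncnS_gt.
  apply/ltW/hrho; rewrite ?t0 ?s0 ?(le_trans s1)//.
  rewrite ger0_norm ?subr_ge0//; apply: (lt_le_trans s2).
  rewrite -[leRHS]invrK lef_pV2 ?posrE ?invr_gt0//; apply: (le_trans hn0).
  by rewrite ler_nat leqW.
apply: measurable_fun_cvg (fun w _ => cv w) => n.
apply: (@lip_coords_measurable _ _ _ n.+2 (fun a => F (fun t => a (Num.truncn (n.+1%:R * t)))) C (fun i => G (i%:R / n.+1%:R))).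
  by move=> i; apply: mG; rewrite divr_ge0.
move=> a b dl dl0 ab; apply: FC => // t /andP[t0 t1]; apply: ab.
rewrite ltnS -(ler_nat R); apply: (@le_trans _ _ (n.+1%:R * t)); first by rewrite truncn_le// mulr_ge0.
by rewrite ler_piMr.
Qed.

End measurability.

(** The pathwise link: if the estimator is accurate on all segments longer than n/K, the actual
    statistics are an admissible value at the path of partial sums. *)
Lemma stat_val_psum (R : realType) (x : nat -> R) (mu H c : R) (q : nat -> nat) (g : R * R -> R) (M : R) (K n : nat) (e1 : R) :
  0 < c -> (forall p, `|g p| <= M) -> (forall n, (0 < q n)%N) -> (0 < K)%N -> (0 < n)%N ->
  e1 <= c ^+ 2 / (2 * K%:R) ->
  (forall a L, (a + L <= n)%N -> K%:R^-1 * n%:R <= L%:R :> R ->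
     `|(q L)%:R `^ (1 - 2 * H) * lrv x a L (q L) - c ^+ 2| <= e1) ->
  stat_val g c M K n (psum_process x mu H n)
    (g (((q (khat x n))%:R / n%:R) `^ (H - 1 / 2) * T_n1 x q n,
        ((q (n - khat x n)%N)%:R / n%:R) `^ (H - 1 / 2) * T_n2 x q n)).
Proof.
move=> c0 gM q0 K0 n0 e1c hlrv; split; first exact: gM.
have [/andP[k1 kn] hk] := khatP x n0; exists (khat x n).
have nR : 0 < (n%:R : R) by rewrite ltr0n.
have KR : 0 < (K%:R : R) by rewrite ltr0n.
split; first by rewrite k1.
  by move=> i hi; rewrite !psum_bridge// ler_pM2l ?powR_gt0//; exact: hk.
move=> h1 h2; rewrite /T_n1 /T_n2 /stat1 /stat2; set k := khat x n in k1 kn h1 h2 *.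
have L2 : K%:R^-1 * n%:R <= (n - k)%N%:R :> R by rewrite natrB// mulrC; lra.
have L20 : (0 < n - k)%N by rewrite -(ltr0n R); apply: lt_le_trans L2; rewrite mulr_gt0// invr_gt0.
have [r1 u1] := sqrt_ratio_close c0 K0 e1c (hlrv 0%N k ltac:(by rewrite add0n) ltac:(by rewrite mulrC)).
have [r2 u2] := sqrt_ratio_close c0 K0 e1c (hlrv k (n - k)%N ltac:(by rewrite subnKC) L2).
eexists; eexists; split; [exact: u1|exact: u2|].
by rewrite (seg_stat_scaled c0 mu n0 k1 (q0 k) r1) (seg_stat_scaled c0 mu n0 L20 (q0 (n - k)%N) r2).
Qed.

Theorem theorem2p2 (R : realType)
  (d : measure_display) (T : measurableType d) (P : probability T R)
  (X : nat -> T -> R) (mu H cH c0 : R)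
  (d' : measure_display) (T' : measurableType d') (Q : probability T' R)
  (W : R -> T' -> R) (q : nat -> nat) :
  (* standing assumptions on the data *)
  fourth_order_stationary P X ->
  (forall j, 'E_P[X j]%E = mu%:E) ->
  1 / 2 < H < 1 ->
  is_fBm Q H W ->
  (* (a) functional limit theorem in D[0,1] *)
  0 < cH ->
  (forall F : (R -> R) -> R, D_bounded_continuous F ->
     (fun n => Exp P (fun w => F (psum_process (fun j => X j w) mu H n)))
       @ \oo --> Exp Q (fun w => F (fun t => cH * W t w))) ->
  (* (b) gamma_j ~ c0 j^{2H-2} *)
  0 < c0 ->
  (fun j : nat => autocov P X j%:Z / (c0 * j%:R `^ (2 * H - 2))) @ \oo --> (1 : R) ->
  (* (c) cumulant condition *)
  (exists C : R, exists N : nat, forall n : nat, (N <= n)%N -> forall h : int,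
     \sum_(a < (2 * n).+1) \sum_(b < (2 * n).+1)
        `|cum4 P X mu h (a%:Z - n%:Z) (b%:Z - n%:Z)|
     <= C * n%:R `^ (2 * H - 1)) ->
  (* assumptions on the bandwidth q *)
  (forall n, (0 < q n)%N) ->
  (forall m n, (m <= n)%N -> (q m <= q n)%N) ->
  (exists C : R, forall k : nat, (q (2 ^ k.+1)%N)%:R / (q (2 ^ k)%N)%:R <= C) ->
  (forall M : nat, exists N : nat, forall n, (N <= n)%N -> (M <= q n)%N) ->
  (exists C : R, exists N : nat, forall n : nat, (N <= n)%N ->
     (q n)%:R <= C * (n%:R * (ln n%:R) `^ (- (7 / (4 - 4 * H))))) ->
  (* conclusion: convergence in distribution of the random vectors *)
  forall g : R * R -> R, continuous g -> (exists M, forall p, `|g p| <= M) ->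
    (fun n => Exp P (fun w =>
       let x := fun j => X j w in
       g (((q (khat x n))%:R / n%:R) `^ (H - 1 / 2) * T_n1 x q n,
          ((q (n - khat x n)%N)%:R / n%:R) `^ (H - 1 / 2) * T_n2 x q n)))
    @ \oo --> Exp Q (fun w => g (limit1 (fun t => W t w),
                                 limit2 (fun t => W t w))).
Proof.
move=> statX meanX /andP[Hl Hu] hW cH0 fclt c00 covX cumX q0 qm qd qy qn g cg [M gM].
have ev := lrv_event statX meanX Hl Hu hW cH0 fclt c00 covX cumX q0 qm qd qy qn.
have M0 : 0 <= M by exact: le_trans (normr_ge0 _) (gM (0, 0)).
have [N [mN QN hN]] := fbm_unique_argmax hW Hl Hu.
have mX j : measurable_fun setT (X j) by case: (statX.1 j).
have mW t : 0 <= t -> measurable_fun setT (W t).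
  move=> t0; have -> : W t = gcomb W [:: (1, t)] by apply/funext => w; rewrite /gcomb big_seq1 mul1r.
  by apply: (gcomb_measurable hW); rewrite /gpos /= t0.
have cW w : {within `[0, 1], continuous (fun t => cH * W t w)}.
  by move=> t; apply: cvgM; [exact: cvg_cst|exact: (fbm_cont01 hW)].
have mZ n F C : sup_lipschitz F C -> measurable_fun setT (fun w => F (psum_process (fun j => X j w) mu H n)).
  exact: psum_lip_measurable.
have mG F C : sup_lipschitz F C -> measurable_fun setT (fun w => F (fun t => cH * W t w)).
  by apply: path_lip_measurable => // t t0; apply: measurable_funM => //; exact: mW.
apply: (functional_limit_cvg M0 fclt mZ mG (Val := stat_val g cH M) (N := N)) => //.
- by move=> K n y v [].
- move=> K e K0 e0.
  have KR : 0 < (K%:R : R) by rewrite ltr0n.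
  (* One number bounds both the exceptional probability and the error of the estimator, hence the
     minimum. *)
  pose e1 := Num.min e (cH ^+ 2 / (2 * K%:R)).
  have e10 : 0 < e1 by rewrite lt_min e0 divr_gt0 ?exprn_gt0 ?mulr_gt0.
  have [n0 hn0] := ev K%:R^-1 e1 ltac:(by rewrite invr_gt0) ltac:(by rewrite invf_le1// ler1n) e10.
  exists (maxn n0 1) => n; rewrite geq_max => /andP[/hn0[E [mE PE hE]] n1].
  exists E; split=> //; first by apply: (le_trans PE); rewrite ge_min lexx.
  move=> w Ew; have e1c : e1 <= cH ^+ 2 / (2 * K%:R) by rewrite ge_min lexx orbT.
  exact: (stat_val_psum mu cH0 gM q0 K0 n1 e1c (hE w Ew)).
- move=> w /hN[W0 [xi xi01 argm]].
  rewrite -(stat_limZ (fbm_cont01 hW (w := w)) W0 xi01 argm cH0 g).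
  by apply: stat_env_cvg => //; exact: argmaxZ.
- move=> w /hN[W0 [xi xi01 argm]].
  rewrite -(stat_limZ (fbm_cont01 hW (w := w)) W0 xi01 argm cH0 g).
  by apply: stat_env_cvgN => //; exact: argmaxZ.
Qed.
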